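(* Assume $\mathbf d\in\mathbf X$ and $p(0,0)=0$, and take $J_{i,j}=\alpha p(i,j)$ and $h=1-\alpha$. (i) The following time and space limits exist and are identical: there is a probability measure $\mu$ such that for any initial probability measure $\nu$ concentrated on $\mathbf X$, any boundary condition $\mathbf y\in\mathbf X$ and any increasing sequence of finite sets $\Lambda\nearrow\mathbb Z^d$, $$\lim_{t\to\infty}\nu S(t)=\lim_{\Lambda\nearrow\mathbb Z^d}\mu_\Lambda(\cdot\,|\,\mathbf y_{\Lambda^c})=\mu$$ (weak convergence, i.e. convergence of integrals of bounded continuous functions depending on finitely many coordinates). (ii) $\mu$ is reversible for $L_k$ for every $k\in\mathbb Z^d$, i.e. $\int g\,L_kf\,\mathrm d\mu=\int f\,L_kg\,\mathrm d\mu$ for all bounded continuous $f,g$ depending on finitely many coordinates; in particular $\mu$ is reversible for $L$. (iii) $\mu$ is the unique probability measure concentrated on $\mathbf X$ satisfying the DLR equations for the specifications $\mu_\Lambda(\cdot|\mathbf y_{\Lambda^c})$.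
   Context: Fix $d\ge1$, a norm $|\cdot|$ on $\mathbb Z^d$, and $\alpha\in(0,1)$. Let $P=(p(i,j))_{i,j\in\mathbb Z^d}$ be a space-homogeneous, finite-range, symmetric stochastic matrix: $p(i,j)\ge0$, $\sum_jp(i,j)=1$, $p(i,i+j)=p(0,j)$, $p(i,j)=p(j,i)$, and $p(0,j)=0$ if $|j|\ge R$, where $R>0$ is fixed. Let $$\mathbf X=\Big\{\mathbf x\in\mathbb R^{\mathbb Z^d}:\ \sum_{j\in\mathbb Z^d}|\mathbf x(j)|\,\alpha^{|j|/R}<\infty\Big\}.$$ $\mathbf d\in\mathbb R^{\mathbb Z^d}$ is a fixed configuration (the data). Gibbs specifications. For finite $\Lambda\subset\mathbb Z^d$, $$H_\Lambda(\mathbf x)=\sum_{\{i,j\}\not\subset\Lambda^c}J_{i,j}(\mathbf x(i)-\mathbf x(j))^2+h\sum_{i\in\Lambda}(\mathbf x(i)-\mathbf d(i))^2,$$ the first sum being over unordered pairs of sites. $\mathbf x_\Lambda$ is the restriction of $\mathbf x$ to $\Lambda$, and $\mathbf x_\Lambda\mathbf y_{\Lambda^c}$ is the configuration equal to $\mathbf x$ on $\Lambda$ and to $\mathbf y$ on $\Lambda^c$. Put $$\mu_\Lambda(\mathrm d\mathbf x_\Lambda|\mathbf y_{\Lambda^c})=\frac1{Z_\Lambda}\exp\big(-\tfrac12H_\Lambda(\mathbf x_\Lambda\mathbf y_{\Lambda^c})\big)\,\mathrm d\mathbf x_\Lambda,$$ where $\mathrm d\mathbf x_\Lambda$ is Lebesgue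 measure on $\mathbb R^\Lambda$ and $Z_\Lambda$ normalizes. A probability measure $\mu$ on $\mathbb R^{\mathbb Z^d}$ satisfies the DLR equations if for every finite $\Lambda$, $\mu(\mathrm d\mathbf x_\Lambda|\mathbf x_{\Lambda^c}=\mathbf y_{\Lambda^c})=\mu_\Lambda(\mathrm d\mathbf x_\Lambda|\mathbf y_{\Lambda^c})$ for $\mu$-almost all $\mathbf y$. Generator. For $k\in\mathbb Z^d$, $z\in\mathbb R$, $\mathbf x\in\mathbf X$ let $(\Theta_{k,z}\mathbf x)(j)=\mathbf x(j)$ for $j\ne k$ and $(\Theta_{k,z}\mathbf x)(k)=\alpha\sum_ip(k,i)\mathbf x(i)+(1-\alpha)\mathbf d(k)+z$. With $G(\mathrm dz)=\frac1{\sqrt{2\pi}}e^{-z^2/2}\mathrm dz$ put $L_kf(\mathbf x)=\int G(\mathrm dz)[f(\Theta_{k,z}\mathbf x)-f(\mathbf x)]$ and $L=\sum_kL_k$ (for $f$ depending on finitely many coordinates). Harness process and semigroup. The harness process is the Markov process on $\mathbf X$ with generator $L$: at the epochs of independent rate-one Poisson processes attached to the sites, the height at the ringing site $k$ is replaced by $\alpha\sum_ip(k,i)\mathbf x(i)+(1-\alpha)\mathbf d(k)$ plus an independent standard Gaussian. Concretely, let $\mathcal N$ be a rate-one Poisson process on $\mathbb Z^d\times\mathbb R$ (points $(j,\tau)$, called epochs) with i.i.d. standard Gaussian marks $\xi(j,\tau)$ independent of $\mathcal N$. Given $\mathcal N$, the backward walk started from $i\in\mathbb Z^d$ at time $t$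 runs backwards in time and, each time it meets an epoch $(j,\tau)$ while located at $j$, it jumps to $k\in\mathbb Z^d$ with probability $\alpha p(j,k)$ or is killed at $j$ with probability $1-\alpha$. Let $b_{[s,t]}(i,j)$ be the conditional probability given $\mathcal N$ that the walk is alive and at $j$ at time $s$ (having used the epochs in $[s,t]$), and $b_{[\tau+,t]}(i,j)$ the conditional probability that it is alive and at $j$ just before using the epochs at time $\tau$. For $\mathbf z\in\mathbf X$ put $$\eta_{[0,t]}(i)=\sum_{(j,\tau)\in\mathcal N,\ \tau\in[0,t]}b_{[\tau+,t]}(i,j)\big(\xi(j,\tau)+(1-\alpha)\mathbf d(j)\big)+\sum_{j}b_{[0,t]}(i,j)\mathbf z(j).$$ Then $S(t)f(\mathbf z)=\mathsf E f(\eta_{[0,t]})$, and $\nu S(t)$ is defined by $\int f\,\mathrm d(\nu S(t))=\int S(t)f\,\mathrm d\nu$. *)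

(* Defs.v *)
From HB Require Import structures.
From mathcomp Require Import all_boot all_order all_algebra finmap.
From mathcomp Require Import all_classical all_reals all_analysis.

Set Implicit Arguments.
Unset Strict Implicit.
Unset Printing Implicit Defensive.

Import Order.TTheory GRing.Theory Num.Theory.
Import numFieldNormedType.Exports.

Local Open Scope classical_set_scope.
Local Open Scope ring_scope.

Definition sigma_generated (R : realType) (T K : Type) (D : set K)
    (X : K -> T -> R) : set (set T) :=
  <<s \bigcup_(k in D) preimage_set_system setT (X k) measurable >>.

(* R^I carries the product topology and the product (cylinder) sigma-algebra. *)
Definition cfg (R : realType) (I : Type) := {ptws I -> R}.

Definition cfg_display : measure_display. Proof. exact: default_measure_display. Qed.

Section cfg_structures.
Context (R : realType) (I : Type).

HB.instance Definition _ := Topological.copy (cfg R I) {ptws I -> R}.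
HB.instance Definition _ := isPointed.Build (cfg R I) (fun=> 0).

Definition cfg_eval (i : I) (x : cfg R I) : R := x i.

Let cfg0 : sigma_generated setT cfg_eval set0.
Proof. exact: sigma_algebra0. Qed.

Let cfgC A : sigma_generated setT cfg_eval A -> sigma_generated setT cfg_eval (~` A).
Proof. exact: sigma_algebraC. Qed.

Let cfgU (F : (set (cfg R I))^nat) :
  (forall i, sigma_generated setT cfg_eval (F i)) ->
  sigma_generated setT cfg_eval (\bigcup_i (F i)).
Proof. exact: sigma_algebra_bigcup. Qed.

HB.instance Definition _ := @isMeasurable.Build cfg_display (cfg R I)
  (sigma_generated setT cfg_eval) cfg0 cfgC cfgU.

End cfg_structures.

(* Sum of an absolutely summable real family. *)
Definition asum (R : realType) (I : choiceType) (D : set I) (f : I -> R) : R :=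
  fine (\esum_(i in D) (Num.max (f i) 0)%:E) -
  fine (\esum_(i in D) (Num.max (- f i) 0)%:E).

Section lattice.
Variables (R : realType) (d : nat).

Definition site := 'rV[int]_d.

Definition is_norm (N : 'rV[R]_d -> R) : Prop :=
  [/\ forall x, N x = 0 -> x = 0,
      forall x y, N (x + y) <= N x + N y &
      forall a x, N (a *: x) = `|a| * N x].

(* A norm on Z^d is the restriction of a norm on R^d. *)
Definition site_norm (N : 'rV[R]_d -> R) (i : site) : R :=
  N (map_mx intr i).

Record harness_matrix (N : 'rV[R]_d -> R) (Rg : R) (p : site -> site -> R) :
    Prop := HarnessMatrix {
  hm_ge0 : forall i j, 0 <= p i j ;
  hm_stochastic : forall i, (\esum_(j in [set: site]) (p i j)%:E = 1)%E ;
  hm_homogeneous : forall i j, p i (i + j) = p 0 j ;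
  hm_symmetric : forall i j, p i j = p j i ;
  hm_range : forall j, Rg <= site_norm N j -> p 0 j = 0 }.

Definition Xspace (N : 'rV[R]_d -> R) (alpha Rg : R) : set (cfg R site) :=
  [set x | (\esum_(j in [set: site])
     (`|x j| * alpha `^ (site_norm N j / Rg))%:E < +oo)%E].

Definition test_function (f : cfg R site -> R) : Prop :=
  [/\ exists M, forall x, `|f x| <= M,
      continuous f &
      exists F : {fset site},
        forall x y : cfg R site, (forall i, i \in F -> x i = y i) -> f x = f y].

End lattice.

Section lebesgue_cfg.
Variable R : realType.

Fixpoint lebesgue_tuple (n : nat) : set (n.-tuple R) -> \bar R :=
  match n with
  | 0 => @dirac _ _ [tuple] R
  | m.+1 => pushforward (@lebesgue_measure R \x @lebesgue_tuple m)%E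
              (fun q => [tuple of q.1 :: q.2])
  end.

Definition cfg_of_tuple (I : finType) (t : #|I|.-tuple R) : cfg R I :=
  fun i => tnth t (enum_rank i).

Definition lebesgue_cfg (I : finType) : set (cfg R I) -> \bar R :=
  pushforward (@lebesgue_tuple #|I|) (@cfg_of_tuple I).

End lebesgue_cfg.

Section gibbs.
Variables (R : realType) (d : nat).
Local Notation site := (site d).
Variables (J : site -> site -> R) (h : R) (dat : cfg R site).
Implicit Types (La : {fset site}).

Definition restr La (x : cfg R site) : cfg R La := fun i => x (val i).

Definition glue La (x : cfg R La) (y : cfg R site) : cfg R site :=
  fun i => oapp x (y i) (insub i).

(* The sum over unordered pairs is half the sum over ordered ones, J being
   symmetric; diagonal terms vanish. *)
Definition hamiltonian La (x : cfg R site) : R :=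
  2^-1 * (\sum_(e \in [set e : site * site | e.1 \in La \/ e.2 \in La])
            J e.1 e.2 * (x e.1 - x e.2) ^+ 2) +
  h * \sum_(i <- La) (x i - dat i) ^+ 2.

Definition gibbs_weight La (y : cfg R site) (x : cfg R La) : R :=
  expR (- 2^-1 * hamiltonian La (glue x y)).

Definition gibbs_Z La (y : cfg R site) : \bar R :=
  (\int[@lebesgue_cfg R La]_x (gibbs_weight y x)%:E)%E.

Definition gibbs La (y : cfg R site) : set (cfg R La) -> \bar R :=
  fun A => ((fine (gibbs_Z La y))^-1%:E *
            \int[@lebesgue_cfg R La]_(x in A) (gibbs_weight y x)%:E)%E.

Definition gibbs_mean La (y : cfg R site) (f : cfg R site -> R) : R :=
  fine (\int[@gibbs La y]_x (f (glue x y))%:E)%E.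

(* kappa is a regular conditional distribution of x_La given x_{La^c}. *)
Definition regular_conditional (mu : probability (cfg R site) R) La
    (kappa : cfg R site -> probability (cfg R La) R) : Prop :=
  let outside := sigma_generated [set i | i \notin La] (@cfg_eval R site) in
  (forall A, measurable A -> forall B : set R, measurable B ->
     outside [set y | B (fine (kappa y A))]) /\
  (forall A B, measurable A -> outside B ->
     mu ((@restr La) @^-1` A `&` B) = (\int[mu]_(y in B) kappa y A)%E).

Definition DLR (mu : probability (cfg R site) R) : Prop :=
  forall La, exists2 kappa : cfg R site -> probability (cfg R La) R,
    regular_conditional mu kappa &
    {ae mu, forall y, forall A, measurable A -> kappa y A = gibbs y A}.

End gibbs.

Section generator.
Variables (R : realType) (d : nat).
Local Notation site := (site d).
Variables (alpha : R) (p : site -> site -> R) (dat : cfg R site).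

Definition Theta (k : site) (z : R) (x : cfg R site) : cfg R site :=
  fun j => if j == k
           then alpha * (\sum_(i \in [set: site]) p k i * x i) +
                (1 - alpha) * dat k + z
           else x j.

Definition site_generator (k : site) (f : cfg R site -> R) (x : cfg R site)
    : R :=
  \int[normal_prob 0 1]_z (f (Theta k z x) - f x).

Definition harness_generator (f : cfg R site -> R) (x : cfg R site) : R :=
  \sum_(k \in [set: site]) site_generator k f x.

Definition reversible (mu : probability (cfg R site) R)
    (A : (cfg R site -> R) -> cfg R site -> R) : Prop :=
  forall f g, test_function f -> test_function g ->
    \int[mu]_x (g x * A f x) = \int[mu]_x (f x * A g x).

End generator.

Section harness_process.
Variables (R : realType) (d : nat).
Local Notation site := (site d).

(* The epochs are the points (j, T j n w), n : nat, and xi j n is the mark of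
   (j, T j n).  The law of the counts of disjoint sets of finite intensity
   characterizes the Poisson process with intensity counting x Lebesgue. *)
Record marked_poisson (dO : measure_display) (Omega : measurableType dO)
    (P : probability Omega R) (T xi : site -> nat -> Omega -> R) : Prop :=
  MarkedPoisson {
  mp_time : forall j n, measurable_fun setT (T j n) ;
  mp_mark : forall j n, measurable_fun setT (xi j n) ;
  mp_poisson : forall (m : nat) (B : 'I_m -> set (site * R))
      (k : 'I_m -> nat) (lam : 'I_m -> R),
    (forall l j, measurable [set s : R | B l (j, s)]) ->
    trivIset setT B ->
    (forall l, (\esum_(j in [set: site])
        lebesgue_measure [set s : R | B l (j, s)])%E = (lam l)%:E) ->
    P [set w | forall l,
         @counting (site * nat)%type R
           [set e | B l (e.1, T e.1 e.2 w)] = (k l)%:R%:E] =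
    (\prod_(l < m) (lam l ^+ k l / (k l)`!%:R * expR (- lam l)))%:E ;
  mp_marks_iid : forall (E : set Omega) (F : {fset site * nat})
      (A : site * nat -> set R),
    sigma_generated [set: site * nat] (fun e => T e.1 e.2) E ->
    (forall e, measurable (A e)) ->
    P (E `&` [set w | forall e, e \in F -> A e (xi e.1 e.2 w)]) =
    (P E * \prod_(e <- F) normal_prob (0 : R) 1 (A e))%E }.

Variables (alpha : R) (p : site -> site -> R) (dat : cfg R site).

(* Conditional probability that the backward walk started at i, using the
   epochs with time in I, makes exactly the jumps to the successive sites of
   w, and then is at j and meets no further epoch; ep k is the set of epochs
   of the site k, and the supremum below is the latest available epoch at i. *)
Fixpoint path_prob (ep : site -> set R) (I : set R) (i : site)
    (w : seq site) (j : site) : R :=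
  let avail := ep i `&` I in
  match w with
  | [::] => if `[< avail = set0 >] && (i == j) then 1 else 0
  | k :: w' =>
      if `[< avail = set0 >] then 0
      else alpha * p i k *
           path_prob ep (I `&` [set s | s < sup avail]) k w' j
  end.

Definition walk_prob (ep : site -> set R) (I : set R) (i j : site) : R :=
  fine (\esum_(w in [set: seq site]) (path_prob ep I i w j)%:E)%E.

Context (dO : measure_display) (Omega : measurableType dO)
  (P : probability Omega R) (T xi : site -> nat -> Omega -> R).

Definition epochs (w : Omega) (j : site) : set R := range (fun n => T j n w).

Definition eta (t : R) (z : cfg R site) (w : Omega) : cfg R site := fun i =>
  asum [set e : site * nat | T e.1 e.2 w \in `[0, t]]
    (fun e => walk_prob (epochs w) `]T e.1 e.2 w, t]%classic i e.1 *
              (xi e.1 e.2 w + (1 - alpha) * dat e.1)) +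
  asum [set: site] (fun j => walk_prob (epochs w) `[0, t]%classic i j * z j).

Definition harness_semigroup (t : R) (f : cfg R site -> R) (z : cfg R site) : R :=
  \int[P]_w f (eta t z w).

End harness_process.

(* Main.v *)
Require Import Defs.
From HB Require Import structures.
From mathcomp Require Import all_boot all_order all_algebra finmap.
From mathcomp Require Import all_classical all_reals all_analysis.
From mathcomp Require Import measurable_realfun ring lra zify.

(* The update at k is a heat bath: it resamples x(k) from its Gaussian conditional
   law given the other sites.  Running it along a list of sites, two
   configurations |x - y| <= C u drift apart by at most C Q_1 ... Q_n u, where Q_k
   replaces v(k) by alpha (P v)(k) and u(i) = alpha^(-|i|/R).  Finite range gives
   alpha P u <= rho u with rho < 1, so a potential argument shows that
   Q_1 ... Q_n u -> 0 along any sequence visiting every site infinitely often, and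
   that skipping updates only makes this quantity larger.  Hence heat-bath runs
   converge to a law mu not depending on the start.  Finite-volume Gibbs laws are
   reversible for the heat baths inside the volume, so they have bounded weighted
   moments and converge to mu too, which gives reversibility, the DLR equations
   (sweeping a fixed volume many times) and uniqueness.  For the harness process,
   conditionally on the epochs the backward-walk formula is the limit of
   heat-bath runs along the time-ordered epochs in finite boxes; for large t these
   contain any prescribed finite list of updates with probability close to 1. *)

Set Implicit Arguments.
Unset Strict Implicit.
Unset Printing Implicit Defensive.

Import Order.TTheory GRing.Theory Num.Theory.
Import numFieldNormedType.Exports.

Local Open Scope classical_set_scope.
Local Open Scope ring_scope.


(** * Bounded measurable functions *)

(** The heat baths contract in no uniform sense: an update acts at one site only, and [u] is
    unbounded. Read backwards, the updates move a killed walk, and each update at a site costs the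
    [u]-potential a fixed fraction of the mass found there, so the mass dies out on every fixed
    site. Mass that runs off to infinity is controlled by the second weight [u'], still
    superharmonic but larger than any multiple of [u] off a finite set. Both rho < 1 and the
    existence of [u'] come from the open range condition: finitely many jumps are possible, so the
    longest is strictly shorter than R. A mean of |x(i)| of order u(i) does not put [mu] on X, since
    u is not summable against its own inverse. This is why first moments are bounded by every
    supersolution of w >= alpha P w + c + |d|, and not just by a multiple of u. The harness height
    is an infinite sum over walks; it is identified only as an almost sure limit of measurable runs,
    and the semigroup is integrated over the start without a measurability claim. Hence the
    integrals of functions that agree almost everywhere with measurable ones, or are enclosed
    between such. *)

Section bounded_measurable.
Context d (T : measurableType d) (R : realType).

Definition bmf (f : T -> R) :=
  measurable_fun setT f /\ exists M, forall x, `|f x| <= M.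

Lemma bmf_integrable (P : probability T R) f :
  bmf f -> P.-integrable setT (EFin \o f).
Proof.
move=> [mf [M fM]]; apply: measurable_bounded_integrable => //.
  by rewrite (le_lt_trans (probability_le1 P measurableT))// ltry.
exists M; split; first exact: num_real.
by move=> y /ltW My x _ /=; exact: le_trans My.
Qed.

Lemma bmf_cst (c : R) : bmf (cst c).
Proof. by split; [exact: measurable_cst | exists `|c|]. Qed.

Lemma bmfD f g : bmf f -> bmf g -> bmf (fun x => f x + g x).
Proof.
move=> [mf [M fM]] [mg [M' gM]]; split; first exact: measurable_funD.
by exists (M + M') => x; rewrite (le_trans (ler_normD _ _))// lerD.
Qed.

Lemma bmfM f g : bmf f -> bmf g -> bmf (fun x => f x * g x).
Proof.
move=> [mf [M fM]] [mg [M' gM]]; split; first exact: measurable_funM.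
by exists (M * M') => x; rewrite normrM ler_pM.
Qed.

Lemma bmfZ c f : bmf f -> bmf (fun x => c * f x).
Proof. by move=> bf; apply: (@bmfM (cst c)) => //; exact: bmf_cst. Qed.

Lemma bmfN f : bmf f -> bmf (fun x => - f x).
Proof.
by move=> [mf [M fM]]; split; [exact: measurableT_comp|exists M => x; rewrite normrN].
Qed.

Lemma bmfB f g : bmf f -> bmf g -> bmf (fun x => f x - g x).
Proof. by move=> bf bg; apply: bmfD => //; exact: bmfN. Qed.

Lemma bmf_norm f : bmf f -> bmf (fun x => `|f x|).
Proof.
move=> [mf [M fM]]; split; first exact: measurableT_comp.
by exists M => x; rewrite normr_id.
Qed.

Variable P : probability T R.

Lemma Rint_cst (c : R) : \int[P]_x c = c.
Proof. rewrite Rintegral_cst// (_ : fine _ = 1) ?mulr1//.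
transitivity (fine (1%E : \bar R)) => //; congr fine; exact: probability_setT. Qed.

Lemma RintD f g : bmf f -> bmf g ->
  \int[P]_x (f x + g x) = \int[P]_x f x + \int[P]_x g x.
Proof. by move=> bf bg; rewrite RintegralD//; exact: bmf_integrable. Qed.

Lemma RintB f g : bmf f -> bmf g ->
  \int[P]_x (f x - g x) = \int[P]_x f x - \int[P]_x g x.
Proof. by move=> bf bg; rewrite RintegralB//; exact: bmf_integrable. Qed.

Lemma RintZ c f : bmf f -> \int[P]_x (c * f x) = c * \int[P]_x f x.
Proof. by move=> bf; rewrite RintegralZl//; exact: bmf_integrable. Qed.

Lemma le_Rint f g : bmf f -> bmf g -> (forall x, f x <= g x) ->
  \int[P]_x f x <= \int[P]_x g x.
Proof. by move=> bf bg fg; apply: le_Rintegral => //; exact: bmf_integrable. Qed.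

Lemma EFin_Rint f : bmf f -> (\int[P]_x f x)%:E = (\int[P]_x (f x)%:E)%E.
Proof.
by move=> bf; rewrite fineK//; apply: integrable_fin_num => //; exact: bmf_integrable.
Qed.

Lemma Rint_norm_le f M : bmf f -> (forall x, `|f x| <= M) -> `|\int[P]_x f x| <= M.
Proof.
move=> bf fM; apply: (le_trans (le_normr_Rintegral _ (bmf_integrable P bf))) => //.
rewrite -[leRHS](Rint_cst M); apply: le_Rint => //; first exact: bmf_norm.
exact: bmf_cst.
Qed.

Lemma Rint_dct (f_ : nat -> T -> R) (f : T -> R) (M : R) :
  (forall n, measurable_fun setT (f_ n)) -> measurable_fun setT f ->
  (forall n x, `|f_ n x| <= M) ->
  {ae P, forall x, f_ n x @[n --> \oo] --> f x} ->
  \int[P]_x f_ n x @[n --> \oo] --> \int[P]_x f x.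
Proof.
move=> mf_ mf fM cf.
have [|||||] := @dominated_convergence _ T R P setT measurableT
  (fun n x => (f_ n x)%:E) (fun x => (f x)%:E) (cst M%:E).
- by move=> n; exact/measurable_EFinP.
- exact/measurable_EFinP.
- apply: filterS cf => x fx _; apply/fine_cvgP; split => //.
  exact: nearW.
- apply: (@bmf_integrable P (cst M)); exact: bmf_cst.
- by apply: aeW => x n _; rewrite lee_fin.
move=> intf _ cv; apply: (@fine_cvg _ _ _ _ _ (\int[P]_x f x)).
by rewrite fineK//; exact: integrable_fin_num.
Qed.

Lemma Rint_pushforward d' (T' : measurableType d') (phi : T -> T')
    (mphi : measurable_fun setT phi) (Q : probability T' R) (f : T' -> R) :
  (forall A, measurable A -> Q A = P (phi @^-1` A)) ->
  measurable_fun setT f ->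
  \int[Q]_x f x = \int[P]_x f (phi x).
Proof.
move=> QP mf; rewrite /Rintegral; congr fine.
rewrite (@eq_measure_integral _ _ _ _ (pushforward P phi)); last first.
  by move=> A mA _; exact: QP.
rewrite integralE [RHS]integralE; congr (_ - _)%E.
- rewrite ge0_integral_pushforward//; last first.
    exact/measurable_funepos/measurable_EFinP.
  by rewrite preimage_setT; apply: eq_integral => x _; rewrite /= !funeposE.
- rewrite ge0_integral_pushforward//; last first.
    exact/measurable_funeneg/measurable_EFinP.
  by rewrite preimage_setT; apply: eq_integral => x _; rewrite /= !funenegE.
Qed.

End bounded_measurable.

(** * Integrands known off a null set only, and densities *)

Section nonmeasurable.
Context d (T : measurableType d) (R : realType) (mu : {measure set T -> \bar R}).
Import HBNNSimple.
Local Open Scope ereal_scope.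

(** The integral of a nonnegative function is the supremum of the integrals of the simple functions
    below it, measurable or not. Cutting off on the measurable null set [N] changes no integral of a
    measurable function, and turns a minorant of one integrand into a minorant of the other. *)
Let ge0_integral_off_null (f g : T -> \bar R) :
  (forall x, 0 <= f x) -> measurable_fun (U := \bar R) setT g -> (forall x, 0 <= g x) ->
  {ae mu, forall x, f x = g x} -> \int[mu]_x f x = \int[mu]_x g x.
Proof.
move=> f0 mg g0 [N [mN N0 fgN]].
have fg x : ~ N x -> f x = g x by move=> Nx; apply: contrapT => /fgN.
pose ind : T -> \bar R := fun x => (\1_(~` N) x)%:E.
have mind : measurable_fun setT ind.
  by apply/measurable_EFinP/measurable_indic; exact: measurableC.
have ind0 x : 0 <= ind x by rewrite lee_fin.
have aeN (h : T -> \bar R) : measurable_fun setT h -> (forall x, 0 <= h x) ->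
    \int[mu]_x h x = \int[mu]_x (h x * ind x).
  move=> mh h0; apply: ge0_ae_eq_integral => //.
  - exact: emeasurable_funM.
  - by move=> x _; rewrite mule_ge0.
  exists N; split => // x /= hx; apply: contrapT => Nx; apply: hx => _.
  by rewrite /ind indicE mem_set// mule1.
apply/eqP; rewrite eq_le; apply/andP; split.
- rewrite ge0_integralTE//; apply: ge_ereal_sup => _ [h /= hf <-].
  rewrite -integralT_nnsfun (aeN (EFin \o h)); last 2 first.
    exact/measurable_EFinP.
    by move=> x; rewrite lee_fin.
  apply: ge0_le_integral => //.
  - by move=> x _; rewrite mule_ge0// lee_fin.
  - by apply: emeasurable_funM => //; exact/measurable_EFinP.
  - move=> x _; rewrite /ind indicE; have [Nx|Nx] := pselect (N x).
      by rewrite memNset//= mule0.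
    by rewrite mem_set//= mule1 -fg.
- rewrite (aeN g)// ge0_integralTE; last by move=> x; rewrite mule_ge0.
  apply: ge_ereal_sup => _ [h /= hg <-].
  rewrite [leRHS]ge0_integralTE//; apply: ereal_sup_ubound; exists h => //= x.
  rewrite (le_trans (hg x))// /ind indicE; have [Nx|Nx] := pselect (N x).
    by rewrite memNset//= mule0.
  by rewrite mem_set// mule1 -fg.
Qed.

(* [f] itself need not be measurable: [mu] is not assumed complete *)
Lemma ae_eq_integral_nonmeasurable (f g : T -> \bar R) :
  measurable_fun (U := \bar R) setT g -> {ae mu, forall x, f x = g x} ->
  \int[mu]_x f x = \int[mu]_x g x.
Proof.
move=> mg fg; rewrite integralE [RHS]integralE; congr (_ - _).
- apply: ge0_integral_off_null => //; first exact: measurable_funepos.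
  by apply: filterS fg => x fg; rewrite !funeposE fg.
- apply: ge0_integral_off_null => //; first exact: measurable_funeneg.
  by apply: filterS fg => x fg; rewrite !funenegE fg.
Qed.

Lemma ge0_integral_density (nu : {measure set T -> \bar R}) (v : T -> R)
    (w := fun x => (v x)%:E) :
  measurable_fun (U := \bar R) setT w -> (forall x, 0 <= w x) ->
  (forall A, measurable A -> nu A = \int[mu]_(x in A) w x) ->
  forall f : T -> \bar R, measurable_fun (U := \bar R) setT f -> (forall x, 0 <= f x) ->
  \int[nu]_x f x = \int[mu]_x (f x * w x).
Proof.
move=> mw w0 nuE f mf f0.
have ind A : measurable A -> \int[nu]_x (\1_A x)%:E = \int[mu]_x ((\1_A x)%:E * w x).
  move=> mA; rewrite integral_indic// setIT nuE// integral_mkcond.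
  apply: eq_integral => x _; rewrite patchE indicE.
  by case: ifPn; rewrite ?mul1e ?mul0e.
have nns (h : {nnsfun T >-> R}) :
    \int[nu]_x (h x)%:E = \int[mu]_x ((h x)%:E * w x).
  under eq_integral do rewrite fimfunE -fsumEFin//.
  rewrite ge0_integral_fsum//; last 2 first.
  - by move=> r; exact/measurable_EFinP/measurableT_comp.
  - by move=> n x _; rewrite EFinM nnfun_muleindic_ge0.
  under [RHS]eq_integral.
    move=> x xD; rewrite fimfunE -fsumEFin// ge0_mule_fsuml; last first.
      by move=> r; rewrite EFinM nnfun_muleindic_ge0.
    over.
  rewrite ge0_integral_fsum//; last 2 first.
  - move=> r; apply: emeasurable_funM => //.
    exact/measurable_EFinP/measurableT_comp.
  - move=> n x _; rewrite mule_ge0//.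
    by rewrite EFinM nnfun_muleindic_ge0.
  apply: eq_fsbigr => r _.
  have mr : measurable (h @^-1` [set r]) by [].
  have [r0|r0] := leP 0%R r; last first.
    rewrite (_ : h @^-1` [set r] = set0); last first.
      rewrite -subset0 => x /= hx; move: r0; rewrite -hx ltNge.
      by move=> /negP; apply.
    by under [RHS]eq_integral do rewrite indic0 mulr0 mul0e;
       under eq_integral do rewrite indic0 mulr0; rewrite !integral0.
  under eq_integral do rewrite EFinM.
  rewrite ge0_integralZl_EFin//; last exact/measurable_EFinP.
  rewrite ind// -ge0_integralZl_EFin//.
  - by apply: eq_integral => x _; rewrite EFinM muleA.
  - by move=> x _; rewrite mule_ge0.
  - by apply: emeasurable_funM => //; exact/measurable_EFinP.
pose f_ := nnsfun_approx measurableT mf.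
have nd x : nondecreasing_seq (fun n => (f_ n x)%:E).
  by move=> m n mn; rewrite lee_fin; exact/lefP/nd_nnsfun_approx.
transitivity (limn (fun n => \int[nu]_x (f_ n x)%:E)).
  rewrite -monotone_convergence//=.
  - apply: eq_integral => x _; apply/esym/cvg_lim => //=.
    exact: cvg_nnsfun_approx.
  - by move=> n; exact/measurable_EFinP.
  - by move=> n x _; rewrite lee_fin.
under eq_fun do rewrite nns.
rewrite -monotone_convergence//=.
- apply: eq_integral => x _; apply/cvg_lim => //=.
  by apply: cvgeZr => //; apply: cvg_nnsfun_approx.
- by move=> n; apply: emeasurable_funM => //; exact/measurable_EFinP.
- by move=> n x _; rewrite mule_ge0// lee_fin.
- by move=> x _ m n mn; rewrite lee_wpmul2r//; exact: nd.
Qed.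

End nonmeasurable.

Section push_prob.
Context d d' (T : measurableType d) (T' : measurableType d') (R : realType).
Variables (P : probability T R) (phi : T -> T').
Hypothesis mphi : measurable_fun setT phi.

(** The [let] keeps [mphi] among the arguments, so that the measure and probability structures are
    attached to the term itself and found by unification. *)
Definition push_prob : set T' -> \bar R := let _ := mphi in pushforward P phi.

Let push0 : push_prob set0 = 0%E.
Proof. by rewrite /push_prob /pushforward preimage_set0 measure0. Qed.

Let push_ge0 A : (0 <= push_prob A)%E.
Proof. exact: measure_ge0. Qed.

Let push_sadd : semi_sigma_additive push_prob.
Proof.
move=> F mF tF mUF; rewrite /push_prob /pushforward preimage_bigcup.
apply: measure_semi_sigma_additive.
- by move=> n; rewrite -[X in measurable X]setTI; exact: mphi.
- apply/trivIsetP => /= i j _ _ ij; rewrite -preimage_setI.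
  by move/trivIsetP : tF => /(_ _ _ _ _ ij) ->//; rewrite preimage_set0.
- by rewrite -preimage_bigcup -[X in measurable X]setTI; exact: mphi.
Qed.

HB.instance Definition _ := isMeasure.Build _ _ _ push_prob push0 push_ge0 push_sadd.

Let pushT : push_prob setT = 1%E.
Proof. by rewrite /push_prob /pushforward preimage_setT probability_setT. Qed.

HB.instance Definition _ := @Measure_isProbability.Build _ _ R push_prob pushT.

Lemma Rint_push (f : T' -> R) : measurable_fun setT f ->
  \int[push_prob]_x f x = \int[P]_x f (phi x).
Proof. exact: Rint_pushforward. Qed.

Lemma ge0_integral_push (f : T' -> \bar R) : measurable_fun (U := \bar R) setT f ->
  (forall x, 0 <= f x)%E -> (\int[push_prob]_x f x = \int[P]_x f (phi x))%E.
Proof.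
move=> mf f0; rewrite (@eq_measure_integral _ _ _ _ (pushforward P phi))//.
by rewrite ge0_integral_pushforward// preimage_setT.
Qed.

End push_prob.

(** * The cylinder sigma-algebra *)

Section sigma_generated.
Context (R : realType) (T K : Type).
Implicit Types (D : set K) (X : K -> T -> R).

Lemma sigma_generatedT D X : sigma_generated D X setT.
Proof. by rewrite -setC0 -setTD; apply: sigma_algebraCD; exact: sigma_algebra0. Qed.

Lemma sigma_generated_gen D X k (B : set R) : D k -> measurable B ->
  sigma_generated D X (X k @^-1` B).
Proof.
move=> Dk mB; apply: sub_sigma_algebra; exists k => //; exists B => //.
by rewrite setTI.
Qed.

Lemma sigma_generated_min D X (S : set (set T)) : sigma_algebra setT S ->
  (forall k (B : set R), D k -> measurable B -> S (X k @^-1` B)) ->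
  sigma_generated D X `<=` S.
Proof.
move=> sS XS; apply: smallest_sub => // A [k Dk [B mB <-]].
by rewrite setTI; exact: XS.
Qed.

Lemma sigma_generated_minC D X : sigma_algebra setT (sigma_generated D X).
Proof. exact: smallest_sigma_algebra. Qed.

Lemma sigma_generatedC D X A : sigma_generated D X A ->
  sigma_generated D X (~` A).
Proof. by move=> sA; rewrite -setTD; exact: sigma_algebraCD. Qed.

Lemma sigma_generatedI D X A B : sigma_generated D X A ->
  sigma_generated D X B -> sigma_generated D X (A `&` B).
Proof.
move=> sA sB; rewrite -(setCK (A `&` B)) setCI.
by apply: sigma_generatedC; rewrite -bigcup2E; apply: sigma_algebra_bigcup;
  case=> [|[|n]] /=; [exact: sigma_generatedC|exact: sigma_generatedC|exact: sigma_algebra0].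
Qed.

Lemma sigma_generated_bigcup (I : countType) D X (F : I -> set T) :
  (forall i, sigma_generated D X (F i)) ->
  sigma_generated D X (\bigcup_i F i).
Proof.
move=> sF; pose G n := if (choice.unpickle n : option I) is Some i then F i else set0.
rewrite (_ : \bigcup_i F i = \bigcup_n G n).
  apply: sigma_algebra_bigcup => n; rewrite /G.
  by case: choice.unpickle => [i|]; [exact: sF|exact: sigma_algebra0].
apply/seteqP; split=> [t [i _ Fit]|t [n _]]; rewrite /G.
  by exists (choice.pickle i) => //; rewrite choice.pickleK.
by case: choice.unpickle => // i Fit; exists i.
Qed.

Lemma sigma_generated_bigcap (I : countType) D X (F : I -> set T) :
  (forall i, sigma_generated D X (F i)) ->
  sigma_generated D X (\bigcap_i F i).
Proof.
move=> sF; rewrite -[X in _ X]setCK setC_bigcap; apply: sigma_generatedC.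
by apply: sigma_generated_bigcup => i; exact: sigma_generatedC.
Qed.

End sigma_generated.

Section countable_measurable.
Context d (T : measurableType d) (I : countType).

Lemma measurable_bigcup_count (F : I -> set T) :
  (forall i, measurable (F i)) -> measurable (\bigcup_i F i).
Proof.
move=> mF; pose G n := if (choice.unpickle n : option I) is Some i then F i else set0.
rewrite (_ : \bigcup_i F i = \bigcup_n G n).
  by apply: bigcup_measurable => n _; rewrite /G; case: choice.unpickle.
apply/seteqP; split=> [t [i _ Fit]|t [n _]]; rewrite /G.
  by exists (choice.pickle i) => //; rewrite choice.pickleK.
by case: choice.unpickle => // i Fit; exists i.
Qed.

Lemma measurable_bigcap_count (F : I -> set T) :
  (forall i, measurable (F i)) -> measurable (\bigcap_i F i).
Proof.
move=> mF; rewrite -[X in measurable X]setCK setC_bigcap; apply: measurableC.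
by apply: measurable_bigcup_count => i; exact: measurableC.
Qed.

End countable_measurable.

Section cfg_measurable.
Context (R : realType) (I : choiceType).
Implicit Types (F : {fset I}) (D : set I).

Lemma measurable_cfg_eval i : measurable_fun setT (fun x : cfg R I => x i).
Proof. by move=> _ B mB; rewrite setTI; apply: (@sigma_generated_gen R _ _ setT). Qed.

Lemma measurable_fun_cfg d (T : measurableType d) (f : T -> cfg R I) :
  (forall i, measurable_fun setT (fun t => f t i)) -> measurable_fun setT f.
Proof.
move=> mf; apply: (@measurability _ _ _ _ _ _
  (\bigcup_(k in setT) preimage_set_system setT (@cfg_eval R I k) measurable)) => //.
move=> _ [_ [k _ [B mB <-]] <-].
by rewrite setTI; exact: (mf k measurableT B mB).
Qed.

Lemma sigma_generated_measurable D A :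
  sigma_generated D (@cfg_eval R I) A -> measurable A.
Proof.
apply: (@sigma_generated_min R _ _ D _ measurable).
  exact: sigma_algebra_measurable.
by move=> k B _ mB; have := measurable_cfg_eval k measurableT mB; rewrite setTI.
Qed.

(** Closed upper rays: taking maxima of the bounds keeps these sets stable under intersection, and
    the indicator of such a box is a decreasing limit of Lipschitz functions. *)
Definition ray_box F (a : I -> R) : set (cfg R I) :=
  [set x | forall i, i \in F -> a i <= x i].

Definition ray_boxes D : set (set (cfg R I)) :=
  [set B | exists F a, (forall i, i \in F -> D i) /\ B = ray_box F a].

Lemma ray_boxes_setI D : setI_closed (ray_boxes D).
Proof.
move=> _ _ [F [a [FD ->]]] [F' [a' [FD' ->]]].
exists (F `|` F')%fset, (fun i => if i \in F then
  (if i \in F' then Num.max (a i) (a' i) else a i) else a' i); split.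
  by move=> i; rewrite in_fsetU => /orP[/FD|/FD'].
apply/seteqP; split=> [x [xF xF'] i|x xF].
  rewrite in_fsetU; case: (boolP (i \in F)) => iF; case: (boolP (i \in F')) => iF' // _.
  - by rewrite ge_max xF// xF'.
  - exact: xF.
  - exact: xF'.
split=> i iF; have := xF i; rewrite in_fsetU iF/= ?orbT => /(_ isT).
  by case: ifPn => // _; rewrite ge_max => /andP[].
by case: ifPn => // _; rewrite ge_max => /andP[].
Qed.

Lemma sigma_generated_ray_boxes D :
  sigma_generated D (@cfg_eval R I) = <<s ray_boxes D >>.
Proof.
apply/seteqP; split.
  apply: sigma_generated_min; first exact: smallest_sigma_algebra.
  move=> k B Dk mB.
  pose S : set (set R) := [set B | <<s ray_boxes D >> (@cfg_eval R I k @^-1` B)].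
  suff : measurable `<=` S by exact.
  have -> : @measurable _ R = <<s @RGenCInfty.G R >>.
    exact: RGenCInfty.measurableE.
  apply: smallest_sub.
    split; rewrite /S/=.
    - rewrite preimage_set0; exact: sigma_algebra0.
    - by move=> A; rewrite setTD preimage_setC; exact: sigma_algebraC.
    - by move=> A mA; rewrite preimage_bigcup; exact: sigma_algebra_bigcup.
  move=> _ [a ->]; apply: sub_sigma_algebra.
  exists [fset k]%fset, (fun=> a); split=> [i|]; first by rewrite inE => /eqP ->.
  apply/seteqP; split=> [x /=|x /=]; rewrite in_itv/= andbT.
    by move=> ax i; rewrite inE => /eqP ->.
  by move=> /(_ k); apply; rewrite inE.
apply: smallest_sub; first exact: sigma_generated_minC.
move=> _ [F [a [FD ->]]].
rewrite (_ : ray_box F a = \bigcap_(i : F) (@cfg_eval R I (val i) @^-1` `[a (val i), +oo[)).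
  by apply: sigma_generated_bigcap => i; apply: sigma_generated_gen => //; exact: FD (fsvalP i).
apply/seteqP; split=> [x xF i _|x xF i iF].
  by rewrite /= in_itv/= andbT; exact: xF.
by have := xF [` iF]%fset Logic.I; rewrite /= in_itv/= andbT.
Qed.

Lemma measurable_ray_box F a : measurable (ray_box F a).
Proof.
apply: (@sigma_generated_measurable setT); rewrite sigma_generated_ray_boxes.
by apply: sub_sigma_algebra; exists F, a.
Qed.

Lemma ray_box0 a : ray_box fset0 a = setT.
Proof. by apply/seteqP; split. Qed.

Lemma cfg_measure_unique (m1 m2 : {measure set (cfg R I) -> \bar R}) :
  (m1 setT < +oo)%E -> (forall F a, m1 (ray_box F a) = m2 (ray_box F a)) ->
  forall A, measurable A -> m1 A = m2 A.
Proof.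
move=> fin1 m12 A mA.
apply: (measure_unique (ray_boxes setT) (fun=> setT)) => //.
- exact: sigma_generated_ray_boxes.
- exact: ray_boxes_setI.
- by move=> _; exists fset0, (fun=> 0); rewrite ray_box0.
- by rewrite bigcup_const.
- by move=> _ [F [a [_ ->]]].
Qed.

Definition proj_on D (x : cfg R I) : cfg R I := fun i => if `[< D i >] then x i else 0.

(** A measurable set that does not change when the coordinates off [D] are set to 0 is its own
    preimage under [proj_on D]. This is how kernels that ignore a finite volume are shown to be
    measurable with respect to the outside. *)
Lemma sigma_generated_proj D A : measurable A ->
  sigma_generated D (@cfg_eval R I) (proj_on D @^-1` A).
Proof.
apply: (@sigma_generated_min R _ _ setT (@cfg_eval R I)
  [set A | sigma_generated D (@cfg_eval R I) (proj_on D @^-1` A)]).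
  split=> /=.
  - by rewrite preimage_set0; exact: sigma_algebra0.
  - by move=> B; rewrite setTD preimage_setC; exact: sigma_generatedC.
  - by move=> B mB; rewrite preimage_bigcup; exact: sigma_algebra_bigcup.
move=> k B _ mB /=; rewrite -comp_preimage.
have [Dk|Dk] := pselect (D k).
  rewrite (_ : _ \o _ = @cfg_eval R I k); first exact: sigma_generated_gen.
  by apply/funext => x; rewrite /proj_on/= /cfg_eval asboolT.
rewrite (_ : _ \o _ = cst 0); last first.
  by apply/funext => x; rewrite /proj_on/= /cfg_eval asboolF.
rewrite preimage_cst; case: ifP => _; first exact: sigma_generatedT.
exact: sigma_algebra0.
Qed.

(** The sets that do not separate [x] from [y] form a sigma-algebra containing the generators. *)
Lemma sigma_generated_dep D A : sigma_generated D (@cfg_eval R I) A ->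
  forall x y, (forall i, D i -> x i = y i) -> A x -> A y.
Proof.
move=> sA x y xy; suff: A x <-> A y by case.
move: A sA; apply: (@sigma_generated_min _ _ _ D (@cfg_eval R I)
  [set A | A x <-> A y]).
  split => //=.
  - by move=> A Axy; rewrite /setD/= Axy.
  - by move=> F Fxy; split=> -[n _ /Fxy ?]; exists n.
by move=> k B Dk mB /=; rewrite /cfg_eval xy.
Qed.

End cfg_measurable.

(** * Bounded Lipschitz local functions *)

Lemma cvg_sumr (R : realType) (S : Type) (G : set_system S) (FG : Filter G)
    (K : Type) (s : seq K) (f : K -> S -> R) (l : K -> R) :
  (forall k, f k x @[x --> G] --> l k) ->
  \sum_(k <- s) f k x @[x --> G] --> \sum_(k <- s) l k.
Proof.
move=> fl; elim: s => [|k s IH].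
  by under eq_fun do rewrite big_nil; rewrite big_nil; exact: cvg_cst.
by under eq_fun do rewrite big_cons; rewrite big_cons; apply: cvgD.
Qed.

Section test_functions.
Context (R : realType) (I : choiceType).
Implicit Types (F : {fset I}) (f g : cfg R I -> R).

Lemma cfg_cvgP (T : Type) (G : set_system T) {FG : Filter G} (u : T -> cfg R I) (x : cfg R I) :
  u @ G --> x <-> forall i, (fun t => u t i) @ G --> x i.
Proof.
split=> [ux i|ux].
  exact: (cvg_comp _ _ ux (@proj_continuous I (fun=> R) i x)).
suff : {ptws, (u @ G) --> x} by [].
apply/cvg_sup => i U [V] [[W oW <-]] Wx WU.
have GW : G [set t | W (u t i)] by apply: ux; exact: open_nbhs_nbhs.
by apply: (@filterS _ G _ _ _ _ GW) => t Wt; exact: WU.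
Qed.

(** [test_function] for an arbitrary index type; at [site d] the two unfold to the same
    proposition. *)
Definition loc_test f :=
  [/\ exists M, forall x, `|f x| <= M, continuous f &
      exists F, forall x y, (forall i, i \in F -> x i = y i) -> f x = f y].

Definition dist_on F (x y : cfg R I) : R := \sum_(i <- F) `|x i - y i|.

Definition BLf f := (exists M, forall x, `|f x| <= M) /\
  exists F C, 0 <= C /\ forall x y, `|f x - f y| <= C * dist_on F x y.

Lemma dist_on_ge0 F x y : 0 <= dist_on F x y.
Proof. by apply: sumr_ge0. Qed.

Lemma dist_onxx F x : dist_on F x x = 0.
Proof. by rewrite /dist_on big1// => i _; rewrite subrr normr0. Qed.

Lemma dist_on_triangle F x y z : dist_on F x z <= dist_on F x y + dist_on F y z.
Proof.
rewrite /dist_on -big_split/=; apply: ler_sum => i _.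
by rewrite (le_trans _ (ler_normD _ _))// addrA subrK.
Qed.

Lemma eq_dist_on F x y x' y' : (forall i, i \in F -> x i = x' i) ->
  (forall i, i \in F -> y i = y' i) -> dist_on F x y = dist_on F x' y'.
Proof. by move=> xx' yy'; apply: eq_big_seq => i iF; rewrite xx'// yy'. Qed.

Lemma dist_on_subset F F' x y : (F `<=` F')%fset -> dist_on F x y <= dist_on F' x y.
Proof.
move=> FF'; rewrite /dist_on (big_fsetID _ (mem F) F')/=.
rewrite (_ : [fset i in F' | i \in F]%fset = F); last first.
  apply/fsetP => i; rewrite !inE/=; apply/andP/idP => [[]//|iF].
  by rewrite iF (fsubsetP FF').
by rewrite lerDl sumr_ge0.
Qed.

Lemma BL_loc_test f : BLf f -> loc_test f.
Proof.
move=> [Mf [F [C [C0 fL]]]]; split => //.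
- move=> x; change (f @ nbhs x --> f x); apply/cvgrPdist_le => e e0.
  suff: dist_on F x y @[y --> x] --> (0 : R).
    move=> /cvgrPdist_le /(_ (e / (C + 1))); rewrite divr_gt0// ?ltr_wpDl//.
    move=> /(_ isT); apply: filterS => y; rewrite sub0r normrN ger0_norm ?dist_on_ge0//.
    rewrite ler_pdivlMr ?ltr_wpDl// => xye; rewrite (le_trans (fL _ _))//.
    by rewrite (le_trans _ xye)// mulrC ler_wpM2l ?dist_on_ge0// lerDl.
  rewrite -(@big1 R 0 +%R I F xpredT (fun=> 0))//.
  rewrite /dist_on; apply: (@cvg_sumr R _ (nbhs x)) => i.
  rewrite [X in _ --> X](_ : 0 = `|x i - x i|); last by rewrite subrr normr0.
  apply: cvg_norm; apply: cvgB; first exact: cvg_cst.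
  exact: (@proj_continuous I (fun=> R) i x).
- exists F => x y xy; apply/eqP; rewrite -subr_eq0 -normr_le0 (le_trans (fL x y))//.
  by rewrite (@eq_dist_on F x y y y)// dist_onxx mulr0.
Qed.

(** Rounding the coordinates in [F] down to multiples of 1/(n+1), and setting the others to 0,
    leaves countably many configurations. So [f] of the rounded configuration is measurable, and
    continuity gives convergence to [f]. *)
Lemma loc_test_measurable f : loc_test f -> measurable_fun setT f.
Proof.
move=> [_ cf [F fF]].
pose D n (x : cfg R I) : cfg R I := fun i =>
  if i \in F then (Num.floor (n.+1%:R * x i))%:~R / n.+1%:R else 0.
pose P (x : cfg R I) : cfg R I := fun i => if i \in F then x i else 0.
have fP x : f x = f (P x) by apply: fF => i iF; rewrite /P iF.
apply: (@measurable_fun_cvg _ _ R setT (fun n x => f (D n x))) => [n|x _]; last first.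
  rewrite fP; apply: (@cvg_comp _ _ _ _ _ _ (nbhs (P x))) ; last exact: cf.
  apply/cfg_cvgP => i; rewrite /D /P; case: ifPn => iF; last exact: cvg_cst.
  apply/cvgrPdist_le => e e0; near=> n.
  have n0 : 0 < n.+1%:R :> R by [].
  have := floor_le (n.+1%:R * x i); have := ltW (floorD1_gt (n.+1%:R * x i)).
  set m := Num.floor _ => m1 m2.
  rewrite ger0_norm; last by rewrite subr_ge0 ler_pdivrMr// mulrC.
  rewrite lerBlDr -(ler_pM2l n0) mulrDr mulrCA divff ?gt_eqF// mulr1.
  rewrite (le_trans m1)// intrD addrC lerD2r.
  rewrite -ler_pdivrMr// mul1r; near: n.
  apply: filterS (near_infty_natSinv_lt (PosNum e0)) => n /ltW/= ne.
  by rewrite -[leRHS]invrK lef_pV2 ?posrE ?invr_gt0.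
move=> _ B mB; rewrite setTI.
pose Q (q : {ffun F -> int}) : cfg R I := fun i =>
  if insub i is Some j then (q j)%:~R / n.+1%:R else 0.
rewrite (_ : _ @^-1` B = \bigcup_(q : {ffun F -> int})
    (if `[< B (f (Q q)) >] then
      \bigcap_(j : F) [set x : cfg R I | Num.floor (n.+1%:R * x (val j)) = q j] else set0)).
  apply: measurable_bigcup_count => q; case: ifPn => // _.
  apply: measurable_bigcap_count => j.
  rewrite (_ : [set _ | _] = (fun x : cfg R I => n.+1%:R * x (val j)) @^-1`
     `[(q j)%:~R, (q j + 1)%:~R[); last first.
    apply/seteqP; split=> x /=; rewrite in_itv/=.
      by move=> <-; rewrite floor_le floorD1_gt.
    by move=> /floor_def.
  rewrite -[X in measurable X]setTI.
  by apply: (measurable_funM (measurable_cst _) (measurable_cfg_eval (val j))).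
have DQ x (q : {ffun F -> int}) :
    (forall j : F, Num.floor (n.+1%:R * x (val j)) = q j) -> D n x = Q q.
  move=> xq; apply/funext => i; rewrite /D /Q; case: insubP => [j iF ji|/negbTE->//].
  by rewrite iF -xq ji.
apply/seteqP; split=> [x /= Bx|x [q _]].
  exists [ffun j : F => Num.floor (n.+1%:R * x (val j))] => //.
  rewrite -(DQ x) => [|j]; last by rewrite ffunE.
  by rewrite asboolT// => j _ /=; rewrite ffunE.
case: ifPn => // /asboolP Bq xq /=; rewrite (DQ x q)// => j; exact: xq.
Unshelve. all: by end_near. Qed.

Lemma loc_test_bmf f : loc_test f -> bmf f.
Proof. by move=> tf; split; [exact: loc_test_measurable|case: tf]. Qed.

Lemma BL_bmf f : BLf f -> bmf f.
Proof. by move=> /BL_loc_test/loc_test_bmf. Qed.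

Lemma loc_testN f : loc_test f -> loc_test (fun x => - f x).
Proof.
move=> [[M fM] cf [F fF]]; split.
- by exists M => x; rewrite normrN.
- move=> x; change ((fun y => - f y) @ nbhs x --> - f x).
  by apply: (@cvgN _ _ _ (nbhs x)); exact: cf.
- by exists F => x y /fF ->.
Qed.

Lemma BLfM f g : BLf f -> BLf g -> BLf (fun x => f x * g x).
Proof.
move=> [[M fM] [F [C [C0 fL]]]] [[M' gM] [F' [C' [C'0 gL]]]].
have M0 : 0 <= M by apply: le_trans (fM (fun=> 0)).
have M'0 : 0 <= M' by apply: le_trans (gM (fun=> 0)).
split; first by exists (M * M') => x; rewrite normrM ler_pM.
exists (F `|` F')%fset, (C * M' + M * C'); split.
  by rewrite addr_ge0// mulr_ge0.
move=> x y; rewrite (_ : _ - _ = (f x - f y) * g x + f y * (g x - g y)); last by ring.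
rewrite (le_trans (ler_normD _ _))// !normrM mulrDl lerD//.
  rewrite mulrAC ler_pM// (le_trans (fL _ _))// ler_wpM2l//.
  by rewrite dist_on_subset// fsubsetUl.
rewrite -mulrA ler_pM// (le_trans (gL _ _))// ler_wpM2l//.
by rewrite dist_on_subset// fsubsetUr.
Qed.

End test_functions.

Section BL_approximation.
Context (R : realType) (I : choiceType).
Implicit Types (F : {fset I}) (f g : cfg R I -> R).

(** The Pasch-Hausdorff envelope: for bounded [f], the largest minorant that is [n]-Lipschitz for
    the pseudo-distance [dist_on F]. *)
Definition infconv F f (n : nat) (x : cfg R I) : R :=
  inf [set f y + n%:R * dist_on F x y | y in setT].

Section infconv.
Variables (F : {fset I}) (f : cfg R I -> R) (M : R).
Hypothesis fM : forall x, `|f x| <= M.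

Let val_ge n x y : - M <= f y + n%:R * dist_on F x y.
Proof.
have := fM y; rewrite ler_norml => /andP[fy _]; rewrite (le_trans fy)//.
by rewrite lerDl mulr_ge0// dist_on_ge0.
Qed.

Let has_inf_val n x : has_inf [set f y + n%:R * dist_on F x y | y in setT].
Proof.
split; first by exists (f x + n%:R * dist_on F x x), x.
by exists (- M) => _ [y _ <-].
Qed.

Lemma infconv_le n x : infconv F f n x <= f x.
Proof.
apply: ge_inf; first by case: (has_inf_val n x).
by exists x => //; rewrite dist_onxx mulr0 addr0.
Qed.

Lemma infconv_le_val n x y : infconv F f n x <= f y + n%:R * dist_on F x y.
Proof. by apply: ge_inf; [case: (has_inf_val n x)|exists y]. Qed.

Lemma infconv_norm n x : `|infconv F f n x| <= M.
Proof.
rewrite ler_norml; apply/andP; split.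
  by apply: lb_le_inf; [case: (has_inf_val n x)|move=> _ [y _ <-]].
by rewrite (le_trans (infconv_le _ _))// (le_trans (ler_norm _)).
Qed.

Let infconv_lip1 n x y : infconv F f n x - infconv F f n y <= n%:R * dist_on F x y.
Proof.
rewrite lerBlDr -lerBlDl; apply: lb_le_inf; first by case: (has_inf_val n y).
move=> _ [z _ <-]; rewrite lerBlDl (le_trans (infconv_le_val n x z))//.
by rewrite addrCA lerD2l -mulrDr ler_wpM2l// dist_on_triangle.
Qed.

Lemma infconv_BL n : BLf (infconv F f n).
Proof.
split; first by exists M; exact: infconv_norm.
exists F, n%:R; split => // x y; rewrite ler_norml infconv_lip1 andbT.
rewrite lerNl opprB (le_trans (infconv_lip1 _ _ _))//.
by rewrite ler_wpM2l// /dist_on ler_sum// => i _; rewrite distrC.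
Qed.

Hypothesis cf : continuous f.
Hypothesis fF : forall x y, (forall i, i \in F -> x i = y i) -> f x = f y.

Lemma cvg_infconv x : infconv F f n x @[n --> \oo] --> f x.
Proof.
apply/cvgrPdist_le => e e0.
(* Otherwise there are points at distance at most 1/(k+1) where [f] is below [f x - e]. Resetting
   their coordinates off [F] to those of [x] makes them converge to [x] in the product topology
   without changing [f], against continuity. *)
have [k dk] : exists k : nat, forall y, k%:R * dist_on F x y <= 1 -> f x - e <= f y.
  apply: contrapT => /forallNP h.
  have {}h k : {y | k.+1%:R * dist_on F x y <= 1 & f y < f x - e}.
    apply/cid2; move: (h k.+1) => /existsNP[y] /not_implyP[h1 h2].
    by exists y => //; rewrite ltNge; apply/negP.
  pose y k : cfg R I := fun i => if i \in F then s2val (h k) i else x i.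
  have yx : y @ \oo --> x.
    apply/cfg_cvgP => i; have [iF|iF] := boolP (i \in F); last first.
      by rewrite /y (negbTE iF); exact: cvg_cst.
    rewrite /y iF.
    apply/cvgrPdist_le => r r0.
    apply: filterS (near_infty_natSinv_lt (PosNum r0)) => n /ltW/= nr.
    rewrite (le_trans _ nr)// -[leRHS]mul1r ler_pdivlMr// mulrC.
    rewrite (le_trans _ (s2valP (h n)))// ler_wpM2l// /dist_on.
    by rewrite (big_fsetD1 i)//= lerDl sumr_ge0.
  have : f (y n) @[n --> \oo] --> f x.
    by apply: (@cvg_comp _ _ _ _ _ _ (nbhs x)) => //; exact: cf.
  move=> /cvgrPdist_lt /(_ _ e0) [n _ /(_ n (leqnn n))] /=.
  rewrite (@fF (y n) (s2val (h n))); last by move=> i iF; rewrite /y iF.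
  rewrite ltr_norml => /andP[_]; rewrite ltrBlDr -ltrBlDl.
  by move=> /lt_trans /(_ (s2valP' (h n))); rewrite ltxx.
have M0 : 0 <= M by apply: le_trans (fM x).
near=> n.
rewrite ger0_norm ?subr_ge0 ?infconv_le// lerBlDr -lerBlDl.
apply: lb_le_inf; first by case: (has_inf_val n x).
move=> _ [y _ <-]; have [d1|d1] := leP (k%:R * dist_on F x y) 1.
  by rewrite (le_trans (dk _ d1))// lerDl mulr_ge0// dist_on_ge0.
(* Beyond distance 1/k the penalty reaches 2M, the largest possible oscillation of [f]. *)
have kn : (2 * M) * k%:R <= n%:R.
  by near: n; exact: nbhs_infty_ger.
have : 2 * M <= n%:R * dist_on F x y.
  apply: (@le_trans _ _ (2 * M * (k%:R * dist_on F x y))).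
    by rewrite ler_peMr// ?mulr_ge0// ltW.
  by rewrite mulrA ler_wpM2r// dist_on_ge0.
have := fM x; have := fM y; rewrite !ler_norml; lra.
Unshelve. all: by end_near. Qed.

End infconv.

Lemma BL_approx f : loc_test f -> exists f_ : nat -> cfg R I -> R,
  [/\ forall n, BLf (f_ n), (exists M, forall n x, `|f_ n x| <= M),
      forall n x, f_ n x <= f x & forall x, f_ n x @[n --> \oo] --> f x].
Proof.
move=> [[M fM] cf [F fF]]; exists (infconv F f); split.
- by move=> n; exact: infconv_BL fM n.
- by exists M => n x; exact: infconv_norm.
- by move=> n x; exact: infconv_le fM n x.
- by move=> x; exact: (cvg_infconv fM).
Qed.

(* Approximating from below by bounded Lipschitz functions makes tightness
   unnecessary. *)
Lemma BL_cvg_test (S : Type) (G : set_system S) (FG : ProperFilter G)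
    (Phi : S -> (cfg R I -> R) -> R) (mu : probability (cfg R I) R) :
  (forall f g, loc_test f -> loc_test g -> (forall x, f x <= g x) ->
     \forall s \near G, Phi s f <= Phi s g) ->
  (forall f, loc_test f -> \forall s \near G, Phi s (fun x => - f x) = - Phi s f) ->
  (forall f, BLf f -> Phi s f @[s --> G] --> \int[mu]_x f x) ->
  forall f, loc_test f -> Phi s f @[s --> G] --> \int[mu]_x f x.
Proof.
move=> Pmono PN PBL f tf.
have lower g e : loc_test g -> 0 < e ->
    \forall s \near G, \int[mu]_x g x - e <= Phi s g.
  move=> tg e0; have [g_ [gBL [M gM] gle gcvg]] := BL_approx tg.
  have e20 : 0 < e / 2 by rewrite divr_gt0.
  have : \int[mu]_x g_ n x @[n --> \oo] --> \int[mu]_x g x.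
    apply: (@Rint_dct _ _ R mu g_ g M) => //.
    - by move=> n; case: (BL_bmf (gBL n)).
    - exact: loc_test_measurable.
    - exact: aeW.
  move=> /cvgrPdist_le /(_ _ e20) [n _ /(_ n (leqnn n))] /=.
  rewrite ler_norml => /andP[_ gn].
  have := Pmono _ _ (BL_loc_test (gBL n)) tg (gle n).
  have := PBL _ (gBL n) => /cvgrPdist_le /(_ _ e20).
  apply: filterS2 => s; rewrite ler_norml => /andP[_]; lra.
apply/cvgrPdist_le => e e0.
(* The upper bound for [f] is the lower bound for [- f]. *)
have := lower _ _ tf e0; have := lower _ _ (loc_testN tf) e0.
have := PN _ tf; apply: filterS3 => s -> h1 h2.
have NI : \int[mu]_x (- f x) = - \int[mu]_x f x.
  rewrite -[RHS]mulN1r -RintZ; last exact: loc_test_bmf.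
  by apply: eq_Rintegral => x _; rewrite mulN1r.
by move: h1; rewrite NI ler_norml; lra.
Qed.

Lemma max0_lip (u v : R) : `|Num.max u 0 - Num.max v 0| <= `|u - v|.
Proof.
have := ler_norm (u - v); have := ler_norm (v - u); rewrite (distrC v u) => h1 h2.
by rewrite ler_norml; case: (leP u 0) => u0; case: (leP v 0) => v0; apply/andP; split; lra.
Qed.

Lemma BL_measure_unique (m1 m2 : probability (cfg R I) R) :
  (forall f, BLf f -> \int[m1]_x f x = \int[m2]_x f x) ->
  forall A, measurable A -> m1 A = m2 A.
Proof.
move=> m12; apply: cfg_measure_unique.
  by rewrite (@le_lt_trans _ _ 1%E) ?probability_le1 ?ltry.
move=> F a.
pose s (x : cfg R I) : R := \sum_(i <- F) Num.max (a i - x i) 0.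
have s0 x : 0 <= s x by apply: sumr_ge0 => i _; rewrite le_max lexx orbT.
have sbox x : ray_box F a x <-> s x = 0.
  split=> [xF|sx0 i iF].
    rewrite /s big_seq big1// => i iF; apply/max_idPr; rewrite subr_le0; exact: xF.
  have /eqP := sx0; rewrite /s psumr_eq0 => [/allP /(_ i iF)|j _]; last first.
    by rewrite le_max lexx orbT.
  by move=> /eqP /max_idPr; rewrite subr_le0.
pose f (n : nat) (x : cfg R I) := Num.max (1 - n%:R * s x) 0.
have f1 n x : `|f n x| <= 1.
  rewrite ger0_norm /f ?le_max ?lexx ?orbT// ge_max ler01 andbT lerBlDr lerDl.
  by rewrite mulr_ge0.
have fBL n : BLf (f n).
  split; first by exists 1.
  exists F, n%:R; split => // x y; rewrite (le_trans (max0_lip _ _))//.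
  rewrite (_ : _ - _ = n%:R * (s y - s x)); last by ring.
  rewrite normrM ger0_norm// ler_wpM2l// distrC.
  rewrite /s -sumrB (le_trans (ler_norm_sum _ _ _))// /dist_on ler_sum// => i _.
  rewrite (le_trans (max0_lip _ _))//.
  by rewrite (_ : _ - (_ - _) = y i - x i) 1?distrC//; ring.
have fcvg x : f n x @[n --> \oo] --> (\1_(ray_box F a) x : R).
  rewrite indicE; have [/sbox sx0|xF] := pselect (ray_box F a x).
    rewrite mem_set//; last exact/sbox.
    under eq_fun do rewrite /f sx0 mulr0 subr0.
    by rewrite max_l ?ler01//; exact: cvg_cst.
  rewrite memNset//; apply: cvg_near_cst.
  have sx0 : 0 < s x by rewrite lt_neqAle s0 andbT eq_sym; apply/eqP => /sbox.
  near=> n; apply/eqP; apply/eqP/max_idPr; rewrite subr_le0.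
  rewrite -ler_pdivrMr// mul1r; near: n; exact: nbhs_infty_ger.
have I1 (m : probability (cfg R I) R) :
    \int[m]_x f n x @[n --> \oo] --> fine (m (ray_box F a)).
  rewrite (_ : fine _ = \int[m]_x \1_(ray_box F a) x); last first.
    by rewrite /Rintegral integral_indic ?setIT//; exact: measurable_ray_box.
  apply: (@Rint_dct _ _ R m f _ 1) => //.
  - by move=> n; case: (BL_bmf (fBL n)).
  - by apply: measurable_indic; exact: measurable_ray_box.
  - exact: aeW.
have mfin (m : probability (cfg R I) R) A : measurable A -> m A \is a fin_num.
  by move=> mA; rewrite ge0_fin_numE// (le_lt_trans (probability_le1 m mA))// ltry.
have mb := @measurable_ray_box R I F a.
rewrite -[LHS]fineK ?mfin// -[RHS]fineK ?mfin//; congr EFin.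
apply: (@cvg_unique _ _ (\int[m1]_x f n x @[n --> \oo])) => //; first exact: I1.
rewrite (_ : (fun n => _) = fun n => \int[m2]_x f n x); first exact: I1.
by apply/funext => n; exact: m12.
Unshelve. all: by end_near. Qed.

End BL_approximation.

(** * Averaging operators *)

(* [u'] grows faster than [u]: it bounds the mass that escapes to infinity. *)
Record harness_kernel (R : realType) (d : nat) (alpha : R)
    (p : site d -> site d -> R) (nb : site d -> {fset site d})
    (rho : R) (u u' : site d -> R) : Prop := HarnessKernel {
  hk_alpha : 0 < alpha < 1 ;
  hk_ge0 : forall i j, 0 <= p i j ;
  hk_sym : forall i j, p i j = p j i ;
  hk_diag : forall i, p i i = 0 ;
  hk_nb : forall i j, p i j != 0 -> j \in nb i ;
  hk_sum1 : forall i, \sum_(j <- nb i) p i j = 1 ;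
  hk_rho : 0 < rho < 1 ;
  hk_u_ge1 : forall i, 1 <= u i ;
  hk_u : forall i, alpha * (\sum_(j <- nb i) p i j * u j) <= rho * u i ;
  hk_u'_ge0 : forall i, 0 <= u' i ;
  hk_u' : forall i, alpha * (\sum_(j <- nb i) p i j * u' j) <= u' i ;
  hk_uu' : forall e, 0 < e ->
    exists B : {fset site d}, forall i, i \notin B -> u i <= e * u' i }.

Section averaging.
Context (R : realType) (d : nat) (alpha : R) (p : site d -> site d -> R)
  (nb : site d -> {fset site d}) (rho : R) (u u' : site d -> R).
Hypothesis hk : harness_kernel alpha p nb rho u u'.
Implicit Types (v w : site d -> R) (i j k : site d).

Let alpha_ge0 : 0 <= alpha. Proof. by have /andP[/ltW] := hk_alpha hk. Qed.

Definition Pavg v i : R := \sum_(j <- nb i) p i j * v j.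

Lemma fsum_Pavg v k : \sum_(i \in [set: site d]) p k i * v i = Pavg v k.
Proof.
rewrite (fsbigE (nb k)) ?fset_uniq//.
  by apply: eq_bigl => i; rewrite in_setT.
move=> i _ ki; have [->|/(hk_nb hk)] := eqVneq (p k i) 0; first by rewrite mul0r.
by rewrite (negbTE ki).
Qed.

Lemma Pavg_le v w i : (forall j, v j <= w j) -> Pavg v i <= Pavg w i.
Proof. by move=> vw; apply: ler_sum => j _; rewrite ler_wpM2l// (hk_ge0 hk). Qed.

Lemma PavgD v w i : Pavg (fun j => v j + w j) i = Pavg v i + Pavg w i.
Proof. by rewrite /Pavg -big_split; apply: eq_bigr => j _; rewrite mulrDr. Qed.

Lemma PavgZ c v i : Pavg (fun j => c * v j) i = c * Pavg v i.
Proof. by rewrite /Pavg big_distrr; apply: eq_bigr => j _; rewrite mulrCA. Qed.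

Lemma Pavg_norm v i : `|Pavg v i| <= Pavg (fun j => `|v j|) i.
Proof.
rewrite (le_trans (ler_norm_sum _ _ _))//; apply: ler_sum => j _.
by rewrite normrM ger0_norm// (hk_ge0 hk).
Qed.

Lemma Pavg_ge0 v i : (forall j, 0 <= v j) -> 0 <= Pavg v i.
Proof. by move=> v0; apply: sumr_ge0 => j _; rewrite mulr_ge0// (hk_ge0 hk). Qed.

Lemma Pavg_cst c i : Pavg (fun=> c) i = c.
Proof. by rewrite /Pavg -mulr_suml (hk_sum1 hk) mul1r. Qed.

Definition update k (a : R) v : site d -> R := fun i => if i == k then a else v i.

Definition Q k v : site d -> R := update k (alpha * Pavg v k) v.

(** The last element of [L] acts first on [v]; the head is the latest update. Read backwards in
    time, [QL L (delta j) i] is the mass at [j] of a killed walk started at [i] that meets the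
    updates of [L] from the head on. *)
Definition QL (L : seq (site d)) v := foldr Q v L.

Lemma Q_le k v w : (forall i, v i <= w i) -> forall i, Q k v i <= Q k w i.
Proof.
by move=> vw i; rewrite /Q /update; case: ifP => // _; rewrite ler_wpM2l// Pavg_le.
Qed.

Lemma QL_le L v w : (forall i, v i <= w i) -> forall i, QL L v i <= QL L w i.
Proof. by move=> vw; elim: L => //= k L; exact: Q_le. Qed.

Lemma QLD L v w : QL L (fun i => v i + w i) = (fun i => QL L v i + QL L w i).
Proof.
elim: L => //= k L ->; apply/funext => i; rewrite /Q /update.
by case: ifP => // _; rewrite PavgD mulrDr.
Qed.

Lemma QLZ L c v : QL L (fun i => c * v i) = (fun i => c * QL L v i).
Proof.
elim: L => //= k L ->; apply/funext => i; rewrite /Q /update.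
by case: ifP => // _; rewrite PavgZ mulrCA.
Qed.

Lemma QL_ge0 L v : (forall i, 0 <= v i) -> forall i, 0 <= QL L v i.
Proof.
move=> v0; elim: L => //= k L IH i; rewrite /Q /update; case: ifP => // _.
by rewrite mulr_ge0// Pavg_ge0.
Qed.

Definition superharmonic v := forall i, alpha * Pavg v i <= v i.

Lemma superharmonic_u : superharmonic u.
Proof.
move=> i; rewrite (le_trans (hk_u hk i))// ler_piMl//.
  by rewrite (le_trans ler01)// (hk_u_ge1 hk).
by have /andP[_ /ltW] := hk_rho hk.
Qed.

Lemma Q_superharmonic_le k v : superharmonic v -> forall i, Q k v i <= v i.
Proof. by move=> sv i; rewrite /Q /update; case: eqP => [->|]. Qed.

Lemma Q_superharmonic k v : superharmonic v -> superharmonic (Q k v).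
Proof.
move=> sv i; have Qv := Q_superharmonic_le k sv.
have h : alpha * Pavg (Q k v) i <= alpha * Pavg v i by rewrite ler_wpM2l// Pavg_le.
have QE : Q k v i = if i == k then alpha * Pavg v k else v i by [].
by rewrite QE; case: eqP => [ik|_]; [rewrite -{2}ik|rewrite (le_trans h)].
Qed.

Lemma QL_superharmonic L v : superharmonic v -> superharmonic (QL L v).
Proof. by move=> sv; elim: L => //= k L; exact: Q_superharmonic. Qed.

Lemma QL_superharmonic_le L v : superharmonic v -> forall i, QL L v i <= v i.
Proof.
move=> sv; elim: L => //= k L IH i.
by rewrite (le_trans (Q_superharmonic_le k (QL_superharmonic L sv) i)).
Qed.

(** [Q k] lowers a superharmonic function and keeps it superharmonic, so an update inserted anywhere
    decreases the result at that stage, and the updates applied after it preserve the order. *)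
Lemma QL_subseq D L v : superharmonic v -> subseq D L ->
  forall i, QL L v i <= QL D v i.
Proof.
move=> sv; elim: L D => [|k L IH] [|j D] //=.
- by move=> _ i; rewrite (QL_superharmonic_le (k :: L)).
- case: eqP => [-> DL|_ DL] i; first by apply: Q_le; exact: IH.
  rewrite (le_trans (Q_superharmonic_le k (QL_superharmonic L sv) i))//.
  exact: (IH (j :: D)).
Qed.

Definition delta k : site d -> R := fun i => (i == k)%:R.

Lemma delta_ge0 k i : 0 <= delta k i. Proof. exact: ler0n. Qed.

Lemma QE k v : Q k v = fun i => v i + (alpha * Pavg v k - v k) * delta k i.
Proof.
apply/funext => i; rewrite /Q /update /delta; case: eqP => [->|_].
  by rewrite mulr1 addrC subrK.
by rewrite mulr0 addr0.
Qed.

Lemma QL_sum (D : seq (site d)) (A : seq (site d)) (v : site d -> R) i :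
  QL D (fun l => \sum_(j <- A) v j * delta j l) i = \sum_(j <- A) v j * QL D (delta j) i.
Proof.
elim: A => [|j r IH].
  under [in LHS]eq_fun do rewrite big_nil; rewrite big_nil.
  by have := QLZ D 0 (fun=> 0); rewrite mul0r => /(congr1 (fun f => f i)) ->; rewrite mul0r.
under [in LHS]eq_fun do rewrite big_cons; rewrite big_cons.
by rewrite QLD QLZ IH.
Qed.

Lemma QL_rcons L k v i :
  QL (rcons L k) v i = QL L v i + (alpha * Pavg v k - v k) * QL L (delta k) i.
Proof. by rewrite /QL foldr_rcons -/(QL L _) QE QLD QLZ. Qed.

Variable s : nat -> site d.
Hypothesis s_io : forall j n, exists2 m, (n <= m)%N & s m = j.

Definition sched n := mkseq s n.

Lemma schedS n : sched n.+1 = rcons (sched n) (s n).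
Proof. by rewrite /sched /mkseq -[n.+1]addn1 iotaD map_cat/= cats1. Qed.

Let u_gt0 i : 0 < u i. Proof. by rewrite (lt_le_trans ltr01)// (hk_u_ge1 hk). Qed.
Let u_ge0 i : 0 <= u i. Proof. exact: ltW. Qed.

Let rho1 : 0 < 1 - rho. Proof. by rewrite subr_gt0; have /andP[] := hk_rho hk. Qed.

(** The killed walk from [i] starts with potential [u i]. If it has mass [b] at [s m] when update
    [m] is met, that mass jumps or dies, and by [hk_u] the potential drops by at least (1 - rho) u(s
    m) b. The drops add up to at most [u i]. *)
Lemma sched_potential i n :
  \sum_(0 <= m < n) u (s m) * QL (sched m) (delta (s m)) i <= u i / (1 - rho).
Proof.
rewrite ler_pdivlMr//.
suff: (\sum_(0 <= m < n) u (s m) * QL (sched m) (delta (s m)) i) * (1 - rho)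
    + QL (sched n) u i <= u i.
  by apply: le_trans; rewrite lerDl QL_ge0.
elim: n => [|n IH]; first by rewrite big_geq// mul0r add0r.
rewrite (le_trans _ IH)// big_nat_recr// schedS QL_rcons.
rewrite mulrDl -!addrA lerD2l addrCA gerDl.
have b0 := QL_ge0 (sched n) (delta_ge0 (s n)) i.
set b := QL _ _ i in b0 *.
have : alpha * Pavg u (s n) * b <= rho * u (s n) * b by rewrite ler_wpM2r// (hk_u hk).
by rewrite mulrBl; lra.
Qed.

(** Mass leaves [j] only when [j] is updated. Hence the mass at [j] at time [T] is at most the mass
    there when the schedule next visits [j], which, as u >= 1, is bounded by a term of the
    convergent series of [sched_potential]. *)
Lemma sched_cvg_delta i j : QL (sched n) (delta j) i @[n --> \oo] --> 0.
Proof.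
pose a m := u (s m) * QL (sched m) (delta (s m)) i.
have a0 m : 0 <= a m by rewrite mulr_ge0// QL_ge0// => ?; exact: delta_ge0.
have : a n @[n --> \oo] --> 0.
  apply: cvg_series_cvg_0; apply: nondecreasing_is_cvgn.
    by apply: nondecreasing_series => m _ _; exact: a0.
  exists (u i / (1 - rho)) => _ [n _ <-]; exact: sched_potential.
move=> /cvgrPdist_le a_0; apply/cvgrPdist_le => e e0.
have [T0 _ aT] := a_0 e e0.
exists T0 => // T /= T0T.
have j0 n : 0 <= QL (sched n) (delta j) i by rewrite QL_ge0// => ?; exact: delta_ge0.
rewrite sub0r normrN ger0_norm//.
have [T1 TT1 sT1] : exists2 T1, (T <= T1)%N & QL (sched T) (delta j) i <= QL (sched T1) (delta j) i
     /\ s T1 = j.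
  have ex : exists m, (T <= m)%N && (s m == j).
    by have [m Tm sm] := s_io j T; exists m; rewrite Tm sm eqxx.
  case: (ex_minnP ex) => m /andP[Tm /eqP smj] mmin; exists m => //; split => //.
  suff: forall r, (T + r <= m)%N -> QL (sched T) (delta j) i <= QL (sched (T + r)) (delta j) i.
    by move=> /(_ (m - T)%N); rewrite subnKC// => /(_ (leqnn _)).
  elim=> [|r IH] Tr; first by rewrite addn0.
  have Trm : (T + r < m)%N by rewrite -addnS.
  rewrite (le_trans (IH (ltnW Trm)))// addnS schedS QL_rcons lerDl.
  rewrite mulr_ge0//; last by rewrite QL_ge0// => ?; exact: delta_ge0.
  have : s (T + r) != j.
    apply/negP => sTr; have := mmin (T + r)%N; rewrite leq_addr sTr => /(_ isT).
    by rewrite leqNgt Trm.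
  rewrite {2}/delta => /negbTE ->; rewrite subr0 mulr_ge0// Pavg_ge0// => ?.
case: sT1 => TT sT1; rewrite (le_trans TT)//.
have := aT T1 (leq_trans T0T TT1); rewrite /= sub0r normrN ger0_norm// /a sT1.
by apply: le_trans; rewrite ler_peMl// (hk_u_ge1 hk).
Qed.

(** On a finite set [B] the mass dies out site by site. Off [B], [u] is at most [e1 * u'], and [u']
    does not grow under [QL] because it is superharmonic. *)
Lemma sched_cvg_u i : QL (sched n) u i @[n --> \oo] --> 0.
Proof.
apply/cvgrPdist_le => e e0.
(* Makes [e1 * u' i] at most e/2; the added 1 covers [u' i = 0]. *)
pose e1 := e / 2 / (u' i + 1).
have u'0 : 0 < u' i + 1 by rewrite ltr_wpDl// (hk_u'_ge0 hk).
have e10 : 0 < e1 by rewrite divr_gt0// divr_gt0.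
have [B uB] := hk_uu' hk e10.
have QB n : QL (sched n) u i <=
    \sum_(j <- B) u j * QL (sched n) (delta j) i + e1 * u' i.
  apply: (@le_trans _ _ (QL (sched n) (fun l => \sum_(j <- B) u j * delta j l + e1 * u' l) i)).
    apply: QL_le => l; have [lB|lB] := boolP (l \in B); last first.
      rewrite (le_trans (uB _ lB))// lerDr sumr_ge0// => j _.
      by rewrite mulr_ge0// delta_ge0.
    rewrite (big_fsetD1 l)//= /delta eqxx mulr1 -addrA lerDl addr_ge0//.
      by rewrite sumr_ge0// => j _; rewrite mulr_ge0// ler0n.
    by rewrite mulr_ge0// ?(hk_u'_ge0 hk)// ltW.
  rewrite QLD QLZ lerD//; last first.
    apply: ler_wpM2l; first exact: ltW.
    by apply: QL_superharmonic_le; exact: (hk_u' hk).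
  by rewrite QL_sum.
have : \sum_(j <- B) u j * QL (sched n) (delta j) i @[n --> \oo] --> \sum_(j <- B) u j * 0.
  apply: cvg_sumr => j; apply: cvgM; first exact: cvg_cst.
  exact: sched_cvg_delta.
rewrite big1; last by move=> ? _; rewrite mulr0.
have e20 : 0 < e / 2 by rewrite divr_gt0.
move=> /cvgrPdist_le /(_ _ e20); apply: filterS => n.
rewrite !sub0r !normrN => Bn.
rewrite ger0_norm; last by rewrite QL_ge0.
rewrite (le_trans (QB n))// (le_trans (lerD (le_trans (ler_norm _) Bn) (lexx _)))//.
have : e1 * u' i <= e / 2.
  by rewrite /e1 mulrAC -mulrA ler_piMr ?(ltW e20)// ler_pdivrMr// mul1r lerDl.
lra.
Qed.

End averaging.

(** * Heat-bath kernels and finite runs *)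

Section heat_bath.
Context (R : realType) (d : nat) (alpha : R) (p : site d -> site d -> R)
  (nb : site d -> {fset site d}) (rho : R) (u u' : site d -> R)
  (dat : cfg R (site d)).
Hypothesis hk : harness_kernel alpha p nb rho u u'.
Implicit Types (k i j : site d) (f g : cfg R (site d) -> R) (x y z : cfg R (site d)).
Local Notation Pavg := (Pavg p nb).
Local Notation Q := (Q alpha p nb).
Local Notation QL := (QL alpha p nb).
Local Notation delta := (@delta R d).
Local Notation Theta := (Theta alpha p dat).
Local Notation G := (@normal_prob R 0 1).

Let alpha_ge0 : 0 <= alpha. Proof. by have /andP[/ltW] := hk_alpha hk. Qed.

Definition drift x k : R := alpha * Pavg x k + (1 - alpha) * dat k.

Lemma ThetaE k s x : Theta k s x = update k (drift x k + s) x.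
Proof.
by apply/funext => j; rewrite /Theta /update (fsum_Pavg hk); case: eqP.
Qed.

(** Synchronous coupling: both configurations receive the same noise and the same datum, which
    cancel at [k]. *)
Lemma Theta_dist k s x y i :
  `|Theta k s x i - Theta k s y i| <= Q k (fun j => `|x j - y j|) i.
Proof.
rewrite !ThetaE /drift /Q /update; case: ifP => // _.
rewrite (_ : _ - _ = alpha * (Pavg x k - Pavg y k)); last by ring.
rewrite normrM ger0_norm// ler_wpM2l//.
have -> : Pavg x k - Pavg y k = Pavg (fun j => x j - y j) k.
  rewrite -[Pavg y k]mul1r -mulNr -PavgZ -PavgD; congr Pavg.
  by apply/funext => j; rewrite mulN1r.
exact: (Pavg_norm hk).
Qed.

Lemma measurable_drift d' (T : measurableType d') (h : T -> cfg R (site d)) k :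
  measurable_fun setT h -> measurable_fun setT (fun t => drift (h t) k).
Proof.
move=> mh; apply: measurable_funD => //; apply: measurable_funM => //.
apply: measurable_sum => j; apply: measurable_funM => //.
exact: (measurableT_comp (measurable_cfg_eval j) mh).
Qed.

Lemma measurable_Theta d' (T : measurableType d') k (s : T -> R)
    (h : T -> cfg R (site d)) :
  measurable_fun setT s -> measurable_fun setT h ->
  measurable_fun setT (fun t => Theta k (s t) (h t)).
Proof.
move=> ms mh; under eq_fun do rewrite ThetaE; apply: measurable_fun_cfg => i.
rewrite /update; case: eqP => _; last exact: (measurableT_comp (measurable_cfg_eval i) mh).
by apply: measurable_funD => //; exact: measurable_drift.
Qed.

Definition heat k f x : R := \int[G]_s f (Theta k s x).

Lemma heat_bmf_aux k f x : bmf f -> bmf (fun s => f (Theta k s x)).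
Proof.
move=> [mf [M fM]]; split; last by exists M.
apply: (measurableT_comp mf); apply: measurable_Theta; first exact: measurable_id.
exact: measurable_cst.
Qed.

Lemma heat_norm k f M x : bmf f -> (forall x, `|f x| <= M) -> `|heat k f x| <= M.
Proof. by move=> bf fM; apply: Rint_norm_le => //; exact: heat_bmf_aux. Qed.

Lemma site_generatorE k f x : bmf f ->
  site_generator alpha p dat k f x = heat k f x - f x.
Proof.
move=> bf; rewrite /site_generator RintB ?Rint_cst//; first exact: heat_bmf_aux.
exact: bmf_cst.
Qed.

Definition mono_fun (A : (site d -> R) -> R) :=
  forall v w, (forall i, v i <= w i) -> A v <= A w.

(** The modulus is an arbitrary functional [A] of the profile |x - y|, so that a heat-bath step acts
    on it by precomposition with [Q k] and no constant is lost along a run. *)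
Definition lipf (A : (site d -> R) -> R) f :=
  forall x y, `|f x - f y| <= A (fun i => `|x i - y i|).

Lemma heat_lip A f k : bmf f -> mono_fun A -> lipf A f ->
  lipf (fun v => A (Q k v)) (heat k f).
Proof.
move=> bf mA Af x y; rewrite /heat -RintB; try exact: heat_bmf_aux.
apply: Rint_norm_le => [|s]; first by apply: bmfB; exact: heat_bmf_aux.
by rewrite (le_trans (Af _ _))//; apply: mA => i; exact: Theta_dist.
Qed.

Lemma BL_lipf f : BLf f -> exists F C, 0 <= C /\
  lipf (fun v => C * \sum_(i <- F : {fset site d}) v i) f.
Proof. by move=> [_ [F [C [C0 fL]]]]; exists F, C. Qed.

Lemma mono_sum (F : {fset site d}) C : 0 <= C ->
  mono_fun (fun v => C * \sum_(i <- F) v i).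
Proof. by move=> C0 v w vw; rewrite ler_wpM2l// ler_sum. Qed.

Lemma p_le1 i j : p i j <= 1.
Proof.
have [ij|ij] := boolP (j \in nb i); last first.
  have [->|/(hk_nb hk)] := eqVneq (p i j) 0; first exact: ler01.
  by rewrite (negbTE ij).
rewrite -(hk_sum1 hk i) (big_fsetD1 j)//= lerDl sumr_ge0// => l _.
exact: (hk_ge0 hk).
Qed.

Lemma Pavg_le_sum v i : (forall j, 0 <= v j) -> Pavg v i <= \sum_(j <- nb i) v j.
Proof.
move=> v0; apply: ler_sum => j _; rewrite ler_piMl// p_le1//.
Qed.

Lemma heat_BL k f : BLf f -> BLf (heat k f).
Proof.
move=> fBL; have bf := BL_bmf fBL; have [[M fM] _] := fBL.
split; first by exists M => x; exact: heat_norm.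
have [F [C [C0 fL]]] := BL_lipf fBL.
(* After the update the sum over [F] is at most the old sum over [F] plus the sum over [nb k], each
   bounded by the distance on the union: hence the factor 2. *)
exists (F `|` nb k)%fset, (C * 2); split; first by rewrite mulr_ge0.
move=> x y; rewrite (le_trans (heat_lip k bf (mono_sum F C0) fL x y))//.
rewrite -mulrA ler_wpM2l//.
have sub : forall F1 F2 : {fset site d}, (F1 `<=` F2)%fset ->
    \sum_(i <- F1) `|x i - y i| <= dist_on F2 x y.
  by move=> F1 F2 F12; exact: dist_on_subset.
apply: (@le_trans _ _ (\sum_(i <- F) `|x i - y i| + \sum_(j <- nb k) `|x j - y j|)).
  have alphaP : alpha * Pavg (fun j => `|x j - y j|) k <= \sum_(j <- nb k) `|x j - y j|.
    apply: le_trans (Pavg_le_sum k _) => //.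
    by rewrite ler_piMl ?(Pavg_ge0 hk)//; have /andP[_ /ltW] := hk_alpha hk.
  have [kF|kF] := boolP (k \in F); last first.
    rewrite -[leLHS]addr0 lerD ?sumr_ge0//.
    rewrite le_eqVlt; apply/orP; left; apply/eqP; apply: eq_big_seq => i iF.
    by rewrite /Q /update; case: eqP iF kF => // -> ->.
  rewrite (big_fsetD1 k)//= [in leRHS](big_fsetD1 k)//= {1}/Q /update eqxx.
  rewrite [X in _ + X <= _](_ : _ = \sum_(i <- (F `\ k)%fset) `|x i - y i|); last first.
    by apply: eq_big_seq => i; rewrite !inE /Q /update => /andP[/negbTE ->].
  by move: alphaP (normr_ge0 (x k - y k)); lra.
by rewrite mulrDl mul1r lerD// sub ?fsubsetUl ?fsubsetUr.
Qed.

(** With [foldl] the head averages [f] first, so on the configuration it is the last update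
    performed. This is the order of [QL] and [evolve]. *)
Definition heats (L : seq (site d)) f := foldl (fun g k => heat k g) f L.

Lemma heats_BL L f : BLf f -> BLf (heats L f).
Proof. by elim: L f => //= k L IH f fBL; apply: IH; exact: heat_BL. Qed.

Lemma heats_norm L f M : BLf f -> (forall x, `|f x| <= M) ->
  forall x, `|heats L f x| <= M.
Proof.
elim: L f => //= k L IH f fBL fM; apply: IH; first exact: heat_BL.
by move=> x; apply: heat_norm => //; exact: BL_bmf.
Qed.

Lemma heats_lip A L f : BLf f -> mono_fun A -> lipf A f ->
  lipf (fun v => A (QL L v)) (heats L f).
Proof.
elim: L f A => //= k L IH f A fBL mA Af.
apply: (IH (heat k f) (fun v => A (Q k v))); first exact: heat_BL.
- by move=> v w vw; apply: mA; exact: (Q_le hk).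
- by apply: heat_lip => //; exact: BL_bmf.
Qed.

Lemma heat_fix k f x : bmf f -> (forall s, f (Theta k s x) = f x) -> heat k f x = f x.
Proof.
move=> bf fk; rewrite /heat -[RHS](Rint_cst G); apply: eq_Rintegral => s _.
exact: fk.
Qed.

Variable K : choiceType.
Implicit Types (L : seq (site d * K)) (zeta : site d * K -> R).

(* The head of [L] is the most recent update. *)
Definition evolve L z zeta : site d -> R :=
  foldr (fun e x => update e.1 (alpha * Pavg x e.1 + zeta e) x) z L.

Lemma evolve_lin L z z' zeta zeta' c :
  evolve L (fun i => z i + c * z' i) (fun e => zeta e + c * zeta' e) =
  fun i => evolve L z zeta i + c * evolve L z' zeta' i.
Proof.
elim: L => //= e L ->; apply/funext => i; rewrite /update; case: ifP => // _.
by rewrite PavgD PavgZ; ring.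
Qed.

Lemma evolve_QL L z : evolve L z (fun=> 0) = QL (map fst L) z.
Proof.
by elim: L => //= e L ->; rewrite /Q; congr update; rewrite addr0.
Qed.

Lemma evolve_split L z zeta i :
  evolve L z zeta i = evolve L (fun=> 0) zeta i + QL (map fst L) z i.
Proof.
have /(congr1 (fun h => h i)) /= := evolve_lin L (fun=> 0) z zeta (fun=> 0) 1.
rewrite evolve_QL !mul1r => <-.
by congr (evolve L _ _ i); apply/funext => j; rewrite ?mulr0 ?addr0 ?add0r ?mul1r.
Qed.

Lemma evolve_ge0 L z zeta : (forall i, 0 <= z i) -> (forall e, 0 <= zeta e) ->
  forall i, 0 <= evolve L z zeta i.
Proof.
move=> z0 zeta0; elim: L => //= e L IH i; rewrite /update; case: ifP => // _.
by rewrite addr_ge0// mulr_ge0// (Pavg_ge0 hk).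
Qed.

(** Comparison principle: a configuration below [w] receives at the updated site at most alpha P w +
    g, which [w] dominates. *)
Lemma evolve_supersol L zeta (w g : site d -> R) : (forall i, 0 <= w i) ->
  (forall i, alpha * Pavg w i + g i <= w i) -> (forall e, e \in L -> zeta e <= g e.1) ->
  forall i, evolve L (fun=> 0) zeta i <= w i.
Proof.
move=> w0 wg; elim: L => //= e L IH Lg i; rewrite /update; case: eqP => [->|_].
  rewrite (le_trans _ (wg _))// lerD ?Lg ?mem_head// ler_wpM2l// (Pavg_le hk)// => j.
  by apply: IH => e' e'L; rewrite Lg// inE e'L orbT.
by apply: IH => e' e'L; rewrite Lg// inE e'L orbT.
Qed.

(** The appended update is the oldest one: started from 0 it creates the point mass [zeta e] at
    [e.1], and by linearity the later updates carry it. *)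
Lemma evolve_rcons L e zeta i : evolve (rcons L e) (fun=> 0) zeta i =
  evolve L (fun=> 0) zeta i + zeta e * QL (map fst L) (delta e.1) i.
Proof.
rewrite /evolve foldr_rcons -/(evolve L _ _) evolve_split; congr (_ + _).
rewrite -[RHS](congr1 (fun h => h i) (QLZ _ _ _ _ _ _)); congr (QL _ _ i).
apply/funext => j; rewrite /update /delta; case: eqP => _; last by rewrite mulr0.
by rewrite mulr1 (Pavg_cst hk) mulr0 add0r.
Qed.

Lemma eq_evolve L z zeta zeta' : (forall e, e \in L -> zeta e = zeta' e) ->
  evolve L z zeta = evolve L z zeta'.
Proof.
elim: L => //= e L IH ee'; rewrite ee' ?mem_head// IH// => e' e'L.
by rewrite ee'// inE e'L orbT.
Qed.

Definition noise (xi : site d * K -> R) (e : site d * K) : R :=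
  xi e + (1 - alpha) * dat e.1.

Lemma noiseE xi e : noise xi e = xi e + (1 - alpha) * dat e.1.
Proof. by []. Qed.

Lemma evolve_cons e L z xi :
  evolve (e :: L) z (noise xi) = Theta e.1 (xi e) (evolve L z (noise xi)).
Proof. by rewrite ThetaE /= /noise /drift -!addrA; congr update; rewrite (addrC (xi e)). Qed.

End heat_bath.

(** * Independent families of real variables *)

Lemma R_measure_unique (R : realType) (m1 m2 : {measure set (measurableTypeR R) -> \bar R}) :
  (m1 setT < +oo)%E -> (forall a, m1 `]a, +oo[%classic = m2 `]a, +oo[%classic) ->
  forall A, measurable A -> m1 A = m2 A.
Proof.
move=> m1oo m12 A mA.
apply: (@measure_unique _ R (measurableTypeR R) (@RGenOInfty.G R) (fun n : nat => `](- n%:R), +oo[%classic)) => //.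
- exact: RGenOInfty.measurableE.
- move=> _ _ [a ->] [b ->]; exists (Num.max a b).
  apply/seteqP; split=> x /=; rewrite !in_itv/= !andbT gt_max.
    by move=> [-> ->].
  by move=> /andP[].
- by move=> n; exists (- n%:R).
- apply/seteqP; split=> // x _; exists (Num.bound `|x|) => //=.
  rewrite in_itv/= andbT ltrNl (le_lt_trans _ (archi_boundP (normr_ge0 x)))//.
  by rewrite -normrN ler_norm.
- by move=> _ [a ->]; exact: m12.
- by move=> n; rewrite (le_lt_trans _ m1oo)// le_measure ?inE.
Qed.

(** * Splitting one uniform variable into two independent ones *)

Section doubling.
Variable R : realType.
Local Notation U := (uniform_prob (ltr01 : (0 : R) < 1)).

Local Notation RB := (measurableTypeR R).

Let half (b : bool) (y : RB) : RB := (b%:R + y) / 2 : R.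

Let measurable_half b : measurable_fun setT (half b).
Proof. by apply: measurable_funM => //; exact: measurable_funD. Qed.

Lemma uniform_ray (a : R) : U `]a, +oo[ = (Num.max 0 (1 - Num.max a 0))%:E.
Proof.
rewrite /uniform_prob integral_uniform_pdf.
rewrite (eq_integral (fun=> 1%E)); last first.
  by move=> x /set_mem[_ /=]; rewrite in_itv/= /uniform_pdf => ->; rewrite subr0 invr1.
rewrite integral_cst//=; last exact: measurableI.
rewrite mul1e; have [a0|a0] := leP a 0.
  have [a00|a00] := eqVneq a 0.
    rewrite (_ : _ `&` _ = `]0, 1]%classic).
      by rewrite lebesgue_measure_itv/= lte_fin ltr01 sube0 subr0 max_r.
    rewrite a00; apply/seteqP; split=> x /=; rewrite !in_itv/= andbT.
      by move=> [-> /andP[]].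
    by move=> /andP[x0 ->]; rewrite x0 (ltW x0).
  rewrite (_ : _ `&` _ = `[0, 1]%classic).
    by rewrite lebesgue_measure_itv/= lte_fin ltr01 sube0 subr0 max_r.
  apply/seteqP; split=> x /=; rewrite !in_itv/= andbT; first by move=> [].
  move=> x01; split => //; case/andP: x01 => x0 _; rewrite (lt_le_trans _ x0)//.
  by rewrite lt_neqAle a00.
rewrite (_ : _ `&` _ = `]a, 1]%classic).
  rewrite lebesgue_measure_itv/= lte_fin; case: ltP => a1.
    by rewrite max_r// subr_ge0 ltW.
  by rewrite max_l// subr_le0.
apply/seteqP; split=> x /=; rewrite !in_itv/= andbT.
  by move=> [-> /andP[]].
by move=> /andP[ax ->]; rewrite ax (ltW (lt_trans a0 ax)).
Qed.

Let mix : {measure set RB -> \bar R} := measure_add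
  (mscale ((2^-1 : R)%:nng) (push_prob U (measurable_half false)))
  (mscale ((2^-1 : R)%:nng) (push_prob U (measurable_half true))).

Let mixE A : mix A = (2^-1%:E * U (half false @^-1` A) + 2^-1%:E * U (half true @^-1` A))%E.
Proof. exact: measure_addE. Qed.

Let uniform_mix A : measurable A -> U A = mix A.
Proof.
apply: R_measure_unique => [|a].
  by rewrite (le_lt_trans (probability_le1 U _))// ltry.
rewrite mixE.
have -> : half false @^-1` `]a, +oo[ = `]2 * a, +oo[%classic.
  by apply/seteqP; split=> x /=; rewrite !in_itv/= !andbT /half/= add0r ltr_pdivlMr// mulrC.
have -> : half true @^-1` `]a, +oo[ = `]2 * a - 1, +oo[%classic.
  apply/seteqP; split=> x /=; rewrite !in_itv/= !andbT /half/= ltr_pdivlMr//;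
  by rewrite mulrC ltrBlDl.
transitivity (U `]a, +oo[%classic) => //.
rewrite !uniform_ray -!EFinM -EFinD; congr EFin.
by case: (leP a 0) => ?; case: (leP (2 * a) 0) => ?; case: (leP (2 * a - 1) 0) => ?;
   repeat (case: leP => ?); lra.
Qed.

(** The uniform law is the equal mixture of its images under y/2 and (1 + y)/2: the first binary
    digit is a fair bit independent of the rest. Additivity of the integral is used for nonnegative
    functions, and a bounded function is shifted by its bound. *)
Lemma uniform_half (f : R -> R) : bmf f ->
  \int[U]_x f x = 2^-1 * (\int[U]_x f (half false x) + \int[U]_x f (half true x)).
Proof.
have main : forall g : R -> R, bmf g -> (forall x, 0 <= g x) ->
    \int[U]_x g x = 2^-1 * (\int[U]_x g (half false x) + \int[U]_x g (half true x)).
  move=> g bg g0.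
  have bgh b : bmf (fun x => g (half b x)).
    case: bg => mg [M gM]; split; last by exists M.
    exact: (measurableT_comp mg (measurable_half b)).
  have mg : measurable_fun (setT : set RB) (fun x : RB => (g x)%:E).
    by case: bg => mg _; exact/measurable_EFinP.
  apply: EFin_inj; rewrite mulrDr EFinD !EFinM !EFin_Rint//.
  rewrite (@eq_measure_integral _ RB R setT mix); last by move=> A mA _; exact: uniform_mix.
  rewrite ge0_integral_measure_add//; last by move=> x _; rewrite lee_fin.
  have g0E (x : RB) : setT x -> (0 <= (g x)%:E)%E by rewrite lee_fin.
  rewrite !(ge0_integral_mscale _ measurableT _ mg g0E).
  by rewrite !ge0_integral_push//; move=> x; rewrite lee_fin.
move=> bf; have [mf [M fM]] := bf.
have bfM : bmf (fun x => f x + M) by apply: bmfD => //; exact: bmf_cst.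
have fM0 x : 0 <= f x + M by have := fM x; rewrite ler_norml; lra.
have := main _ bfM fM0.
have bfh b : bmf (fun x => f (half b x)).
  split; last by exists M.
  exact: (measurableT_comp mf (measurable_half b)).
rewrite !RintD ?Rint_cst//; try exact: (bmf_cst _ M); lra.
Qed.

Lemma uniform_01 : {ae U, forall x, 0 < x < 1}.
Proof.
exists (`]-oo, 0] `|` `[1, +oo[); split; first exact: measurableU.
  apply/eqP; rewrite eq_le measure_ge0 andbT.
  have U0 : U `]0, 1[ = 1%E.
    rewrite /uniform_prob integral_uniform_pdf.
    rewrite (_ : _ `&` _ = `]0, 1[%classic); last first.
      apply/seteqP; split=> x /=; rewrite !in_itv/=; first by case.
      by move=> /andP[x0 x1]; rewrite x0 x1 !ltW.
    rewrite (eq_integral (fun=> 1%E)); last first.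
      move=> x /set_mem /=; rewrite in_itv/= /uniform_pdf => /andP[/ltW -> /ltW ->].
      by rewrite subr0 invr1.
    by rewrite integral_cst//= mul1e lebesgue_measure_itv/= lte_fin ltr01 sube0.
  have UC : U (~` `]0, 1[%classic) = (1 - U `]0%R, 1%R[%classic)%E.
    exact: probability_setC.
  rewrite U0 subee// in UC; rewrite -UC; apply: le_measure; rewrite ?inE.
  - exact: measurableU.
  - exact: measurableC.
  - move=> x /= [|]; rewrite !in_itv/= ?andbT => h; apply/negP; rewrite negb_and -!leNgt h//.
    by rewrite orbT.
move=> x /= /negP; rewrite negb_and -!leNgt => /orP[x0|x1]; [left|right];
by rewrite /= in_itv/= ?andbT.
Qed.

(** On ]0, 1[, [bit] is the first binary digit, [dbl] the doubling map that removes it, and [quad]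
    removes two digits. *)
Let bit (x : R) : R := (2^-1 <= x)%R%:R.
Let dbl (x : R) : R := 2 * x - bit x.
Let quad := dbl \o dbl.

Let bit_half b y : 0 < y < 1 -> bit (half b y) = b%:R.
Proof.
move=> /andP[y0 y1]; rewrite /bit /half; case: b => /=.
  by rewrite ler_pdivlMr// mulVf// lerDl ltW.
by rewrite add0r ler_pdivlMr// mulVf// leNgt y1.
Qed.

Let dbl_half b y : 0 < y < 1 -> dbl (half b y) = y.
Proof. by move=> y01; rewrite /dbl bit_half// /half; field. Qed.

Let measurable_bit : measurable_fun setT bit.
Proof.
rewrite (_ : bit = \1_(`[2^-1, +oo[%classic)); first exact: measurable_indic.
apply/funext => x; rewrite indicE /bit; congr ((nat_of_bool _)%:R).
by apply/idP/idP => [h|/set_mem]; [apply/mem_set|]; rewrite /= in_itv/= andbT.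
Qed.

Let measurable_dbl : measurable_fun setT dbl.
Proof.
apply: measurable_funB; last exact: measurable_bit.
exact: (measurable_funM (measurable_cst _) (@measurable_id _ _ setT)).
Qed.

Let bit01 x : 0 <= bit x <= 1.
Proof. by rewrite /bit; case: (_ <= x) => /=; rewrite ?lexx ?ler01. Qed.

Let term (x : R) (k : nat) : R := bit (iter k quad x) / 2 ^+ k.+1.
(** The number formed by the binary digits of odd rank of [x]; applied to [dbl x] it collects the
    digits of even rank. *)
Let unravel (x : R) : R := limn (series (term x)).

Let term_ge0 x k : 0 <= term x k.
Proof. by rewrite divr_ge0// ?exprn_ge0//; have /andP[] := bit01 (iter k quad x). Qed.

Let term_le x n : series (term x) n <= 1 - (2 ^+ n)^-1.
Proof.
elim: n => [|n IH]; first by rewrite /series/= big_geq// expr0 invr1 subrr.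
rewrite seriesSr (le_trans (lerD IH (lexx _)))//.
have : term x n <= (2 ^+ n.+1)^-1.
  rewrite /term ler_piMl// ?invr_ge0 ?exprn_ge0//.
  by have /andP[] := bit01 (iter n quad x).
have -> : (2 ^+ n)^-1 = 2 * (2 ^+ n.+1)^-1 :> R.
  by rewrite exprS invfM mulrA divff ?mul1r.
lra.
Qed.

Let cvg_term x : cvgn (series (term x)).
Proof.
apply: nondecreasing_is_cvgn; first by apply: nondecreasing_series => n _ _; exact: term_ge0.
exists 1 => _ [n _ <-]; rewrite (le_trans (term_le x n))// gerBl invr_ge0.
Qed.

Let unravel01 x : 0 <= unravel x <= 1.
Proof.
apply/andP; split.
  apply: limr_ge; first exact: cvg_term.
  by apply: nearW => n; apply: sumr_ge0 => k _; exact: term_ge0.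
apply: limr_le; first exact: cvg_term.
apply: nearW => n; rewrite (le_trans (term_le x n))// gerBl invr_ge0.
Qed.

Let unravelE x : unravel x = (bit x + unravel (quad x)) / 2.
Proof.
have -> : unravel x = limn (fun n => series (term x) n.+1).
  by apply/esym/cvg_lim => //; rewrite (cvg_shiftS (series (term x))); exact: cvg_term.
apply/cvg_lim => //.
have -> : (fun n => series (term x) n.+1) =
          (fun n => (bit x + series (term (quad x)) n) / 2).
  apply/funext => n; rewrite /series/= big_nat_recl//= mulrDl.
  rewrite {1}/term/= expr1; congr (_ + _).
  rewrite mulr_suml; apply: eq_bigr => k _.
  by rewrite /term iterSr [2 ^+ k.+2]exprSr invfM mulrA.
apply: cvgM; last exact: cvg_cst.
by apply: cvgD; [exact: cvg_cst|exact: cvg_term].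
Qed.

Let measurable_unravel : measurable_fun setT unravel.
Proof.
apply: (@measurable_fun_cvg _ _ R setT (fun n x => series (term x) n)) => [n|x _].
  apply: measurable_sum => k; apply: measurable_funM => //.
  apply: (measurableT_comp measurable_bit).
  elim: k => [|k IH]; first exact: measurable_id.
  by rewrite /=; apply: (measurableT_comp measurable_dbl); apply: (measurableT_comp measurable_dbl).
exact: cvg_term.
Qed.

(* Both the law of [(unravel, unravel \o dbl)] and the product of uniform laws are
   fixed by the map induced by [(v, w) |-> ((b + w) / 2, v)] with [b] a fair bit, and
   that map contracts Lipschitz constants. *)
Let pair_cfg (x y : R) : cfg R bool := fun b => if b then x else y.

Let measurable_pair_cfg d (T : measurableType d) (f g : T -> R) :
  measurable_fun setT f -> measurable_fun setT g ->
  measurable_fun setT (fun t => pair_cfg (f t) (g t)).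
Proof. by move=> mf mg; apply: measurable_fun_cfg => -[]. Qed.

Let ctr (b : bool) (x : cfg R bool) := pair_cfg (half b (x false)) (x true).

Let E1 (f : cfg R bool -> R) := \int[U]_x f (pair_cfg (unravel x) (unravel (dbl x))).
Let E2 (f : cfg R bool -> R) := \int[U]_x \int[U]_y f (pair_cfg x y).

Let bmf_comp d d' (T : measurableType d) (T' : measurableType d') (f : T' -> R) (h : T -> T') :
  bmf f -> measurable_fun setT h -> bmf (f \o h).
Proof.
by move=> [mf [M fM]] mh; split; [exact: measurableT_comp|exists M => x; exact: fM].
Qed.

Let bmf_pair (f : cfg R bool -> R) : bmf f -> bmf (fun z : RB * RB => f (pair_cfg z.1 z.2)).
Proof.
move=> bf; apply: (@bmf_comp _ _ _ _ f (fun z : RB * RB => pair_cfg z.1 z.2)) => //.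
by apply: measurable_pair_cfg; [exact: measurable_fst|exact: measurable_snd].
Qed.

Let bmf_pair1 (f : cfg R bool -> R) (x : R) : bmf f -> bmf (fun y : RB => f (pair_cfg x y)).
Proof.
move=> bf; apply: (@bmf_comp _ _ _ _ f (pair_cfg x)) => //.
by apply: measurable_pair_cfg; [exact: measurable_cst|exact: measurable_id].
Qed.

Let bmf_pair2 (f : cfg R bool -> R) (y : R) : bmf f -> bmf (fun x : RB => f (pair_cfg x y)).
Proof.
move=> bf; apply: (@bmf_comp _ _ _ _ f (fun x => pair_cfg x y)) => //.
by apply: measurable_pair_cfg; [exact: measurable_id|exact: measurable_cst].
Qed.

Let integrable_pair (f : cfg R bool -> R) : bmf f ->
  (U \x U)%E.-integrable setT (EFin \o (fun z : RB * RB => f (pair_cfg z.1 z.2))).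
Proof.
move=> bf; have [mf [M fM]] := bmf_pair bf.
apply: measurable_bounded_integrable => //.
  have UU1 : (U \x U)%E setT = 1%E.
    rewrite -setXTT; transitivity (U setT * U setT)%E; first exact: product_measure1E.
    by rewrite probability_setT mule1.
  by have := ltry (1 : R); rewrite -UU1.
exists M; split; first exact: num_real.
by move=> y /ltW My x _ /=; exact: le_trans My.
Qed.

Let Rint_pair (f : cfg R bool -> R) : bmf f ->
  \int[(U \x U)%E]_z f (pair_cfg z.1 z.2) = E2 f.
Proof.
move=> bf; have := integral12_prod_meas1 (integrable_pair bf).
rewrite /Rintegral => <-; congr fine; apply: eq_integral => x _.
by rewrite /fubini_F/= EFin_Rint//; exact: bmf_pair1.
Qed.

Let bmf_E2 (f : cfg R bool -> R) : bmf f -> bmf (fun x : RB => \int[U]_y f (pair_cfg x y)).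
Proof.
move=> bf; have [mf [M fM]] := bf; split; last first.
  by exists M => x; apply: Rint_norm_le; [exact: bmf_pair1|move=> y; exact: fM].
have := measurable_fubini_F (integrable_pair bf); move=> mF; apply/measurable_EFinP.
apply: eq_measurable_fun mF => x _; rewrite /fubini_F/= EFin_Rint//; exact: bmf_pair1.
Qed.

Let E2_swap (f : cfg R bool -> R) : bmf f -> E2 f = \int[U]_y \int[U]_x f (pair_cfg x y).
Proof.
move=> bf; rewrite -Rint_pair//; have := integral21_prod_meas1 (integrable_pair bf).
rewrite /Rintegral => <-; congr fine; apply: eq_integral => x _.
by rewrite /fubini_G/= EFin_Rint//; exact: bmf_pair2.
Qed.

Let bmf_ctr (f : cfg R bool -> R) (b : bool) : bmf f -> bmf (f \o ctr b).
Proof.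
move=> bf; apply: bmf_comp => //; apply: measurable_pair_cfg.
  by apply: (measurableT_comp (measurable_half b)); exact: measurable_cfg_eval.
exact: measurable_cfg_eval.
Qed.

Let E1_rec (f : cfg R bool -> R) : bmf f -> E1 f = 2^-1 * (E1 (f \o ctr false) + E1 (f \o ctr true)).
Proof.
move=> bf.
have mu1 : measurable_fun setT (fun x : RB => pair_cfg (unravel x) (unravel (dbl x))).
  apply: measurable_pair_cfg; first exact: measurable_unravel.
  exact: (measurableT_comp measurable_unravel measurable_dbl).
rewrite /E1 (@uniform_half (fun x => f (pair_cfg (unravel x) (unravel (dbl x))))); last first.
  exact: (bmf_comp bf mu1).
suff h b : \int[U]_x f (pair_cfg (unravel (half b x)) (unravel (dbl (half b x)))) =
    \int[U]_x (f \o ctr b) (pair_cfg (unravel x) (unravel (dbl x))) by rewrite (h false) (h true).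
(* A digit [b] put in front of [x] becomes the first digit of the odd part and exchanges the odd and
   even digits of the rest. The digit identities hold on ]0, 1[, which has full mass. *)
rewrite /Rintegral; congr fine; apply: ae_eq_integral_nonmeasurable.
  apply/measurable_EFinP; case: (bmf_comp (bmf_ctr b bf) mu1) => + _; exact.
have [N [mN N0 sub]] := uniform_01; exists N; split => // y /= h; apply: sub => /= y01.
apply: h; congr (f _)%:E.
apply/funext => -[]; rewrite /pair_cfg /ctr/=; last by rewrite dbl_half.
by rewrite unravelE /quad/= dbl_half// bit_half.
Qed.

(** [ctr] also exchanges the two coordinates, hence the change of the order of integration. *)
Let E2_rec (f : cfg R bool -> R) : bmf f -> E2 f = 2^-1 * (E2 (f \o ctr false) + E2 (f \o ctr true)).
Proof.
move=> bf; rewrite /E2 (@uniform_half (fun x => \int[U]_y f (pair_cfg x y))); last exact: bmf_E2.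
suff h b : \int[U]_x \int[U]_y f (pair_cfg (half b x) y) = E2 (f \o ctr b) by rewrite (h false) (h true).
by rewrite E2_swap//; exact: bmf_ctr.
Qed.

Let Rint_uniform_le (h : RB -> R) c : bmf h -> (forall x, 0 < x < 1 -> `|h x| <= c) ->
  `|\int[U]_x h x| <= c.
Proof.
move=> bh hc.
have c0 : 0 <= c.
  by apply: (le_trans _ (hc 2^-1 _)) => //; apply/andP; split; rewrite ?invr_gt0// invf_lt1// ltr1n.
have [mh [M hM]] := bh.
pose h' x := h x * \1_(`]0, 1[%classic : set R) x.
have mh' : measurable_fun setT h' by apply: measurable_funM => //; exact: measurable_indic.
have h'c x : `|h' x| <= c.
  rewrite /h' indicE; have [x01|x01] := boolP (x \in `]0, 1[%classic).
    by rewrite mulr1 hc//; move: x01; rewrite inE /= in_itv.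
  by rewrite mulr0 normr0.
have -> : \int[U]_x h x = \int[U]_x h' x.
  rewrite /Rintegral; congr fine; apply: ae_eq_integral_nonmeasurable.
    exact/measurable_EFinP.
  have [N [mN N0 sub]] := uniform_01; exists N; split => // x /= nh; apply: sub => /= x01.
  by apply: nh; rewrite /h' indicE mem_set ?mulr1//= in_itv.
by apply: Rint_norm_le => //; split => //; exists c.
Qed.

Let lip2 (A B : R) (f : cfg R bool -> R) := forall x y,
  `|f x - f y| <= A * `|x true - y true| + B * `|x false - y false|.

(** One step sends the Lipschitz constants (A, B) to (B, A/2), so the induction takes two steps at a
    time, which halve both. For n = 0 both functionals are within A + B of the value of [f] at the
    origin, since all variables lie in [0, 1] up to a null set. *)
Let contraction n : forall A B (f : cfg R bool -> R), 0 <= A -> 0 <= B -> bmf f -> lip2 A B f ->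
  `|E1 f - E2 f| <= 2 * (A + B) / 2 ^+ n.
Proof.
elim: n => [|n IH] A B f A0 B0 bf fL.
  rewrite expr0 divr1.
  pose c := f (pair_cfg 0 0).
  have near0 x y : 0 <= x <= 1 -> 0 <= y <= 1 -> `|f (pair_cfg x y) - c| <= A + B.
    move=> /andP[x0 x1] /andP[y0 y1]; rewrite (le_trans (fL _ _))// /pair_cfg.
    by rewrite !subr0 !ger0_norm// lerD// ler_piMr.
  have mu1 : measurable_fun setT (fun x : RB => pair_cfg (unravel x) (unravel (dbl x))).
    apply: measurable_pair_cfg; first exact: measurable_unravel.
    exact: (measurableT_comp measurable_unravel measurable_dbl).
  have b1 : bmf (fun x : RB => f (pair_cfg (unravel x) (unravel (dbl x)))).
    exact: (bmf_comp bf mu1).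
  have h1 : `|E1 f - c| <= A + B.
    rewrite -[c](Rint_cst U) /E1 -RintB//; last exact: bmf_cst.
    apply: Rint_norm_le => [|x]; first by apply: bmfB => //; exact: bmf_cst.
    exact: near0.
  have h2 : `|E2 f - c| <= A + B.
    rewrite -[c](Rint_cst U) /E2 -RintB//; [|exact: bmf_E2|exact: bmf_cst].
    apply: Rint_uniform_le => [|x /andP[x0 x1]].
      by apply: bmfB; [exact: bmf_E2|exact: bmf_cst].
    rewrite -[c](Rint_cst U) -RintB//; [|exact: bmf_pair1|exact: bmf_cst].
    apply: Rint_uniform_le => [|y /andP[y0 y1]].
      by apply: bmfB; [exact: bmf_pair1|exact: bmf_cst].
    by apply: near0; rewrite !ltW.
  rewrite (_ : E1 f - E2 f = (E1 f - c) - (E2 f - c)); last by ring.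
  rewrite (le_trans (ler_normB _ _))//; lra.
have E12 g : bmf g -> E1 g - E2 g = 2^-1 * ((E1 (g \o ctr false) - E2 (g \o ctr false)) +
    (E1 (g \o ctr true) - E2 (g \o ctr true))).
  by move=> bg; rewrite E1_rec// E2_rec// -mulrBr opprD addrACA.
have lctr C D g b : 0 <= C -> lip2 C D g -> lip2 D (C / 2) (g \o ctr b).
  move=> C0 gL x y; rewrite /= (le_trans (gL _ _))// /ctr /pair_cfg /half addrC.
  rewrite lerD// (_ : _ - _ = 2^-1 * (x false - y false)); last by field.
  by rewrite normrM ger0_norm// mulrA.
have avg (v1 v2 w : R) : `|v1| <= w -> `|v2| <= w -> `|2^-1 * (v1 + v2)| <= w.
  by rewrite !ler_norml => /andP[? ?] /andP[? ?]; apply/andP; split; lra.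
have step b b' : `|E1 (f \o ctr b \o ctr b') - E2 (f \o ctr b \o ctr b')| <=
    2 * (A + B) / 2 ^+ n.+1.
  have := IH (A / 2) (B / 2) (f \o ctr b \o ctr b').
  rewrite !divr_ge0// => /(_ isT isT (bmf_ctr b' (bmf_ctr b bf))).
  have -> : 2 * (A / 2 + B / 2) / 2 ^+ n = 2 * (A + B) / 2 ^+ n.+1.
    by rewrite exprS; field; rewrite expf_neq0.
  apply; apply: (lctr) => //; exact: lctr.
have step1 b : `|E1 (f \o ctr b) - E2 (f \o ctr b)| <= 2 * (A + B) / 2 ^+ n.+1.
  by rewrite E12; [exact: (avg _ _ _ (step b false) (step b true))|exact: bmf_ctr].
by rewrite E12//; exact: (avg _ _ _ (step1 false) (step1 true)).
Qed.

Lemma uniform_split : exists phi : R -> R, exists psi : R -> R,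
  [/\ measurable_fun setT phi, measurable_fun setT psi &
   forall A B : set R, measurable A -> measurable B ->
     U [set x | A (phi x) /\ B (psi x)] = (U A * U B)%E].
Proof.
exists unravel, (unravel \o dbl).
have m2 : measurable_fun setT (unravel \o dbl).
  exact: (measurableT_comp measurable_unravel measurable_dbl).
split => // A B mA mB.
have mu1 : measurable_fun setT (fun x : RB => pair_cfg (unravel x) (unravel (dbl x))).
  exact: measurable_pair_cfg.
have mu2 : measurable_fun setT (fun z : RB * RB => pair_cfg z.1 z.2).
  by apply: measurable_pair_cfg; [exact: measurable_fst|exact: measurable_snd].
pose Q1 : probability (cfg R bool) R := push_prob U mu1.
pose Q2 : probability (cfg R bool) R := push_prob (U \x U)%E mu2.
have Q12 C : measurable C -> Q1 C = Q2 C.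
  apply: BL_measure_unique => f fBL; have bf := BL_bmf fBL.
  have mf : measurable_fun setT f by case: bf.
  rewrite /Q1 /Q2 !Rint_push//.
  apply/eqP; rewrite -subr_eq0 -normr_le0.
  have [_ [F [C0 [C00 fL]]]] := fBL.
  have fL2 : lip2 C0 C0 f.
    move=> x y; rewrite -mulrDr (le_trans (fL x y))// ler_wpM2l//.
    have -> : `|x true - y true| + `|x false - y false| = dist_on [fset true; false]%fset x y.
      by rewrite /dist_on big_fsetU1/= ?big_seq_fset1// inE.
    by apply: dist_on_subset; apply/fsubsetP => -[]; rewrite !inE.
  have cE : forall n, `|E1 f - E2 f| <= 2 * (C0 + C0) / 2 ^+ n.
    by move=> n; apply: contraction.
  rewrite [X in _ - X](_ : _ = E2 f); last by rewrite -Rint_pair.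
  rewrite -/(E1 f); apply/ler_addgt0Pl => e e0; rewrite addr0.
  have [n en] : exists n, 2 * (C0 + C0) / 2 ^+ n <= e.
    pose a := 2 * (C0 + C0) / e.
    exists (Num.bound `|a|); rewrite ler_pdivrMr ?exprn_gt0// [leRHS]mulrC -ler_pdivrMr// -/a.
    rewrite (le_trans (ler_norm _))// (le_trans (ltW (archi_boundP (normr_ge0 a))))//.
    by rewrite -natrX ler_nat ltnW// ltn_expl.
  exact: le_trans (cE n) en.
pose C : set (cfg R bool) := [set x | A (x true) /\ B (x false)].
have mC : measurable C.
  have -> : C = (fun x : cfg R bool => x true) @^-1` A `&` (fun x : cfg R bool => x false) @^-1` B by [].
  by apply: measurableI; rewrite -[X in measurable X]setTI; exact: measurable_cfg_eval.
transitivity (Q1 C) => //; rewrite Q12//.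
transitivity ((U \x U)%E (A `*` B)) => //; exact: product_measure1E.
Qed.

End doubling.

(** * Any law on the line as an image of the uniform law *)

Section quantile.
Variable R : realType.
Local Notation RB := (measurableTypeR R).
Local Notation U := (uniform_prob (ltr01 : (0 : R) < 1)).
Variable nu : probability RB R.

Let idTR : RB -> R := idfun.

#[local] HB.instance Definition _ :=
  @isMeasurableFun.Build _ _ _ _ idTR (@measurable_id _ _ setT).

Let F : R -> \bar R := cdf (idTR : {RV nu >-> R}).

Let FE r : F r = nu `]-oo, r]%classic. Proof. by []. Qed.

Let F_fin r : F r \is a fin_num.
Proof. by rewrite FE ge0_fin_numE// (le_lt_trans (probability_le1 nu _))// ltry. Qed.

Let quantile (u : R) : R := inf [set x | (u%:E <= F x)%E].

Let quantile_le u x : 0 < u < 1 -> (quantile u <= x) <-> (u%:E <= F x)%E.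
Proof.
move=> /andP[u0 u1].
have Fnd : nondecreasing_fun F by exact: cdf_nondecreasing.
have hi : has_inf [set x | (u%:E <= F x)%E].
  split.
    have : F r @[r --> +oo%R] --> 1%E by exact: cvg_cdfy1.
    move=> /fine_cvgP[_ /cvgrPdist_lt /(_ (1 - u))]; rewrite subr_gt0 => /(_ u1).
    move=> [M [_ /(_ (M + 1))]]; rewrite ltrDl ltr01 => /(_ isT)/= h.
    exists (M + 1) => /=; rewrite -[F _]fineK// lee_fin.
    move: h; rewrite ltr_norml => /andP[_]; lra.
  have : F r @[r --> -oo%R] --> 0%E by exact: cvg_cdfNy0.
  move=> /fine_cvgP[_ /cvgrPdist_lt /(_ u u0)].
  move=> [M [_ /(_ (M - 1))]]; rewrite gtrDl ltrN10 => /(_ isT)/= h.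
  exists (M - 1) => y /= uy; rewrite leNgt; apply/negP => yM.
  have := le_trans uy (Fnd _ _ (ltW yM)); rewrite -[F _]fineK// lee_fin.
  move: h; rewrite ltr_norml => /andP[]; lra.
split=> [qx|ux]; last by apply: ge_inf; case: hi.
rewrite leNgt; apply/negP => Fxu.
(* Right continuity keeps [F] below [u] a little beyond [x], which pushes the infimum past [x]. *)
have : F r @[r --> x^'+] --> F x by exact: cdf_right_continuous.
rewrite -[F x]fineK// => /fine_cvgP[_ /cvgrPdist_lt /(_ (u - fine (F x)))].
rewrite subr_gt0 -lte_fin fineK// => /(_ Fxu).
move=> [e /= e0 h].
have := h (x + e / 2); rewrite /ball_/= opprD addrA subrr add0r normrN gtr0_norm ?divr_gt0//.
rewrite ltr_pdivrMr// ltr_pMr// ltr1n ltrDl divr_gt0// => /(_ isT isT) {}h.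
have : x + e / 2 <= quantile u.
  apply: lb_le_inf; first by case: hi.
  move=> y /= uy; rewrite leNgt; apply/negP => yx.
  have := le_trans uy (Fnd _ _ (ltW yx)); rewrite -[F _]fineK// lee_fin.
  move: h; rewrite ltr_norml => /andP[]; lra.
have : 0 < e / 2 by rewrite divr_gt0.
by move: qx; lra.
Qed.

(** Outside ]0, 1[ the infimum may be taken over an empty or unbounded set; the value 0 is assigned
    there, on a null set. *)
Let q (u : RB) : RB := if 0 < u < 1 then quantile u else 0.

Let q_preimage a : q @^-1` `]a, +oo[%classic =
  (`]0, 1[%classic `&` `]fine (F a), +oo[%classic) `|`
  (if a < 0 then ~` `]0, 1[%classic else set0) :> set RB.
Proof.
apply/seteqP; split=> u /=; rewrite !in_itv/= ?andbT /q.
  have [u01|u01] := boolP (0 < u < 1) => au.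
    left; split => //; rewrite ltNge; apply/negP; rewrite -lee_fin fineK// => /quantile_le h.
    by move: au; rewrite ltNge h.
  by right; rewrite au/= => /negP; rewrite in_itv/= (negbTE u01).
move=> [[u01]|].
  rewrite u01 !ltNge => h; apply/negP => /quantile_le; move: h; rewrite -lee_fin fineK//.
  by move=> /negP h /(_ u01).
by case: ifPn => // a0 /negP; rewrite /= in_itv/= => /negbTE ->.
Qed.

Let measurable_q : measurable_fun setT q.
Proof.
apply: (measurability _ (RGenOInfty.measurableE R)) => _ [_ [a ->] <-].
rewrite setTI q_preimage; apply: measurableU; first exact: measurableI.
by case: ifP => // _; exact: measurableC.
Qed.

Let law_q A : measurable A -> U (q @^-1` A) = nu A.
Proof.
move=> mA; apply: (@R_measure_unique R (push_prob U measurable_q) nu) => // [|a].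
  by rewrite (le_lt_trans (probability_le1 _ _))// ltry.
transitivity (U `]fine (F a), +oo[%classic).
  have [N [mN N0 sub]] := @uniform_01 R.
  transitivity (U (q @^-1` `]a, +oo[%classic)) => //; rewrite q_preimage.
  have m1 : measurable (`]0, 1[%classic : set RB) by [].
  have m2 : measurable (`]fine (F a), +oo[%classic : set RB) by [].
  have m3 : measurable ((if a < 0 then ~` `]0, 1[%classic else set0) : set RB).
    by case: ifP => // _; exact: measurableC.
  have sN (B : set RB) : measurable B -> B `<=` ~` `]0, 1[%classic -> U B = 0%E.
    move=> mB BN; apply/eqP; rewrite eq_le measure_ge0 andbT -N0.
    apply: le_measure; rewrite ?inE// => x /BN /=; rewrite in_itv/= => x01.
    exact: sub.
  rewrite measureU//; [|exact: measurableI|]; last first.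
    rewrite -subset0 => x [[x01 _]]; case: ifP => // _; exact.
  have s2 : U (if a < 0 then ~` `]0, 1[%classic else set0) = 0%E.
    apply: sN => //; case: ifP => [_|_]; first exact: subset_refl.
    exact: sub0set.
  have s3 : U (`]fine (F a), +oo[%classic `\` `]0, 1[%classic) = 0%E.
    apply: sN; first exact: measurableD.
    by move=> x [].
  pose IJ : set RB := `]0, 1[%classic `&` `]fine (F a), +oo[%classic.
  transitivity (U IJ + 0)%E; first by congr (_ + _)%E; exact: s2.
  rewrite adde0; apply/esym; apply: (etrans (measureDI U m2 m1)).
  by rewrite -[RHS]add0e /IJ setIC; congr (_ + _)%E; exact: s3.
rewrite uniform_ray.
have F0 : 0 <= fine (F a) by rewrite fine_ge0// FE.
have F1 : fine (F a) <= 1.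
  by rewrite -lee_fin fineK// FE; exact: probability_le1.
rewrite (max_l F0) max_r ?subr_ge0// EFinB fineK//.
have := probability_setC nu (measurable_itv (`]-oo, a] : interval R)).
move=> h; apply/esym; transitivity (nu (~` `]-oo, a]%classic)); last exact: h.
by rewrite setCitvl.
Qed.

Lemma quantile_transform : exists2 h : RB -> RB, measurable_fun setT h &
  forall A, measurable A -> U (h @^-1` A) = nu A.
Proof. by exists q; [exact: measurable_q|exact: law_q]. Qed.

End quantile.

Section independent_family.
Variable R : realType.
Local Notation RB := (measurableTypeR R).
Local Notation U := (uniform_prob (ltr01 : (0 : R) < 1)).

(** Splitting the second variable again and again makes phi(x), phi(psi x), phi(psi (psi x)), and so
    on, independent and uniform. *)
Let law_seq phi psi : measurable_fun (setT : set RB) (phi : RB -> RB) ->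
   measurable_fun (setT : set RB) (psi : RB -> RB) ->
   (forall A B : set R, measurable A -> measurable B ->
     U [set x | A (phi x) /\ B (psi x)] = (U A * U B)%E) ->
  forall m (A : nat -> set RB), (forall n, measurable (A n)) ->
  measurable [set x : RB | forall n, (n < m)%N -> A n (phi (iter n psi x))] /\
  U [set x | forall n, (n < m)%N -> A n (phi (iter n psi x))] = (\prod_(n < m) U (A n))%E.
Proof.
move=> mphi mpsi split_ m; elim: m => [|m IH] A mA.
  rewrite big_ord0 (_ : [set x | _] = setT); last by apply/seteqP; split.
  by rewrite probability_setT.
have [mB UB] := IH (fun n => A n.+1) (fun n => mA n.+1).
set B := [set x | _] in mB UB.
rewrite (_ : [set x | _] = [set x | A 0%N (phi x) /\ B (psi x)]); last first.
  apply/seteqP; split=> x /=.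
    move=> h; split; first exact: (h 0%N).
    by move=> n nm; rewrite -iterSr; exact: h.
  by move=> [A0 Bx] [|n] nm //; rewrite iterSr; exact: Bx.
split; last by rewrite big_ord_recl -UB; exact: (split_ _ _ (mA 0%N) mB).
rewrite (_ : [set x | _] = phi @^-1` (A 0%N) `&` psi @^-1` B)//.
by apply: measurableI; rewrite -[X in measurable X]setTI; [exact: mphi|exact: mpsi].
Qed.

(** Coordinate [k] reads the uniform variable whose rank is the code of [k], through the quantile
    transform of [nu k]. *)
Lemma indep_measure (K : countType) (nu : K -> probability RB R) :
  exists gam : probability (cfg R K) R,
  forall (S : {fset K}) (A : K -> set RB), (forall k, measurable (A k)) ->
    gam [set x | forall k, k \in S -> A k (x k)] = (\prod_(k <- S) nu k (A k))%E.
Proof.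
have ex k : exists h : RB -> RB, measurable_fun setT h /\
    forall A, measurable A -> U (h @^-1` A) = nu k A.
  by have [h] := quantile_transform (nu k); exists h.
have [q hq] := boolp.choice ex.
have [phi [psi [mphi mpsi split_]]] := uniform_split R.
have mit n : measurable_fun (setT : set RB) (iter n psi : RB -> RB).
  elim: n => [|n IHn]; first exact: measurable_id.
  exact: (@measurableT_comp _ _ _ RB RB RB psi setT (iter n psi)).
pose h (x : RB) : cfg R K := fun k => q k (phi (iter (choice.pickle k) psi x)).
have mh : measurable_fun setT h.
  apply: measurable_fun_cfg => k.
  apply: (@measurableT_comp _ _ _ RB RB RB (q k) setT); first exact: (hq k).1.
  exact: (@measurableT_comp _ _ _ RB RB RB phi setT).
exists (push_prob U mh) => S A mA.
rewrite /push_prob /pushforward/=.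
pose s := [seq choice.pickle k | k <- S].
(* The constraint on the uniform variable of rank [n]; it is void unless [n] is the code of an
   element of [S]. *)
pose B n : set RB := if n \in s then
  (if (choice.unpickle n : option K) is Some k then q k @^-1` (A k) else setT) else setT.
have mB n : measurable (B n).
  rewrite /B; case: ifP => // _; case: choice.unpickle => // k.
  by rewrite -[X in measurable X]setTI; exact: (hq k).1.
have [m sm] : exists m, forall n, n \in s -> (n < m)%N.
  exists (\max_(n <- s) n).+1 => n ns; rewrite ltnS.
  by rewrite (big_rem n)//= leq_maxl.
have [_ UB] := law_seq mphi mpsi split_ m mB.
rewrite (_ : _ @^-1` _ = [set x | forall n, (n < m)%N -> B n (phi (iter n psi x))]); last first.
  apply/seteqP; split=> x /= hx.
    move=> n nm; rewrite /B; case: ifPn => // /mapP[k kS nk].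
    by rewrite nk choice.pickleK; exact: hx.
  move=> k kS; have ks : choice.pickle k \in s by exact: map_f.
  by have := hx _ (sm _ ks); rewrite /B ks choice.pickleK.
rewrite UB -(big_mkord xpredT (fun n => U (B n))).
rewrite (eq_bigr (fun n => if n \in s then U (B n) else 1%E)); last first.
  by move=> n _; case: ifP => // ns; rewrite /B ns; exact: probability_setT.
rewrite -big_mkcond -big_filter (perm_big s); last first.
  apply: uniq_perm.
  - by rewrite filter_uniq// iota_uniq.
  - rewrite map_inj_uniq ?fset_uniq//; exact: (pcan_inj choice.pickleK).
  - move=> n; rewrite mem_filter mem_index_iota leq0n/=.
    by case: (boolP (n \in s)) => // ns; rewrite sm.
rewrite big_map; apply: eq_big_seq => k kS.
by rewrite /B map_f// choice.pickleK (hq k).2.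
Qed.

End independent_family.

(** * Gaussian noise *)

Lemma ae_count d (T : measurableType d) (R : realType) (mu : {measure set T -> \bar R})
    (I : countType) (P : I -> T -> Prop) :
  (forall i, {ae mu, forall x, P i x}) -> {ae mu, forall x, forall i, P i x}.
Proof.
move=> aeP.
have : {ae mu, forall x, forall n : nat,
    if (choice.unpickle n : option I) is Some i then P i x else True}.
  apply: ae_foralln => n; case: choice.unpickle => [i|]; first exact: aeP.
  exact: aeW.
by apply: filterS => x h i; have := h (choice.pickle i); rewrite choice.pickleK.
Qed.

(** * Absolutely convergent real series *)

Section real_sums.
Variable R : realType.
Implicit Types t a : nat -> R.

(** Going through positive and negative parts makes it measurable in the terms with no summability
    assumption; where the series converges absolutely it is the sum. *)
Definition rsum t : R := fine (\sum_(m <oo) (Num.max (t m) 0)%:E)%E -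
  fine (\sum_(m <oo) (Num.max (- t m) 0)%:E)%E.

Lemma nneseries_cvg_fine a : (forall m, 0 <= a m) ->
  (\sum_(m <oo) (a m)%:E < +oo)%E ->
  series a n @[n --> \oo] --> fine (\sum_(m <oo) (a m)%:E)%E.
Proof.
move=> a0 aoo.
have cv : (fun n => \sum_(0 <= m < n) (a m)%:E)%E @ \oo -->
    (fine (\sum_(m <oo) (a m)%:E)%E)%:E.
  rewrite fineK; first by apply: is_cvg_nneseries => m _ _; rewrite lee_fin.
  by rewrite ge0_fin_numE// nneseries_ge0// => m _ _; rewrite lee_fin.
move: cv => /fine_cvgP[_].
rewrite (_ : fine \o _ = series a)//.
by apply/funext => n; rewrite /= sumEFin.
Qed.

Lemma max0_le_norm (r : R) : Num.max r 0 <= `|r|.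
Proof. by rewrite ge_max normr_ge0 ler_norm. Qed.

Lemma max0N_le_norm (r : R) : Num.max (- r) 0 <= `|r|.
Proof. by rewrite -normrN max0_le_norm. Qed.

Lemma max0_ge0 (r : R) : 0 <= Num.max r 0.
Proof. by rewrite le_max lexx orbT. Qed.

Lemma max0B (r : R) : Num.max r 0 - Num.max (- r) 0 = r.
Proof. by case: (leP r 0) => r0; [rewrite max_l ?oppr_ge0|rewrite max_r ?oppr_le0 ?ltW]; lra. Qed.

Lemma max0D (r : R) : Num.max r 0 + Num.max (- r) 0 = `|r|.
Proof.
case: (leP r 0) => r0; first by rewrite max_l ?oppr_ge0// ler0_norm// add0r.
by rewrite max_r ?oppr_le0 ?ltW// gtr0_norm// addr0.
Qed.

Lemma max0_sum_lty t : (\sum_(m <oo) (`|t m|)%:E < +oo)%E ->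
  (\sum_(m <oo) (Num.max (t m) 0)%:E < +oo)%E /\
  (\sum_(m <oo) (Num.max (- t m) 0)%:E < +oo)%E.
Proof.
move=> too; split; apply: le_lt_trans too; apply: lee_nneseries.
- by move=> m _; rewrite lee_fin max0_ge0.
- by move=> m _; rewrite lee_fin max0_le_norm.
- by move=> m _; rewrite lee_fin max0_ge0.
- by move=> m _; rewrite lee_fin max0N_le_norm.
Qed.

Lemma rsum_cvg t : (\sum_(m <oo) (`|t m|)%:E < +oo)%E ->
  series t n @[n --> \oo] --> rsum t.
Proof.
move=> too; have [p q] := max0_sum_lty too.
rewrite (_ : series t = (fun n => series (fun m => Num.max (t m) 0) n -
    series (fun m => Num.max (- t m) 0) n)).
  by apply: cvgB; apply: nneseries_cvg_fine => // m; exact: max0_ge0.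
apply/funext => n; rewrite /series/= -sumrB; apply: eq_bigr => m _.
by rewrite max0B.
Qed.

Lemma rsum_norm t : (`|rsum t|%:E <= \sum_(m <oo) (`|t m|)%:E)%E.
Proof.
have [too|] := ltP (\sum_(m <oo) (`|t m|)%:E)%E +oo%E; last first.
  by rewrite leye_eq => /eqP ->; rewrite leey.
have [p q] := max0_sum_lty too.
have s0 (a : nat -> R) : (forall m, 0 <= a m) -> (0 <= \sum_(m <oo) (a m)%:E)%E.
  by move=> a0; apply: nneseries_ge0 => m _ _; rewrite lee_fin.
rewrite (_ : (\sum_(m <oo) (`|t m|)%:E)%E =
  (\sum_(m <oo) (Num.max (t m) 0)%:E + \sum_(m <oo) (Num.max (- t m) 0)%:E)%E); last first.
  rewrite -nneseriesD; [|by move=> m _ _; rewrite lee_fin max0_ge0..].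
  by apply: eq_eseriesr => m _; rewrite -EFinD max0D.
rewrite -[X in (_ <= X + _)%E]fineK ?ge0_fin_numE ?s0//; last by move=> m; exact: max0_ge0.
rewrite -[X in (_ <= _ + X)%E]fineK ?ge0_fin_numE ?s0//; last by move=> m; exact: max0_ge0.
rewrite -EFinD lee_fin /rsum (le_trans (ler_normB _ _))// !ger0_norm//.
  by apply: fine_ge0; apply: s0 => m; exact: max0_ge0.
by apply: fine_ge0; apply: s0 => m; exact: max0_ge0.
Qed.

Lemma measurable_rsum d (T : measurableType d) (f : nat -> T -> R) :
  (forall m, measurable_fun setT (f m)) ->
  measurable_fun setT (fun x => rsum (f^~ x)).
Proof.
move=> mf; apply: measurable_funB.
- apply: (@measurableT_comp _ _ _ _ _ _ fine).
    by apply: fine_measurable.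
  apply: ge0_emeasurable_sum => m; first by move=> x _ _; rewrite lee_fin max0_ge0.
  by move=> _; apply/measurable_EFinP; exact: measurable_maxr.
- apply: (@measurableT_comp _ _ _ _ _ _ fine).
    by apply: fine_measurable.
  apply: ge0_emeasurable_sum => m; first by move=> x _ _; rewrite lee_fin max0_ge0.
  move=> _; apply/measurable_EFinP; apply: measurable_maxr => //.
  exact: measurableT_comp.
Qed.

End real_sums.

(** * Redrawing one coordinate of a product law *)

Section resampling.
Context (R : realType) (E : countType).
Local Notation RB := (measurableTypeR R).
Variables (nu : E -> probability RB R) (gam : probability (cfg R E) R).
Hypothesis gamE : forall (S : {fset E}) (A : E -> set RB),
  (forall e, measurable (A e)) ->
  gam [set x | forall e, e \in S -> A e (x e)] = (\prod_(e <- S) nu e (A e))%E.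

Definition resample (e : E) (s : R) (x : cfg R E) : cfg R E :=
  fun e' => if e' == e then s else x e'.

Lemma measurable_resample e :
  measurable_fun setT (fun z : cfg R E * RB => resample e z.2 z.1).
Proof.
apply: measurable_fun_cfg => e'; rewrite /resample; case: eqP => _.
  exact: measurable_snd.
exact: (measurableT_comp (measurable_cfg_eval e') measurable_fst).
Qed.

Lemma gam_resample e A : measurable A ->
  push_prob (gam \x nu e)%E (measurable_resample e) A = gam A.
Proof.
apply: cfg_measure_unique; first by rewrite (le_lt_trans (probability_le1 _ _))// ltry.
move=> S a; rewrite /push_prob /pushforward/=.
pose A0 e' : set RB := `[a e', +oo[%classic.
have mA0 e' : measurable (A0 e') by exact: measurable_itv.
have gam_box S' : gam (ray_box S' a) = (\prod_(e <- S') nu e (A0 e))%E.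
  rewrite -gamE//; congr (gam _); apply/seteqP; split=> x /= h e' /h;
  by rewrite /A0/= in_itv/= andbT.
have [eS|eS] := boolP (e \in S).
  rewrite (_ : _ @^-1` _ = ray_box (S `\ e)%fset a `*` A0 e); last first.
    apply/seteqP; split=> [[x s]|[x s] [/= xS se] e' e'S] /=.
      move=> h; split=> /=.
        by move=> e'; rewrite !inE => /andP[/negbTE e'e /h]; rewrite /resample e'e.
      by have := h _ eS; rewrite /resample eqxx /A0 /= in_itv/= andbT.
    rewrite /resample; case: eqP => [->|/eqP e'e]; first by move: se; rewrite /A0/= in_itv/= andbT.
    by apply: xS; rewrite !inE e'e.
  transitivity (gam (ray_box (S `\ e)%fset a) * nu e (A0 e))%E.
    by apply: product_measure1E => //; exact: measurable_ray_box.
  by rewrite !gam_box (big_fsetD1 e eS)/= muleC.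
rewrite (_ : _ @^-1` _ = ray_box S a `*` setT); last first.
  apply/seteqP; split=> [[x s]|[x s] [/= xS _] e' e'S] /=.
    move=> h; split=> //= e' e'S; have := h _ e'S; rewrite /resample.
    by case: eqP e'S eS => // -> ->.
  rewrite /resample; case: eqP => [ee'|_]; last exact: xS.
  by move: e'S eS; rewrite ee' => ->.
transitivity (gam (ray_box S a) * nu e setT)%E.
  by apply: product_measure1E => //; exact: measurable_ray_box.
by rewrite probability_setT mule1.
Qed.

(** Lets one coordinate be integrated first, the others frozen: the newest noise of a run, or one
    site of a finite-volume Gibbs law. *)
Lemma Rint_resample e (Phi : cfg R E -> R) : bmf Phi ->
  \int[gam]_x Phi x = \int[gam]_x \int[nu e]_s Phi (resample e s x) /\
  bmf (fun x => \int[nu e]_s Phi (resample e s x)).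
Proof.
move=> bPhi; have [mPhi [M PhiM]] := bPhi.
have mR := measurable_resample e.
have bR : bmf (fun z : cfg R E * RB => Phi (resample e z.2 z.1)).
  by split; [exact: (measurableT_comp mPhi mR)|exists M].
have bR1 x : bmf (fun s : RB => Phi (resample e s x)).
  split; last by exists M.
  apply: (measurableT_comp mPhi); apply: measurable_fun_cfg => e'.
  by rewrite /resample; case: eqP => _; [exact: measurable_id|exact: measurable_cst].
have iR := bmf_integrable (gam \x nu e)%E bR.
split.
  transitivity (\int[push_prob (gam \x nu e)%E mR]_x Phi x).
    rewrite /Rintegral; congr fine; apply: eq_measure_integral => A mA _.
    by apply/esym; exact: gam_resample.
  rewrite Rint_push//; have := integral12_prod_meas1 iR.
  rewrite /Rintegral => <-; congr fine; apply: eq_integral => x _.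
  by rewrite /fubini_F/= EFin_Rint.
split; last by exists M => x; exact: Rint_norm_le.
apply/measurable_EFinP; have := measurable_fubini_F iR.
by move=> mF; apply: eq_measurable_fun mF => x _; rewrite /fubini_F/= EFin_Rint.
Qed.

End resampling.

Section gaussian_noise.
Context (R : realType) (d : nat) (alpha : R) (p : site d -> site d -> R)
  (nb : site d -> {fset site d}) (rho : R) (u u' : site d -> R)
  (dat : cfg R (site d)).
Hypothesis hk : harness_kernel alpha p nb rho u u'.
Local Notation RB := (measurableTypeR R).
Local Notation G := (@normal_prob R 0 1).
Variable K : countType.
Local Notation label := (site d * K)%type.
Variable gam : probability (cfg R label) R.
Hypothesis gamE : forall (S : {fset label}) (A : label -> set RB),
  (forall e, measurable (A e)) ->
  gam [set x | forall e, e \in S -> A e (x e)] = (\prod_(e <- S) G (A e))%E.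
Local Notation evolve := (@evolve R d alpha p nb K).
Local Notation noise := (@noise R d alpha dat K).
Local Notation heat := (heat alpha p dat).
Local Notation heats := (heats alpha p dat).

Lemma measurable_evolve d' (T : measurableType d') (L : seq label)
    (z : T -> cfg R (site d)) (xi : T -> cfg R label) :
  measurable_fun setT z -> measurable_fun setT xi ->
  measurable_fun setT (fun t => evolve L (z t) (noise (xi t)) : cfg R (site d)).
Proof.
move=> mz mxi; elim: L => [|e L IH]; first exact: mz.
under eq_fun do rewrite (evolve_cons dat hk).
apply: (measurable_Theta _ hk) => //.
exact: (measurableT_comp (measurable_cfg_eval e) mxi).
Qed.

(** Distinct labels carry fresh noise: integrating the mark of the newest update turns [f] into
    [heat e.1 f] and does not touch the earlier part of the run. *)
Lemma evolve_law (L : seq label) f z : uniq L -> BLf f ->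
  \int[gam]_xi f (evolve L z (noise xi)) = heats (map fst L) f z.
Proof.
elim: L f => [|e L IH] f; first by rewrite /= Rint_cst.
move=> /andP[eL uL] fBL; rewrite [RHS]/= -IH//; last exact: (heat_BL _ hk).
have [mf [M fM]] := BL_bmf fBL.
have bPhi : bmf (fun xi : cfg R label => f (evolve (e :: L) z (noise xi))).
  split; last by exists M.
  apply: (measurableT_comp mf); apply: measurable_evolve; first exact: measurable_cst.
  exact: measurable_id.
rewrite (Rint_resample gamE e bPhi).1; apply: eq_Rintegral => x _.
apply: eq_Rintegral => s _; rewrite (evolve_cons dat hk) /resample eqxx.
congr (f (Theta _ _ _ _ _ _)); apply: eq_evolve => e' e'L.
by rewrite !noiseE; case: eqP e'L eL => // -> ->.
Qed.

Lemma noise_moment c e : (\int[G]_z (`|z|%:E) <= c%:E)%E ->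
  (\int[gam]_xi (`|noise xi e|%:E) <= (c + `|dat e.1|)%:E)%E.
Proof.
move=> Gc.
have me : measurable_fun setT (fun x : cfg R label => x e : RB) := measurable_cfg_eval e.
have lawe : (\int[gam]_xi `|xi e|%:E = \int[G]_z (`|z|%:E))%E.
  transitivity (\int[push_prob gam me]_z (`|z|%:E))%E.
    rewrite ge0_integral_push//.
    by apply/measurable_EFinP; exact: normr_measurable.
  apply: eq_measure_integral => A mA _; rewrite /push_prob /pushforward/=.
  have := gamE [fset e]%fset (fun=> mA); rewrite big_seq_fset1 => <-; congr (gam _).
  apply/seteqP; split=> x /= xA; first by move=> e'; rewrite inE => /eqP ->.
  by apply: xA; rewrite inE.
apply: (@le_trans _ _ (\int[gam]_xi (`|xi e|%:E + `|dat e.1|%:E))%E).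
  apply: ge0_le_integral => //.
  - apply/measurable_EFinP; apply: measurableT_comp => //.
    by apply: measurable_funD => //; exact: measurable_cfg_eval.
  - apply: emeasurable_funD; last exact: measurable_cst.
    by apply/measurable_EFinP; apply: measurableT_comp => //; exact: measurable_cfg_eval.
  - move=> x _; rewrite -EFinD lee_fin !noiseE (le_trans (ler_normD _ _))// lerD2l.
    have /andP[a0 a1] := hk_alpha hk.
    by rewrite normrM ger0_norm ?subr_ge0 ?(ltW a1)// ler_piMl// gerBl ltW.
rewrite ge0_integralD//; last first.
  by apply/measurable_EFinP; apply: measurableT_comp => //; exact: measurable_cfg_eval.
have g1 : gam setT = 1%E by exact: probability_setT.
rewrite integral_cst// EFinD leeD//; first by rewrite lawe.
by move: g1; rewrite /= => ->; rewrite mule1.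
Qed.

End gaussian_noise.

(** * The stationary law *)

Section stationary_law.
Context (R : realType) (d : nat) (alpha : R) (p : site d -> site d -> R)
  (nb : site d -> {fset site d}) (rho : R) (u u' : site d -> R)
  (dat : cfg R (site d)).
Hypothesis hk : harness_kernel alpha p nb rho u u'.
Local Notation G := (@normal_prob R 0 1).
Local Notation heats := (heats alpha p dat).
Local Notation QL := (QL alpha p nb).
Local Notation Pavg := (Pavg p nb).
Variable c : R.
Hypothesis c_ge0 : 0 <= c.
Hypothesis Gc : (\int[G]_z (`|z|%:E) <= c%:E)%E.
Variable D : R.
Hypothesis datD : forall i, `|dat i| <= D * u i.
Variable s : nat -> site d.
Hypothesis s_io : forall j n, exists2 m, (n <= m)%N & s m = j.

(** [c] bounds the mean of |z| for a standard Gaussian. If such a [w] dominates the mean absolute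
    heights around a site, it still does so after the site is updated. *)
Definition supersol (w : site d -> R) := (forall i, 0 <= w i) /\
  forall i, alpha * Pavg w i + (c + `|dat i|) <= w i.

Let rho1 : 0 < 1 - rho. Proof. by rewrite subr_gt0; have /andP[] := hk_rho hk. Qed.

Lemma u_gt0 i : 0 < u i. Proof. by rewrite (lt_le_trans ltr01)// (hk_u_ge1 hk). Qed.

Lemma data_bound_ge0 : 0 <= D.
Proof. by rewrite -(pmulr_lge0 _ (u_gt0 0)) (le_trans _ (datD 0)). Qed.

(** The slack (1 - rho) u in [hk_u] has to absorb the source, which is at most (c + D) u because u
    >= 1. *)
Lemma supersol_u : supersol (fun i => (c + D) / (1 - rho) * u i).
Proof.
have C0 : 0 <= (c + D) / (1 - rho).
  by rewrite divr_ge0 ?(ltW rho1)// addr_ge0// data_bound_ge0.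
split=> [i|i]; first by rewrite mulr_ge0// ltW// u_gt0.
rewrite PavgZ mulrCA; have := hk_u hk i; rewrite -/(Pavg u i) => hu.
apply: (@le_trans _ _ ((c + D) / (1 - rho) * (rho * u i) + (c * u i + D * u i))).
  apply: lerD; first exact: ler_wpM2l.
  by apply: lerD => //; rewrite ler_peMr// (hk_u_ge1 hk).
have -> : (c * u i + D * u i) = (c + D) / (1 - rho) * ((1 - rho) * u i).
  by field; rewrite gt_eqF.
by rewrite -mulrDr -mulrDl (addrC rho) subrK mul1r.
Qed.

Lemma heats_cvg_indep f z z' C (l : R) : BLf f -> (forall i, `|z i - z' i| <= C * u i) ->
  heats (sched s n) f z' @[n --> \oo] --> l ->
  heats (sched s n) f z @[n --> \oo] --> l.
Proof.
move=> fBL zz' cl.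
have [F [C' [C'0 fL]]] := BL_lipf fBL.
have bnd0 : C' * (\sum_(i <- F) C * QL (sched s n) u i) @[n --> \oo] --> (0 : R).
  rewrite -[X in _ --> X](mulr0 C'); apply: cvgMr.
  rewrite [X in _ --> X](_ : 0 = \sum_(i <- F) C * 0); last first.
    by rewrite big1// => ? _; rewrite mulr0.
  by apply: cvg_sumr => i; apply: cvgMr; exact: (sched_cvg_u hk).
rewrite -[l]addr0.
have -> : (fun n => heats (sched s n) f z) =
   (fun n => heats (sched s n) f z' + (heats (sched s n) f z - heats (sched s n) f z')).
  by apply/funext => n; rewrite addrC subrK.
apply: cvgD => //.
apply: (@squeeze_cvgr _ _ _ _ (fun n => - (C' * \sum_(i <- F) C * QL (sched s n) u i))
   (fun n => C' * \sum_(i <- F) C * QL (sched s n) u i)).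
- apply: nearW => n; rewrite -ler_norml.
  have /(_ z z') := heats_lip dat hk (sched s n) fBL (mono_sum F C'0) fL.
  move=> /le_trans; apply.
  rewrite ler_wpM2l//; apply: ler_sum => i _.
  rewrite -[leRHS](congr1 (fun h => h i) (QLZ _ _ _ _ _ _)).
  exact: (QL_le hk).
- by have := cvgN bnd0; rewrite oppr0; apply.
- exact: bnd0.
Qed.

Local Notation label := (site d * nat)%type.

Section with_noise.
Variable gam : probability (cfg R label) R.
Hypothesis gamE : forall (S : {fset label}) (A : label -> set (measurableTypeR R)),
  (forall e, measurable (A e)) ->
  gam [set x | forall e, e \in S -> A e (x e)] = (\prod_(e <- S) G (A e))%E.

(** Pairing the site with its rank makes the labels distinct although sites recur, so that every
    update has its own noise. *)
Let lab m : label := (s m, m).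
Let labs n := mkseq lab n.
Let b m i := QL (sched s m) (delta R (s m)) i.
Let term i (xi : cfg R label) m := noise alpha dat xi (lab m) * b m i.

Let b_ge0 m i : 0 <= b m i. Proof. by apply: (QL_ge0 hk) => j; exact: delta_ge0. Qed.

Let map_labs n : map fst (labs n) = sched s n.
Proof. by rewrite /labs /sched /mkseq -map_comp. Qed.

(** Coupling from the past: a longer schedule has one more, older, update, which adds a term and
    alters no other. So runs of growing length are partial sums of one random series and converge
    almost surely, not only in law. *)
Let evolve_labs zeta n i : evolve alpha p nb (labs n) (fun=> 0) zeta i =
  \sum_(0 <= m < n) zeta (lab m) * b m i.
Proof.
elim: n => [|n IH]; first by rewrite big_geq.
have -> : labs n.+1 = rcons (labs n) (lab n).
  by rewrite /labs /mkseq -[n.+1]addn1 iotaD map_cat/= cats1.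
rewrite big_nat_recr//= -IH.
by rewrite [LHS](evolve_rcons hk) map_labs.
Qed.

Let mterm i m : measurable_fun setT (fun xi => term i xi m).
Proof.
apply: measurable_funM => //; apply: measurable_funD => //.
exact: measurable_cfg_eval.
Qed.

(** The mean absolute terms add up to at most a run from 0 with the deterministic source c + |dat|,
    which any supersolution dominates. *)
Let term_moment w i : supersol w ->
  (\int[gam]_xi \sum_(m <oo) (`|term i xi m|%:E) <= (w i)%:E)%E.
Proof.
move=> [w0 wsup].
have mt m : measurable_fun setT (fun xi => (`|term i xi m|%:E)).
  by apply/measurable_EFinP; apply: measurableT_comp => //; exact: mterm.
rewrite integral_nneseries//.
apply: lime_le; first by apply: is_cvg_nneseries => m _ _; apply: integral_ge0 => x _; rewrite lee_fin.
apply: nearW => n.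
apply: (@le_trans _ _ (\sum_(0 <= m < n) (((c + `|dat (s m)|) * b m i)%:E))%E).
  apply: lee_sum => m _.
  rewrite (_ : (\int[gam]_x (`|term i x m|)%:E)%E =
    (\int[gam]_x ((b m i)%:E * `|noise alpha dat x (lab m)|%:E))%E); last first.
    by apply: eq_integral => x _; rewrite /term normrM (ger0_norm (b_ge0 _ _)) EFinM muleC.
  rewrite ge0_integralZl//; last 2 first.
  - apply/measurable_EFinP; apply: measurableT_comp => //; apply: measurable_funD => //.
    exact: measurable_cfg_eval.
  - by rewrite lee_fin b_ge0.
  rewrite mulrC EFinM lee_wpmul2l ?lee_fin//.
  exact: (noise_moment _ hk gamE (lab m) Gc).
rewrite sumEFin lee_fin -(evolve_labs (fun e => c + `|dat e.1|)).
apply: (evolve_supersol hk (g := fun j => c + `|dat j|)) => //.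
Qed.

Let term_fin : {ae gam, forall xi, forall i,
  (\sum_(m <oo) (`|term i xi m|%:E) < +oo)%E}.
Proof.
apply: ae_count => i.
have mt m : measurable_fun setT (fun xi => (`|term i xi m|%:E)).
  by apply/measurable_EFinP; apply: measurableT_comp => //; exact: mterm.
have mS : measurable_fun setT (fun xi => \sum_(m <oo) (`|term i xi m|%:E))%E.
  by apply: ge0_emeasurable_sum => // m x _ _; rewrite lee_fin.
have S0 xi : (0 <= \sum_(m <oo) (`|term i xi m|%:E))%E.
  by apply: nneseries_ge0 => m _ _; rewrite lee_fin.
have /integrable_ae : gam.-integrable setT (fun xi => \sum_(m <oo) (`|term i xi m|%:E))%E.
  apply/integrableP; split=> //.
  under eq_integral => x _ do rewrite gee0_abs//.
  by rewrite (le_lt_trans (term_moment i supersol_u))// ltry.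
move=> /(_ measurableT); apply: filterS => x /(_ I).
by rewrite ge0_fin_numE.
Qed.

Definition perpetuity (xi : cfg R label) : cfg R (site d) := fun i => rsum (term i xi).

Lemma measurable_perpetuity : measurable_fun setT perpetuity.
Proof. by apply: measurable_fun_cfg => i; apply: measurable_rsum => m; exact: mterm. Qed.

Lemma perpetuity_limit f : BLf f -> heats (sched s n) f (fun=> 0) @[n --> \oo] -->
  \int[push_prob gam measurable_perpetuity]_x f x.
Proof.
move=> fBL; have [mf [M fM]] := BL_bmf fBL; have [_ cf _] := BL_loc_test fBL.
rewrite Rint_push//.
rewrite (_ : (fun n => heats _ f _) = fun n => \int[gam]_xi
    f (evolve alpha p nb (labs n) (fun=> 0) (noise alpha dat xi))); last first.
  apply/funext => n; rewrite (evolve_law dat hk gamE)// ?map_labs//.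
  by rewrite map_inj_uniq ?iota_uniq// => m m' [].
apply: (@Rint_dct _ _ _ _ _ _ M) => //.
- move=> n; apply: (measurableT_comp mf); apply: (measurable_evolve _ hk).
    exact: measurable_cst.
  exact: measurable_id.
- by apply: (measurableT_comp mf); exact: measurable_perpetuity.
- move: term_fin; apply: filterS => xi fin.
  have cX : (fun n => evolve alpha p nb (labs n) (fun=> 0) (noise alpha dat xi) : cfg R (site d))
      @ \oo --> perpetuity xi.
    apply/cfg_cvgP => i; apply: cvg_trans (rsum_cvg (fin i)).
    by rewrite (_ : (fun n => _) = series (term i xi))//; apply/funext => n; rewrite evolve_labs.
  exact: (cvg_comp _ _ cX (cf (perpetuity xi))).
Qed.

(** Kept for every supersolution and not only for the multiple of [u]: [weighted_moment] applies it
    to finer ones. *)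
Lemma perpetuity_moment w i : supersol w ->
  (\int[push_prob gam measurable_perpetuity]_x `|x i|%:E <= (w i)%:E)%E.
Proof.
move=> wsup; rewrite ge0_integral_push//; last first.
  apply/measurable_EFinP; apply: measurableT_comp => //; exact: measurable_cfg_eval.
apply: le_trans (term_moment i wsup); apply: ge0_le_integral => //.
- apply/measurable_EFinP; apply: measurableT_comp => //.
  exact: (measurableT_comp (measurable_cfg_eval i) measurable_perpetuity).
- apply: ge0_emeasurable_sum => [m x _ _|m _]; first by rewrite lee_fin.
  by apply/measurable_EFinP; apply: measurableT_comp => //; exact: mterm.
- by move=> x _; exact: rsum_norm.
Qed.

End with_noise.

Lemma stationary_law : exists mu : probability (cfg R (site d)) R,
  (forall f z C, BLf f -> (forall i, `|z i| <= C * u i) ->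
     heats (sched s n) f z @[n --> \oo] --> \int[mu]_x f x) /\
  (forall w i, supersol w -> (\int[mu]_x `|x i|%:E <= (w i)%:E)%E).
Proof.
have [gam gamE] := @indep_measure R label (fun=> G).
exists (push_prob gam measurable_perpetuity); split=> [f z C fBL zC|w i].
  apply: (heats_cvg_indep fBL (z' := fun=> 0) (C := C)); first by move=> i; rewrite subr0.
  exact: perpetuity_limit.
exact: perpetuity_moment.
Qed.

End stationary_law.

(** * Weighted moments *)

Section exhaustion.
Variable I : choiceType.
Implicit Types (F : nat -> {fset I}) (A B : {fset I}).

Definition exhausts F :=
  (forall n, {subset F n <= F n.+1}) /\ (forall i, exists n, i \in F n).

Lemma exhausts_mono F n m : exhausts F -> (n <= m)%N -> {subset F n <= F m}.
Proof.
move=> [Fs _] /subnK <-; elim: (m - n)%N => // k IH i /IH ?.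
by rewrite addSn; exact: Fs.
Qed.

Lemma exhausts_subset F A : exhausts F ->
  exists n0, forall n, (n0 <= n)%N -> {subset A <= F n}.
Proof.
move=> eF.
suff [n0 h] : exists n0, forall i, i \in A -> i \in F n0.
  by exists n0 => n n0n i iA; apply: (exhausts_mono eF n0n); exact: h.
suff : forall s : seq I, exists n0, forall i, i \in s -> i \in F n0 by exact.
elim=> [|i s [n h]]; first by exists 0%N.
have [m im] := eF.2 i; exists (maxn n m) => j.
rewrite inE => /predU1P[->|/h]; first by apply: (exhausts_mono eF _ im); exact: leq_maxr.
by apply: (exhausts_mono eF); exact: leq_maxl.
Qed.

Variable R : realType.
Implicit Types a : I -> \bar R.
Local Open Scope ereal_scope.

Lemma le_fset_esum a A : (forall i, 0 <= a i) ->
  \sum_(i <- A) a i <= \esum_(i in [set: I]) a i.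
Proof.
move=> a0; apply: esum_ge; exists [set` A]; first by split.
by rewrite fsbig_finite//= set_fsetK.
Qed.

Lemma esum_le_fset a (B : \bar R) : (forall A, \sum_(i <- A) a i <= B) ->
  \esum_(i in [set: I]) a i <= B.
Proof.
by move=> h; apply: ge_ereal_sup => _ [X [finX _] <-]; rewrite fsbig_finite//=.
Qed.

Lemma esum_cvg_fset F a : exhausts F -> (forall i, 0 <= a i) ->
  (fun n => \sum_(i <- F n) a i) @ \oo --> \esum_(i in [set: I]) a i.
Proof.
move=> eF a0.
have sub A B : {subset A <= B} -> \sum_(i <- A) a i <= \sum_(i <- B) a i.
  by move=> AB; apply: lee_sum_nneg_subfset => // i _ _; exact: a0.
rewrite (_ : esum _ _ = ereal_sup (range (fun n => \sum_(i <- F n) a i))).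
  apply: ereal_nondecreasing_cvgn => m n mn.
  by apply: sub; exact: exhausts_mono.
apply/eqP; rewrite eq_le; apply/andP; split.
  apply: esum_le_fset => A; have [n0 h] := exhausts_subset A eF.
  apply: (@le_trans _ _ (\sum_(i <- F n0) a i)); first by apply: sub; exact: h.
  by apply: ereal_sup_ubound; exists n0.
by apply: ge_ereal_sup => _ [n _ <-]; exact: le_fset_esum.
Qed.

End exhaustion.

Lemma exhausts_countable (I : countType) : exists F : nat -> {fset I}, exhausts F.
Proof.
pose F k := [fset j in pmap (@choice.unpickle I) (iota 0 k)]%fset.
have inF i k : (i \in F k) = (Some i \in [seq choice.unpickle m | m <- iota 0 k]).
  by rewrite !inE /= mem_pmap.
exists F; split=> [n i|i].
  rewrite !inF => /mapP[m mn e]; apply/mapP; exists m => //.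
  by move: mn; rewrite !mem_iota !add0n !leq0n; exact: leqW.
exists (choice.pickle i).+1; rewrite inF; apply/mapP.
by exists (choice.pickle i); rewrite ?choice.pickleK// mem_iota add0n ltnS leqnn.
Qed.

Section esum_measurable.
Context d (T : measurableType d) (R : realType) (I : countType).
Variable f : I -> T -> \bar R.
Hypothesis mf : forall i, measurable_fun setT (f i).
Hypothesis f0 : forall i x, (0 <= f i x)%E.
Local Open Scope ereal_scope.

Let msum (A : {fset I}) : measurable_fun setT (fun x => \sum_(i <- A) f i x).
Proof. exact: emeasurable_sum. Qed.

Lemma measurable_esum : measurable_fun setT (fun x => \esum_(i in [set: I]) f i x).
Proof.
have [F eF] := exhausts_countable I.
apply: (emeasurable_fun_cvg (fun n x => \sum_(i <- F n) f i x)) => // x _.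
by apply: esum_cvg_fset.
Qed.

Lemma integral_esum_le (mu : {measure set T -> \bar R}) B :
  (forall A : {fset I}, \int[mu]_x \sum_(i <- A) f i x <= B) ->
  \int[mu]_x (\esum_(i in [set: I]) f i x) <= B.
Proof.
move=> h; have [F eF] := exhausts_countable I.
have cv : (fun n => \int[mu]_x \sum_(i <- F n) f i x) @ \oo -->
    \int[mu]_x (\esum_(i in [set: I]) f i x).
  have := @cvg_monotone_convergence _ _ _ mu setT measurableT
     (fun n x => \sum_(i <- F n) f i x) (fun n => msum (F n)) .
  rewrite (_ : (fun x => limn _) = fun x => \esum_(i in [set: I]) f i x); last first.
    by apply/funext => x; apply/cvg_lim => //; exact: esum_cvg_fset.
  apply; first by move=> n x _; exact: sume_ge0.
  move=> x _ m n mn; apply: lee_sum_nneg_subfset => // i.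
  exact: exhausts_mono.
rewrite -(cvg_lim _ cv)//; apply: lime_le; first by apply/cvg_ex; eexists; exact: cv.
exact: nearW.
Qed.

End esum_measurable.

Section summable_weight.
Context (R : realType) (d : nat) (alpha : R) (p : site d -> site d -> R)
  (nb : site d -> {fset site d}) (rho : R) (u u' : site d -> R)
  (dat : cfg R (site d)).
Hypothesis hk : harness_kernel alpha p nb rho u u'.
Local Notation Pavg := (Pavg p nb).
Variable w : site d -> R.
Hypothesis w_ge0 : forall i, 0 <= w i.
Hypothesis wu : forall i, w i * u i <= 1.
Hypothesis w_rho : forall j (A : {fset site d}),
  alpha * \sum_(i <- A) p j i * w i <= rho * w j.

Let alpha_ge0 : 0 <= alpha. Proof. by have /andP[/ltW] := hk_alpha hk. Qed.
Let rho_ge0 : 0 <= rho. Proof. by have /andP[/ltW] := hk_rho hk. Qed.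
Let rho1 : 0 < 1 - rho. Proof. by rewrite subr_gt0; have /andP[] := hk_rho hk. Qed.

Lemma Pavg_subset v i (A : {fset site d}) : {subset nb i <= A} ->
  Pavg v i = \sum_(j <- A) p i j * v j.
Proof.
move=> /fsubsetP sub; rewrite /Pavg; apply: big_fset_incl => // j _ jnb.
by have [->|/(hk_nb hk)] := eqVneq (p i j) 0; rewrite ?mul0r// (negbTE jnb).
Qed.

(** The symmetry of [p] moves the averaging from [v] to the weight [w], where [w_rho] controls
    it. *)
Lemma Pavg_weight_sum v S : (forall i, 0 <= v i) ->
  (forall A : {fset site d}, \sum_(i <- A) w i * v i <= S) ->
  forall A : {fset site d}, \sum_(i <- A) w i * (alpha * Pavg v i) <= rho * S.
Proof.
move=> v0 vS A.
have [B nbB] : exists B : {fset site d}, forall i, i \in A -> {subset nb i <= B}.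
  exists (\bigcup_(i <- A) nb i)%fset => i iA; apply/fsubsetP.
  exact: bigfcup_sup.
apply: (@le_trans _ _ (\sum_(j <- B) rho * w j * v j)); last first.
  rewrite (_ : \sum_(j <- B) _ = rho * \sum_(j <- B) w j * v j).
    by rewrite ler_wpM2l.
  by rewrite mulr_sumr; apply: eq_bigr => j _; rewrite mulrA.
rewrite (_ : \sum_(i <- A) _ =
    \sum_(j <- B) (alpha * \sum_(i <- A) p j i * w i) * v j); last first.
  rewrite (_ : \sum_(j <- B) _ =
    \sum_(j <- B) \sum_(i <- A) alpha * (p j i * w i) * v j); last first.
    by apply: eq_bigr => j _; rewrite mulr_sumr mulr_suml.
  rewrite exchange_big/=; apply: eq_big_seq => i iA.
  rewrite (Pavg_subset _ (nbB _ iA)) !mulr_sumr; apply: eq_bigr => j _.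
  by rewrite (hk_sym hk i j); ring.
by apply: ler_sum => j _; rewrite ler_wpM2r.
Qed.

Variables (c D S : R).
Hypothesis c_ge0 : 0 <= c.
Hypothesis datD : forall i, `|dat i| <= D * u i.
Hypothesis dat_sum : forall A : {fset site d}, \sum_(i <- A) w i * (c + `|dat i|) <= S.

Let g l := iter l (fun v i => alpha * Pavg v i) (fun i => c + `|dat i|).

Let g_ge0 l i : 0 <= g l i.
Proof.
elim: l i => [|l IH] i /=; first by rewrite addr_ge0.
by rewrite mulr_ge0// (Pavg_ge0 hk).
Qed.

Let g_sum l (A : {fset site d}) : \sum_(i <- A) w i * g l i <= rho ^+ l * S.
Proof.
elim: l A => [|l IH] A /=; first by rewrite expr0 mul1r; exact: dat_sum.
by rewrite exprS -mulrA; apply: Pavg_weight_sum => // i; exact: g_ge0.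
Qed.

Let cD0 : 0 <= c + D. Proof. by rewrite addr_ge0// (data_bound_ge0 hk datD). Qed.

Let g_le l i : g l i <= (c + D) * rho ^+ l * u i.
Proof.
elim: l i => [|l IH] i /=.
  rewrite expr0 mulr1 mulrDl lerD//; rewrite ler_peMr// (hk_u_ge1 hk)//.
apply: (@le_trans _ _ (alpha * Pavg (fun j => (c + D) * rho ^+ l * u j) i)).
  by rewrite ler_wpM2l// (Pavg_le hk).
rewrite PavgZ mulrCA.
have -> : (c + D) * rho ^+ l.+1 * u i = (c + D) * rho ^+ l * (rho * u i).
  by rewrite exprS; ring.
apply: ler_wpM2l; first by rewrite mulr_ge0// exprn_ge0.
exact: (hk_u hk).
Qed.

(** In the application w u = 1, so a bound by a multiple of [u] gives nothing summable. [W n]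
    consists of [n] terms of the Neumann series of alpha P applied to c + |dat|, which are summable
    against [w], and of a remainder of order rho^n u that makes it a supersolution. *)
Let W n i := \sum_(l < n) g l i + (c + D) / (1 - rho) * rho ^+ n * u i.

Let W_supersol n : supersol alpha p nb dat c (W n).
Proof.
have C0 : 0 <= (c + D) / (1 - rho) * rho ^+ n.
  by rewrite mulr_ge0 ?exprn_ge0// divr_ge0// ltW.
split=> i.
  by rewrite addr_ge0 ?sumr_ge0// mulr_ge0//; exact: ltW (u_gt0 hk i).
have -> : alpha * Pavg (W n) i + (c + `|dat i|) =
    \sum_(l < n.+1) g l i + (c + D) / (1 - rho) * rho ^+ n * (alpha * Pavg u i).
  rewrite PavgD PavgZ mulrDr big_ord_recl/=.
  have -> : alpha * Pavg (fun j => \sum_(l < n) g l j) i =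
      \sum_(l < n) alpha * Pavg (g l) i.
    rewrite /Pavg mulr_sumr.
    rewrite (eq_bigr (fun j => \sum_(l < n) alpha * (p i j * g l j))); last first.
      by move=> j _; rewrite !mulr_sumr.
    by rewrite exchange_big; apply: eq_bigr => l _ /=; rewrite mulr_sumr.
  rewrite (eq_bigr (fun l : 'I_n => alpha * Pavg (g (0 + l)%N) i))//; ring.
rewrite big_ord_recr/= -addrA lerD2l.
have := hk_u hk i; rewrite -/(Pavg u i) => hu.
apply: (@le_trans _ _ ((c + D) * rho ^+ n * u i +
    (c + D) / (1 - rho) * rho ^+ n * (rho * u i))).
  by apply: lerD; [exact: g_le|exact: ler_wpM2l].
rewrite le_eqVlt; apply/orP; left; apply/eqP; field; rewrite gt_eqF//.
Qed.

Lemma weighted_moment (mu : probability (cfg R (site d)) R) :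
  (forall v i, supersol alpha p nb dat c v -> (\int[mu]_x `|x i|%:E <= (v i)%:E)%E) ->
  (\int[mu]_x (\esum_(i in [set: site d]) (`|x i| * w i)%:E) <= (S / (1 - rho))%:E)%E.
Proof.
move=> hmu.
have mf i : measurable_fun setT (fun x : cfg R (site d) => (`|x i|)%:E).
  apply/measurable_EFinP; apply: measurableT_comp => //; exact: measurable_cfg_eval.
apply: integral_esum_le => [i|i x|A].
- under eq_fun do rewrite EFinM; apply: emeasurable_funM => //; exact: measurable_cst.
- by rewrite lee_fin mulr_ge0.
apply: (@le_trans _ _ (\sum_(i <- A) (\int[mu]_x (`|x i| * w i)%:E))%E).
  rewrite ge0_integral_sum// => i.
    by under eq_fun do rewrite EFinM; apply: emeasurable_funM => //; exact: measurable_cst.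
  by move=> x _; rewrite lee_fin mulr_ge0.
have S0 : 0 <= S.
  by have := dat_sum fset0; rewrite big_seq_fset0.
(* On a finite set [A] the remainder costs a constant times rho^n |A|, and it vanishes as [n]
   grows. *)
have bound n : (\sum_(i <- A) (\int[mu]_x (`|x i| * w i)%:E) <=
    (S / (1 - rho) + (c + D) / (1 - rho) * rho ^+ n * (size A)%:R)%:E)%E.
  apply: (@le_trans _ _ (\sum_(i <- A) (w i * W n i)%:E)%E).
    apply: lee_sum => i _.
    under eq_integral do rewrite mulrC EFinM.
    rewrite ge0_integralZl ?lee_fin// EFinM lee_wpmul2l ?lee_fin//.
    exact: hmu.
  rewrite sumEFin lee_fin.
  have -> : \sum_(i <- A) w i * W n i = \sum_(l < n) \sum_(i <- A) w i * g l i +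
     (c + D) / (1 - rho) * rho ^+ n * \sum_(i <- A) w i * u i.
    rewrite exchange_big mulr_sumr -big_split; apply: eq_bigr => i _ /=.
    by rewrite /W mulrDr mulr_sumr; congr (_ + _); ring.
  apply: lerD.
    apply: (@le_trans _ _ (\sum_(l < n) rho ^+ l * S)); first exact: ler_sum.
    rewrite -mulr_suml mulrC ler_wpM2l// -[leRHS]mul1r ler_pdivlMr//.
    rewrite mulrC -[1 - rho]opprB mulNr -subrX1 opprB gerBl exprn_ge0//.
  apply: ler_wpM2l; first by rewrite mulr_ge0 ?exprn_ge0// divr_ge0// ltW.
  rewrite -sum1_size natr_sum; apply: ler_sum => i _; exact: wu.
have cv : (fun n => (S / (1 - rho) + (c + D) / (1 - rho) * rho ^+ n * (size A)%:R)%:E)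
    @ \oo --> (S / (1 - rho))%:E.
  apply: cvg_EFin; first exact: nearW.
  rewrite -[X in _ --> X]addr0; apply: cvgD; first exact: cvg_cst.
  rewrite -[X in _ --> X](mul0r (size A)%:R); apply: cvgMl.
  rewrite -[X in _ --> X](mulr0 ((c + D) / (1 - rho))); apply: cvgMr.
  by apply: cvg_expr; rewrite ger0_norm//; have /andP[] := hk_rho hk.
by rewrite -(cvg_lim _ cv)//; apply: lime_ge; [apply/cvg_ex; eexists; exact: cv|exact: nearW].
Qed.

End summable_weight.

(** * Exponential weights on the lattice *)

Section lattice_norm.
Context (R : realType) (d : nat) (N : 'rV[R]_d -> R).
Hypothesis hN : is_norm N.

Let N_sep x : N x = 0 -> x = 0. Proof. by case: hN => h _ _; exact: h. Qed.
Let N_tri x y : N (x + y) <= N x + N y. Proof. by case: hN. Qed.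
Let N_hom a x : N (a *: x) = `|a| * N x. Proof. by case: hN. Qed.
Let N0 : N 0 = 0. Proof. by rewrite -(scale0r 0) N_hom normr0 mul0r. Qed.
Let N_opp x : N (- x) = N x. Proof. by rewrite -scaleN1r N_hom normrN normr1 mul1r. Qed.
Let N_ge0 x : 0 <= N x.
Proof. by have := N_tri x (- x); rewrite subrr N0 N_opp; lra. Qed.

Let N_sum (s : seq 'I_d) (F : 'I_d -> 'rV[R]_d) :
  N (\sum_(l <- s) F l) <= \sum_(l <- s) N (F l).
Proof.
elim: s => [|l s IH]; first by rewrite !big_nil N0.
by rewrite !big_cons (le_trans (N_tri _ _))// lerD2l.
Qed.

Let coord_le (x : 'rV[R]_d) l : `|x 0 l| <= `|x|.
Proof.
rewrite [leRHS]/Num.norm/= mx_normrE; apply: (le_bigmax _ (fun ij : 'I_1 * 'I_d => `|x ij.1 ij.2|) (0, l)).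
Qed.

Let N_upper : exists2 K, 0 < K & forall x, N x <= K * `|x|.
Proof.
exists (1 + \sum_l N (delta_mx 0 l)); first by rewrite ltr_pwDl// sumr_ge0.
move=> x; rewrite {1}(row_sum_delta x) (le_trans (N_sum _ _))//.
rewrite mulrDl mul1r mulr_suml ler_wpDl// ler_sum// => l _.
by rewrite N_hom mulrC; apply: ler_wpM2l => //; exact: coord_le.
Qed.

Let N_continuous : continuous N.
Proof.
have [K K0 NK] := N_upper => x; change (N @ nbhs x --> N x).
apply/cvgrPdist_le => e e0.
have eK : 0 < e / K by rewrite divr_gt0.
apply: filterS (nbhsx_ballx x (e / K) eK) => y; rewrite -ball_normE/= => xy.
have h a b : N a - N b <= N (a - b) by have := N_tri (a - b) b; rewrite subrK; lra.
rewrite ler_norml; apply/andP; split.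
  rewrite lerNl opprB (le_trans (h _ _))// (le_trans (NK _))//.
  by rewrite -ler_pdivlMl// mulrC distrC ltW.
by rewrite (le_trans (h _ _))// (le_trans (NK _))// -ler_pdivlMl// mulrC ltW.
Qed.

(** Equivalence of norms: [c] is the minimum of [N] on the unit sphere of the supremum norm,
    positive by compactness. *)
Lemma norm_coord_le : exists2 c : R, 0 < c &
  forall (x : 'rV[R]_d) l, c * `|x 0 l| <= N x.
Proof.
pose S := [set x : 'rV[R]_d | `|x| = 1].
have unit_sphere x : x != 0 -> S (`|x|^-1 *: x).
  move=> x0; rewrite /S/= normrZ normfV normr_id mulVf// normr_eq0//.
(* The sphere is empty only in dimension 0, where every vector is 0. *)
have [[x0 Sx0]|S0] := pselect (S !=set0); last first.
  exists 1 => // x l; have [->|x0] := eqVneq x 0; first by rewrite mxE normr0 mulr0.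
  by exfalso; apply: S0; exists (`|x|^-1 *: x); exact: unit_sphere.
have cS : compact S.
  apply: bounded_closed_compact.
    by exists 1; split; [exact: num_real|move=> M M1 x /= ->; exact: ltW].
  rewrite (_ : S = Num.norm @^-1` [set 1])//.
  by apply: closed_comp; [move=> x _; exact: norm_continuous|exact: closed_eq].
have [c Sc cmin] := @EVT_min_rV R d N S (ex_intro _ _ Sx0) cS (continuous_subspaceT N_continuous).
have c0 : 0 < N c.
  rewrite lt_neqAle N_ge0 andbT eq_sym; apply/eqP => /N_sep c0.
  by move: Sc; rewrite inE /S/= c0 normr0 => /eqP; rewrite eq_sym oner_eq0.
exists (N c) => // x l; have [->|xn0] := eqVneq x 0; first by rewrite mxE normr0 mulr0.
have nx0 : 0 < `|x| by rewrite normr_gt0.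
have := cmin (`|x|^-1 *: x); rewrite inE => /(_ (unit_sphere _ xn0)).
rewrite N_hom normfV normr_id ler_pdivlMl// => h.
by rewrite (le_trans _ h)// mulrC ler_wpM2r// ltW.
Qed.

Local Notation nrm := (site_norm N).
Implicit Types i j : site d.

Lemma site_norm_ge0 i : 0 <= nrm i. Proof. exact: N_ge0. Qed.

Lemma site_norm_triangle i j : nrm (i + j) <= nrm i + nrm j.
Proof. by rewrite /site_norm map_mxD. Qed.

(** The cube of the sites with coordinates between -n and n, encoded by maps into a finite ordinal
    so that sums over it factor over the coordinates. *)
Definition site_box n : {fset site d} :=
  [fset i in codom (fun t : {ffun 'I_d -> 'I_(n.*2.+1)} =>
     \row_l ((t l)%:Z - n%:Z)%R : site d)]%fset.

Lemma mem_site_box n i : (forall l, (absz (i 0%R l) <= n)%N) -> i \in site_box n.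
Proof.
move=> hi; rewrite !inE/=; apply/codomP.
exists [ffun l => inord (absz (i 0 l + n%:Z))]; apply/rowP => l.
rewrite !mxE ffunE inordK.
  by have := hi l; case: (i 0 l) => a /=; rewrite ?NegzE; lia.
by have := hi l; case: (i 0 l) => a /=; rewrite ?NegzE -?addnn; lia.
Qed.

Lemma site_norm_box : exists2 c : R, 0 < c &
  forall r n i, nrm i <= r -> r / c <= n%:R -> i \in site_box n.
Proof.
have [c c0 hc] := norm_coord_le; exists c => // r n i ir rn.
apply: mem_site_box => l; rewrite -(ler_nat R) (le_trans _ rn)//.
rewrite ler_pdivlMr// mulrC (le_trans _ ir)// (le_trans _ (hc _ l))//.
by apply: ler_wpM2l; [exact: ltW|rewrite mxE -intr_norm natr_absz].
Qed.

Lemma finite_site_ball r : exists B : {fset site d}, forall i, nrm i <= r -> i \in B.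
Proof.
have [c c0 hc] := site_norm_box.
exists (site_box (Num.truncn (r / c)).+1) => i ir; apply: (hc r) => //.
exact/ltW/truncnS_gt.
Qed.

Let geo_le (q : R) n : 0 <= q < 1 -> \sum_(m < n) q ^+ m <= (1 - q)^-1.
Proof.
move=> /andP[q0 q1]; have q1' : 0 < 1 - q by rewrite subr_gt0.
rewrite -[leRHS]mul1r ler_pdivlMr// mulrC -[1 - q]opprB mulNr -subrX1 opprB.
by rewrite gerBl exprn_ge0.
Qed.

Let two_sided (q : R) n : 0 <= q < 1 ->
  \sum_(a < n.*2.+1) q ^+ `|(a%:Z - n%:Z)%R|%N <= 2 / (1 - q).
Proof.
move=> q01; rewrite -(big_mkord xpredT (fun a => q ^+ `|(a%:Z - n%:Z)%R|%N)).
have nn : (n <= n.*2.+1)%N by rewrite -addnn; lia.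
rewrite (big_cat_nat _ nn)//= mulrDl mul1r lerD//.
  rewrite big_nat_rev/= add0n big_mkord.
  apply: le_trans (geo_le n.+1 q01); rewrite big_ord_recl/= expr0 ler_wpDl//.
  apply: ler_sum => a _; rewrite le_eqVlt; apply/orP; left; apply/eqP; congr (_ ^+ _).
  by have := ltn_ord a; rewrite /bump/=; lia.
rewrite -{1}[n]add0n big_addn big_mkord; apply: le_trans (geo_le (n.*2.+1 - n) q01).
apply: ler_sum => a _; rewrite le_eqVlt; apply/orP; left; apply/eqP; congr (_ ^+ _).
by lia.
Qed.

Let sum_fset_le_fin (J : finType) (f : J -> site d) (F : site d -> R) (A : {fset site d}) :
  (forall i, 0 <= F i) -> (forall i, i \in A -> exists t, i = f t) ->
  \sum_(i <- A) F i <= \sum_t F (f t).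
Proof.
move=> F0 fA; apply: (@le_trans _ _ (\sum_(i <- A) \sum_(t | f t == i) F (f t))).
  rewrite big_seq [leRHS]big_seq; apply: ler_sum => i /fA[t ->].
  by rewrite (bigD1 t)//= lerDl sumr_ge0.
rewrite (exchange_big_dep xpredT)//=; apply: ler_sum => t _.
have [tA|tA] := boolP (f t \in A); last first.
  rewrite big_seq_cond big_pred0// => i; apply/negbTE/negP => /andP[iA /eqP ti].
  by move: tA; rewrite ti iA.
rewrite big_mkcond (big_fsetD1 (f t))//= eqxx big1_seq ?addr0// => i /andP[_].
by rewrite !inE (eq_sym (f t)) => /andP[/negbTE ->].
Qed.

(** As [N] dominates every coordinate, exp(-k N(i)) is at most a product of one-dimensional
    geometric terms. On a cube the sum of these products is the product of the sums, each at most
    2/(1 - q). *)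
Lemma exp_site_norm_summable k : 0 < k -> exists S,
  forall A : {fset site d}, \sum_(i <- A) expR (- k * nrm i) <= S.
Proof.
move=> k0; have [c c0 hc] := norm_coord_le.
have [cb cb0 hcb] := site_norm_box.
(* The exponent is shared among the coordinates; [d.+1] in place of [d] avoids a division by 0 and
   only weakens the bound. *)
pose q := expR (- (k * c / d.+1%:R)).
have q01 : 0 <= q < 1.
  by rewrite expR_ge0/= expR_lt1 oppr_lt0 divr_gt0// mulr_gt0.
exists ((2 / (1 - q)) ^+ d) => A.
have [n nA] : exists n, {subset A <= site_box n}.
  have [r rA] : exists r, forall i, i \in A -> nrm i <= r.
    exists (\sum_(i <- A) nrm i) => i iA; rewrite (big_fsetD1 i)//= lerDl sumr_ge0// => j _.
    exact: site_norm_ge0.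
  exists (Num.truncn (r / cb)).+1 => i /rA ir; apply: (hcb r) => //.
  exact/ltW/truncnS_gt.
have term i : expR (- k * nrm i) <= \prod_l q ^+ absz (i 0%R l).
  rewrite (eq_bigr (fun l => expR (- (k * c / d.+1%:R) * (absz (i 0%R l))%:R))); last first.
    by move=> l _; rewrite expRM_natr.
  rewrite -expR_sum ler_expR -mulr_sumr !mulNr lerN2.
  rewrite (_ : _ * \sum_l _ = k * ((c * \sum_l (absz (i 0%R l))%:R) / d.+1%:R)); last by ring.
  rewrite ler_pM2l//.
  rewrite ler_pdivrMr// mulr_sumr.
  apply: (@le_trans _ _ (\sum_(l < d) nrm i)).
    apply: ler_sum => l _; rewrite (le_trans _ (hc _ l))//.
    by rewrite mxE -intr_norm natr_absz.
  by rewrite sumr_const card_ord -[_ *+ d]mulr_natr ler_wpM2l ?site_norm_ge0// ler_nat.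
pose f (t : {ffun 'I_d -> 'I_(n.*2.+1)}) := \row_l ((t l)%:Z - n%:Z)%R : site d.
apply: (@le_trans _ _ (\sum_t \prod_l q ^+ absz (f t 0%R l))).
  apply: (@le_trans _ _ (\sum_t expR (- k * nrm (f t)))); last exact: ler_sum.
  by apply: sum_fset_le_fin => [i|i /nA]; rewrite ?expR_ge0// !inE/= => /codomP.
under eq_bigr do under eq_bigr do rewrite mxE.
rewrite -(bigA_distr_bigA (fun (l : 'I_d) (a : 'I_(n.*2.+1)) => q ^+ `|(a%:Z - n%:Z)%R|%N)).
rewrite prodr_const card_ord; have ts := two_sided n q01.
have s0 : 0 <= \sum_(a < n.*2.+1) q ^+ `|(a%:Z - n%:Z)%R|%N.
  by apply: sumr_ge0 => a _; rewrite exprn_ge0// expR_ge0.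
by apply: lerXn2r => //; rewrite nnegrE// (le_trans s0).
Qed.

End lattice_norm.

Section lattice_kernel.
Context (R : realType) (d : nat) (N : 'rV[R]_d -> R) (alpha Rg : R)
  (p : site d -> site d -> R).
Hypothesis hN : is_norm N.
Hypothesis halpha : 0 < alpha < 1.
Hypothesis hRg : 0 < Rg.
Hypothesis hp : harness_matrix N Rg p.
Hypothesis hp0 : p 0 0 = 0.
Local Notation nrm := (site_norm N).
Implicit Types i j : site d.

Let lam := - ln alpha.

Let alpha_gt0 : 0 < alpha. Proof. by case/andP: halpha. Qed.

Let lam_gt0 : 0 < lam. Proof. by rewrite oppr_gt0 ln_lt0. Qed.

Let alphaE : alpha = expR (- lam).
Proof. by rewrite opprK lnK. Qed.

Definition lattice_weight i : R := expR (nrm i * (lam / Rg)).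

Lemma powR_lattice_weight i : alpha `^ (nrm i / Rg) = (lattice_weight i)^-1.
Proof.
by rewrite /powR gt_eqF// -expRN /lattice_weight /lam; congr expR; ring.
Qed.

Let pE i j : p i j = p 0 (j - i).
Proof. by rewrite -(hm_homogeneous hp i) addrC subrK. Qed.

(** Only finitely many sites lie in the ball of radius [Rg], and [p 0] vanishes on its boundary, so
    the longest jump is strictly shorter than [Rg]. *)
Let strict_range : exists r, [/\ 0 < r, r < Rg & forall i j, p i j != 0 -> nrm (j - i) <= r].
Proof.
have [B hB] := finite_site_ball hN Rg.
have [r [r0 rR hr]] : exists r, [/\ 0 < r, r < Rg &
    forall j, j \in (B : seq _) -> p 0 j != 0 -> nrm j <= r].
  elim: (B : seq _) => [|j s [r [r0 rR hr]]]; first exists (Rg / 2).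
    by split=> [||j]; [rewrite divr_gt0|rewrite ltr_pdivrMr// ltr_pMr// ltr1n|rewrite in_nil].
  have [p0|p0] := eqVneq (p 0 j) 0.
    exists r; split=> // i; rewrite inE => /predU1P[->|/hr//].
    by rewrite p0 eqxx.
  exists (Num.max r (nrm j)); split=> [||i]; first by rewrite lt_max r0.
    rewrite gt_max rR/= ltNge; apply: contra p0 => /(hm_range hp) ->//.
  by rewrite inE le_max => /predU1P[->|/hr h /h ->//]; rewrite lexx orbT.
exists r; split=> // i j; rewrite pE => pij; apply: hr => //.
apply: hB; rewrite leNgt; apply: contra pij => /ltW /(hm_range hp) ->//.
Qed.

Lemma lattice_harness_kernel : exists nb rho u',
  harness_kernel alpha p nb rho lattice_weight u' /\
  forall j (A : {fset site d}), alpha * \sum_(i <- A) p j i * (lattice_weight i)^-1 <=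
    rho * (lattice_weight j)^-1.
Proof.
have [r [r0 rR hr]] := strict_range.
have [B hB] := finite_site_ball hN r.
pose nb i : {fset site d} := [fset (i + j)%R | j in B]%fset.
have nbP i j : p i j != 0 -> j \in nb i.
  move=> /hr /hB jB; apply/imfsetP; exists (j - i) => //.
  by rewrite addrC subrK.
have p0 i j : 0 <= p i j by exact: (hm_ge0 hp).
have sum1 i : \sum_(j <- nb i) p i j = 1.
  apply/EFin_inj; rewrite -(hm_stochastic hp i) -sumEFin.
  transitivity (\esum_(j in [set` nb i]) (p i j)%:E)%E.
    rewrite esum_fset//; last by move=> j _; rewrite lee_fin.
    by rewrite fsbig_finite//= set_fsetK.
  rewrite esum_mkcond; apply: eq_esum => j _; case: ifPn => //.
  rewrite notin_setE/= => jnb; have [->//|/nbP] := eqVneq (p i j) 0.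
  by move: jnb => /negP/negbTE ->.
have sumA i (A : {fset site d}) : \sum_(j <- A) p i j <= 1.
  rewrite -lee_fin -sumEFin -(hm_stochastic hp i).
  by apply: le_fset_esum => j; rewrite lee_fin.
(* A jump of length at most [r] multiplies the weight by at most exp(r lam / Rg), so rho = alpha^(1
   - r/Rg). *)
pose rho := expR (- (lam * (1 - r / Rg))).
have rhoE : rho = alpha * expR (r * (lam / Rg)).
  by rewrite alphaE -expRD; congr expR; ring.
have step k i j : 0 <= k -> p i j != 0 ->
    expR (nrm j * k) <= expR (nrm i * k) * expR (r * k).
  move=> k0 /hr pij; rewrite -expRD ler_expR -mulrDl ler_wpM2r//.
  by rewrite -{1}(subrK i j) addrC (le_trans (site_norm_triangle hN _ _))// lerD2l.
have avg k i : 0 <= k ->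
    alpha * (\sum_(j <- nb i) p i j * expR (nrm j * k)) <=
    alpha * expR (r * k) * expR (nrm i * k).
  move=> k0; rewrite -mulrA ler_wpM2l ?(ltW alpha_gt0)//.
  apply: (@le_trans _ _ (\sum_(j <- nb i) p i j * (expR (nrm i * k) * expR (r * k)))).
    apply: ler_sum => j _; have [->|pij] := eqVneq (p i j) 0; first by rewrite !mul0r.
    by rewrite ler_wpM2l// step.
  by rewrite -mulr_suml sum1 mul1r mulrC.
have rRlam : 0 < lam * (1 - r / Rg) by rewrite mulr_gt0// subr_gt0 ltr_pdivrMr// mul1r.
(* [u'] has the critical rate lam / r, for which alpha times the largest growth over one jump is
   exactly 1; as r < Rg it outgrows [lattice_weight]. *)
exists nb, rho, (fun i => expR (nrm i * (lam / r))); split; first split => //.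
- exact: (hm_symmetric hp).
- by move=> i; rewrite pE subrr.
- by rewrite expR_gt0/= expR_lt1 oppr_lt0.
- by move=> i; rewrite -expR0 ler_expR mulr_ge0 ?site_norm_ge0// divr_ge0// ltW.
- by move=> i; rewrite rhoE; apply: avg; rewrite divr_ge0// ltW.
- move=> i; apply: le_trans (avg (lam / r) i _) _; first by rewrite divr_ge0// ltW.
  by rewrite mulrC (mulrC r) divfK ?gt_eqF// alphaE -expRD addNr expR0 mulr1.
- move=> e e0; pose k := lam / r - lam / Rg.
  have k0 : 0 < k by rewrite subr_gt0 ltr_pM2l// ltf_pV2.
  have [C hC] := finite_site_ball hN (- ln e / k).
  exists C => i iC; rewrite -{1}(lnK e0) -expRD ler_expR.
  have : - ln e / k <= nrm i.
    by rewrite leNgt; apply: contra iC => /ltW /hC.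
  rewrite ler_pdivrMr// /k mulrBr; lra.
(* The inverse weight obeys the same inequality, because a jump divides the weight by at most exp(r
   lam / Rg) too. *)
- move=> j A; rewrite rhoE -mulrA ler_wpM2l ?(ltW alpha_gt0)//.
  apply: (@le_trans _ _ (\sum_(i <- A) p j i * (expR (r * (lam / Rg)) * (lattice_weight j)^-1))).
    apply: ler_sum => i _; have [->|pji] := eqVneq (p j i) 0; first by rewrite !mul0r.
    have k0 : 0 <= lam / Rg by rewrite divr_ge0// ltW.
    have := step _ i j k0; rewrite (hm_symmetric hp i j) => /(_ pji) st.
    apply: ler_wpM2l => //; rewrite ler_pdivlMr ?expR_gt0// ler_pdivrMl ?expR_gt0//.
  rewrite -mulr_suml -[leRHS]mul1r ler_wpM2r//.
  by rewrite mulr_ge0 ?expR_ge0// invr_ge0 expR_ge0.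
Qed.

Lemma XspaceE x : Xspace N alpha Rg x <->
  (\esum_(j in [set: site d]) (`|x j| * (lattice_weight j)^-1)%:E < +oo)%E.
Proof.
rewrite /Xspace/=.
by have -> : (fun j => (`|x j| * alpha `^ (nrm j / Rg))%:E) =
  (fun j => (`|x j| * (lattice_weight j)^-1)%:E)
  by apply/funext => j; rewrite powR_lattice_weight.
Qed.

Let term_ge0 (x : cfg R (site d)) j : (0 <= (`|x j| * (lattice_weight j)^-1)%:E)%E.
Proof. by rewrite lee_fin mulr_ge0// invr_ge0 expR_ge0. Qed.

Lemma Xspace_bound x : Xspace N alpha Rg x ->
  exists S, forall A : {fset site d}, \sum_(i <- A) (lattice_weight i)^-1 * `|x i| <= S.
Proof.
move=> /XspaceE xoo.
exists (fine (\esum_(j in [set: site d]) (`|x j| * (lattice_weight j)^-1)%:E)) => A.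
rewrite -lee_fin fineK; last by rewrite ge0_fin_numE// esum_ge0.
rewrite -sumEFin; under eq_bigr do rewrite mulrC.
exact: le_fset_esum.
Qed.

Lemma Xspace_le_weight x : Xspace N alpha Rg x ->
  exists C, forall i, `|x i| <= C * lattice_weight i.
Proof.
move=> /Xspace_bound[S hS]; exists S => i; have := hS [fset i]%fset.
by rewrite big_seq_fset1 mulrC ler_pdivrMr// expR_gt0.
Qed.

Lemma measurable_Xspace : measurable (Xspace N alpha Rg).
Proof.
have mf i : measurable_fun setT
    (fun x : cfg R (site d) => (`|x i| * (lattice_weight i)^-1)%:E).
  apply/measurable_EFinP; apply: measurable_funM => //; apply: measurableT_comp => //.
  exact: measurable_cfg_eval.
have := measurable_esum mf (fun i x => term_ge0 x i).
move=> /(emeasurable_fin_num measurableT); rewrite setTI; congr measurable.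
have S0 (x : cfg R (site d)) :
    (0 <= \esum_(j in [set: site d]) (`|x j| * (lattice_weight j)^-1)%:E)%E.
  by apply: esum_ge0 => i _; exact: term_ge0.
apply/seteqP; split=> x /=; first by rewrite ge0_fin_numE// => ?; apply/XspaceE.
by move=> /XspaceE; rewrite ge0_fin_numE.
Qed.

Lemma weight_summable : exists S, forall A : {fset site d},
  \sum_(i <- A) (lattice_weight i)^-1 <= S.
Proof.
have k0 : 0 < lam / Rg by rewrite divr_gt0.
have [S hS] := exp_site_norm_summable hN k0; exists S => A.
rewrite (eq_bigr (fun i => expR (- (lam / Rg) * nrm i)))// => i _.
by rewrite /lattice_weight -expRN mulNr mulrC.
Qed.

End lattice_kernel.

(** * Lebesgue and Gaussian measures on finite products *)

Section push_measure.
Context d d' (T : measurableType d) (T' : measurableType d') (R : realType).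
Variables (m : {sigma_finite_measure set T -> \bar R}) (phi : T -> T') (psi : T' -> T).
Hypotheses (mphi : measurable_fun setT phi) (mpsi : measurable_fun setT psi).
Hypothesis phiK : cancel phi psi.

(** The measurable left inverse [psi] transports a covering by sets of finite measure, so the image
    measure inherits sigma-finiteness. The [let] ties the three proofs to the term. *)
Definition push_measure : set T' -> \bar R := let _ := (mphi, mpsi, phiK) in pushforward m phi.

Let push0 : push_measure set0 = 0%E.
Proof. by rewrite /push_measure /pushforward preimage_set0 measure0. Qed.

Let push_ge0 A : (0 <= push_measure A)%E.
Proof. exact: measure_ge0. Qed.

Let push_sadd : semi_sigma_additive push_measure.
Proof.
move=> F mF tF mUF; rewrite /push_measure /pushforward preimage_bigcup.
apply: measure_semi_sigma_additive.
- by move=> n; rewrite -[X in measurable X]setTI; exact: mphi.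
- apply/trivIsetP => /= i j _ _ ij; rewrite -preimage_setI.
  by move/trivIsetP : tF => /(_ _ _ _ _ ij) ->//; rewrite preimage_set0.
- by rewrite -preimage_bigcup -[X in measurable X]setTI; exact: mphi.
Qed.

HB.instance Definition _ := isMeasure.Build _ _ _ push_measure push0 push_ge0 push_sadd.

Let push_sfinite : sigma_finite setT push_measure.
Proof.
have [F FT mF] := sigma_finiteT m.
exists (fun n => psi @^-1` F n); first by rewrite -preimage_bigcup -FT preimage_setT.
move=> n; split; first by rewrite -[X in measurable X]setTI; exact: mpsi (mF n).1.
rewrite /push_measure /pushforward -comp_preimage.
by rewrite (_ : psi \o phi = id); [exact: (mF n).2|apply/funext => x /=; rewrite phiK].
Qed.

HB.instance Definition _ := @Measure_isSigmaFinite.Build _ _ _ push_measure push_sfinite.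

Lemma ge0_integral_push_measure (f : T' -> \bar R) :
  measurable_fun (U := \bar R) setT f -> (forall x, 0 <= f x)%E ->
  (\int[push_measure]_x f x = \int[m]_x f (phi x))%E.
Proof.
move=> mf f0; rewrite (@eq_measure_integral _ _ _ _ (pushforward m phi))//.
by rewrite ge0_integral_pushforward// preimage_setT.
Qed.

End push_measure.

Section sigma_finite_product.
Context d1 d2 (T1 : measurableType d1) (T2 : measurableType d2) (R : realType).
Variables (m1 : {sigma_finite_measure set T1 -> \bar R})
  (m2 : {sigma_finite_measure set T2 -> \bar R}).
Local Open Scope ereal_scope.

(* The library's sigma-finite instance on [m1 \x m2] asks for finite factors. *)
Definition sigma_finite_prod : set (T1 * T2) -> \bar R := m1 \x m2.

HB.instance Definition _ := Measure.copy sigma_finite_prod (m1 \x m2).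

Let sigma_finite_prodT : sigma_finite setT sigma_finite_prod.
Proof.
have /sigma_finiteP[F [FT ndF Foo]] := sigma_finiteT m1.
have /sigma_finiteP[G [GT ndG Goo]] := sigma_finiteT m2.
exists (fun n => F n `*` G n).
  rewrite -setXTT FT GT predeqE => -[x y]; split; last by move=> [n _ []]; split; exists n.
  move=> [/= [n _ Fnx] [k _ Gky]]; exists (maxn n k) => //; split.
    by move: x Fnx; exact/subsetPset/ndF/leq_maxl.
  by move: y Gky; exact/subsetPset/ndG/leq_maxr.
move=> k; have [mF Fk] := Foo k; have [mG Gk] := Goo k.
split; first exact: measurableX.
by rewrite /sigma_finite_prod product_measure1E// lte_mul_pinfty// ge0_fin_numE.
Qed.

HB.instance Definition _ :=
  @Measure_isSigmaFinite.Build _ _ _ sigma_finite_prod sigma_finite_prodT.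

End sigma_finite_product.

Lemma emeasurable_prod d (T : measurableType d) (R : realType) (I : Type) (s : seq I)
    (f : I -> T -> \bar R) : (forall i, measurable_fun setT (f i)) ->
  measurable_fun setT (fun x => \prod_(i <- s) f i x)%E.
Proof.
move=> mf; elim: s => [|i s IH].
  by under eq_fun do rewrite big_nil; exact: measurable_cst.
by under eq_fun do rewrite big_cons; exact: emeasurable_funM.
Qed.

Lemma prode_ge0 (R : realType) (I : Type) (s : seq I) (f : I -> \bar R) :
  (forall i, 0 <= f i)%E -> (0 <= \prod_(i <- s) f i)%E.
Proof. by move=> f0; elim/big_ind: _ => //; exact: mule_ge0. Qed.

Section lebesgue_product.
Variable R : realType.
Local Notation RB := (measurableTypeR R).
Local Notation leb := (@lebesgue_measure R).
Local Open Scope ereal_scope.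

(** Products of one-variable functions are all that is integrated: with the boxes of rays they
    suffice to identify Gaussian densities. *)
Lemma lebesgue_tupleE n : exists2 m : {sigma_finite_measure set (n.-tuple R) -> \bar R},
  @lebesgue_tuple R n = m &
  forall g : 'I_n -> R -> \bar R, (forall l, measurable_fun setT (g l)) ->
    (forall l x, 0 <= g l x) ->
    \int[m]_t (\prod_(l < n) g l (tnth t l)) = \prod_(l < n) \int[leb]_x g l x.
Proof.
elim: n => [|n [m mE IH]].
  exists (dirac [tuple]) => // g mg g0; rewrite big_ord0.
  under eq_integral do rewrite big_ord0.
  by rewrite integral_cst// mul1e /= /dirac indicT.
pose phi (q : RB * n.-tuple R) : n.+1.-tuple R := [tuple of (q.1 : R) :: q.2].
pose psi (t : n.+1.-tuple R) : RB * n.-tuple R := (thead t, [tuple of behead t]).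
have mphi : measurable_fun setT phi.
  apply: (@measurable_cons _ _ (RB * n.-tuple R)%type R (fun q => q.1) n (fun q => q.2)).
    exact: measurable_fst.
  exact: measurable_snd.
have mpsi : measurable_fun setT psi.
  apply/measurable_fun_pairP; split; last exact: measurable_behead.
  exact: (measurable_tnth ord0).
have phiK : cancel phi psi.
  by move=> [x t]; rewrite /psi /phi /= theadE; congr pair; apply/val_inj.
exists (push_measure (sigma_finite_prod leb m) mphi mpsi phiK).
  by apply/funext => A; rewrite /= mE.
move=> g mg g0.
have mtn k (h : 'I_k -> R -> \bar R) (mh : forall l, measurable_fun setT (h l)) :
    measurable_fun setT (fun t : k.-tuple R => \prod_(l < k) h l (tnth t l)).
  apply: emeasurable_prod => l; apply: (measurableT_comp (mh l)).
  exact: measurable_tnth.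
rewrite ge0_integral_push_measure; [|exact: mtn|by move=> t; exact: prode_ge0].
transitivity (\int[leb \x m]_q (\prod_(l < n.+1) g l (tnth (phi q) l))) => //.
rewrite fubini_tonelli1; [|exact: (measurableT_comp (mtn _ g mg) mphi)|
  by move=> t; exact: prode_ge0].
rewrite /fubini_F big_ord_recl -IH//.
transitivity (\int[leb]_x (g ord0 x *
    \int[m]_t (\prod_(l < n) g (lift ord0 l) (tnth t l)))).
  apply: eq_integral => x _; rewrite -ge0_integralZl//.
  - by apply: eq_integral => t _; rewrite big_ord_recl; congr (_ * _); apply: eq_bigr => l _; rewrite tnthS.
  - exact: (mtn n (fun l => g (lift ord0 l))).
  - by move=> t _; exact: prode_ge0.
rewrite ge0_integralZr//; first exact: mg.
by apply: integral_ge0 => t _; exact: prode_ge0.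
Qed.

Lemma lebesgue_cfgE (I : finType) : exists2 m : {measure set (cfg R I) -> \bar R},
  @lebesgue_cfg R I = m &
  forall g : I -> R -> \bar R, (forall i, measurable_fun setT (g i)) ->
    (forall i x, 0 <= g i x) ->
    \int[m]_x (\prod_(i : I) g i (x i)) = \prod_(i : I) \int[leb]_x g i x.
Proof.
have [m mE mP] := lebesgue_tupleE #|I|.
have mphi : measurable_fun setT (@cfg_of_tuple R I).
  by apply: measurable_fun_cfg => i; exact: measurable_tnth.
pose psi (x : cfg R I) : #|I|.-tuple R := [tuple x (enum_val l) | l < #|I|].
have mpsi : measurable_fun setT psi.
  apply/measurable_fun_tnthP => l.
  rewrite (_ : _ \o _ = fun x : cfg R I => x (enum_val l)); first exact: measurable_cfg_eval.
  by apply/funext => x; rewrite /= tnth_mktuple.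
have phiK : cancel (@cfg_of_tuple R I) psi.
  by move=> t; apply: eq_from_tnth => l; rewrite tnth_mktuple /cfg_of_tuple enum_valK.
exists (push_measure m mphi mpsi phiK); first by apply/funext => A; rewrite /lebesgue_cfg mE.
move=> g mg g0; rewrite ge0_integral_push_measure; last 2 first.
- by apply: emeasurable_prod => i; exact: (measurableT_comp (mg i) (measurable_cfg_eval i)).
- by move=> x; exact: prode_ge0.
have re (h : I -> \bar R) : \prod_(i : I) h i = \prod_(l < #|I|) h (enum_val l).
  by rewrite (reindex (@enum_val I predT))//; apply/onW_bij/enum_val_bij.
rewrite re -mP//; apply: eq_integral => t _; rewrite re; apply: eq_bigr => l _.
by rewrite /cfg_of_tuple enum_valK.
Qed.

End lebesgue_product.

Section density_measure.
Context d (T : measurableType d) (R : realType) (mu : {measure set T -> \bar R}).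
Variable w : T -> \bar R.
Hypotheses (mw : measurable_fun (U := \bar R) setT w) (w0 : forall x, (0 <= w x)%E).
Local Open Scope ereal_scope.

Definition density_measure (A : set T) : \bar R :=
  let _ := (mw, w0) in \int[mu]_(x in A) w x.

Let density0 : density_measure set0 = 0.
Proof. exact: integral_set0. Qed.

Let density_ge0 A : 0 <= density_measure A.
Proof. exact: integral_ge0. Qed.

Let density_sadd : semi_sigma_additive density_measure.
Proof.
move=> F mF tF mUF; rewrite /density_measure ge0_integral_bigcup//.
  by apply: is_cvg_ereal_nneg_natsum_cond => n _ _; exact: integral_ge0.
exact: measurable_funS mw.
Qed.

HB.instance Definition _ :=
  isMeasure.Build _ _ _ density_measure density0 density_ge0 density_sadd.

End density_measure.

Section gaussian_density.
Context (R : realType) (I : finType) (mean : I -> R) (s : R).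
Local Notation RB := (measurableTypeR R).
Local Open Scope ereal_scope.
Variable gam : probability (cfg R I) R.
Hypothesis gamE : forall (S : {fset I}) (A : I -> set RB),
  (forall e, measurable (A e)) ->
  gam [set x | forall e, e \in S -> A e (x e)] = \prod_(e <- S) normal_prob (mean e) s (A e).

Definition gauss_density (x : cfg R I) : R := (\prod_i normal_pdf (mean i) s (x i))%R.

Lemma gauss_density_ge0 x : (0 <= gauss_density x)%R.
Proof. by apply: prodr_ge0 => i _; exact: normal_pdf_ge0. Qed.

Lemma measurable_gauss_density : measurable_fun setT gauss_density.
Proof.
apply: measurable_prod => i _.
exact: (measurableT_comp (measurable_normal_pdf _ _) (measurable_cfg_eval i)).
Qed.

(** On a box of rays both sides are products of one-dimensional integrals, and such boxes determine
    the measure. *)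
Lemma gam_density (m : {measure set (cfg R I) -> \bar R}) :
  (forall g : I -> R -> \bar R, (forall i, measurable_fun setT (g i)) ->
    (forall i x, 0 <= g i x) ->
    \int[m]_x (\prod_(i : I) g i (x i)) = \prod_(i : I) \int[@lebesgue_measure R]_x g i x) ->
  forall A, measurable A -> gam A = \int[m]_(x in A) (gauss_density x)%:E.
Proof.
move=> mP.
have mw : measurable_fun setT (fun x => (gauss_density x)%:E).
  by apply/measurable_EFinP; exact: measurable_gauss_density.
have w0 x : 0 <= (gauss_density x)%:E by rewrite lee_fin gauss_density_ge0.
have key : forall A, measurable A -> gam A = density_measure m mw w0 A; last exact: key.
apply: cfg_measure_unique => [|F a].
  by rewrite (le_lt_trans (probability_le1 _ _))// ltry.
pose A i : set RB := if i \in F then `[a i, +oo[%classic else setT.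
have mA i : measurable (A i) by rewrite /A; case: ifP.
pose S := [fset i | i in I]%fset.
have inS i : i \in S by rewrite inE.
have boxE : ray_box F a = [set x | forall e, e \in S -> A e (x e)].
  apply/seteqP; split=> x /= h i.
    by move=> _; rewrite /A; case: ifPn => // /h; rewrite /= in_itv/= andbT.
  by move=> iF; have := h i (inS i); rewrite /A iF /= in_itv/= andbT.
transitivity (gam [set x | forall e, e \in S -> A e (x e)]); first by rewrite -boxE.
rewrite gamE//.
have -> : \prod_(e <- S) normal_prob (mean e) s (A e) =
    \prod_(i : I) normal_prob (mean i) s (A i).
  apply: perm_big; apply: uniq_perm; rewrite ?fset_uniq ?index_enum_uniq// => i.
  by rewrite mem_index_enum; exact: inS.
pose g i (x : R) := ((fun y => (normal_pdf (mean i) s y)%:E) \_ (A i)) x.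
have g0 i x : 0 <= g i x by rewrite /g patchE; case: ifP => // _; rewrite lee_fin normal_pdf_ge0.
have mg i : measurable_fun setT (g i).
  apply/(measurable_restrictT _ (mA i)).
  apply: (measurable_funS measurableT) => //.
  by apply/measurable_EFinP; exact: measurable_normal_pdf.
transitivity (\prod_(i : I) \int[@lebesgue_measure R]_x g i x).
  by apply: eq_bigr => i _; rewrite /normal_prob integral_mkcond.
rewrite -mP//; transitivity (\int[m]_(x in ray_box F a) (gauss_density x)%:E); last by [].
rewrite [RHS]integral_mkcond; apply: eq_integral => x _.
rewrite patchE; case: ifPn; rewrite ?inE ?notin_setE => xb.
  rewrite /gauss_density -prodEFin; apply: eq_bigr => i _; rewrite /g patchE ifT// inE.
  by move: xb; rewrite boxE => /(_ i (inS i)).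
have [i iF ai] : exists2 i, i \in F & ~ (a i <= x i)%R.
  apply: contrapT => h; apply: xb => i iF; apply: contrapT => ai; apply: h.
  by exists i.
rewrite (bigD1 i)//= {1}/g patchE ifF ?mul0e//.
by apply/negbTE; rewrite notin_setE /A iF /= in_itv/= andbT.
Qed.

End gaussian_density.

(** * Translations and first moments of Gaussian laws *)

Section normal_law.
Variable R : realType.
Local Notation RB := (measurableTypeR R).
Local Notation leb := (@lebesgue_measure R).

Let measurable_shift (a : R) : measurable_fun (setT : set RB) (fun x : RB => a + x : RB).
Proof. by apply: measurable_funD; [exact: measurable_cst|exact: measurable_id]. Qed.

Lemma lebesgue_shift (a : R) (A : set RB) : measurable A ->
  leb ((fun x => a + x) @^-1` A) = leb A.
Proof.
move=> mA; apply/esym.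
apply: (@lebesgue_measure_unique R (pushforward leb (fun x : RB => a + x : RB))) => //.
move=> _ [[b c]] _ <-; rewrite /= /pushforward.
have -> : (fun x => a + x) @^-1` `]b, c]%classic = `]b - a, c - a]%classic.
  by apply/seteqP; split=> x /=; rewrite !in_itv/= lerBrDl ltrBlDl.
by rewrite !lebesgue_measure_itv/= !lte_fin ltrD2r opprB -!EFinD addrA subrK.
Qed.

Lemma normal_shift (a s : R) (A : set RB) : s != 0 -> measurable A ->
  normal_prob a s A = normal_prob 0 s ((fun x => a + x) @^-1` A).
Proof.
move=> s0 mA; rewrite /normal_prob.
transitivity (\int[pushforward leb (fun x : RB => (a + x)%R : RB)]_(x in A)
    (normal_pdf a s x)%:E)%E.
  by apply: eq_measure_integral => B mB _; exact/esym/lebesgue_shift.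
rewrite ge0_integral_pushforward//.
- apply: eq_integral => x _; rewrite /= !normal_pdfE//.
  by rewrite normal_fun_center /= addrAC subrr add0r.
- apply: (measurable_funS measurableT) => //.
  by apply/measurable_EFinP; exact: measurable_normal_pdf.
- by move=> x _; rewrite lee_fin normal_pdf_ge0.
Qed.

Lemma Rint_normal_shift (a s : R) (f : R -> R) : s != 0 -> measurable_fun setT f ->
  \int[normal_prob a s]_x f x = \int[normal_prob 0 s]_x f (a + x).
Proof.
move=> s0 mf; apply: (Rint_pushforward (measurable_shift a)) => //.
by move=> A mA; exact: normal_shift.
Qed.

(** Comparison with the Gaussian density of standard deviation 2s: with w = x/s the ratio of the
    exponentials is exp(3 w^2 / 8), and |w| <= 4 (1 + 3 w^2 / 8) <= 4 exp(3 w^2 / 8). *)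
Lemma normal_abs_moment_at (s : R) : s != 0 -> exists2 c : R, 0 <= c &
  (\int[@normal_prob R 0 s]_z (`|z|%:E) <= c%:E)%E.
Proof.
move=> s0; have s20 : 2 * s != 0 by rewrite mulf_neq0.
pose c : R := `|s| * 4 * normal_peak s / normal_peak (2 * s).
have p2 : 0 < normal_peak (2 * s) :> R by apply: normal_peak_gt0.
have c0 : 0 <= c by rewrite divr_ge0 ?mulr_ge0 ?normal_peak_ge0.
exists c => //.
have mpdf t : measurable_fun setT (fun x : R => (normal_pdf 0 t x)%:E).
  by apply/measurable_EFinP; exact: measurable_normal_pdf.
rewrite (@ge0_integral_density _ _ _ leb (@normal_prob R 0 s) (normal_pdf 0 s))//; last 3 first.
- exact: mpdf.
- by move=> x; rewrite lee_fin normal_pdf_ge0.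
- by apply/measurable_EFinP; exact: normr_measurable.
apply: (@le_trans _ _ (\int[leb]_x (c%:E * (normal_pdf 0 (2 * s) x)%:E))%E).
  apply: ge0_le_integral => //.
  - by move=> x _; rewrite -EFinM lee_fin mulr_ge0// normal_pdf_ge0.
  - apply: emeasurable_funM; last exact: mpdf.
    by apply/measurable_EFinP; exact: normr_measurable.
  - by apply: emeasurable_funM; [exact: measurable_cst|exact: mpdf].
  - move=> x _; rewrite -!EFinM lee_fin !normal_pdfE// /c.
    rewrite /normal_fun !subr0.
    set E1 := expR _; set E2 := expR _.
    rewrite [leRHS](_ : _ = `|s| * 4 * E2 * normal_peak s); last by field; rewrite gt_eqF.
    rewrite [leLHS]mulrCA [leLHS]mulrC ler_wpM2r ?normal_peak_ge0// /E1 /E2.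
    pose w := x / s.
    have -> : x = w * s by rewrite /w divfK.
    have -> : - (w * s) ^+ 2 / (s ^+ 2 *+ 2) = - w ^+ 2 / 2 by field.
    have -> : - (w * s) ^+ 2 / ((2 * s) ^+ 2 *+ 2) = - w ^+ 2 / 2 + 3 / 8 * w ^+ 2.
      by field.
    rewrite normrM expRD; have := expR_ge1Dx (3 / 8 * w ^+ 2).
    set E := expR (3 / 8 * w ^+ 2) => hE.
    rewrite mulrCA [leRHS](_ : _ = expR (- w ^+ 2 / 2) *
      (`|s| * (4 * E))); last by ring.
    rewrite (mulrC `|w|) -mulrA [leLHS](_ : _ = expR (- w ^+ 2 / 2) * (`|s| * `|w|)); last by ring.
    apply: ler_wpM2l; first exact: expR_ge0.
    apply: ler_wpM2l => //.
    have := sqr_ge0 (`|w| - 1); rewrite sqrrB1 real_normK ?num_real//.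
    have := sqr_ge0 w; move: hE; lra.
rewrite ge0_integralZl//.
- by rewrite integral_normal_pdf mule1.
- exact: mpdf.
- by move=> x _; rewrite lee_fin normal_pdf_ge0.
Qed.

End normal_law.

Section probability_tools.
Context d (T : measurableType d) (R : realType).

Lemma Rint_gt0 (P : probability T R) (f : T -> R) : bmf f -> (forall x, 0 < f x) ->
  0 < \int[P]_x f x.
Proof.
move=> bf f0; rewrite lt_neqAle; apply/andP; split; last first.
  by rewrite -(Rint_cst P 0); apply: le_Rint => //; [exact: bmf_cst|move=> x; exact: ltW].
apply/eqP => If0.
have mf : measurable_fun setT (EFin \o f) by apply/measurable_EFinP; exact: bf.1.
have : (\int[P]_(x in setT) `|(EFin \o f) x| = 0)%E.
  have -> : 0%E = (\int[P]_x f x)%:E by rewrite -If0.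
  rewrite (EFin_Rint P bf); apply: eq_integral => x _ /=.
  by rewrite ger0_norm// ltW.
move=> /(ae_eq_integral_abs P measurableT mf)[B [mB B0 sub]].
have BT : B = setT.
  apply/seteqP; split=> // x _; apply: sub => /= /(_ I) /eqP.
  by rewrite eqe gt_eqF.
have P1 : P setT = 1%E by exact: probability_setT.
have /eqP : (1%E : \bar R) = 0%E by rewrite -P1 -BT; exact: B0.
by rewrite eqe oner_eq0.
Qed.

Section as_probability.
Variables (P : {measure set T -> \bar R}) (f : set T -> \bar R).
Hypotheses (PT : P setT = 1%E) (f0 : forall A, (0 <= f A)%E)
  (fP : forall A, measurable A -> f A = P A).

Definition as_probability : set T -> \bar R := let _ := (PT, f0, fP) in f.

Let as0 : as_probability set0 = 0%E.
Proof. by rewrite /as_probability fP// measure0. Qed.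

Let as_sadd : semi_sigma_additive as_probability.
Proof.
move=> F mF tF mUF; rewrite /as_probability fP//.
under eq_fun do under eq_bigr do rewrite fP//.
exact: measure_semi_sigma_additive.
Qed.

HB.instance Definition _ := isMeasure.Build _ _ _ as_probability as0 f0 as_sadd.

Let asT : as_probability setT = 1%E.
Proof. by rewrite /as_probability fP. Qed.

HB.instance Definition _ := @Measure_isProbability.Build _ _ R as_probability asT.

End as_probability.

(** [gibbs_mean] integrates against [gibbs] as a raw set function, so a probability is needed that
    equals it on all sets and not only on the measurable ones. *)
Lemma probability_of_eq (P : {measure set T -> \bar R}) (f : set T -> \bar R) :
  P setT = 1%E -> (forall A, (0 <= f A)%E) -> (forall A, measurable A -> f A = P A) ->
  exists Q : probability T R, Q = f :> (set T -> \bar R).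
Proof. by move=> PT f0 fP; exists (as_probability PT f0 fP). Qed.

Lemma Rint_density (P Q : probability T R) (V f : T -> R) :
  bmf V -> (forall x, 0 < V x) ->
  (forall A, measurable A -> Q A = (\int[P]_(x in A) (V x / \int[P]_x V x)%:E)%E) ->
  bmf f -> \int[Q]_x f x = (\int[P]_x (f x * V x)) / \int[P]_x V x.
Proof.
move=> bV V0 QE bf; set Z := \int[P]_x V x.
have Z0 : 0 < Z by exact: Rint_gt0.
have ge0 (g : T -> R) : bmf g -> (forall x, 0 <= g x) ->
    \int[Q]_x g x = (\int[P]_x (g x * V x)) / Z.
  move=> bg g0; apply: EFin_inj; rewrite (EFin_Rint Q bg).
  rewrite (@ge0_integral_density _ _ _ P Q (fun x => V x / Z))//.
  - rewrite mulrC EFinM (EFin_Rint P (bmfM bg bV)) -ge0_integralZl//.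
    + by apply: eq_integral => x _; rewrite -!EFinM; congr EFin; ring.
    + by apply/measurable_EFinP; exact: (bmfM bg bV).1.
    + by move=> x _; rewrite lee_fin mulr_ge0// ltW.
    + by rewrite lee_fin invr_ge0 ltW.
  - by apply/measurable_EFinP; apply: measurable_funM => //; exact: bV.1.
  - by move=> x; rewrite lee_fin divr_ge0// ltW.
  - by apply/measurable_EFinP; exact: bg.1.
have [_ [M fM]] := bf.
have bM : bmf (fun x => f x + M) by apply: bmfD => //; exact: bmf_cst.
have := ge0 _ bM.
rewrite RintD//; last exact: bmf_cst.
rewrite Rint_cst => h; apply: (addIr M); rewrite h; last first.
  by move=> x; have := fM x; rewrite ler_norml -lerBlDr add0r => /andP[].
under eq_Rintegral do rewrite mulrDl.
rewrite RintD; [|exact: bmfM|exact: bmfZ].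
by rewrite RintZ// -/Z; field; rewrite gt_eqF.
Qed.

End probability_tools.

(** * Gibbs specifications *)

Section gibbs_measure.
Context (R : realType) (d : nat) (alpha : R) (p : site d -> site d -> R)
  (nb : site d -> {fset site d}) (rho : R) (u u' : site d -> R)
  (dat : cfg R (site d)).
Hypothesis hk : harness_kernel alpha p nb rho u u'.
Implicit Types (La B : {fset site d}) (k i j : site d) (x y : cfg R (site d)).
Local Notation RB := (measurableTypeR R).
Local Notation Pavg := (Pavg p nb).
Local Notation G := (@normal_prob R 0 1).
Local Notation J := (fun i j => alpha * p i j).
Local Notation heat := (heat alpha p dat).
Local Notation drift := (drift alpha p nb dat).
Local Notation glue := Defs.glue.

Let alpha_ge0 : 0 <= alpha. Proof. by have /andP[/ltW] := hk_alpha hk. Qed.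
Let h_gt0 : 0 < 1 - alpha. Proof. by rewrite subr_gt0; have /andP[] := hk_alpha hk. Qed.

(** Only the interaction: the pinning to the data is moved into a Gaussian reference law, centred at
    [dat] with variance 1/(1 - alpha), so that the remaining Boltzmann factor lies in ]0, 1]. *)
Definition energy La x : R :=
  2^-1 * (\sum_(e \in [set e : site d * site d | e.1 \in La \/ e.2 \in La])
            J e.1 e.2 * (x e.1 - x e.2) ^+ 2).

Lemma hamiltonianE La x : hamiltonian J (1 - alpha) dat La x =
  energy La x + (1 - alpha) * \sum_(i <- La) (x i - dat i) ^+ 2.
Proof. by []. Qed.

Definition nbhood La : {fset site d} := (La `|` \bigcup_(i <- La) nb i)%fset.

Let c La i j : R := if (i \in La) || (j \in La) then alpha * p i j else 0.

Lemma energyE La x : energy La x =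
  2^-1 * \sum_(i <- nbhood La) \sum_(j <- nbhood La) c La i j * (x i - x j) ^+ 2.
Proof.
congr (_ * _); set B := nbhood La.
have nbB i j : i \in La -> p i j != 0 -> (i \in B) && (j \in B).
  move=> iLa pij; rewrite !inE iLa/=; apply/orP; right; apply/bigfcupP.
  by exists i; rewrite ?iLa// (hk_nb hk).
pose r := [seq e <- [seq (i, j) | i <- B, j <- B] | (e.1 \in La) || (e.2 \in La)].
rewrite (fsbigE r).
- rewrite /r big_filter_cond big_mkcond big_allpairs_dep/=; apply: eq_bigr => i _.
  apply: eq_bigr => j _; rewrite /c /=.
  case: ifP => [/andP[-> _]//|/negbT]; rewrite negb_and.
  case: ifP => /=; last by rewrite mul0r.
  by move=> /orP h; rewrite notin_setE => /(_ h).
- by rewrite filter_uniq// allpairs_uniq ?fset_uniq// => -[? ?] [? ?].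
- by move=> e /=; rewrite mem_filter => /andP[/orP].
- move=> [i j] /= ij; rewrite mem_filter/=.
  have [->|pij] := eqVneq (p i j) 0; first by rewrite mulr0 mul0r.
  have -> : (i \in La) || (j \in La) by apply/orP.
  have /andP[iB jB] : (i \in B) && (j \in B).
    case: ij => ij; first exact: nbB.
    by rewrite andbC; apply: nbB => //; rewrite (hk_sym hk).
  by rewrite /= => /negP[]; apply/allpairsP; exists (i, j).
Qed.

Let c_ge0 La i j : 0 <= c La i j.
Proof. by rewrite /c; case: ifP => // _; rewrite mulr_ge0// (hk_ge0 hk). Qed.

Lemma energy_ge0 La x : 0 <= energy La x.
Proof.
rewrite energyE mulr_ge0// sumr_ge0// => i _; apply: sumr_ge0 => j _.
by rewrite mulr_ge0// sqr_ge0.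
Qed.

Lemma measurable_energy d' (T : measurableType d') (f : T -> cfg R (site d)) La :
  measurable_fun setT f -> measurable_fun setT (fun t => energy La (f t)).
Proof.
move=> mf; under eq_fun do rewrite energyE.
apply: measurable_funM => //; apply: measurable_sum => i; apply: measurable_sum => j.
apply: measurable_funM => //; apply: measurable_funX; apply: measurable_funB.
  exact: (measurableT_comp (measurable_cfg_eval i) mf).
exact: (measurableT_comp (measurable_cfg_eval j) mf).
Qed.

(** Completing the square at [k]: as the p(k,j) add up to 1 and p(k,k) = 0, the coefficient of s^2
    is alpha + (1 - alpha) = 1 and the centre is [drift x k]. So the conditional law of x(k) is
    Gaussian of variance 1 around the drift, which is the heat-bath move. *)
Lemma energy_update La k s x : k \in La ->
  energy La (update k s x) + (1 - alpha) * (s - dat k) ^+ 2 =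
  (s - drift x k) ^+ 2 + (energy La (update k 0 x) + (1 - alpha) * dat k ^+ 2 - drift x k ^+ 2).
Proof.
move=> kLa; set B := nbhood La.
have kB : k \in B by rewrite !inE kLa.
have nbB : {subset nb k <= B}.
  by move=> j jk; rewrite !inE; apply/orP; right; apply/bigfcupP; exists k; rewrite ?kLa.
suff : energy La (update k s x) - energy La (update k 0 x) =
    alpha * s ^+ 2 - 2 * s * (alpha * Pavg x k).
  by rewrite /drift => h; apply/eqP; rewrite -subr_eq0; apply/eqP; move: h; lra.
rewrite !energyE -/B -mulrBr -sumrB.
(* The change due to the ordered pair (k, j); the pair (j, k) contributes as much, and the factor
   1/2 compensates. *)
pose r j := alpha * (p k j * (s ^+ 2 - 2 * s * x j)).
have rk : r k = 0 by rewrite /r (hk_diag hk) mul0r mulr0.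
have term i j : c La i j * (update k s x i - update k s x j) ^+ 2 -
    c La i j * (update k 0 x i - update k 0 x j) ^+ 2 =
    (i == k)%:R * r j + (j == k)%:R * r i.
  rewrite /update; have [->|ik] := eqVneq i k; have [->|jk] := eqVneq j k.
  - by rewrite rk subrr; ring.
  - by rewrite /r /c kLa/=; ring.
  - by rewrite /r /c kLa orbT (hk_sym hk i)/=; ring.
  - by rewrite /= !mulr0n !mul0r addr0 subrr.
transitivity (2^-1 * \sum_(i <- B) \sum_(j <- B) ((i == k)%:R * r j + (j == k)%:R * r i)).
  congr (_ * _); apply: eq_bigr => i _; rewrite -sumrB; apply: eq_bigr => j _.
  exact: term.
have sdelta (f : site d -> R) : \sum_(i <- B) (i == k)%:R * f i = f k.
  rewrite (big_fsetD1 k)//= eqxx mul1r big1_seq ?addr0// => i /andP[_].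
  by rewrite !inE => /andP[/negbTE -> _]; rewrite mul0r.
have -> : \sum_(i <- B) \sum_(j <- B) ((i == k)%:R * r j + (j == k)%:R * r i) =
    2 * \sum_(j <- B) r j.
  under eq_bigr => i _ do rewrite big_split/= -mulr_sumr sdelta.
  by rewrite big_split/= sdelta mulrDl !mul1r.
rewrite mulKf ?pnatr_eq0// /r.
have -> : \sum_(j <- B) alpha * (p k j * (s ^+ 2 - 2 * s * x j)) =
    alpha * Pavg (fun j => s ^+ 2 + (- (2 * s)) * x j) k.
  by rewrite (Pavg_subset hk _ nbB) mulr_sumr; apply: eq_bigr => j _; ring.
have -> : Pavg (fun j => s ^+ 2 + (- (2 * s)) * x j) k = s ^+ 2 - 2 * s * Pavg x k.
  by rewrite PavgD (Pavg_cst hk) PavgZ mulNr.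
by ring.
Qed.

Definition boltzmann La x : R := expR (- 2^-1 * energy La x).

Lemma boltzmann_gt0 La x : 0 < boltzmann La x. Proof. exact: expR_gt0. Qed.

Lemma boltzmann_le1 La x : boltzmann La x <= 1.
Proof.
rewrite /boltzmann -expR0 ler_expR mulNr oppr_le0 mulr_ge0 ?energy_ge0//.
Qed.

Lemma bmf_boltzmann d' (T : measurableType d') (f : T -> cfg R (site d)) La :
  measurable_fun setT f -> bmf (fun t => boltzmann La (f t)).
Proof.
move=> mf; split; last first.
  by exists 1 => t; rewrite ger0_norm ?boltzmann_le1// ltW// boltzmann_gt0.
rewrite /boltzmann; apply: measurableT_comp => //; apply: measurable_funM => //.
exact: measurable_energy.
Qed.

Definition gibbs_sd : R := (Num.sqrt (1 - alpha))^-1.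

Lemma gibbs_sd_neq0 : gibbs_sd != 0.
Proof. by rewrite invr_eq0 sqrtr_eq0 -ltNge. Qed.

Lemma gibbs_pdfE m s : normal_pdf m gibbs_sd s =
  normal_peak gibbs_sd * expR (- 2^-1 * ((1 - alpha) * (s - m) ^+ 2)).
Proof.
rewrite normal_pdfE ?gibbs_sd_neq0//; congr (_ * expR _).
rewrite /gibbs_sd exprVn sqr_sqrtr ?(ltW h_gt0)//; field.
by rewrite gt_eqF.
Qed.

Lemma boltzmann_update La k x : k \in La -> exists2 C : R, 0 < C & forall s : R,
  boltzmann La (update k s x) * normal_pdf (dat k) gibbs_sd s =
  C * normal_pdf (drift x k) 1 s.
Proof.
move=> kLa.
pose E0 := energy La (update k 0 x) + (1 - alpha) * dat k ^+ 2 - drift x k ^+ 2.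
have p1 : 0 < normal_peak (1 : R) by rewrite normal_peak_gt0// oner_eq0.
have ps : 0 < normal_peak gibbs_sd by rewrite normal_peak_gt0// gibbs_sd_neq0.
exists (normal_peak gibbs_sd / normal_peak 1 * expR (- 2^-1 * E0)).
  by rewrite mulr_gt0 ?expR_gt0// divr_gt0.
move=> t; rewrite gibbs_pdfE normal_pdfE ?oner_eq0// /boltzmann /normal_fun.
have -> : - (t - drift x k) ^+ 2 / (1 ^+ 2 *+ 2) = - 2^-1 * (t - drift x k) ^+ 2 by field.
rewrite mulrCA -expRD -mulrDr energy_update// -/E0 mulrDr expRD.
by field; rewrite gt_eqF.
Qed.

Lemma heat_bmf k (f : cfg R (site d) -> R) : bmf f -> bmf (heat k f).
Proof.
move=> bf; have [mf [M fM]] := bf; split; last by exists M => x; exact: (heat_norm dat hk).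
have mT : measurable_fun setT
    (fun q : cfg R (site d) * RB => Theta alpha p dat k q.2 q.1).
  by apply: (measurable_Theta dat hk); [exact: measurable_snd|exact: measurable_fst].
have bfT : bmf (fun q : cfg R (site d) * RB => f (Theta alpha p dat k q.2 q.1)).
  by split; [exact: (measurableT_comp mf mT)|exists M].
apply/measurable_EFinP.
(* Any probability on the first factor would do: Fubini is called for the measurability of the
   partial integral. *)
have iF := bmf_integrable (dirac (point : cfg R (site d)) \x G)%E bfT.
have mF := measurable_fubini_F iF.
apply: eq_measurable_fun mF => x _; rewrite /fubini_F/= EFin_Rint//.
exact: (heat_bmf_aux _ hk).
Qed.

Section volume.
Variable La : {fset site d}.

Definition ref_measure : probability (cfg R La) R :=
  projT1 (cid (@indep_measure R (La : finType) (fun i : La => normal_prob (dat (val i)) gibbs_sd))).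

Lemma ref_measureE (S : {fset La}) (A : La -> set RB) : (forall e, measurable (A e)) ->
  ref_measure [set x | forall e, e \in S -> A e (x e)] =
  (\prod_(e <- S) normal_prob (dat (val e)) gibbs_sd (A e))%E.
Proof. exact: (projT2 (cid (@indep_measure R (La : finType) _))). Qed.

Lemma glueT (z : cfg R La) y (i : La) : glue z y (val i) = z i.
Proof. by rewrite /glue valK. Qed.

Lemma glueF (z : cfg R La) y i : i \notin La -> glue z y i = y i.
Proof. by move=> iLa; rewrite /glue insubF//; exact: negbTE. Qed.

Lemma measurable_glue d' (T : measurableType d') (f : T -> cfg R La)
    (g : T -> cfg R (site d)) : measurable_fun setT f -> measurable_fun setT g ->
  measurable_fun setT (fun t => glue (f t) (g t)).
Proof.
move=> mf mg; apply: measurable_fun_cfg => i; rewrite /glue.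
case: insubP => [i' _ _|_] /=; first exact: (measurableT_comp (measurable_cfg_eval i') mf).
exact: (measurableT_comp (measurable_cfg_eval i) mg).
Qed.

Variable y : cfg R (site d).
Local Notation V := (fun z : cfg R La => boltzmann La (glue z y)).
Local Notation P := ref_measure.

Let mglue : measurable_fun setT (fun z : cfg R La => glue z y).
Proof. by apply: measurable_glue; [exact: measurable_id|exact: measurable_cst]. Qed.

Let bV : bmf V. Proof. exact: bmf_boltzmann. Qed.

Let Z := \int[P]_z V z.

Let Z_gt0 : 0 < Z. Proof. by apply: Rint_gt0 => // z; exact: boltzmann_gt0. Qed.

(** Cancels the normalizing constants of the one-dimensional densities in [gauss_density]. *)
Let C := (normal_peak gibbs_sd ^- #|` La|) : R.

Let C_gt0 : 0 < C.
Proof. by rewrite invr_gt0 exprn_gt0// normal_peak_gt0// gibbs_sd_neq0. Qed.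

Let weightE (z : cfg R La) : gibbs_weight J (1 - alpha) dat y z =
  C * V z * gauss_density (fun i : La => dat (val i)) gibbs_sd z.
Proof.
have ps : 0 < normal_peak gibbs_sd by rewrite normal_peak_gt0// gibbs_sd_neq0.
rewrite /gibbs_weight hamiltonianE mulrDr expRD /boltzmann.
rewrite [RHS](_ : _ = boltzmann La (glue z y) *
    (C * gauss_density (fun i : La => dat (val i)) gibbs_sd z)); last first.
  by rewrite [RHS]mulrCA mulrA.
congr (_ * _).
rewrite /gauss_density (eq_bigr (fun i : La => normal_peak gibbs_sd *
    expR (- 2^-1 * ((1 - alpha) * (z i - dat (val i)) ^+ 2)))); last first.
  by move=> i _; rewrite gibbs_pdfE.
rewrite big_split/= prodr_const -cardfE /C mulKf ?expf_neq0 ?gt_eqF//.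
rewrite -expR_sum -!mulr_sumr; congr (expR (_ * (_ * _))).
by rewrite big_seq_fsetE; apply: eq_bigr => i _; rewrite glueT.
Qed.

Let int_weight A : measurable A ->
  (\int[@lebesgue_cfg R La]_(z in A) (gibbs_weight J (1 - alpha) dat y z)%:E =
   C%:E * \int[P]_(z in A) (V z)%:E)%E.
Proof.
move=> mA; have [m mE mP] := lebesgue_cfgE R La; rewrite mE.
have dens := gam_density ref_measureE mP.
rewrite integral_mkcond [in RHS]integral_mkcond.
have mVA : measurable_fun setT ((fun z => (V z)%:E) \_ A).
  apply/(measurable_restrictT _ mA); apply: (measurable_funS measurableT) => //.
  by apply/measurable_EFinP; exact: bV.1.
have VA0 z : (0 <= ((fun z => (V z)%:E) \_ A) z)%E.
  by rewrite patchE; case: ifP => // _; rewrite lee_fin ltW// boltzmann_gt0.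
rewrite (@ge0_integral_density _ _ _ m P (gauss_density (fun i : La => dat (val i)) gibbs_sd))//; last 2 first.
- by apply/measurable_EFinP; exact: measurable_gauss_density.
- by move=> z; rewrite lee_fin gauss_density_ge0.
rewrite -ge0_integralZl//; last 3 first.
- apply: emeasurable_funM => //.
  by apply/measurable_EFinP; exact: measurable_gauss_density.
- by move=> z _; rewrite mule_ge0// lee_fin gauss_density_ge0.
- by rewrite lee_fin ltW.
apply: eq_integral => z _; rewrite !patchE; case: ifP => _; last by rewrite mul0e mule0.
by rewrite -!EFinM weightE mulrA.
Qed.

Let gibbs_ZE : gibbs_Z J (1 - alpha) dat La y = (C * Z)%:E.
Proof. by rewrite /gibbs_Z int_weight// -(EFin_Rint _ bV). Qed.

Let gibbsE A : measurable A -> gibbs J (1 - alpha) dat y A =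
  (\int[P]_(z in A) (V z / Z)%:E)%E.
Proof.
move=> mA; rewrite /gibbs gibbs_ZE int_weight//= muleA -EFinM invfM.
rewrite mulrAC mulVf ?gt_eqF// mul1r -ge0_integralZl//.
- by apply: eq_integral => z _; rewrite -EFinM mulrC.
- apply: (measurable_funS measurableT) => //.
  by apply/measurable_EFinP; exact: bV.1.
- by move=> z _; rewrite lee_fin ltW// boltzmann_gt0.
- by rewrite lee_fin invr_ge0 ltW.
Qed.

Lemma gibbs_probability : exists Q : probability (cfg R La) R,
  Q = gibbs J (1 - alpha) dat y :> (set (cfg R La) -> \bar R).
Proof.
have mw : measurable_fun setT (fun z => (V z / Z)%:E).
  by apply/measurable_EFinP; apply: measurable_funM => //; exact: bV.1.
have w0 z : (0 <= (V z / Z)%:E)%E.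
  by rewrite lee_fin divr_ge0// ltW// boltzmann_gt0.
apply: (probability_of_eq (P := density_measure P mw w0)).
- rewrite /= /density_measure; under eq_integral do rewrite mulrC EFinM.
  rewrite ge0_integralZl//.
  + by rewrite -(EFin_Rint _ bV) -EFinM mulVf// gt_eqF.
  + by apply/measurable_EFinP; exact: bV.1.
  + by move=> z _; rewrite lee_fin ltW// boltzmann_gt0.
  + by rewrite lee_fin invr_ge0 ltW.
- move=> A; rewrite /gibbs mule_ge0//.
    by rewrite lee_fin invr_ge0 gibbs_ZE/= mulr_ge0// ltW.
  have [m -> _] := lebesgue_cfgE R La; apply: integral_ge0 => z _.
  by rewrite lee_fin expR_ge0.
- by move=> A; exact: gibbsE.
Qed.

Definition gibbs_kernel : probability (cfg R La) R := projT1 (cid gibbs_probability).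

Lemma gibbs_kernelE : gibbs_kernel = gibbs J (1 - alpha) dat y :> (set (cfg R La) -> \bar R).
Proof. exact: (projT2 (cid gibbs_probability)). Qed.

Lemma gibbs_kernel_density A : measurable A -> gibbs_kernel A =
  (\int[P]_(z in A) (V z / Z)%:E)%E.
Proof. by move=> mA; rewrite gibbs_kernelE gibbsE. Qed.

Definition gibbs_law := push_prob gibbs_kernel mglue.

Lemma Rint_gibbs_kernel f : bmf f ->
  \int[gibbs_kernel]_z f z = (\int[P]_z (f z * V z)) / Z.
Proof.
move=> bf; apply: Rint_density => //; first by move=> z; exact: boltzmann_gt0.
exact: gibbs_kernel_density.
Qed.

Lemma Rint_gibbs_law f : bmf f ->
  \int[gibbs_law]_x f x = (\int[P]_z (f (glue z y) * V z)) / Z.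
Proof.
move=> [mf [M fM]]; rewrite Rint_push// Rint_gibbs_kernel//.
by split; [exact: (measurableT_comp mf mglue)|exists M].
Qed.

Lemma gibbs_meanE f : measurable_fun setT f ->
  gibbs_mean J (1 - alpha) dat La y f = \int[gibbs_law]_x f x.
Proof. by move=> mf; rewrite Rint_push// /Rintegral /gibbs_mean -gibbs_kernelE. Qed.

Let glue_resample (k : La) s (z : cfg R La) :
  glue (resample k s z) y = update (val k) s (glue z y).
Proof.
apply/funext => i; rewrite /update; have [iLa|iLa] := boolP (i \in La); last first.
  rewrite !glueF//; case: eqP iLa => // ->; by rewrite (valP k).
rewrite -[i]/(val (FSetSub iLa)) !glueT /resample.
by rewrite -(inj_eq val_inj).
Qed.

(** As p(k,k) = 0, the heat bath forgets the current height at [k]. *)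
Let heat_update k s x f : heat k f (update k s x) = heat k f x.
Proof.
apply: eq_Rintegral => t _; congr f; rewrite !(ThetaE dat hk); apply/funext => j.
rewrite /update; case: eqP => // _; congr (_ + t); rewrite /drift; congr (_ * _ + _).
apply: eq_bigr => i _; have [->|_] := eqVneq i k; last by [].
by rewrite (hk_diag hk) !mul0r.
Qed.

(** [c0] is the one-site partition function; being the same for all [f], it can be factored out of
    both sides in [gibbs_law_reversible]. *)
Let resample_factor (k : La) (x : cfg R (site d)) : exists c0 : R,
  forall f : cfg R (site d) -> R, bmf f ->
  \int[normal_prob (dat (val k)) gibbs_sd]_s
    (f (update (val k) s x) * boltzmann La (update (val k) s x)) =
  c0 * heat (val k) f x.
Proof.
have [C0 C00 hC] := boltzmann_update x (valP k).
have mupd : measurable_fun setT (fun s : R => update (val k) s x : cfg R (site d)).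
  apply: measurable_fun_cfg => j; rewrite /update; case: eqP => _.
    exact: measurable_id.
  exact: measurable_cst.
pose N1 : probability RB R := normal_prob (dat (val k)) gibbs_sd.
pose N2 : probability RB R := normal_prob (drift x (val k)) 1.
pose W (s : RB) := boltzmann La (update (val k) s x).
have bW : bmf W by exact: bmf_boltzmann.
have W0 s : 0 < W s by exact: boltzmann_gt0.
have mpdf m t : measurable_fun setT (fun s : RB => (normal_pdf m t s)%:E).
  by apply/measurable_EFinP; exact: measurable_normal_pdf.
have intW (A : set RB) : measurable A -> (\int[N1]_(s in A) (W s)%:E = C0%:E * N2 A)%E.
  move=> mA; rewrite integral_mkcond.
  rewrite (@ge0_integral_density _ _ _ (@lebesgue_measure R) N1 (normal_pdf (dat (val k)) gibbs_sd))//.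
  - rewrite /N2 /= /normal_prob [in RHS]integral_mkcond -ge0_integralZl//.
    + apply: eq_integral => s _; rewrite !patchE; case: ifP => _; last by rewrite mul0e mule0.
      by rewrite -!EFinM hC.
    + by apply/(measurable_restrictT _ mA); apply: (measurable_funS measurableT).
    + by move=> s _; rewrite patchE; case: ifP => // _; rewrite lee_fin normal_pdf_ge0.
    + by rewrite lee_fin ltW.
  - by move=> s; rewrite lee_fin normal_pdf_ge0.
  - apply/(measurable_restrictT _ mA); apply: (measurable_funS measurableT) => //.
    by apply/measurable_EFinP; exact: bW.1.
  - by move=> s; rewrite patchE; case: ifP => // _; rewrite lee_fin ltW.
have WE : \int[N1]_s W s = C0.
  apply: EFin_inj; rewrite (EFin_Rint N1 bW) intW//.
  have N21 : N2 setT = 1%E by exact: probability_setT.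
  by rewrite N21 mule1.
exists C0 => f [mf [M fM]].
have bfk : bmf (fun s : RB => f (update (val k) s x)).
  by split; [exact: (measurableT_comp mf mupd)|exists M].
have -> : heat (val k) f x = \int[N2]_s f (update (val k) s x).
  rewrite (Rint_normal_shift _ (oner_neq0 _)); last exact: bfk.1.
  by apply: eq_Rintegral => t _; rewrite (ThetaE dat hk).
rewrite (Rint_density (P := N1) bW W0)//; last first.
  move=> A mA; rewrite WE; under eq_integral do rewrite mulrC EFinM.
  rewrite ge0_integralZl//.
  - by rewrite intW// muleA -EFinM mulVf ?gt_eqF// mul1e.
  - by apply: (measurable_funS measurableT) => //; apply/measurable_EFinP; exact: bW.1.
  - by move=> s _; rewrite lee_fin ltW.
  - by rewrite lee_fin invr_ge0 ltW.
by rewrite WE mulrC divfK// gt_eqF.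
Qed.

Lemma gibbs_law_reversible k f g : k \in La -> bmf f -> bmf g ->
  \int[gibbs_law]_x (g x * heat k f x) = \int[gibbs_law]_x (f x * heat k g x).
Proof.
move=> kLa bf bg; pose k' : La := FSetSub kLa.
(* Given the heights off [k], [heat k h2] is constant and the weighted one-site average of [h1] is
   [c0 * heat k h1], so the integrand becomes symmetric in [h1] and [h2]. *)
have key h1 h2 : bmf h1 -> bmf h2 -> \int[gibbs_law]_x (h1 x * heat k h2 x) =
   (\int[P]_z (projT1 (cid (resample_factor k' (glue z y))) *
     heat k h1 (glue z y) * heat k h2 (glue z y))) / Z.
  move=> b1 b2; have b12 := bmfM b1 (heat_bmf k b2).
  rewrite Rint_gibbs_law//; congr (_ / _).
  have bPhi : bmf (fun z => (h1 (glue z y) * heat k h2 (glue z y)) * V z).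
    apply: bmfM => //; have [m12 [M hM]] := b12; split; last by exists M => z; exact: hM.
    exact: (measurableT_comp m12 mglue).
  rewrite (Rint_resample ref_measureE k' bPhi).1; apply: eq_Rintegral => z _.
  case: cid => c0 hc0 /=; rewrite -(hc0 h1)//=.
  rewrite mulrC -RintZ.
    apply: eq_Rintegral => s _; rewrite !glue_resample heat_update mulrCA.
    by rewrite -mulrA mulrCA.
  apply: bmfM; last first.
    apply: bmf_boltzmann; apply: measurable_fun_cfg => j; rewrite /update; case: eqP => _.
      exact: measurable_id.
    exact: measurable_cst.
  have [m1 [M hM]] := b1; split; last by exists M.
  apply: (measurableT_comp m1); apply: measurable_fun_cfg => j; rewrite /update.
  by case: eqP => _; [exact: measurable_id|exact: measurable_cst].
rewrite (key _ _ bg bf) (key _ _ bf bg); congr (_ / _); apply: eq_Rintegral => z _.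
exact: mulrAC.
Qed.

End volume.
End gibbs_measure.

(** * Heat-bath invariance and moments *)

Section invariant_laws.
Context (R : realType) (d : nat) (alpha : R) (p : site d -> site d -> R)
  (nb : site d -> {fset site d}) (rho : R) (u u' : site d -> R)
  (dat : cfg R (site d)).
Hypothesis hk : harness_kernel alpha p nb rho u u'.
Implicit Types (k i j : site d) (w : site d -> R).
Local Notation RB := (measurableTypeR R).
Local Notation Pavg := (Pavg p nb).
Local Notation QL := (QL alpha p nb).
Local Notation G := (@normal_prob R 0 1).
Local Notation heat := (heat alpha p dat).
Local Notation heats := (heats alpha p dat).
Local Notation drift := (drift alpha p nb dat).

Let alpha_ge0 : 0 <= alpha. Proof. by have /andP[/ltW] := hk_alpha hk. Qed.
Let rho_ge0 : 0 <= rho. Proof. by have /andP[/ltW] := hk_rho hk. Qed.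
Let rho1 : 0 < 1 - rho. Proof. by rewrite subr_gt0; have /andP[] := hk_rho hk. Qed.

Let mnorm i : measurable_fun setT (fun x : cfg R (site d) => (`|x i|)%:E).
Proof.
by apply/measurable_EFinP; apply: measurableT_comp => //; exact: measurable_cfg_eval.
Qed.

Definition heat_invariant (m : probability (cfg R (site d)) R) k :=
  forall f : cfg R (site d) -> R, BLf f -> \int[m]_x heat k f x = \int[m]_x f x.

Definition moments_le (m : probability (cfg R (site d)) R) w :=
  forall i, (\int[m]_x `|x i|%:E <= (w i)%:E)%E.

(** Bounded Lipschitz functions determine the law after one update, so invariance extends from them
    to nonnegative measurable functions such as |x(k)|. *)
Lemma heat_invariant_ge0 (m : probability (cfg R (site d)) R) k (F : cfg R (site d) -> \bar R) :
  heat_invariant m k -> measurable_fun (U := \bar R) setT F -> (forall x, 0 <= F x)%E ->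
  (\int[m]_x F x = \int[m]_x \int[G]_z F (Theta alpha p dat k z x))%E.
Proof.
move=> minv mF F0.
have mT : measurable_fun setT
    (fun q : cfg R (site d) * RB => Theta alpha p dat k q.2 q.1).
  by apply: (measurable_Theta dat hk); [exact: measurable_snd|exact: measurable_fst].
transitivity (\int[push_prob (m \x G)%E mT]_x F x)%E.
  apply: eq_measure_integral => A mA _; apply/esym.
  apply: (BL_measure_unique (m1 := push_prob (m \x G)%E mT)) => // f fBL.
  have [mf [M fM]] := BL_bmf fBL.
  rewrite Rint_push// -(minv _ fBL).
  have bfT : bmf (fun q : cfg R (site d) * RB => f (Theta alpha p dat k q.2 q.1)).
    by split; [exact: (measurableT_comp mf mT)|exists M].
  have := integral12_prod_meas1 (bmf_integrable (m \x G)%E bfT).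
  rewrite /Rintegral => <-; congr fine; apply: eq_integral => x _.
  by rewrite /fubini_F/= EFin_Rint//; apply: (heat_bmf_aux _ hk); exact: BL_bmf.
rewrite ge0_integral_push// fubini_tonelli1//.
exact: (measurableT_comp mF mT).
Qed.

Variable c : R.
Hypothesis c_ge0 : 0 <= c.
Hypothesis Gc : (\int[G]_z (`|z|%:E) <= c%:E)%E.

Lemma heat_invariant_moment (m : probability (cfg R (site d)) R) k w :
  heat_invariant m k -> moments_le m w ->
  (\int[m]_x `|x k|%:E <= (alpha * Pavg w k + (c + `|dat k|))%:E)%E.
Proof.
move=> minv mw; rewrite (heat_invariant_ge0 minv)//.
have mnorm_sum : measurable_fun setT (fun x : cfg R (site d) =>
    (alpha * Pavg (fun j => `|x j|) k + (c + `|dat k|))%:E).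
  apply/measurable_EFinP; apply: measurable_funD => //; apply: measurable_funM => //.
  apply: measurable_sum => j; apply: measurable_funM => //.
  by apply: measurableT_comp => //; exact: measurable_cfg_eval.
have mT : measurable_fun setT
    (fun q : cfg R (site d) * RB => Theta alpha p dat k q.2 q.1).
  by apply: (measurable_Theta dat hk); [exact: measurable_snd|exact: measurable_fst].
apply: (@le_trans _ _ (\int[m]_x
    (alpha * Pavg (fun j => `|x j|) k + (c + `|dat k|))%:E)%E).
  apply: ge0_le_integral => //.
  - by move=> x _; apply: integral_ge0 => z _; rewrite lee_fin.
  - have := @measurable_fun_fubini_tonelli_F _ _ _ _ _ G _ (measurableT_comp (mnorm k) mT).
    by apply => q; rewrite /= lee_fin.
  - move=> x _.
    apply: (@le_trans _ _ (\int[G]_z (`|drift x k|%:E + `|z|%:E))%E).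
      apply: ge0_le_integral => //.
      + have mz : measurable_fun setT (fun z : RB => Theta alpha p dat k z x).
          apply: (measurable_Theta dat hk); first exact: measurable_id.
          exact: measurable_cst.
        exact: (measurableT_comp (mnorm k) mz).
      + apply: emeasurable_funD; first exact: measurable_cst.
        by apply/measurable_EFinP; exact: normr_measurable.
      + by move=> z _; rewrite (ThetaE dat hk) /update eqxx -EFinD lee_fin ler_normD.
    rewrite ge0_integralD//; last by apply/measurable_EFinP; exact: normr_measurable.
    have G1 : G setT = 1%E by exact: probability_setT.
    rewrite integral_cst// [X in (_ * X)%E]G1 mule1.
    apply: (@le_trans _ _ (`|drift x k|%:E + c%:E)%E); first by rewrite leeD2l.
    have hd : `|drift x k| <= alpha * Pavg (fun j => `|x j|) k + `|dat k|.
      rewrite (le_trans (ler_normD _ _))// lerD//.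
        by rewrite normrM ger0_norm// ler_wpM2l// (Pavg_norm hk).
      have /andP[_ a1] := hk_alpha hk.
      by rewrite normrM ger0_norm ?subr_ge0 ?(ltW a1)// ler_piMl// gerBl.
    by rewrite -EFinD lee_fin; move: hd; lra.
under eq_integral do rewrite EFinD.
have mPavg : measurable_fun setT (fun x : cfg R (site d) => (alpha * Pavg (fun j => `|x j|) k)%:E).
  apply/measurable_EFinP; apply: measurable_funM => //.
  apply: measurable_sum => j; apply: measurable_funM => //.
  by apply: measurableT_comp => //; exact: measurable_cfg_eval.
have P0 (x : cfg R (site d)) : 0 <= Pavg (fun j => `|x j|) k by exact: (Pavg_ge0 hk).
rewrite ge0_integralD//; last 2 first.
- by move=> x _; rewrite lee_fin mulr_ge0.
- by move=> x _; rewrite lee_fin addr_ge0.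
have m1 : m setT = 1%E by exact: probability_setT.
rewrite integral_cst// [X in (_ * X)%E]m1 mule1 [leRHS]EFinD leeD2r//.
under eq_integral do rewrite EFinM.
rewrite ge0_integralZl//; last 2 first.
- apply/measurable_EFinP; apply: measurable_sum => j; apply: measurable_funM => //.
  by apply: measurableT_comp => //; exact: measurable_cfg_eval.
- by move=> x _; rewrite lee_fin.
rewrite EFinM lee_wpmul2l ?lee_fin//.
under eq_integral do rewrite /Pavg -sumEFin.
rewrite ge0_integral_sum//; last 2 first.
- move=> j; under eq_fun do rewrite EFinM.
  by apply: emeasurable_funM; [exact: measurable_cst|exact: mnorm].
- by move=> j x _; rewrite lee_fin mulr_ge0// (hk_ge0 hk).
rewrite /Pavg -sumEFin; apply: lee_sum => j _.
under eq_integral do rewrite EFinM.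
rewrite ge0_integralZl// ?lee_fin ?(hk_ge0 hk)// EFinM lee_wpmul2l ?lee_fin ?(hk_ge0 hk)//.
Qed.

(** [M0] is an a priori excess that may depend on the volume. Invariance multiplies it by rho,
    because the source fits in the slack (1 - rho) C u; iterating removes it and leaves a bound in
    which only [C] appears. *)
Lemma invariant_moment_bound (m : probability (cfg R (site d)) R) (La : {fset site d}) C M0 :
  0 <= C -> (forall k, k \in La -> heat_invariant m k) ->
  (forall j, j \notin La -> (\int[m]_x `|x j|%:E <= (C * u j)%:E)%E) ->
  (forall k, c + `|dat k| <= (1 - rho) * C * u k) ->
  0 <= M0 -> moments_le m (fun j => (C + M0) * u j) ->
  moments_le m (fun j => C * u j).
Proof.
move=> C0 inv out g M00 m0.
have u0 j : 0 <= u j by rewrite (le_trans ler01)// (hk_u_ge1 hk).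
have it n : moments_le m (fun j => (C + rho ^+ n * M0) * u j).
  elim: n => [|n IH]; first by rewrite expr0 mul1r.
  move=> k; have [kLa|kLa] := boolP (k \in La); last first.
    rewrite (le_trans (out _ kLa))// lee_fin ler_wpM2r// lerDl.
    by rewrite mulr_ge0// exprn_ge0.
  rewrite (le_trans (heat_invariant_moment (inv _ kLa) IH))// lee_fin.
  rewrite PavgZ mulrCA; have hu := hk_u hk k; rewrite -/(Pavg u k) in hu.
  apply: (@le_trans _ _ ((C + rho ^+ n * M0) * (rho * u k) + (1 - rho) * C * u k)).
    by rewrite lerD// ler_wpM2l// addr_ge0// mulr_ge0// exprn_ge0.
  by rewrite exprS le_eqVlt; apply/orP; left; apply/eqP; ring.
move=> j.
have cv : (fun n => ((C + rho ^+ n * M0) * u j)%:E) @ \oo --> (C * u j)%:E.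
  apply: cvg_EFin; first exact: nearW.
  have -> : C * u j = (C + 0 * M0) * u j by rewrite mul0r addr0.
  apply: cvgMl; apply: cvgD; first exact: cvg_cst.
  apply: cvgMl.
  by apply: cvg_expr; rewrite ger0_norm//; have /andP[] := hk_rho hk.
rewrite -(cvg_lim _ cv)//; apply: lime_ge; first by apply/cvg_ex; eexists; exact: cv.
by apply: nearW => n; exact: it.
Qed.

Lemma heats_invariant (m : probability (cfg R (site d)) R) (L : seq (site d)) f :
  (forall k, k \in L -> heat_invariant m k) -> BLf f ->
  \int[m]_x heats L f x = \int[m]_x f x.
Proof.
elim: L f => //= k L IH f inv fBL; rewrite IH//.
- by apply: inv; rewrite ?mem_head.
- by move=> j jL; apply: inv; rewrite inE jL orbT.
- exact: (heat_BL _ hk).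
Qed.

Let measurable_QL L i : measurable_fun setT (fun x : cfg R (site d) => QL L (fun j => `|x j|) i).
Proof.
elim: L i => [|k L IH] i /=; first by apply: measurableT_comp => //; exact: measurable_cfg_eval.
rewrite /Q /update; case: eqP => _; last exact: IH.
by apply: measurable_funM => //; apply: measurable_sum => j; apply: measurable_funM.
Qed.

Lemma QL_moment (m : probability (cfg R (site d)) R) (L : seq (site d)) w :
  moments_le m w -> forall i, (\int[m]_x (QL L (fun j => `|x j|) i)%:E <= (QL L w i)%:E)%E.
Proof.
move=> mw; elim: L => [|k L IH] i /=; first exact: mw.
rewrite /Q /update; case: eqP => _; last exact: IH.
have q0 (x : cfg R (site d)) j : 0 <= QL L (fun j => `|x j|) j by exact: (QL_ge0 hk).
have mq j : measurable_fun setT (fun x : cfg R (site d) => (QL L (fun j => `|x j|) j)%:E).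
  by apply/measurable_EFinP; exact: measurable_QL.
under eq_integral do rewrite EFinM.
rewrite ge0_integralZl//; last 2 first.
- by apply/measurable_EFinP; apply: measurable_sum => j; apply: measurable_funM.
- by move=> x _; rewrite lee_fin (Pavg_ge0 hk).
rewrite EFinM lee_wpmul2l ?lee_fin//.
under eq_integral do rewrite /Pavg -sumEFin.
rewrite ge0_integral_sum//; last 2 first.
- move=> j; under eq_fun do rewrite EFinM.
  by apply: emeasurable_funM; [exact: measurable_cst|exact: mq].
- by move=> j x _; rewrite lee_fin mulr_ge0// (hk_ge0 hk).
rewrite /Pavg -sumEFin; apply: lee_sum => j _.
under eq_integral do rewrite EFinM.
rewrite ge0_integralZl ?lee_fin ?(hk_ge0 hk)//; last by move=> x _; rewrite lee_fin.
rewrite EFinM lee_wpmul2l ?lee_fin ?(hk_ge0 hk)//.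
Qed.

(** A start drawn from [m] differs from the start 0 by the profile |x|, whose mean is at most C u;
    [QL] is linear and monotone, so the mean of the coupled distance is at most C times [QL L u]. *)
Lemma heats_concentrate (m : probability (cfg R (site d)) R) L f F C' C : BLf f -> 0 <= C' ->
  lipf (fun v => C' * \sum_(i <- F : {fset site d}) v i) f -> moments_le m (fun j => C * u j) ->
  `|\int[m]_x heats L f x - heats L f (fun=> 0)| <= C' * \sum_(i <- F) C * QL L u i.
Proof.
move=> fBL C'0 fL mC.
have bh := BL_bmf (heats_BL dat hk L fBL).
rewrite -[X in _ - X](Rint_cst m) -RintB//; last exact: bmf_cst.
have bd := bmfB bh (bmf_cst _ (heats L f (fun=> 0))).
apply: (@le_trans _ _ (\int[m]_x `|heats L f x - heats L f (fun=> 0)|)).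
  have bn := bmf_norm bd; rewrite ler_norml; apply/andP; split.
    rewrite -mulN1r -RintZ//; apply: le_Rint => //; first exact: bmfZ.
    by move=> x; rewrite mulN1r lerNl -normrN ler_norm.
  by apply: le_Rint => // x; exact: ler_norm.
rewrite -lee_fin (EFin_Rint m (bmf_norm bd)).
apply: (@le_trans _ _ (\int[m]_x (C'%:E * \sum_(i <- F) (QL L (fun j => `|x j|) i)%:E))%E).
  apply: ge0_le_integral => //.
  - by apply/measurable_EFinP; exact: (bmf_norm bd).1.
  - apply: emeasurable_funM; first exact: measurable_cst.
    apply: emeasurable_sum => i; apply/measurable_EFinP; exact: measurable_QL.
  - move=> x _; rewrite sumEFin -EFinM lee_fin.
    have := heats_lip dat hk L fBL (mono_sum F C'0) fL x (fun=> 0).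
    rewrite (_ : (fun i => `|x i - 0|) = fun i => `|x i|)//.
    by apply/funext => i; rewrite subr0.
rewrite ge0_integralZl//; last 2 first.
- by apply: emeasurable_sum => i; apply/measurable_EFinP; exact: measurable_QL.
- by move=> x _; rewrite sume_ge0// => i _; rewrite lee_fin (QL_ge0 hk).
rewrite EFinM lee_wpmul2l ?lee_fin// ge0_integral_sum//; last 2 first.
- by move=> i; apply/measurable_EFinP; exact: measurable_QL.
- by move=> i x _; rewrite lee_fin (QL_ge0 hk).
rewrite -sumEFin; apply: lee_sum => i _; rewrite (le_trans (QL_moment L mC i))//.
by rewrite QLZ.
Qed.

Variable s : nat -> site d.
Hypothesis s_io : forall j n, exists2 m, (n <= m)%N & s m = j.

(** A run long enough to forget its start is fixed first. The laws are eventually invariant under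
    its finitely many updates, so their means of [f] are means over that run, hence close to [l]. *)
Lemma invariant_cvg (m_ : nat -> probability (cfg R (site d)) R) C f (l : R) :
  (forall k, \forall n \near \oo, heat_invariant (m_ n) k) ->
  (forall n, moments_le (m_ n) (fun j => C * u j)) -> BLf f ->
  heats (sched s n) f (fun=> 0) @[n --> \oo] --> l ->
  \int[m_ n]_x f x @[n --> \oo] --> l.
Proof.
move=> inv mC fBL cl; have [F [C' [C'0 fL]]] := BL_lipf fBL.
have bnd0 : C' * (\sum_(i <- F) C * QL (sched s n) u i) @[n --> \oo] --> (0 : R).
  rewrite -[X in _ --> X](mulr0 C'); apply: cvgMr.
  rewrite [X in _ --> X](_ : 0 = \sum_(i <- F) C * 0); last first.
    by rewrite big1// => ? _; rewrite mulr0.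
  by apply: cvg_sumr => i; apply: cvgMr; exact: (sched_cvg_u hk).
apply/cvgrPdist_le => e e0; have e20 : 0 < e / 2 by rewrite divr_gt0.
move/cvgrPdist_le : cl => /(_ _ e20) cl; move/cvgrPdist_le : bnd0 => /(_ _ e20) b0.
have [T _ hT] : \forall n \near \oo, `|l - heats (sched s n) f (fun=> 0)| <= e / 2 /\
    `|0 - C' * (\sum_(i <- F) C * QL (sched s n) u i)| <= e / 2 by near=> n; split; near: n.
have [h1 h2] := hT T (leqnn T).
have invT : \forall n \near \oo, forall k, k \in sched s T -> heat_invariant (m_ n) k.
  elim: (sched s T) => [|k L IH]; first exact: nearW.
  have := inv k; apply: filterS2 IH => n IH ik j.
  by rewrite inE => /predU1P[->|/IH].
apply: filterS invT => n invT.
rewrite -(heats_invariant invT fBL).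
have h3 := heats_concentrate (sched s T) fBL C'0 fL (mC n).
rewrite sub0r normrN in h2.
rewrite (_ : l - _ = (l - heats (sched s T) f (fun=> 0)) -
  (\int[m_ n]_x heats (sched s T) f x - heats (sched s T) f (fun=> 0))); last by ring.
rewrite (le_trans (ler_normB _ _))//.
have h4 := le_trans h3 (le_trans (ler_norm _) h2).
by rewrite (splitr e) lerD.
Unshelve. all: by end_near.
Qed.

End invariant_laws.

Section gibbs_limits.
Context (R : realType) (d : nat) (alpha : R) (p : site d -> site d -> R)
  (nb : site d -> {fset site d}) (rho : R) (u u' : site d -> R)
  (dat : cfg R (site d)).
Hypothesis hk : harness_kernel alpha p nb rho u u'.
Implicit Types (La : {fset site d}) (k i j : site d) (y : cfg R (site d)).
Local Notation RB := (measurableTypeR R).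
Local Notation G := (@normal_prob R 0 1).
Local Notation J := (fun i j => alpha * p i j).
Local Notation heat := (heat alpha p dat).
Local Notation heats := (heats alpha p dat).
Local Notation glue := Defs.glue.
Local Notation law := (gibbs_law dat hk).
Local Notation kernel := (gibbs_kernel dat hk).
Local Notation ref := (ref_measure alpha dat).
Local Notation sd := (gibbs_sd alpha).

Let rho1 : 0 < 1 - rho. Proof. by rewrite subr_gt0; have /andP[] := hk_rho hk. Qed.
Let u_ge0 j : 0 <= u j. Proof. by rewrite (le_trans ler01)// (hk_u_ge1 hk). Qed.

Lemma gibbs_law_invariant La y k : k \in La -> heat_invariant alpha p dat (law La y) k.
Proof.
move=> kLa f fBL; have bf := BL_bmf fBL.
have := gibbs_law_reversible dat hk y kLa bf (bmf_cst _ (1 : R)).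
under eq_Rintegral do rewrite mul1r; move=> ->.
apply: eq_Rintegral => x _; rewrite heat_fix ?mulr1//; first exact: bmf_cst.
Qed.

Let mnorm (I : choiceType) (i : I) : measurable_fun setT (fun x : cfg R I => (`|x i|)%:E).
Proof.
by apply/measurable_EFinP; apply: measurableT_comp => //; exact: measurable_cfg_eval.
Qed.

Let mglue La y : measurable_fun setT (fun z : cfg R La => glue z y).
Proof. by apply: measurable_glue; [exact: measurable_id|exact: measurable_cst]. Qed.

Let law_push La y (F : cfg R (site d) -> \bar R) : measurable_fun (U := \bar R) setT F ->
  (forall x, 0 <= F x)%E -> (\int[law La y]_x F x = \int[kernel La y]_z F (glue z y))%E.
Proof. by move=> mF F0; rewrite ge0_integral_push. Qed.

Lemma gibbs_law_out La y j : j \notin La -> (\int[law La y]_x `|x j|%:E = `|y j|%:E)%E.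
Proof.
move=> jLa; rewrite law_push; [|exact: (mnorm j)|by []].
under eq_integral do rewrite glueF//.
have k1 : kernel La y setT = 1%E by exact: probability_setT.
by rewrite integral_cst// [X in (_ * X)%E]k1 mule1.
Qed.

Let ref_moment La (j : La) : (\int[ref La]_z `|z j|%:E < +oo)%E.
Proof.
have s0 := gibbs_sd_neq0 hk.
have [c c0 hc] := normal_abs_moment_at s0.
have me : measurable_fun setT (fun x : cfg R La => x j : RB) := measurable_cfg_eval j.
have mab : measurable_fun (setT : set RB) (fun z : RB => (`|z|)%:E).
  by apply/measurable_EFinP; exact: normr_measurable.
have -> : (\int[ref La]_z `|z j|%:E = \int[normal_prob (dat (val j)) sd]_s (`|s|%:E))%E.
  transitivity (\int[push_prob (ref La) me]_z (`|z|%:E))%E.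
    by rewrite ge0_integral_push.
  apply: eq_measure_integral => A mA _; rewrite /push_prob /pushforward/=.
  have := @ref_measureE R d alpha dat La [fset j]%fset (fun=> A) (fun=> mA); rewrite big_seq_fset1 => <-; congr (ref La _).
  apply/seteqP; split=> x /= xA; first by move=> e'; rewrite inE => /eqP ->.
  by apply: xA; rewrite inE.
have msh : measurable_fun (setT : set RB) (fun x : RB => (dat (val j) + x)%R : RB).
  by apply: measurable_funD; [exact: measurable_cst|exact: measurable_id].
have -> : (\int[normal_prob (dat (val j)) sd]_s (`|s|%:E) =
    \int[normal_prob 0 sd]_s (`|dat (val j) + s|%:E))%E.
  transitivity (\int[push_prob (normal_prob 0 sd) msh]_s (`|s|%:E))%E.
    by apply: eq_measure_integral => A mA _; exact: normal_shift.
  by rewrite ge0_integral_push.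
apply: (@le_lt_trans _ _ (\int[normal_prob 0 sd]_s (`|dat (val j)|%:E + `|s|%:E))%E).
  apply: ge0_le_integral => //.
  - exact: (measurableT_comp mab msh).
  - by apply: emeasurable_funD => //; exact: measurable_cst.
  - by move=> s _; rewrite -EFinD lee_fin ler_normD.
rewrite ge0_integralD//.
have N1 : @normal_prob R 0 sd setT = 1%E by exact: probability_setT.
rewrite integral_cst// [X in (_ * X)%E]N1 mule1.
by rewrite (@le_lt_trans _ _ (`|dat (val j)|%:E + c%:E)%E)// ?leeD2l// -EFinD ltry.
Qed.

(** The density with respect to the reference law is at most 1/Z. Only finiteness matters: the value
    becomes the excess that [invariant_moment_bound] removes. *)
Let law_moment_fin La y j : (\int[law La y]_x `|x j|%:E < +oo)%E.
Proof.
have [jLa|jLa] := boolP (j \in La); last by rewrite gibbs_law_out// ltry.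
rewrite law_push; [|exact: (mnorm j)|by []]; pose j' : La := FSetSub jLa.
have bV : bmf (fun z : cfg R La => boltzmann alpha p La (glue z y)).
  by apply: (bmf_boltzmann hk); exact: mglue.
set Z := \int[ref La]_z boltzmann alpha p La (glue z y).
have Z0 : 0 < Z by apply: Rint_gt0 => // z; exact: boltzmann_gt0.
rewrite (@ge0_integral_density _ _ _ (ref La) (kernel La y)
   (fun z => boltzmann alpha p La (glue z y) / Z))//; last 4 first.
- by apply/measurable_EFinP; apply: measurable_funM => //; exact: bV.1.
- by move=> z; rewrite lee_fin divr_ge0// ltW// boltzmann_gt0.
- by move=> A mA; exact: gibbs_kernel_density.
- exact: (measurableT_comp (mnorm j) (mglue y)).
apply: (@le_lt_trans _ _ (\int[ref La]_z (Z^-1%:E * `|z j'|%:E))%E).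
  apply: ge0_le_integral => //.
  - by move=> z _; rewrite mule_ge0 ?lee_fin// divr_ge0// ltW// boltzmann_gt0.
  - apply: emeasurable_funM; first exact: (measurableT_comp (mnorm j) (mglue y)).
    by apply/measurable_EFinP; apply: measurable_funM => //; exact: bV.1.
  - by apply: emeasurable_funM; [exact: measurable_cst|exact: mnorm].
  - move=> z _; rewrite -!EFinM lee_fin -[j]/(val j') glueT mulrC ler_wpM2r//.
    by rewrite ler_piMl ?invr_ge0 ?(ltW Z0)// (boltzmann_le1 hk).
rewrite ge0_integralZl//; last 2 first.
- exact: (mnorm j').
- by rewrite lee_fin invr_ge0 ltW.
by rewrite lte_mul_pinfty ?lee_fin ?invr_ge0 ?(ltW Z0)// ref_moment.
Qed.

Variables (c D : R).
Hypothesis c_ge0 : 0 <= c.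
Hypothesis Gc : (\int[G]_z (`|z|%:E) <= c%:E)%E.
Hypothesis datD : forall i, `|dat i| <= D * u i.

Lemma gibbs_law_moment C0 y : (forall i, `|y i| <= C0 * u i) -> exists2 C, 0 <= C &
  forall La, moments_le (law La y) (fun j => C * u j).
Proof.
move=> yC0; have D0 := data_bound_ge0 hk datD.
have C00 : 0 <= C0 by rewrite -(pmulr_lge0 _ (u_gt0 hk 0)) (le_trans _ (yC0 0)).
(* The first term dominates the boundary condition, the second leaves room for the source in the
   slack. *)
pose C := Num.max C0 ((c + D) / (1 - rho)).
have CC0 : C0 <= C by rewrite le_max lexx.
have C_ge0 : 0 <= C by rewrite (le_trans C00).
exists C => // La.
have [M0 M00 hM0] : exists2 M0, 0 <= M0 &
    forall j, j \in La -> (\int[law La y]_x `|x j|%:E <= (M0 * u j)%:E)%E.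
  exists (\sum_(j <- La) fine (\int[law La y]_x `|x j|%:E)%E).
    by apply: sumr_ge0 => j _; rewrite fine_ge0// integral_ge0.
  move=> j jLa; rewrite -[leLHS]fineK; last first.
    by rewrite ge0_fin_numE ?integral_ge0// law_moment_fin.
  rewrite lee_fin (big_fsetD1 j)//=.
  set a := fine _; have a0 : 0 <= a by rewrite fine_ge0// integral_ge0.
  set b := \sum_(_ <- _) _.
  have b0 : 0 <= b by apply: sumr_ge0 => i _; rewrite fine_ge0// integral_ge0.
  apply: (@le_trans _ _ (a + b)); first by rewrite lerDl.
  by rewrite ler_peMr ?addr_ge0// (hk_u_ge1 hk).
have out j : j \notin La -> (\int[law La y]_x `|x j|%:E <= (C * u j)%:E)%E.
  by move=> jLa; rewrite gibbs_law_out// lee_fin (le_trans (yC0 j))// ler_wpM2r.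
apply: (@invariant_moment_bound R d alpha p nb rho u u' dat hk c c_ge0 Gc (law La y) La C M0).
- exact: C_ge0.
- by move=> k kLa; exact: gibbs_law_invariant.
- exact: out.
- move=> k; apply: (@le_trans _ _ ((c + D) * u k)).
    by rewrite mulrDl lerD// ler_peMr// (hk_u_ge1 hk).
  rewrite ler_wpM2r// mulrC -ler_pdivrMr// le_max lexx orbT//.
- exact: M00.
- move=> j; have [jLa|jLa] := boolP (j \in La).
    by rewrite (le_trans (hM0 _ jLa))// lee_fin ler_wpM2r// lerDr.
  by rewrite (le_trans (out _ jLa))// lee_fin ler_wpM2r// lerDl.
Qed.

Lemma gibbs_law_cvg (s : nat -> site d) (La : nat -> {fset site d}) C0 y f (l : R) :
  (forall j n, exists2 m, (n <= m)%N & s m = j) ->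
  exhausts La -> (forall i, `|y i| <= C0 * u i) -> BLf f ->
  heats (sched s n) f (fun=> 0) @[n --> \oo] --> l ->
  \int[law (La n) y]_x f x @[n --> \oo] --> l.
Proof.
move=> s_io eLa yC0 fBL cl; have [C C_ge0 hC] := gibbs_law_moment yC0.
apply: (@invariant_cvg R d alpha p nb rho u u' dat hk s s_io (fun n => law (La n) y) C f l) => //.
move=> k.
have [n0 hn0] := exhausts_subset [fset k]%fset eLa.
exists n0; first by [].
move=> n n0n; have kLa : k \in La n by apply: (hn0 n n0n); rewrite inE.
exact: (gibbs_law_invariant y kLa).
Qed.

Lemma bmf_Rint_law La (f : cfg R (site d) -> R) : bmf f ->
  bmf (fun y => \int[law La y]_x f x).
Proof.
move=> bf; have [mf [M fM]] := bf; split; last by exists M => y; exact: Rint_norm_le.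
have bV y : bmf (fun z : cfg R La => boltzmann alpha p La (glue z y)).
  by apply: (bmf_boltzmann hk); exact: mglue.
have mglue2 : measurable_fun setT (fun q : cfg R (site d) * cfg R La => glue q.2 q.1).
  by apply: measurable_glue; [exact: measurable_snd|exact: measurable_fst].
have bglue (h : cfg R (site d) -> R) y : bmf h -> bmf (fun z : cfg R La => h (glue z y)).
  by move=> [mh [Mh hM]]; split; [exact: (measurableT_comp mh (mglue y))|exists Mh].
have mint (h : cfg R (site d) -> R) : bmf h ->
    measurable_fun setT (fun y => \int[ref La]_z (h (glue z y) * boltzmann alpha p La (glue z y))).
  move=> bh; have [mh [Mh hM]] := bh.
  have bW : bmf (fun q : cfg R (site d) * cfg R La =>
      h (glue q.2 q.1) * boltzmann alpha p La (glue q.2 q.1)).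
    apply: bmfM; last exact: (bmf_boltzmann hk).
    by split; [exact: (measurableT_comp mh mglue2)|exists Mh].
  apply/measurable_EFinP.
  have iF := bmf_integrable (dirac (point : cfg R (site d)) \x ref La)%E bW.
  have mF := measurable_fubini_F iF.
  apply: eq_measurable_fun mF => y _; rewrite /fubini_F/= EFin_Rint//.
  by apply: bmfM => //; exact: bglue.
(* The inverse of the positive partition function is written as a power, which is measurable. *)
rewrite (_ : (fun y => _) = fun y =>
    (\int[ref La]_z (f (glue z y) * boltzmann alpha p La (glue z y))) *
    (\int[ref La]_z (1 * boltzmann alpha p La (glue z y))) `^ (-1)).
  apply: measurable_funM; first exact: mint.
  apply: (measurableT_comp (measurable_powR (-1))).
  by apply: (mint (fun=> 1)); exact: bmf_cst.
apply/funext => y; rewrite (Rint_gibbs_law dat hk)//; congr (_ * _).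
under [in RHS]eq_Rintegral do rewrite mul1r.
by rewrite powR_inv1// ltW//; apply: Rint_gt0 => // z; exact: boltzmann_gt0.
Qed.

Lemma law_restr La y A : measurable A -> law La y (@restr R d La @^-1` A) = kernel La y A.
Proof.
move=> mA; rewrite /gibbs_law /push_prob /pushforward/=; congr (kernel La y _).
have rg (z : cfg R La) : restr (glue z y) = z.
  by apply/funext => i; rewrite /restr glueT.
by apply/seteqP; split=> z /=; rewrite rg.
Qed.

(** Properness of the specification: [law La y] is carried by configurations that agree with [y] off
    [La]. *)
Lemma law_out La y B : sigma_generated [set i | i \notin La] (@cfg_eval R (site d)) B ->
  forall A, law La y (A `&` B) = if y \in B then law La y A else 0%E.
Proof.
move=> oB A; rewrite /gibbs_law /push_prob /pushforward/=.
have BE (z : cfg R La) : B (glue z y) <-> B y.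
  by split; apply: (sigma_generated_dep oB) => i /= iLa; rewrite glueF.
case: ifPn => yB.
  congr (kernel La y _); apply/seteqP; split=> z /= => [[]//|Az]; split=> //.
  by apply/BE; move: yB; rewrite inE.
rewrite (_ : _ @^-1` _ = set0) ?measure0//; apply/seteqP; split=> z //= [_ /BE].
by move: yB; rewrite notin_setE.
Qed.

Lemma eq_gibbs_kernel La y y' A : measurable A -> (forall i, i \notin La -> y i = y' i) ->
  kernel La y A = kernel La y' A.
Proof.
move=> mA yy'; rewrite (gibbs_kernel_density dat hk y mA) (gibbs_kernel_density dat hk y' mA).
have E (z : cfg R La) : glue z y = glue z y'.
  apply/funext => i; have [iLa|iLa] := boolP (i \in La); last by rewrite !glueF// yy'.
  by rewrite -[i]/(val (FSetSub iLa)) !glueT.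
have -> : \int[ref La]_z boltzmann alpha p La (glue z y) =
    \int[ref La]_z boltzmann alpha p La (glue z y').
  by apply: eq_Rintegral => z _; rewrite E.
by apply: eq_integral => z _; rewrite E.
Qed.

End gibbs_limits.

(** * DLR equations and uniqueness *)

Section mixture.
Context d d' (T : measurableType d) (T' : measurableType d') (R : realType).
Variables (mu : probability T R) (K : T -> probability T' R).
Hypothesis mK : forall A, measurable A -> measurable_fun setT (fun y => K y A).
Local Open Scope ereal_scope.

Definition mixture (A : set T') : \bar R := let _ := mK in \int[mu]_y K y A.

Let mixture0 : mixture set0 = 0.
Proof. by rewrite /mixture integral0_eq// => y _; rewrite measure0. Qed.

Let mixture_ge0 A : 0 <= mixture A.
Proof. by apply: integral_ge0 => y _; exact: measure_ge0. Qed.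

Let mixture_sadd : semi_sigma_additive mixture.
Proof.
move=> F mF tF mUF; rewrite [X in _ --> X](_ : _ = \sum_(i <oo) mixture (F i)).
  by apply: is_cvg_ereal_nneg_natsum => n _; exact: mixture_ge0.
rewrite /mixture -integral_nneseries//; last by move=> n; exact: mK.
apply: eq_integral => y _; apply/esym/cvg_lim => //.
exact: measure_semi_sigma_additive.
Qed.

HB.instance Definition _ := isMeasure.Build _ _ _ mixture mixture0 mixture_ge0 mixture_sadd.

Let mixtureT : mixture setT = 1.
Proof.
rewrite /mixture; under eq_integral do rewrite probability_setT.
have m1 : mu setT = 1 by exact: probability_setT.
by rewrite integral_cst// mul1e.
Qed.

HB.instance Definition _ := @Measure_isProbability.Build _ _ R mixture mixtureT.

Import HBNNSimple.

Lemma ge0_integral_mixture (f : T' -> \bar R) : measurable_fun (U := \bar R) setT f ->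
  (forall x, 0 <= f x) ->
  measurable_fun (U := \bar R) setT (fun y => \int[K y]_x f x) /\
  \int[mixture]_x f x = \int[mu]_y \int[K y]_x f x.
Proof.
move=> mf f0.
have nnsE (m : {measure set T' -> \bar R}) (h : {nnsfun T' >-> R}) :
    \int[m]_x (h x)%:E = \sum_(r \in range h) r%:E * m (h @^-1` [set r]).
  rewrite integral_nnsfun// (_ : h \_ setT = h) ?sintegralE//.
  by apply/funext => x; rewrite patchE in_setT.
have mr (h : {nnsfun T' >-> R}) r : measurable (h @^-1` [set r]) by [].
have r0 (h : {nnsfun T' >-> R}) r y : 0 <= r%:E * K y (h @^-1` [set r]).
  have [->|/set0P[x hx]] := eqVneq (h @^-1` [set r]) set0; first by rewrite measure0 mule0.
  by rewrite mule_ge0// lee_fin -hx.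
have mnns (h : {nnsfun T' >-> R}) : measurable_fun setT (fun y => \int[K y]_x (h x)%:E).
  under eq_fun do rewrite nnsE.
  apply: emeasurable_fsum => // r; apply: emeasurable_funM; first exact: measurable_cst.
  exact: mK.
have inns (h : {nnsfun T' >-> R}) :
    \int[mixture]_x (h x)%:E = \int[mu]_y \int[K y]_x (h x)%:E.
  rewrite nnsE; under [RHS]eq_integral do rewrite nnsE.
  have mrK r : measurable_fun setT (fun y => r%:E * K y (h @^-1` [set r])).
    by apply: emeasurable_funM; [exact: measurable_cst|exact: mK].
  rewrite ge0_integral_fsum//; try by move=> r y _; exact: r0.
  apply: eq_fsbigr => r _.
  have [->|/set0P[x hx]] := eqVneq (h @^-1` [set r]) set0.
    by rewrite measure0 mule0; under eq_integral do rewrite measure0 mule0; rewrite integral0.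
  rewrite ge0_integralZl//; first exact: mK.
  by rewrite lee_fin -hx.
pose f_ := nnsfun_approx measurableT mf.
have nd x : nondecreasing_seq (fun n => (f_ n x)%:E).
  by move=> m n mn; rewrite lee_fin; exact/lefP/nd_nnsfun_approx.
have lim_ (m : {measure set T' -> \bar R}) :
    limn (fun n => \int[m]_x (f_ n x)%:E) = \int[m]_x f x.
  rewrite -monotone_convergence//=.
  - by apply: eq_integral => x _; apply/cvg_lim => //=; exact: cvg_nnsfun_approx.
  - by move=> n; exact/measurable_EFinP.
  - by move=> n x _; rewrite lee_fin.
have ndint y : nondecreasing_seq (fun n => \int[K y]_x (f_ n x)%:E).
  move=> m n mn; apply: ge0_le_integral => //.
  - by move=> x _; rewrite lee_fin.
  - exact/measurable_EFinP.
  - exact/measurable_EFinP.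
  - by move=> x _; exact: nd.
split.
  apply: (emeasurable_fun_cvg (fun n y => \int[K y]_x (f_ n x)%:E)) => // y _.
  rewrite -lim_; apply: ereal_nondecreasing_is_cvgn; exact: ndint.
rewrite -(lim_ mixture); under eq_fun do rewrite inns.
rewrite -monotone_convergence//=.
- by apply: eq_integral => y _; rewrite lim_.
- by move=> n y _; apply: integral_ge0 => x _; rewrite lee_fin.
Qed.

Lemma Rint_mixture (f : T' -> R) : bmf f ->
  (\int[mixture]_x f x = \int[mu]_y \int[K y]_x f x)%R /\
  bmf (fun y => \int[K y]_x f x)%R.
Proof.
move=> bf; have [mf [M fM]] := bf.
have bM : bmf (fun x => f x + M)%R by apply: bmfD => //; exact: bmf_cst.
have M0 x : (0 <= f x + M)%R.
  by have := fM x; rewrite ler_norml -lerBlDr add0r => /andP[].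
have [mI E] := ge0_integral_mixture (f := fun x => (f x + M)%:E)
  ltac:(by apply/measurable_EFinP; exact: bM.1) ltac:(by move=> x; rewrite lee_fin).
have KE y : \int[K y]_x (f x + M)%:E = ((\int[K y]_x f x)%R + M)%:E.
  by rewrite -(EFin_Rint _ bM) RintD ?Rint_cst//; exact: bmf_cst.
have bK : bmf (fun y => \int[K y]_x f x)%R.
  split; last by exists M => y; exact: Rint_norm_le.
  rewrite (_ : (fun y => _) = (fun y => fine (\int[K y]_x (f x + M)%:E) - M)%R); last first.
    by apply/funext => y; rewrite KE/= addrK.
  by apply: measurable_funB => //; apply: (measurableT_comp (fine_measurable measurableT)).
split => //; apply: (addIr M); rewrite -[in LHS](Rint_cst mixture M) -RintD//; last exact: bmf_cst.
apply: EFin_inj; rewrite (EFin_Rint _ bM) E.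
under eq_integral do rewrite KE.
have bKM : bmf (fun y => (\int[K y]_x f x)%R + M)%R by apply: bmfD => //; exact: bmf_cst.
by rewrite -(EFin_Rint mu bKM) RintD ?Rint_cst//; exact: bmf_cst.
Qed.

End mixture.

Opaque gibbs_kernel.

Lemma sigma_generated_of_proj (R : realType) (I : choiceType) (D : set I)
    (h : cfg R I -> \bar R) (B : set R) :
  measurable_fun setT h -> measurable B -> (forall y, h (proj_on D y) = h y) ->
  sigma_generated D (@cfg_eval R I) [set y | B (fine (h y))].
Proof.
move=> mh mB hD; set S := [set y | _].
have mS : measurable S.
  have mf := measurableT_comp (fine_measurable measurableT) mh.
  by have := mf measurableT B mB; rewrite setTI.
have -> : S = proj_on D @^-1` S.
  by apply/seteqP; split=> y; rewrite /preimage/S/mkset/= hD.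
exact: sigma_generated_proj.
Qed.

Section equilibrium.
Context (R : realType) (d : nat) (alpha : R) (p : site d -> site d -> R)
  (nb : site d -> {fset site d}) (rho : R) (u u' : site d -> R)
  (dat : cfg R (site d)).
Hypothesis hk : harness_kernel alpha p nb rho u u'.
Implicit Types (La : {fset site d}) (k i j : site d) (x y : cfg R (site d)).
Local Notation G := (@normal_prob R 0 1).
Local Notation J := (fun i j => alpha * p i j).
Local Notation QL := (QL alpha p nb).
Local Notation heat := (heat alpha p dat).
Local Notation heats := (heats alpha p dat).
Local Notation law := (gibbs_law dat hk).
Local Notation kernel := (gibbs_kernel dat hk).

Let alpha_ge0 : 0 <= alpha. Proof. by have /andP[/ltW] := hk_alpha hk. Qed.

Lemma measurable_law La A : measurable A -> measurable_fun setT (fun y => law La y A).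
Proof.
move=> mA; have bA : bmf (\1_A : cfg R (site d) -> R).
  split; first exact: measurable_indic.
  by exists 1 => x; rewrite indicE ger0_norm// lern1 leq_b1.
have [mI _] := bmf_Rint_law dat hk La bA.
rewrite (_ : (fun y => _) = fun y => (\int[law La y]_x \1_A x)%:E).
  exact/measurable_EFinP.
apply/funext => y; rewrite (EFin_Rint _ bA).
by have := @integral_indic _ _ _ (law La y) setT measurableT A mA; rewrite setIT => ->.
Qed.

Lemma measurable_gibbs_kernel La A : measurable A ->
  measurable_fun setT (fun y => kernel La y A).
Proof.
move=> mA; under eq_fun do rewrite -(law_restr dat hk)//.
apply: measurable_law; rewrite -[X in measurable X]setTI.
by apply: (measurable_fun_cfg (f := @restr R d La)) => // i; exact: measurable_cfg_eval.
Qed.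

Lemma outside_gibbs_kernel La A (B : set R) : measurable A -> measurable B ->
  sigma_generated [set i | i \notin La] (@cfg_eval R (site d))
    [set y | B (fine (kernel La y A))].
Proof.
move=> mA mB.
apply: (@sigma_generated_of_proj R (site d) [set i | i \notin La] (fun y => kernel La y A) B).
- exact: measurable_gibbs_kernel.
- exact: mB.
- move=> y; apply: (eq_gibbs_kernel dat hk mA) => i iLa.
  by rewrite /proj_on; case: asboolP.
Qed.

(** The DLR equation of [La] in integrated form. Unlike the conditional form it can be reached by
    passing to the limit in means of bounded Lipschitz functions. *)
Definition gibbs_stationary (m : probability (cfg R (site d)) R) La :=
  forall f, BLf f -> \int[m]_x f x = \int[m]_y \int[law La y]_x f x.

Local Notation mix m La := (mixture m (@measurable_law La)).

Lemma gibbs_stationaryE m La : gibbs_stationary m La ->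
  forall A, measurable A -> m A = mix m La A.
Proof.
move=> st; apply: BL_measure_unique => f fBL; rewrite st//.
by rewrite (Rint_mixture m (@measurable_law La) (BL_bmf fBL)).1.
Qed.

Lemma gibbs_stationary_DLR m : (forall La, gibbs_stationary m La) ->
  DLR J (1 - alpha) dat m.
Proof.
move=> st La; exists (kernel La); last first.
  by apply: aeW => y A mA; rewrite gibbs_kernelE.
split=> [A mA B mB|A B mA oB]; first exact: outside_gibbs_kernel.
have mrA : measurable (@restr R d La @^-1` A).
  rewrite -[X in measurable X]setTI.
  by apply: (measurable_fun_cfg (f := @restr R d La)) => // i; exact: measurable_cfg_eval.
have mB := sigma_generated_measurable oB.
rewrite (gibbs_stationaryE (st La)); last exact: measurableI.
rewrite /= /mixture [RHS]integral_mkcond; apply: eq_integral => y _.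
rewrite patchE; apply: etrans (law_out dat hk y oB _) _.
by case: ifP => // _; exact: law_restr.
Qed.

(** A box of rays is the intersection of an event inside [La] and one outside, which is the form on
    which conditional laws are specified; such boxes determine the measure. *)
Lemma DLR_gibbs_stationary (m : probability (cfg R (site d)) R) La :
  DLR J (1 - alpha) dat m -> gibbs_stationary m La.
Proof.
move=> dlr f fBL; have [ka [_ kaE] aeka] := dlr La.
have mE : forall A, measurable A -> m A = mix m La A; last first.
  rewrite -(Rint_mixture m (@measurable_law La) (BL_bmf fBL)).1.
  by rewrite /Rintegral; congr fine; apply: eq_measure_integral => A mA _; exact: mE.
apply: cfg_measure_unique => [|F a].
  by rewrite (le_lt_trans (probability_le1 _ _))// ltry.
pose A : set (cfg R La) := ray_box [fset i in {: La} | fsval i \in F]%fset (fun i : La => a (fsval i)).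
pose B : set (cfg R (site d)) := ray_box [fset i in F | i \notin La]%fset a.
have mA : measurable A by exact: measurable_ray_box.
have oB : sigma_generated [set i | i \notin La] (@cfg_eval R (site d)) B.
  rewrite sigma_generated_ray_boxes; apply: sub_sigma_algebra.
  exists [fset i in F | i \notin La]%fset, a; split=> // i.
  by rewrite !inE => /andP[].
have mB := sigma_generated_measurable oB.
have boxE : ray_box F a = @restr R d La @^-1` A `&` B.
  apply/seteqP; split=> [x xF|x [xA xB] i iF].
    split=> [i|i]; rewrite !inE/=; first by move=> iF; exact: xF.
    by move=> /andP[/xF].
  have [iLa|iLa] := boolP (i \in La); last by apply: xB; rewrite !inE iF.
  by have := xA (FSetSub iLa); rewrite !inE; apply.
transitivity (m (@restr R d La @^-1` A `&` B)); first by rewrite -boxE.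
rewrite (kaE _ _ mA oB).
transitivity (\int[m]_y law La y (@restr R d La @^-1` A `&` B))%E; last by rewrite -boxE.
(* The two integrands agree almost surely, and measurability is supplied by the one built from
   [law]. *)
rewrite integral_mkcond; apply: ae_eq_integral_nonmeasurable.
  by apply: measurable_law; rewrite -boxE; exact: measurable_ray_box.
move: aeka; apply: filterS => y kaEy.
rewrite patchE; apply/esym; apply: etrans (law_out dat hk y oB _) _.
case: ifP => // _; rewrite kaEy// -(gibbs_kernelE dat hk); exact: law_restr.
Qed.

Variables (c D : R).
Hypothesis c_ge0 : 0 <= c.
Hypothesis Gc : (\int[G]_z (`|z|%:E) <= c%:E)%E.
Hypothesis datD : forall i, `|dat i| <= D * u i.
Variable s : nat -> site d.
Hypothesis s_io : forall j n, exists2 m, (n <= m)%N & s m = j.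
Variable mu : probability (cfg R (site d)) R.
Hypothesis mu_lim : forall f z C, BLf f -> (forall i, `|z i| <= C * u i) ->
  heats (sched s n) f z @[n --> \oo] --> \int[mu]_x f x.

Let heats0 f : BLf f -> heats (sched s n) f (fun=> 0) @[n --> \oo] --> \int[mu]_x f x.
Proof. by move=> fBL; apply: (mu_lim (C := 0)) => // i; rewrite normr0 mul0r. Qed.

Lemma gibbs_law_cvg_mu (Ls : nat -> {fset site d}) C y f : exhausts Ls -> (forall i, `|y i| <= C * u i) ->
  BLf f -> \int[law (Ls n) y]_x f x @[n --> \oo] --> \int[mu]_x f x.
Proof.
move=> eLa yC fBL; exact: (gibbs_law_cvg hk c_ge0 Gc datD s_io eLa yC fBL (heats0 fBL)).
Qed.

Lemma gibbs_mean_cvg (Ls : nat -> {fset site d}) C y f : exhausts Ls -> (forall i, `|y i| <= C * u i) ->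
  loc_test f -> gibbs_mean J (1 - alpha) dat (Ls n) y f @[n --> \oo] --> \int[mu]_x f x.
Proof.
move=> eLa yC; move: f.
apply: (@BL_cvg_test _ _ _ \oo _
  (fun n f => gibbs_mean J (1 - alpha) dat (Ls n) y f)).
- move=> f g tf tg fg; apply: nearW => n.
  rewrite !(gibbs_meanE dat hk); try exact: loc_test_measurable.
  by apply: le_Rint => //; exact: loc_test_bmf.
- move=> f tf; apply: nearW => n.
  rewrite !(gibbs_meanE dat hk); try (apply: loc_test_measurable => //; exact: loc_testN).
  have := RintZ (law (Ls n) y) (-1) (loc_test_bmf tf).
  by rewrite mulN1r => <-; apply: eq_Rintegral => x _; rewrite mulN1r.
- move=> f fBL.
  rewrite (_ : (fun n => _) = fun n => \int[law (Ls n) y]_x f x).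
    exact: (gibbs_law_cvg_mu eLa yC fBL).
  by apply/funext => n; rewrite (gibbs_meanE dat hk)//; exact: (BL_bmf fBL).1.
Qed.

(** [g * heat k f] is again bounded, Lipschitz and local, so the identity passes to the limit along
    an exhausting sequence of volumes, which eventually contain [k]. *)
Let mu_reversible_BL k f g : BLf f -> BLf g ->
  \int[mu]_x (g x * heat k f x) = \int[mu]_x (f x * heat k g x).
Proof.
move=> fBL gBL; have [Ls eLa] := exhausts_countable (site d).
have y0 i : `|(fun=> 0 : R) i| <= 0 * u i by rewrite normr0 mul0r.
have c1 := gibbs_law_cvg_mu eLa y0 (BLfM gBL (heat_BL dat hk k fBL)).
have c2 := gibbs_law_cvg_mu eLa y0 (BLfM fBL (heat_BL dat hk k gBL)).
apply: (@cvg_unique _ (@norm_hausdorff _ R) _ _ _ _ c1).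
apply: cvg_trans c2; apply: near_eq_cvg.
have [n0 hn0] := exhausts_subset [fset k]%fset eLa.
exists n0; first by [].
move=> n n0n; have kLa : k \in Ls n by apply: (hn0 n n0n); rewrite inE.
exact/esym/(gibbs_law_reversible dat hk _ kLa (BL_bmf fBL) (BL_bmf gBL)).
Qed.

Let heat_cvg k (f_ : nat -> cfg R (site d) -> R) f M x : (forall n, bmf (f_ n)) -> bmf f ->
  (forall n x, `|f_ n x| <= M) -> (forall x, f_ n x @[n --> \oo] --> f x) ->
  heat k (f_ n) x @[n --> \oo] --> heat k f x.
Proof.
move=> bf_ bf fM cf; apply: (@Rint_dct _ _ _ _ _ _ M).
- by move=> n; exact: (heat_bmf_aux _ hk _ _ (bf_ n)).1.
- exact: (heat_bmf_aux _ hk _ _ bf).1.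
- by move=> n z; exact: fM.
- by apply: aeW => z; exact: cf.
Qed.

Lemma mu_heat_reversible k f g : loc_test f -> loc_test g ->
  \int[mu]_x (g x * heat k f x) = \int[mu]_x (f x * heat k g x).
Proof.
move=> tf tg.
have [f_ [fBL [Mf fM] _ cf]] := BL_approx tf.
have [g_ [gBL [Mg gM] _ cg]] := BL_approx tg.
have bf := loc_test_bmf tf; have bg := loc_test_bmf tg.
have Mf0 : 0 <= Mf by exact: le_trans (fM 0%N point).
have Mg0 : 0 <= Mg by exact: le_trans (gM 0%N point).
have lim_ (f1 g1 : nat -> cfg R (site d) -> R) (f2 g2 : cfg R (site d) -> R) M1 M2 :
    0 <= M1 -> 0 <= M2 -> (forall n, BLf (f1 n)) -> (forall n, BLf (g1 n)) -> bmf f2 -> bmf g2 ->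
    (forall n x, `|f1 n x| <= M1) -> (forall n x, `|g1 n x| <= M2) ->
    (forall x, f1 n x @[n --> \oo] --> f2 x) -> (forall x, g1 n x @[n --> \oo] --> g2 x) ->
    \int[mu]_x (g1 n x * heat k (f1 n) x) @[n --> \oo] --> \int[mu]_x (g2 x * heat k f2 x).
  move=> M10 M20 f1BL g1BL bf2 bg2 f1M g1M cf1 cg1.
  apply: (@Rint_dct _ _ _ _ _ _ (M2 * M1)).
  - by move=> n; apply: (bmfM _ _).1; [exact: BL_bmf|apply: (heat_bmf dat hk); exact: BL_bmf].
  - by apply: (bmfM _ _).1 => //; exact: (heat_bmf dat hk).
  - move=> n x; rewrite normrM ler_pM//.
    by apply: (heat_norm _ hk) => //; exact: BL_bmf.
  - apply: aeW => x; apply: cvgM; first exact: cg1.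
    by apply: (heat_cvg (M := M1)) => // n; exact: BL_bmf.
have l1 := lim_ f_ g_ f g Mf Mg Mf0 Mg0 fBL gBL bf bg fM gM cf cg.
have l2 := lim_ g_ f_ g f Mg Mf Mg0 Mf0 gBL fBL bg bf gM fM cg cf.
apply: (@cvg_unique _ (@norm_hausdorff _ R) _ _ _ _ l1).
by apply: cvg_trans l2; apply: near_eq_cvg; apply: nearW => n; exact: mu_reversible_BL.
Qed.

Let bmf_gen k f : bmf f -> bmf (site_generator alpha p dat k f).
Proof.
move=> bf; rewrite (_ : site_generator _ _ _ _ _ = fun x => heat k f x - f x).
  by apply: bmfB => //; exact: (heat_bmf dat hk).
by apply/funext => x; rewrite (site_generatorE _ hk).
Qed.

Lemma mu_reversible_site k : reversible mu (site_generator alpha p dat k).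
Proof.
move=> f g tf tg; have bf := loc_test_bmf tf; have bg := loc_test_bmf tg.
have E f1 g1 : bmf f1 -> bmf g1 -> \int[mu]_x (g1 x * site_generator alpha p dat k f1 x) =
    \int[mu]_x (g1 x * heat k f1 x) - \int[mu]_x (g1 x * f1 x).
  move=> b1 b2; rewrite -RintB.
  - by apply: eq_Rintegral => x _; rewrite (site_generatorE _ hk)// mulrBr.
  - by apply: bmfM => //; exact: (heat_bmf dat hk).
  - exact: bmfM.
rewrite !E// (mu_heat_reversible _ tf tg); congr (_ - _).
by apply: eq_Rintegral => x _; rewrite mulrC.
Qed.

Lemma mu_reversible : reversible mu (harness_generator alpha p dat).
Proof.
move=> f g tf tg; have bf := loc_test_bmf tf; have bg := loc_test_bmf tg.
have [_ _ [F hF]] := tf; have [_ _ [F' hF']] := tg.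
pose H := (F `|` F')%fset.
(* [heat k] fixes a function that does not depend on the height at [k], so the sum over all sites
   reduces to [H]. *)
have genE f1 : bmf f1 -> (forall x y, (forall i, i \in H -> x i = y i) -> f1 x = f1 y) ->
    forall x, harness_generator alpha p dat f1 x = \sum_(k <- H) site_generator alpha p dat k f1 x.
  move=> b1 h1 x; rewrite /harness_generator (fsbigE H) ?fset_uniq//.
    by apply: eq_bigl => k; rewrite in_setT.
  move=> k _ kH; rewrite (site_generatorE _ hk)// heat_fix ?subrr// => t.
  by apply: h1 => i iH; rewrite /Theta; case: eqP iH kH => // -> ->.
have hFH x y : (forall i, i \in H -> x i = y i) -> f x = f y.
  by move=> xy; apply: hF => i iF; apply: xy; rewrite inE iF.
have hF'H x y : (forall i, i \in H -> x i = y i) -> g x = g y.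
  by move=> xy; apply: hF' => i iF; apply: xy; rewrite inE iF orbT.
have E f1 g1 : bmf f1 -> bmf g1 ->
    (forall x, harness_generator alpha p dat f1 x = \sum_(k <- H) site_generator alpha p dat k f1 x) ->
    \int[mu]_x (g1 x * harness_generator alpha p dat f1 x) =
    \sum_(k <- H) \int[mu]_x (g1 x * site_generator alpha p dat k f1 x).
  move=> b1 b2 h1; under eq_Rintegral do rewrite h1 mulr_sumr.
  have hr : forall r : seq (site d),
    \int[mu]_x (\sum_(k <- r) g1 x * site_generator alpha p dat k f1 x) =
    \sum_(k <- r) \int[mu]_x (g1 x * site_generator alpha p dat k f1 x) /\
    bmf (fun x => \sum_(k <- r) g1 x * site_generator alpha p dat k f1 x).
    elim=> [|k r [IH1 IH2]].
      split; first by under eq_Rintegral do rewrite big_nil; rewrite Rint_cst big_nil.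
      by under eq_fun do rewrite big_nil; exact: bmf_cst.
    have bk : bmf (fun x => g1 x * site_generator alpha p dat k f1 x).
      by apply: bmfM => //; exact: bmf_gen.
    split; last by under eq_fun do rewrite big_cons; exact: bmfD.
    by under eq_Rintegral do rewrite big_cons; rewrite RintD// IH1 big_cons.
  exact: (hr H).1.
rewrite (E f g bf bg (genE f bf hFH)) (E g f bg bf (genE g bg hF'H)).
by apply: eq_bigr => k _; exact: mu_reversible_site.
Qed.

Lemma mu_heat_invariant k : heat_invariant alpha p dat mu k.
Proof.
move=> f fBL; have t1 : loc_test (fun _ : cfg R (site d) => 1 : R).
  by apply: BL_loc_test; split; [exists 1 => x; rewrite normr1|
    exists fset0, 0; split=> // x y; rewrite subrr normr0 mul0r].
have := mu_heat_reversible k (BL_loc_test fBL) t1.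
under eq_Rintegral do rewrite mul1r; move=> ->.
apply: eq_Rintegral => x _; rewrite heat_fix ?mulr1//; exact: bmf_cst.
Qed.

(** The profile never exceeds [M] during the sweep, so every updated site is left with at most alpha
    M; each site of [La] is updated, and off [La] the profile stays 0. *)
Let QL_sweep La (M : R) i : 0 <= M ->
  QL La (fun j => if j \in La then M else 0) i <= if i \in La then alpha * M else 0.
Proof.
move=> M0; have a1 : alpha <= 1 by have /andP[_ /ltW] := hk_alpha hk.
suff h : forall r : seq (site d), {subset r <= La} -> forall i,
    QL r (fun j => if j \in La then M else 0) i <=
    if i \in r then alpha * M else if i \in La then M else 0.
  by have := h La (fun _ => id) i; case: (i \in La).
elim=> [|k r IH] sub j /=; first by rewrite lexx.
have sub' : {subset r <= La} by move=> l lr; apply: sub; rewrite inE lr orbT.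
have {}IH := IH sub'.
have kLa : k \in La by apply: sub; rewrite mem_head.
have IH' l : QL r (fun j => if j \in La then M else 0) l <= M.
  rewrite (le_trans (IH l))//; case: ifP => _; first by rewrite ler_piMl.
  by case: ifP.
rewrite /Q /update inE; case: eqP => [->|_] /=; last exact: IH.
by rewrite ler_wpM2l// -[leRHS](Pavg_cst hk M k) (Pavg_le hk).
Qed.

Let sweeps La n := flatten (nseq n (La : seq (site d))).

Let QL_sweeps La n (v : site d -> R) M i : 0 <= M ->
  (forall j, v j <= if j \in La then M else 0) -> QL (sweeps La n) v i <= alpha ^+ n * M.
Proof.
move=> M0 hv.
suff h : QL (sweeps La n) v i <= if i \in La then alpha ^+ n * M else 0.
  rewrite (le_trans h)//; case: ifP => // _; rewrite mulr_ge0// exprn_ge0//.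
elim: n i => [|n IH] i; first by rewrite /= expr0 mul1r.
rewrite /sweeps /= /QL foldr_cat -!/(QL _ _) exprS -mulrA.
have aM : 0 <= alpha ^+ n * M by rewrite mulr_ge0// exprn_ge0.
apply: le_trans (QL_sweep La i aM).
exact: (QL_le hk).
Qed.

(** Sweeping [La] over and over from [y] leads to [law La y]: this law is invariant, and its
    configurations differ from [y] in [La] only, a difference that each sweep shrinks by alpha. As
    [mu] is invariant under the sweeps, integrating the limit against [mu] returns the mean of
    [f]. *)
Lemma mu_gibbs_stationary La : gibbs_stationary mu La.
Proof.
move=> f fBL; have [[M fM] _] := fBL.
have cvgy y : heats (sweeps La n) f y @[n --> \oo] --> \int[law La y]_x f x.
  have [F [C' [C'0 fL]]] := BL_lipf fBL.
  have bH n : bmf (fun z : cfg R La => heats (sweeps La n) f (Defs.glue z y)).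
    have [mh [Mh hM]] := BL_bmf (heats_BL dat hk (sweeps La n) fBL).
    split; last by exists Mh.
    by apply: (measurableT_comp mh); apply: measurable_glue; [exact: measurable_id|exact: measurable_cst].
  have E n : \int[kernel La y]_z (heats (sweeps La n) f (Defs.glue z y) -
      heats (sweeps La n) f y) = \int[law La y]_x f x - heats (sweeps La n) f y.
    rewrite RintB//; last exact: bmf_cst.
    have HI : \int[law La y]_x heats (sweeps La n) f x = \int[law La y]_x f x.
      apply: (heats_invariant hk) => // k.
      rewrite /sweeps => /flattenP[r]; rewrite mem_nseq => /andP[_ /eqP ->].
      exact: gibbs_law_invariant.
    rewrite Rint_cst -HI.
    by rewrite Rint_push//; exact: (BL_bmf (heats_BL dat hk (sweeps La n) fBL)).1.
  have : \int[kernel La y]_z (heats (sweeps La n) f (Defs.glue z y) -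
      heats (sweeps La n) f y) @[n --> \oo] --> \int[kernel La y]_z (0 : R).
    apply: (@Rint_dct _ _ _ _ _ _ (M + M)).
    - by move=> n; apply: (bmfB _ _).1 => //; exact: bmf_cst.
    - exact: measurable_cst.
    - move=> n z; rewrite (le_trans (ler_normB _ _))// lerD//; exact: (heats_norm dat hk).
    - apply: aeW => z.
      pose Mz := \sum_(l <- La) `|Defs.glue z y l - y l|.
      have Mz0 : 0 <= Mz by exact: sumr_ge0.
      have hMz j : `|Defs.glue z y j - y j| <= if j \in La then Mz else 0.
        case: ifPn => jLa; last by rewrite glueF// subrr normr0.
        by rewrite /Mz (big_fsetD1 j)//= lerDl sumr_ge0.
      apply/cvgrPdist_le => e e0.
      have : C' * (\sum_(i <- F) alpha ^+ n * Mz) @[n --> \oo] --> (0 : R).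
        rewrite -[X in _ --> X](mulr0 C'); apply: cvgMr.
        rewrite [X in _ --> X](_ : 0 = \sum_(i <- F) 0 * Mz); last first.
          by rewrite big1// => ? _; rewrite mul0r.
        apply: cvg_sumr => i; apply: cvgMl; apply: cvg_expr.
        by rewrite ger0_norm//; have /andP[] := hk_alpha hk.
      move=> /cvgrPdist_le /(_ _ e0); apply: filterS => n.
      rewrite !sub0r !normrN => h; apply: le_trans (le_trans (ler_norm _) h).
      rewrite (le_trans (heats_lip dat hk (sweeps La n) fBL (mono_sum F C'0) fL _ y))//.
      by rewrite ler_wpM2l//; apply: ler_sum => i _; exact: QL_sweeps.
  rewrite Rint_cst; under eq_fun do rewrite E.
  move=> h.
  have {}h : \int[law La y]_x f x - (\int[law La y]_x f x - heats (sweeps La n) f y)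
      @[n --> \oo] --> \int[law La y]_x f x - 0 by apply: cvgB => //; exact: cvg_cst.
  rewrite subr0 in h; apply: cvg_trans h; apply: near_eq_cvg; apply: nearW => n.
  by rewrite opprB addrC subrK.
have inv n : \int[mu]_x heats (sweeps La n) f x = \int[mu]_x f x.
  by apply: (heats_invariant hk) => // k _; exact: mu_heat_invariant.
have : \int[mu]_x heats (sweeps La n) f x @[n --> \oo] --> \int[mu]_y \int[law La y]_x f x.
  apply: (@Rint_dct _ _ _ _ _ _ M).
  - by move=> n; exact: (BL_bmf (heats_BL dat hk _ fBL)).1.
  - exact: (bmf_Rint_law dat hk _ (BL_bmf fBL)).1.
  - by move=> n x; exact: (heats_norm dat hk).
  - by apply: aeW => y; exact: cvgy.
under eq_fun do rewrite inv.
by move=> /(cvg_unique (@norm_hausdorff _ R) (cvg_cst _)).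
Qed.

(** A stationary [m] is a mixture of finite-volume laws whose boundary conditions lie almost surely
    in [X]; each of these laws converges to [mu], and dominated convergence concludes. *)
Lemma mu_unique (X : set (cfg R (site d))) (m : probability (cfg R (site d)) R) :
  (forall x, X x -> exists C, forall i, `|x i| <= C * u i) ->
  measurable X -> m X = 1%E -> (forall La, gibbs_stationary m La) ->
  forall A, measurable A -> m A = mu A.
Proof.
move=> Xu mX mX1 st; apply: BL_measure_unique => f fBL.
have [[M fM] _] := fBL; have [Ls eLa] := exhausts_countable (site d).
have : \int[m]_y \int[law (Ls n) y]_x f x @[n --> \oo] --> \int[m]_y \int[mu]_x f x.
  apply: (@Rint_dct _ _ _ _ _ _ M).
  - by move=> n; exact: (bmf_Rint_law dat hk _ (BL_bmf fBL)).1.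
  - exact: measurable_cst.
  - by move=> n y; apply: Rint_norm_le => //; exact: BL_bmf.
  - exists (~` X); split; [exact: measurableC| |].
      by have := probability_setC m mX; rewrite mX1 subee.
    move=> y /= ny Xy; apply: ny; have [C yC] := Xu _ Xy.
    exact: (gibbs_law_cvg_mu eLa yC fBL).
rewrite Rint_cst; under eq_fun do rewrite -st//.
by move=> /(cvg_unique (@norm_hausdorff _ R) (cvg_cst _)).
Qed.

End equilibrium.

(** * The backward walk *)

Section esum_limits.
Variables (R : realType) (I : choiceType).
Local Open Scope ereal_scope.

Lemma esum_uniq (D : set I) (s : seq I) (g : I -> \bar R) : uniq s ->
  (forall i, i \in s -> D i) -> (forall i, D i -> 0 <= g i) ->
  (forall i, D i -> i \notin s -> g i = 0) ->
  \esum_(i in D) g i = \sum_(i <- s) g i.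
Proof.
move=> us sD g0 gs; rewrite (esumID [set` s])// [X in _ + X]esum1 ?adde0; last first.
  by move=> i [Di /= /negP]; exact: gs.
rewrite (_ : D `&` _ = [set` s]); last by apply/seteqP; split=> [i []//|i is_]; split => //; exact: sD.
rewrite esum_fset//; last by move=> i /[!inE] /sD; exact: g0.
by rewrite -fsbig_seq.
Qed.

Lemma esum_nondecreasing_cvg (D : set I) (a : nat -> I -> R) (b : I -> R) :
  (forall n i, D i -> (0 <= a n i)%R) -> (forall n i, D i -> (a n i <= a n.+1 i)%R) ->
  (forall i, D i -> a n i @[n --> \oo] --> b i) ->
  (fun n => \esum_(i in D) (a n i)%:E) @ \oo --> \esum_(i in D) (b i)%:E.
Proof.
move=> a0 aS ab.
have amono i n m : D i -> (n <= m)%N -> (a n i <= a m i)%R.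
  move=> Di /subnK <-; elim: (m - n)%N => // k IH.
  by rewrite addSn (le_trans IH)// aS.
have ab_le n i : D i -> (a n i <= b i)%R.
  move=> Di; rewrite -(cvg_lim (@Rhausdorff R) (ab _ Di)).
  by apply: nondecreasing_cvgn_le; [move=> m k; exact: amono|apply/cvg_ex; exists (b i); exact: ab].
rewrite (_ : \esum_(i in D) (b i)%:E = ereal_sup (range (fun n => \esum_(i in D) (a n i)%:E))).
  apply: ereal_nondecreasing_cvgn => n m nm.
  by apply: le_esum => i Di; rewrite lee_fin; exact: amono.
apply/eqP; rewrite eq_le; apply/andP; split; last first.
  by apply: ge_ereal_sup => _ [n _ <-]; apply: le_esum => i Di; rewrite lee_fin; exact: ab_le.
apply: ge_ereal_sup => _ [X [finX XD] <-].
rewrite fsbig_finite//= sumEFin.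
have XDi i : i \in fset_set X -> D i by rewrite in_fset_set// inE => /XD.
have cv : (fun n => (\sum_(i <- fset_set X) a n i)%:E) @ \oo -->
    (\sum_(i <- fset_set X) b i)%:E.
  apply: cvg_EFin; first exact: nearW.
  rewrite (_ : fine \o _ = (fun n => \sum_(i <- fset_set X) (if i \in fset_set X then a n i else 0))%R); last first.
    by apply/funext => n /=; apply: eq_big_seq => i ->.
  rewrite [X in _ --> X](_ : _ = (\sum_(i <- fset_set X) (if i \in fset_set X then b i else 0))%R); last first.
    by apply: eq_big_seq => i ->.
  apply: cvg_sumr => i; case: ifPn => [/XDi Di|_]; [exact: ab|exact: cvg_cst].
rewrite -(cvg_lim _ cv)//; apply: lime_le; first by apply/cvg_ex; eexists; exact: cv.
apply: nearW => n; apply: le_trans (ereal_sup_ubound _); last by exists n.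
apply: esum_ge; exists X => //; by rewrite fsbig_finite//= sumEFin.
Qed.

Let esumZ_le (D : set I) (c : R) (f : I -> \bar R) : (0 <= c)%R ->
  (forall i, 0 <= f i) ->
  \esum_(i in D) (c%:E * f i) <= c%:E * \esum_(i in D) f i.
Proof.
move=> c0 f0; apply: ge_ereal_sup => _ [X [finX XD] <-].
rewrite -ge0_mule_fsumr// lee_wpmul2l ?lee_fin//.
by apply: ereal_sup_ubound; exists X.
Qed.

Lemma esumZ (D : set I) (c : R) (f : I -> \bar R) : (0 <= c)%R ->
  (forall i, 0 <= f i) ->
  \esum_(i in D) (c%:E * f i) = c%:E * \esum_(i in D) f i.
Proof.
rewrite le_eqVlt => /predU1P[<- f0|c0 f0].
  by rewrite mul0e esum1// => i _; rewrite mul0e.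
apply/eqP; rewrite eq_le esumZ_le ?(ltW c0)//= muleC -lee_pdivlMr//.
rewrite [leRHS]muleC.
have ci0 : (0 <= c^-1)%R by rewrite invr_ge0 ltW.
have cf0 i : 0 <= c%:E * f i by rewrite mule_ge0 ?lee_fin ?(ltW c0).
apply: le_trans (esumZ_le D ci0 cf0).
by apply: le_esum => i _; rewrite muleA -EFinM mulVf ?gt_eqF// mul1e.
Qed.

End esum_limits.

(** Used to split the backward walks by their first jump. *)
Lemma esum_words (R : realType) (S : choiceType) (f : seq S -> \bar R) :
  (forall w, 0 <= f w)%E ->
  (\esum_(w in [set: seq S]) f w =
   f [::] + \esum_(k in [set: S]) \esum_(w in [set: seq S]) f (k :: w))%E.
Proof.
move=> f0; rewrite (esumID [set [::]])// setTI esum_set1//; congr (_ + _)%E.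
rewrite esum_esum//; apply: (@reindex_esum _ _ _ _ _ (fun q : S * seq S => q.1 :: q.2)).
split=> [[k w]|[k w] [k' w'] _ _ /= [-> ->]|[|k w] [_ h]] //=.
  by exfalso; apply: h.
by exists (k, w).
Qed.

Section duality.
Context (R : realType) (d : nat) (alpha : R) (p : site d -> site d -> R)
  (nb : site d -> {fset site d}) (rho : R) (u u' : site d -> R).
Hypothesis hk : harness_kernel alpha p nb rho u u'.
Local Notation label := (site d * nat)%type.
Local Notation Pavg := (Pavg p nb).
Local Notation QL := (QL alpha p nb).
Local Notation evolve := (@evolve R d alpha p nb nat).
Variable tau : label -> R.
Implicit Types (L : seq label) (La : {fset site d}) (J : set R) (i j k : site d).

Let ep k : set R := range (fun n => tau (k, n)).
Local Notation pp := (path_prob alpha p ep).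

(** The strict order excludes ties, puts the latest epoch at the head as [evolve] and [QL] require,
    and makes the list unique. *)
Definition epoch_list La J L := (forall e, e \in L <-> e.1 \in La /\ J (tau e)) /\
  pairwise (fun e e' => tau e' < tau e) L.

Lemma epoch_list_uniq La J L : epoch_list La J L -> uniq L.
Proof. by move=> [_ /pairwise_uniq]; apply => e; rewrite ltxx. Qed.

Let alpha_ge0 : 0 <= alpha. Proof. by have /andP[/ltW] := hk_alpha hk. Qed.

Lemma path_prob_ge0 J i w j : 0 <= pp J i w j.
Proof.
elim: w J i => [|k w IH] J i /=; first by case: ifP.
by case: ifP => // _; rewrite !mulr_ge0// (hk_ge0 hk).
Qed.

Lemma QL_delta_off L i j : i \notin map fst L -> QL (map fst L) (delta R j) i = (i == j)%:R.
Proof.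
elim: L => //= e L IH; rewrite inE negb_or => /andP[ie iL].
by rewrite /Q /update (negbTE ie) IH.
Qed.

Let latest La J e L : epoch_list La J (e :: L) ->
  [/\ e.1 \in La, J (tau e) & forall n, J (tau (e.1, n)) -> tau (e.1, n) <= tau e].
Proof.
move=> [EL /= /andP[/allP Le _]]; have [eLa Je] := (EL e).1 (mem_head _ _).
split=> // n Jn; have /(EL (e.1, n)).2 : (e.1, n).1 \in La /\ J (tau (e.1, n)) by split.
by rewrite inE => /predU1P[->//|/Le /ltW].
Qed.

Let epoch_list_tail La J e L : epoch_list La J (e :: L) ->
  epoch_list La (J `&` [set s | s < tau e]) L.
Proof.
move=> [EL /= /andP[/allP Le pL]]; split=> // e'; split=> [e'L|[e'La [Je' /= e'e]]].
  have [e'La Je'] : e'.1 \in La /\ J (tau e') by apply/EL; rewrite inE e'L orbT.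
  by split=> //; split=> //=; exact: Le.
have /(EL e').2 : e'.1 \in La /\ J (tau e') by split.
by rewrite inE => /predU1P[ee'|//]; move: e'e; rewrite ee' ltxx.
Qed.

(** The walk at [i] ignores the epoch of another site. After its first jump the window ends before
    the latest epoch of [i], which precedes [e], so removing [e] has no later effect. *)
Let pp_other La J e L i w j : epoch_list La J (e :: L) -> i \in La -> i != e.1 ->
  pp J i w j = pp (J `&` [set s | s < tau e]) i w j.
Proof.
move=> EL iLa ie; have EL' := epoch_list_tail EL.
have AA : ep i `&` J = ep i `&` (J `&` [set s | s < tau e]).
  apply/seteqP; split=> [_ [[n _ <-] Jn]|s [es [Js _]]//]; split; first by exists n.
  have : (i, n) \in e :: L by apply/(EL.1 _).2.
  rewrite inE => /predU1P[en|/(EL'.1 _).1[//]].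
  by move: ie; rewrite -en eqxx.
case: w => [|k w] /=; rewrite -AA//; case: ifPn => // /asboolPn A0.
congr (_ * pp _ _ _ _); rewrite -setIA; congr (_ `&` _).
apply/seteqP; split=> [s /= sA|s [_ //]]; split=> //=; apply: lt_le_trans sA _.
apply: ge_sup; first by apply/set0P/eqP.
by rewrite AA => s' [_ [_ /= /ltW]].
Qed.

Let pp_self La J e L k w j : epoch_list La J (e :: L) ->
  pp J e.1 (k :: w) j = alpha * p e.1 k * pp (J `&` [set s | s < tau e]) k w j.
Proof.
move=> EL; have [eLa Je emax] := latest EL.
have eA : (ep e.1 `&` J) (tau e) by split=> //; exists e.2 => //; rewrite -surjective_pairing.
rewrite /=; case: ifPn => [/asboolP A0|_]; first by move: eA; rewrite A0.
suff -> : sup (ep e.1 `&` J) = tau e by [].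
have ub : ubound (ep e.1 `&` J) (tau e) by move=> _ [[n _ <-] Jn]; exact: emax.
apply/eqP; rewrite eq_le; apply/andP; split.
  by apply: ge_sup => //; exists (tau e).
by apply: ub_le_sup => //; exists (tau e).
Qed.

(* Paths staying in [La] only see the epochs of [La]. *)
Lemma esum_path_prob La J L i j : epoch_list La J L -> i \in La -> j \in La ->
  (\esum_(w in [set: seq (site d)]) (if all (mem La) w then pp J i w j else 0)%:E =
   (QL (map fst L) (delta R j) i)%:E)%E.
Proof.
have ge0 J' i' w : 0 <= (if all (mem La) w then pp J' i' w j else 0).
  by case: ifP => // _; exact: path_prob_ge0.
move=> + + jLa; elim: L J i => [|e L IH] J i EL iLa.
  have A0 : ep i `&` J = set0.
    by rewrite -subset0 => _ [[n _ <-] Jn]; have := (EL.1 (i, n)).2 (conj iLa Jn).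
  rewrite esum_words; last by move=> w; rewrite lee_fin.
  rewrite [X in (_ + X)%E]esum1; last first.
    move=> k _; apply: esum1 => w _ /=; case: ifP => // _; case: ifPn => //.
    by move=> /asboolPn.
  rewrite adde0 /= /delta; congr EFin; case: (i == j); rewrite ?andbT ?andbF//.
  by case: ifPn => // /asboolPn.
have EL' := epoch_list_tail EL.
have [ie|ie] := eqVneq i e.1; last first.
  rewrite [RHS](_ : _ = (QL (map fst L) (delta R j) i)%:E); last first.
    by rewrite /= {1}/Q /update (negbTE ie).
  rewrite -(IH _ _ EL' iLa); apply: eq_esum => w _; case: ifP => // _.
  by rewrite (pp_other _ _ EL).
rewrite ie in iLa *; rewrite esum_words; last by move=> w; rewrite lee_fin.
have [eLa Je _] := latest EL.
rewrite [X in (X + _)%E](_ : _ = 0%E) ?add0e; last first.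
  rewrite /=; case: ifPn => // /andP[/asboolP A0 _].
  suff : (set0 : set R) (tau e) by [].
  by rewrite -A0; split=> //; exists e.2 => //; rewrite -surjective_pairing.
have step k : (\esum_(w in [set: seq (site d)])
     (if all (mem La) (k :: w) then pp J e.1 (k :: w) j else 0)%:E =
   (alpha * p e.1 k * QL (map fst L) (delta R j) k)%:E)%E.
  (* A jump out of [La] contributes 0 on both sides: such words are excluded, and [QL] leaves
     [delta j] equal to 0 at sites off [La]. *)
  under eq_esum do rewrite (pp_self _ _ _ EL).
  have [kLa|kLa] := boolP (k \in La); last first.
    rewrite QL_delta_off; last first.
      apply/mapP => -[e' e'L ke']; have := (EL'.1 _).1 e'L.
      by rewrite -ke' => -[]; rewrite (negbTE kLa).
    rewrite (_ : (k == j) = false) ?mulr0; last by apply: contraNF kLa => /eqP ->.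
    by apply: esum1 => w _; rewrite /= (negbTE kLa).
  under eq_esum do rewrite /= kLa/=.
  rewrite EFinM -(IH _ _ EL' kLa) -esumZ ?mulr_ge0 ?(hk_ge0 hk)//.
    by apply: eq_esum => w _; case: ifP => _; rewrite -?EFinM ?mulr0.
  by move=> w; rewrite lee_fin.
under eq_esum do rewrite step.
rewrite (@esum_uniq _ _ setT (nb e.1)) ?fset_uniq//.
- rewrite sumEFin /= /Q /update eqxx /Pavg big_distrr/=; congr EFin.
  by apply: eq_bigr => k _; rewrite mulrA.
- move=> k _; rewrite -step; apply: esum_ge0 => w _; rewrite lee_fin.
  by case: ifP => // _; exact: path_prob_ge0.
- move=> k _ knb; have [->|/(hk_nb hk)] := eqVneq (p e.1 k) 0; first by rewrite mulr0 mul0r.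
  by rewrite (negbTE knb).
Qed.

(** The noise of an epoch is carried by the strictly later epochs, which are those ahead of it in
    the list. *)
Lemma evolve_sum J La L zeta i : epoch_list La J L ->
  evolve L (fun=> 0) zeta i =
  \sum_(e <- L) QL (map fst [seq e' <- L | tau e < tau e']) (delta R e.1) i * zeta e.
Proof.
move=> [_]; elim/last_ind: L => [|L e0 IH]; first by rewrite big_nil.
rewrite pairwise_rcons => /andP[/allP Le pL]; rewrite (evolve_rcons hk) IH//.
rewrite -cats1 big_cat big_seq1/=; congr (_ + _).
  apply: eq_big_seq => e eL; rewrite filter_cat/= [tau e < tau e0](_ : _ = false) ?cats0//.
  by apply/negbTE; rewrite -leNgt ltW// Le.
rewrite filter_cat/= ltxx cats0 mulrC; congr (QL (map _ _) _ _ * _).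
by apply/esym/all_filterP/allP => e eL; exact: Le.
Qed.

Definition cutoff La (z : site d -> R) : site d -> R := fun j => if j \in La then z j else 0.

Lemma evolve_cutoff J La L z zeta i : epoch_list La J L ->
  evolve L (cutoff La z) zeta i =
  \sum_(e <- L) QL (map fst [seq e' <- L | tau e < tau e']) (delta R e.1) i * zeta e +
  \sum_(j <- La) QL (map fst L) (delta R j) i * z j.
Proof.
move=> EL; rewrite evolve_split (evolve_sum _ _ EL); congr (_ + _).
rewrite (_ : cutoff La z = fun l => \sum_(j <- La) z j * delta R j l).
  by rewrite QL_sum; apply: eq_bigr => j _; rewrite mulrC.
apply/funext => l; rewrite /cutoff /delta; case: ifPn => lLa.
  rewrite (big_fsetD1 l)//= eqxx mulr1 big1_fset ?addr0// => j.
  by rewrite !inE => /andP[/negbTE jl _] _; rewrite eq_sym jl mulr0.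
rewrite big_seq big1// => j jLa; rewrite (_ : (l == j) = false) ?mulr0//.
by apply: contraNF lLa => /eqP ->.
Qed.

Lemma epoch_list_after La t L e : 0 <= tau e -> epoch_list La `[0, t]%classic L ->
  epoch_list La `]tau e, t]%classic [seq e' <- L | tau e < tau e'].
Proof.
move=> e0 [EL pL]; split; last exact: pairwise_filter.
move=> e'; rewrite mem_filter /= in_itv/=; split=> [/andP[ee' /EL[]]|].
  by rewrite /= in_itv/= => ? /andP[_ ->]; rewrite ee'.
move=> [e'La /andP[ee' e't]]; rewrite ee'/=; apply/EL; split=> //=.
by rewrite in_itv/= e't andbT ltW// (le_lt_trans e0).
Qed.

Variable F : nat -> {fset site d}.
Hypothesis eF : exhausts F.

Let wp := walk_prob alpha p ep.

(** Set to 0 unless both ends lie in the box: it is then a sum over the paths that stay in the box,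
    hence nondecreasing in [n]. *)
Let value (l : nat -> seq label) i j n :=
  if (i \in F n) && (j \in F n) then QL (map fst (l n)) (delta R j) i else 0.

Let value_esum J l i j n : (forall n, epoch_list (F n) J (l n)) ->
  (\esum_(w in [set: seq (site d)])
     (if all (mem (F n)) [:: i, j & w] then pp J i w j else 0)%:E = (value l i j n)%:E)%E.
Proof.
move=> El; rewrite /value /=; have [iF|iF] /= := boolP (i \in F n); last by rewrite esum1.
have [jF|jF] /= := boolP (j \in F n); last by rewrite esum1.
exact: (esum_path_prob (El n)).
Qed.

Let value_ge0 l i j n : 0 <= value l i j n.
Proof. by rewrite /value; case: ifP => // _; rewrite (QL_ge0 hk)// => ?; exact: delta_ge0. Qed.

Let value_le1 l i j n : value l i j n <= 1.
Proof.
rewrite /value; case: ifP => // _.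
have s1 : superharmonic alpha p nb (fun=> 1).
  by move=> k; rewrite (Pavg_cst hk) mulr1; have /andP[_ /ltW] := hk_alpha hk.
apply: le_trans (QL_superharmonic_le hk _ s1 i); apply: (QL_le hk) => k.
by rewrite /delta lern1 leq_b1.
Qed.

Let value_nondecreasing J l i j n : (forall n, epoch_list (F n) J (l n)) ->
  value l i j n <= value l i j n.+1.
Proof.
move=> El; rewrite -lee_fin -!(value_esum _ _ _ El); apply: le_esum => w _.
rewrite lee_fin; case: ifPn => [/allP h|_]; last by case: ifP => // _; exact: path_prob_ge0.
by rewrite ifT//; apply/allP => k /h; exact: eF.1.
Qed.

Let walk_prob_cvg J l i j : (forall n, epoch_list (F n) J (l n)) ->
  value l i j n @[n --> \oo] --> wp J i j.
Proof.
move=> El; pose a n w := if all (mem (F n)) [:: i, j & w] then pp J i w j else 0.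
have cv : (fun n => \esum_(w in [set: seq (site d)]) (a n w)%:E)%E @ \oo -->
    (\esum_(w in [set: seq (site d)]) (pp J i w j)%:E)%E.
  apply: esum_nondecreasing_cvg => [n w _|n w _|w _]; rewrite /a.
  - by case: ifP => // _; exact: path_prob_ge0.
  - case: ifPn => [/allP h|_]; last by case: ifP => // _; exact: path_prob_ge0.
    by rewrite ifT//; apply/allP => k /h; exact: eF.1.
  - have [n0 h] := exhausts_subset [fset k in [:: i, j & w]]%fset eF.
    apply: cvg_near_cst; exists n0 => // n /= /h sub; rewrite ifT//.
    have sub' k : k \in [:: i, j & w] -> k \in F n by move=> kw; apply: sub; rewrite in_fset.
    apply/and3P; split; [apply: sub'|apply: sub'|apply/allP => k kw; apply: sub'];
      by rewrite !inE ?eqxx ?orbT// kw !orbT.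
(* The values in finite boxes are at most 1, hence so is their limit. *)
have fin : (\esum_(w in [set: seq (site d)]) (pp J i w j)%:E)%E \is a fin_num.
  rewrite ge0_fin_numE; last by apply: esum_ge0 => w _; rewrite lee_fin path_prob_ge0.
  apply: (@le_lt_trans _ _ 1%E); last by rewrite ltry.
  rewrite -(cvg_lim _ cv)//; apply: lime_le; first by apply/cvg_ex; eexists; exact: cv.
  by apply: nearW => n; rewrite (value_esum _ _ _ El) lee_fin.
move: cv; rewrite -(fineK fin) => /fine_cvgP[_].
by apply: cvg_trans; apply: near_eq_cvg; apply: nearW => n; rewrite /= (value_esum _ _ _ El).
Qed.

Variables (t : R) (l : nat -> seq label).
Hypothesis El : forall n, epoch_list (F n) `[0, t]%classic (l n).

Let after e n := [seq e' <- l n | tau e < tau e'].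

Let ElA e : 0 <= tau e -> forall n, epoch_list (F n) `]tau e, t]%classic (after e n).
Proof. by move=> e0 n; exact: epoch_list_after. Qed.

Let D := [set e | tau e \in `[0, t]].
Let D0 e : D e -> 0 <= tau e. Proof. by rewrite /D/= in_itv/= => /andP[]. Qed.

Let dual_e i (zeta : label -> R) :=
  (\esum_(e in D) (wp `]tau e, t]%classic i e.1 * zeta e)%:E)%E.
Let dual_z i (z : site d -> R) :=
  (\esum_(j in [set: site d]) (wp `[0, t]%classic i j * z j)%:E)%E.

(** Monotone convergence over growing boxes. The limit is taken in the extended reals and may be
    infinite; [eta_limit] settles finiteness by a moment bound. *)
Lemma evolve_cvg_ge0 z zeta i : (forall j, 0 <= z j) -> (forall e, 0 <= zeta e) ->
  (fun n => (evolve (l n) (cutoff (F n) z) zeta i)%:E) @ \oo -->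
  (dual_e i zeta + dual_z i z)%E.
Proof.
move=> z0 zeta0.
have ce : (fun n => \esum_(e in D) (value (after e) i e.1 n * zeta e)%:E)%E @ \oo --> dual_e i zeta.
  apply: esum_nondecreasing_cvg => [n e De|n e De|e De].
  - by rewrite mulr_ge0.
  - by rewrite ler_wpM2r//; apply: value_nondecreasing; exact: ElA (D0 De).
  - by apply: cvgMl; apply: walk_prob_cvg; exact: ElA (D0 De).
have cz : (fun n => \esum_(j in [set: site d]) (value l i j n * z j)%:E)%E @ \oo --> dual_z i z.
  apply: esum_nondecreasing_cvg => [n j _|n j _|j _].
  - by rewrite mulr_ge0.
  - by rewrite ler_wpM2r//; apply: value_nondecreasing; exact: El.
  - by apply: cvgMl; apply: walk_prob_cvg; exact: El.
have wp0 J k j : 0 <= wp J k j.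
  by apply: fine_ge0; apply: esum_ge0 => w _; rewrite lee_fin path_prob_ge0.
have de0 : (0 <= dual_e i zeta)%E by apply: esum_ge0 => e _; rewrite lee_fin mulr_ge0.
have dz0 : (0 <= dual_z i z)%E by apply: esum_ge0 => e _; rewrite lee_fin mulr_ge0.
apply: cvg_trans (cvgeD _ ce cz); last by apply: ge0_adde_def; rewrite inE.
apply: near_eq_cvg; have [n0 h] := exhausts_subset [fset i]%fset eF.
exists n0 => // n /= /h /(_ i); rewrite inE eqxx => /(_ isT) iF.
rewrite (evolve_cutoff _ _ _ (El n)) EFinD -!sumEFin; congr (_ + _)%E.
- rewrite (@esum_uniq _ _ D (l n)); first apply: eq_big_seq => e /(El n).1[eF' _].
  + by rewrite /value iF eF'.
  + exact: epoch_list_uniq (El n).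
  + by move=> e /(El n).1[].
  + by move=> e _; rewrite lee_fin mulr_ge0.
  + move=> e De el; rewrite /value iF/=; case: ifPn; last by rewrite mul0r.
    by move=> eF'; move: el; rewrite (_ : e \in l n)//; apply/(El n).1.
- rewrite (@esum_uniq _ _ setT (F n)) ?fset_uniq//.
  + by apply: eq_big_seq => j jF; rewrite /value iF jF.
  + by move=> j _; rewrite lee_fin mulr_ge0.
  + by move=> j _ jF; rewrite /value iF (negbTE jF) mul0r.
Qed.

Lemma evolve_cvg_dual z zeta i :
  (dual_e i (fun e => `|zeta e|%R) + dual_z i (fun j => `|z j|%R) < +oo)%E ->
  evolve (l n) (cutoff (F n) z) zeta i @[n --> \oo] -->
  asum D (fun e => wp `]tau e, t]%classic i e.1 * zeta e) +
  asum [set: site d] (fun j => wp `[0, t]%classic i j * z j).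
Proof.
move=> fin.
have wp0 J k j : 0 <= wp J k j.
  by apply: fine_ge0; apply: esum_ge0 => w _; rewrite lee_fin path_prob_ge0.
have de0 zt : (forall e, 0 <= zt e) -> (0 <= dual_e i zt)%E.
  by move=> zt0; apply: esum_ge0 => e _; rewrite lee_fin mulr_ge0.
have dz0 v : (forall e, 0 <= v e) -> (0 <= dual_z i v)%E.
  by move=> v0; apply: esum_ge0 => e _; rewrite lee_fin mulr_ge0.
(* The signs s = 1 and s = -1 select the positive and negative parts of noise and start, which are
   run separately and subtracted by linearity. *)
have main (s : R) (zt := fun e => Num.max (s * zeta e) 0) (v := fun j => Num.max (s * z j) 0) :
    `|s| <= 1 ->
    evolve (l n) (cutoff (F n) v) zt i @[n --> \oo] --> fine (dual_e i zt) + fine (dual_z i v).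
  move=> s1.
  have maxle r : Num.max (s * r) 0 <= `|r|.
    by rewrite (le_trans (max0_le_norm _))// normrM ler_piMl.
  have zt0 e : 0 <= zt e by exact: max0_ge0.
  have v0 j : 0 <= v j by exact: max0_ge0.
  have le1 : (dual_e i zt <= dual_e i (fun e => `|zeta e|%R))%E.
    by apply: le_esum => e _; rewrite lee_fin; apply: ler_wpM2l => //; exact: maxle.
  have le2 : (dual_z i v <= dual_z i (fun e => `|z e|%R))%E.
    by apply: le_esum => e _; rewrite lee_fin; apply: ler_wpM2l => //; exact: maxle.
  have fe : dual_e i zt \is a fin_num.
    rewrite ge0_fin_numE ?de0// (le_lt_trans le1)// (le_lt_trans _ fin)//.
    by rewrite leeDl// dz0.
  have fz : dual_z i v \is a fin_num.
    rewrite ge0_fin_numE ?dz0// (le_lt_trans le2)// (le_lt_trans _ fin)//.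
    by rewrite leeDr// de0.
  have := @evolve_cvg_ge0 v zt i v0 zt0; rewrite -(fineK fe) -(fineK fz) -EFinD.
  by move=> /fine_cvgP[].
have E1 J (i' j' : site d) (r : R) : Num.max (wp J i' j' * r) 0 = wp J i' j' * Num.max (1 * r) 0.
  by rewrite mul1r maxr_pMr// mulr0.
have E2 J (i' j' : site d) (r : R) : Num.max (- (wp J i' j' * r)) 0 = wp J i' j' * Num.max (-1 * r) 0.
  by rewrite mulN1r maxr_pMr// mulr0 mulrN.
rewrite [X in _ --> X](_ : _ =
    (fine (dual_e i (fun e => Num.max (1 * zeta e) 0)) +
     fine (dual_z i (fun j => Num.max (1 * z j) 0))) -
    (fine (dual_e i (fun e => Num.max (-1 * zeta e) 0)) +
     fine (dual_z i (fun j => Num.max (-1 * z j) 0)))); last first.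
  rewrite /asum opprD [RHS]addrACA; congr (fine _ - fine _ + (fine _ - fine _));
  by apply: eq_esum => e _; rewrite ?E1 ?E2.
rewrite (_ : (fun n => _) = fun n =>
    evolve (l n) (cutoff (F n) (fun j => Num.max (1 * z j) 0)) (fun e => Num.max (1 * zeta e) 0) i -
    evolve (l n) (cutoff (F n) (fun j => Num.max (-1 * z j) 0)) (fun e => Num.max (-1 * zeta e) 0) i).
  by apply: cvgB; apply: main; rewrite ?normrN1 ?normr1.
apply/funext => n.
rewrite -[X in _ - X]mul1r -mulNr -(congr1 (fun h => h i) (evolve_lin _ _ _ _ _ _ _ _ _)).
congr (evolve _ _ _ i).
  apply/funext => j; rewrite /cutoff; case: ifP => _; last by rewrite mulr0 addr0.
  by rewrite !mulN1r mul1r max0B.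
by apply/funext => e; rewrite !mulN1r mul1r max0B.
Qed.

End duality.

(** * Poisson epochs and marks *)

Section independent_fiber.
Context d d' (Omega : measurableType d) (T' : measurableType d') (R : realType).
Variables (P : probability Omega R) (X : Omega -> T') (m : probability T' R).
Hypothesis mX : measurable_fun setT X.
Local Open Scope ereal_scope.

Lemma integral_indep (F : set Omega) (Phi : T' -> \bar R) : measurable F ->
  (forall A, measurable A -> P (F `&` X @^-1` A) = P F * m A) ->
  measurable_fun (U := \bar R) setT Phi -> (forall x, 0 <= Phi x) ->
  \int[P]_w ((\1_F w)%:E * Phi (X w)) = P F * \int[m]_x Phi x.
Proof.
move=> mF indep mPhi Phi0.
pose nu_ : {measure set T' -> \bar R} := pushforward (mrestr P mF) X.
pose nu : {measure set T' -> \bar R} := nu_ mX.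
have PF : P F \is a fin_num by exact: fin_num_measure.
have mPX : measurable_fun (U := \bar R) setT (fun w => Phi (X w)) := measurableT_comp mPhi mX.
transitivity (\int[mrestr P mF]_w Phi (X w)).
  rewrite (@ge0_integral_density _ _ _ P (mrestr P mF) (\1_F))//.
  - by apply: eq_integral => w _; rewrite muleC.
  - by apply/measurable_EFinP; exact: measurable_indic.
  - by move=> A mA; rewrite integral_indic// setIC.
transitivity (\int[nu]_x Phi x).
  by rewrite ge0_integral_pushforward.
rewrite (@ge0_integral_density _ _ _ m nu (fun=> fine (P F)))//.
- by rewrite ge0_integralZr ?lee_fin ?fine_ge0// fineK// muleC.
- by move=> x; rewrite lee_fin fine_ge0.
- by move=> A mA; rewrite integral_cst// fineK// -indep// setIC.
Qed.

Variables (C : countType) (phi : Omega -> C) (Phi : C -> T' -> \bar R).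
Hypothesis mphi : forall c, measurable (phi @^-1` [set c]).
Hypothesis mPhi : forall c, measurable_fun (U := \bar R) setT (Phi c).
Hypothesis Phi0 : forall c x, 0 <= Phi c x.

Let F n : set Omega :=
  if (choice.pickle_inv n : option C) is Some c then phi @^-1` [set c] else set0.
Let g n w := if (choice.pickle_inv n : option C) is Some c
  then (\1_(F n) w)%:E * Phi c (X w) else 0.

Let gE w : Phi (phi w) (X w) = \sum_(n <oo) g n w.
Proof.
have g0 n : 0 <= g n w.
  by rewrite /g; case: choice.pickle_inv => // c; rewrite mule_ge0// lee_fin.
rewrite nneseries_esumT// (@esum_uniq _ _ setT [:: choice.pickle (phi w)])//.
  by rewrite big_seq1 /g /F choice.pickleK_inv indicE mem_set// mul1e.
move=> n _ nw; rewrite /g /F; case E: choice.pickle_inv => [c|]//.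
rewrite indicE memNset ?mul0e//= => wc; move: nw; rewrite inE wc.
by have := @choice.pickle_invK C n; rewrite E /= => ->; rewrite eqxx.
Qed.


Let mg n : measurable_fun (U := \bar R) setT (g n).
Proof.
rewrite /g /F; case: choice.pickle_inv => [c|]; last exact: measurable_cst.
apply: emeasurable_funM; first by apply/measurable_EFinP; exact: measurable_indic.
exact: (measurableT_comp (mPhi c) mX).
Qed.

Let g0 n w : 0 <= g n w.
Proof. by rewrite /g; case: choice.pickle_inv => // c; rewrite mule_ge0// lee_fin. Qed.

Hypothesis indep : forall c A, measurable A ->
  P (phi @^-1` [set c] `&` X @^-1` A) = P (phi @^-1` [set c]) * m A.

Lemma integral_fiber_sum : \int[P]_w Phi (phi w) (X w) = \sum_(n <oo)
  (if (choice.pickle_inv n : option C) is Some c then P (F n) * \int[m]_x Phi c x else 0).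
Proof.
under eq_integral do rewrite gE.
rewrite integral_nneseries//; apply: eq_eseriesr => n _.
rewrite /g /F; case E: choice.pickle_inv => [c|]; last by rewrite integral0.
by apply: integral_indep => //; exact: indep.
Qed.

End independent_fiber.

(** [phi] takes countably many values, so a sum over its fibres, each independent of [X], does the
    work of conditioning. *)
Lemma integral_fiber d d' (Omega : measurableType d) (T' : measurableType d') (R : realType)
    (P : probability Omega R) (X : Omega -> T') (m : probability T' R) (C : countType)
    (phi : Omega -> C) (Phi : C -> T' -> \bar R) :
  measurable_fun setT X -> (forall c, measurable (phi @^-1` [set c])) ->
  (forall c, measurable_fun (U := \bar R) setT (Phi c)) -> (forall c x, 0 <= Phi c x)%E ->
  (forall c A, measurable A ->
    P (phi @^-1` [set c] `&` X @^-1` A) = P (phi @^-1` [set c]) * m A)%E ->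
  (\int[P]_w Phi (phi w) (X w) = \int[P]_w \int[m]_x Phi (phi w) x)%E.
Proof.
move=> mX mphi mPhi Phi0 indep; rewrite (integral_fiber_sum mX _ _ _ indep)//.
rewrite (@integral_fiber_sum _ _ _ _ _ P X m mX _ phi (fun c _ => \int[m]_x Phi c x)%E)//.
- apply: eq_eseriesr => n _; case: choice.pickle_inv => // c.
  rewrite integral_cst//; have m1 : m setT = 1%E by exact: probability_setT.
  by rewrite [X in (_ = _ * (_ * X))%E]m1 mule1.
- by move=> c x; exact: integral_ge0.
Qed.

(** * Counts, local finiteness and absence of ties *)

Section epochs.
Context (R : realType) (d : nat) (dO : measure_display) (Omega : measurableType dO)
  (P : probability Omega R) (T xi : site d -> nat -> Omega -> R).
Hypothesis mp : marked_poisson P T xi.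
Local Notation label := (site d * nat)%type.
Local Notation RB := (measurableTypeR R).
Implicit Types (A : {fset site d}) (L : seq label) (B : site d -> set R) (e : label).

Definition epoch_time w e := T e.1 e.2 w.
Local Notation tau := epoch_time.

Definition time_event := sigma_generated [set: label] (fun e w => T e.1 e.2 w).

Lemma time_event_measurable E : time_event E -> measurable E.
Proof.
apply: (@sigma_generated_min R _ _ setT _ measurable); first exact: sigma_algebra_measurable.
by move=> e C _ mC; have := mp_time mp e.1 e.2 measurableT mC; rewrite setTI.
Qed.

Lemma time_event_at e (C : set R) : measurable C -> time_event [set w | C (tau w e)].
Proof. by move=> mC; apply: (@sigma_generated_gen R _ _ setT). Qed.

Lemma time_event_if (b : bool) E : time_event E -> time_event [set w | b <-> E w].
Proof.
case: b => tE.
  by rewrite (_ : [set w | _] = E)//; apply/seteqP; split=> w //=; case=> + _; exact.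
rewrite (_ : [set w | _] = ~` E); first exact: sigma_generatedC.
by apply/seteqP; split=> w /=; [case=> _ h /h|move=> h; split].
Qed.

Lemma time_event_lt e e' : time_event [set w | tau w e' < tau w e].
Proof.
rewrite (_ : [set w | _] = \bigcup_(q : rat)
    ([set w | `]-oo, ratr q[%classic (tau w e')] `&` [set w | `]ratr q, +oo[%classic (tau w e)])).
  by apply: sigma_generated_bigcup => q; apply: sigma_generatedI;
    apply: time_event_at; exact: measurable_itv.
apply/seteqP; split=> [w /= /rat_in_itvoo[q]|w [q _ []]] /=.
  by rewrite !in_itv/= => /andP[h1 h2]; exists q => //; rewrite /= !in_itv/= andbT.
by rewrite !in_itv/= andbT; exact: lt_trans.
Qed.

Definition hits B w : set label := [set e | B e.1 (tau w e)].

Lemma time_event_hits B (S : {fset label}) : (forall j, measurable (B j)) ->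
  time_event [set w | hits B w = [set` S]].
Proof.
move=> mB; rewrite (_ : [set w | _] = \bigcap_(e : label)
    [set w | (e \in S) <-> [set w | B e.1 (tau w e)] w]).
  by apply: sigma_generated_bigcap => e; apply: time_event_if; exact: time_event_at.
apply/seteqP; split=> w /=.
  by move=> h e _; rewrite /= -[B _ _]/(hits B w e) h.
by move=> h; apply/seteqP; split=> e /= /(h e I).
Qed.

Definition count_is B k := [set w | counting (hits B w) = k%:R%:E :> \bar R].

Lemma count_isP B k w : count_is B k w <->
  exists2 S : {fset label}, #|` S| = k & hits B w = [set` S].
Proof.
rewrite /count_is /= /counting; split=> [|[S Sk ->]]; last first.
  by case: asboolP => [_|/(_ (finite_fset S))//]; rewrite set_fsetK Sk.
case: asboolP => // finS [/eqP]; rewrite eqr_nat => /eqP <-.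
by exists (fset_set (hits B w)) => //; rewrite fset_setK.
Qed.

Lemma time_event_count B k : (forall j, measurable (B j)) -> time_event (count_is B k).
Proof.
move=> mB; rewrite (_ : count_is B k = \bigcup_(S : {fset label})
    (if #|` S| == k then [set w | hits B w = [set` S]] else set0)).
  apply: sigma_generated_bigcup => S; case: ifP => _; first exact: time_event_hits.
  exact: sigma_algebra0.
apply/seteqP; split=> w.
  by move=> /count_isP[S /eqP Sk hS]; exists S => //; rewrite Sk.
by move=> [S _]; case: ifP => //= /eqP Sk hS; apply/count_isP; exists S.
Qed.

Definition slab A (a b : R) : site d -> set R :=
  fun j => if j \in A then `[a, b[%classic else set0.

Lemma measurable_slab A a b j : measurable (slab A a b j).
Proof. by rewrite /slab; case: ifP => _; [exact: measurable_itv|exact: measurable0]. Qed.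

Lemma slabP A a b w e : hits (slab A a b) w e <-> e.1 \in A /\ a <= tau w e < b.
Proof.
by rewrite /hits /slab /=; case: ifP => eA /=; [rewrite in_itv/=; split=> [|[]]|split=> [|[]]].
Qed.

Lemma count_slab A a b k (lam := #|` A|%:R * (b - a)) : a <= b ->
  P (count_is (slab A a b) k) = (lam ^+ k / k`!%:R * expR (- lam))%:E.
Proof.
move=> ab.
have := mp_poisson mp (m := 1) (B := fun=> [set q | slab A a b q.1 q.2]) (lam := fun=> lam)
  (fun=> k).
rewrite big_ord1 => <-; first congr (P _).
- apply/seteqP; split=> w /=; last by move=> /(_ ord0).
  by move=> h _.
- by move=> _ j; exact: measurable_slab.
- by move=> i j _ _ _; rewrite !ord1.
- move=> _; rewrite (@esum_uniq _ _ setT A) ?fset_uniq//.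
  + rewrite (eq_big_seq (fun=> (b - a)%:E)) => [|j jA].
      by rewrite sumEFin /lam big_const_seq count_predT iter_addr_0 mulr_natl.
    have -> : [set s | [set q : site d * R | slab A a b q.1 q.2] (j, s)] = `[a, b[%classic.
      by rewrite /= /slab jA.
    by rewrite lebesgue_measure_itv/= lte_fin; case: ltgtP ab => // -> _; rewrite subrr.
  + by move=> j _ jA; rewrite /= /slab (negbTE jA) measure0.
Qed.

Lemma void_slab A a b : a <= b ->
  P [set w | forall e, e.1 \in A -> ~~ (a <= T e.1 e.2 w < b)] =
  (expR (- (#|` A|%:R * (b - a))))%:E.
Proof.
move=> ab; rewrite -[expR _]mul1r -[X in (X * _)%:E](_ : (#|` A|%:R * (b - a)) ^+ 0 / 0`!%:R = 1).
  rewrite -(count_slab _ 0 ab); congr (P _); apply/seteqP; split=> w.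
    move=> h; apply/count_isP; exists fset0 => //; apply/seteqP; split=> e //.
    by move=> /slabP[eA et]; have := h e eA; rewrite et.
  move=> /count_isP[S /eqP]; rewrite cardfs_eq0 => /eqP -> h e eA; apply/negP => et.
  suff : [set` (fset0 : {fset label})] e by [].
  by rewrite -h; apply/slabP.
by rewrite expr0 fact0 divr1.
Qed.

Lemma finite_slab A a b : 
  {ae P, forall w, finite_set (hits (slab A a b) w)}.
Proof.
have [ab|ba] := ltP a b; last first.
  apply: aeW => w; rewrite (_ : hits _ w = set0)//; apply/seteqP; split=> e // /slabP[_ /andP[h1 h2]].
  by have := le_lt_trans h1 h2; rewrite ltNge ba.
have [->|/fset0Pn[j jA]] := eqVneq A fset0.
  by apply: aeW => w; rewrite (_ : hits _ w = set0)//; apply/seteqP; split=> e // /slabP[].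
pose lam : R := #|` A|%:R * (b - a).
have lam0 : 0 < lam.
  by rewrite mulr_gt0 ?subr_gt0// ltr0n cardfs_gt0; apply/fset0Pn; exists j.
have mC k : measurable (count_is (slab A a b) k).
  by apply: time_event_measurable; apply: time_event_count => ?; exact: measurable_slab.
have mU : measurable (\bigcup_k count_is (slab A a b) k) by exact: bigcupT_measurable.
exists (~` \bigcup_k count_is (slab A a b) k); split; first exact: measurableC.
  rewrite probability_setC//.
  rewrite measure_semi_bigcup//; last first.
    apply/trivIsetP => k k' _ _ kk'; apply/seteqP; split=> w // [].
    rewrite /count_is/= => -> [/eqP]; rewrite eqr_nat => /eqP kE.
    by move: kk'; rewrite kE eqxx.
  (* The Poisson weights add up to 1, which leaves no mass for an infinite count. *)
  rewrite (_ : (\sum_(k <oo) _)%E = @poisson_prob R lam 0%N setT); last first.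
    rewrite /poisson_prob lam0 -nneseries_esumT; last by move=> *; rewrite lee_fin poisson_pmf_ge0.
    by apply: eq_eseriesr => k _; rewrite /poisson_pmf lam0; exact: count_slab (ltW ab).
  by rewrite (_ : poisson_prob _ _ _ = 1%E) ?subee//; exact: probability_setT.
move=> w /= h [k _ /count_isP[S _ hS]]; apply: h; rewrite hS; exact: finite_fset.
Qed.

Let multi A a b := ~` (count_is (slab A a b) 0 `|` count_is (slab A a b) 1).

Let multi_measurable A a b : measurable (multi A a b).
Proof.
by apply: measurableC; apply: measurableU; apply: time_event_measurable;
  apply: time_event_count => ?; exact: measurable_slab.
Qed.

(** From exp(-l) >= 1 - l follows 1 - exp(-l)(1 + l) <= l^2: two or more epochs in a slab are an
    event of second order. *)
Let multi_le A a b : a <= b -> (P (multi A a b) <= ((#|` A|%:R * (b - a)) ^+ 2)%:E)%E.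
Proof.
move=> ab; set lam := _ * (b - a).
have lam0 : 0 <= lam by rewrite mulr_ge0// subr_ge0.
have m k : measurable (count_is (slab A a b) k).
  by apply: time_event_measurable; apply: time_event_count => ?; exact: measurable_slab.
rewrite probability_setC; last exact: measurableU.
rewrite measureU//; last first.
  apply/seteqP; split=> w // []; rewrite /count_is/= => -> [/eqP].
  by rewrite eq_sym oner_eq0.
have c0 := count_slab A 0 ab; have c1 := count_slab A 1 ab.
apply: (@le_trans _ _ (1 - (expR (- lam) + lam * expR (- lam)))%:E).
  move: c0 c1; rewrite -/lam expr0 expr1 fact0 (_ : 1`! = 1)%N// !divr1 mul1r => c0 c1.
  by rewrite EFinB EFinD -c0 -c1.
rewrite lee_fin.
have h := expR_ge1Dx (- lam).
have : (1 - lam) * (1 + lam) <= expR (- lam) * (1 + lam) by rewrite ler_wpM2r// addr_ge0.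
rewrite expr2; lra.
Qed.

(** A tie before time [n] puts two distinct labels in one cell of length 1/(K+1). Each of the n(K+1)
    cells does so with probability at most (2/(K+1))^2, so the total is at most 4n/(K+1) for every
    [K]. *)
Lemma no_ties : {ae P, forall w, forall e e', 0 <= T e.1 e.2 w ->
  T e.1 e.2 w = T e'.1 e'.2 w -> e = e'}.
Proof.
suff h : {ae P, forall w, forall q : label * label * nat,
    q.1.1 != q.1.2 -> ~ (0 <= tau w q.1.1 < q.2%:R /\ tau w q.1.1 = tau w q.1.2)}.
  apply: filterS h => w h e e' e0 ee'; apply/eqP; apply: contrapT => /negP ne.
  apply: (h (e, e', (Num.truncn (tau w e)).+1) ne); split=> //=.
  by rewrite e0 truncnS_gt.
apply: ae_count => -[[e e'] n] /=.
have [->|ne] := eqVneq e e'; first exact: aeW.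
pose tie := [set w | 0 <= tau w e < n%:R /\ tau w e = tau w e'].
have mtau e1 : measurable_fun setT (fun w => tau w e1) by exact: mp_time mp _ _.
have mtie : measurable tie.
  rewrite (_ : tie = ((fun w => tau w e) @^-1` `[0, n%:R[%classic) `&`
    ((fun w => tau w e - tau w e') @^-1` [set 0])).
    apply: measurableI; first by rewrite -[X in measurable X]setTI; exact: mtau.
    by rewrite -[X in measurable X]setTI; apply: measurable_funB.
  apply/seteqP; split=> w; rewrite /tie /= in_itv/=.
    by move=> [-> ->]; rewrite subrr.
  by move=> [-> /eqP]; rewrite subr_eq0 => /eqP ->.
exists tie; split=> //; last first.
  by move=> w /= h; apply: contrapT => tw; apply: h => _.
pose A := [fset e.1; e'.1]%fset.
pose cell K l := multi A (l%:R / K.+1%:R) (l.+1%:R / K.+1%:R).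
have cover K : tie `<=` \big[setU/set0]_(l < n * K.+1) cell K l.
  move=> w [/andP[t0 tn] tt].
  pose l := Num.truncn (tau w e * K.+1%:R).
  have K0 : 0 < K.+1%:R :> R by [].
  have tK0 : 0 <= tau w e * K.+1%:R by rewrite mulr_ge0.
  have /andP[l1 l2] := truncn_itv tK0.
  have lt : (l < n * K.+1)%N.
    by rewrite -(ltr_nat R) (le_lt_trans l1)// natrM ltr_pM2r.
  rewrite -bigcup_mkord; exists l => //=; move=> Cl.
  have he : hits (slab A (l%:R / K.+1%:R) (l.+1%:R / K.+1%:R)) w e.
    by apply/slabP; rewrite !inE eqxx; split=> //; rewrite ler_pdivrMr// ltr_pdivlMr// l1.
  have he' : hits (slab A (l%:R / K.+1%:R) (l.+1%:R / K.+1%:R)) w e'.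
    apply/slabP; rewrite !inE eqxx orbT; split=> //.
    by rewrite -tt ler_pdivrMr// ltr_pdivlMr// l1.
  case: Cl => /count_isP[S Sk hS]; move: he he'; rewrite hS /= => eS e'S.
    by move/eqP: Sk; rewrite cardfs_eq0 => /eqP S0; rewrite S0 in eS.
  move/eqP: Sk => /cardfs1P[x Sx]; move: eS e'S; rewrite Sx !in_fset1 => /eqP ex /eqP e'x.
  by move: ne; rewrite ex e'x eqxx.
have bound K : (P tie <= ((n%:R * 4) / K.+1%:R)%:E)%E.
  have mc l : (l < n * K.+1)%N -> measurable (cell K l) by move=> _; exact: multi_measurable.
  apply: le_trans (@content_subadditive _ _ _ P _ _ _ mc mtie (cover K)) _.
  apply: (@le_trans _ _ (\sum_(l < n * K.+1) (4 / K.+1%:R ^+ 2)%:E)%E).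
    apply: lee_sum => l _.
    apply: le_trans (multi_le _ _) _; first by rewrite ler_pM2r ?invr_gt0// ler_nat.
    rewrite lee_fin -mulrBl -natrB// subSnn mul1r exprMn exprVn.
    rewrite ler_pM2r ?invr_gt0 ?exprn_gt0//.
    rewrite (_ : 4 = 2%:R ^+ 2 :> R); last by rewrite -natrX.
    by rewrite lerXn2r ?nnegrE// ler_nat /A cardfs2; case: (_ == _).
  rewrite sumEFin lee_fin sumr_const card_ord -[_ *+ (n * _)%N]mulr_natr natrM.
  have k0 : K.+1%:R != 0 :> R by rewrite pnatr_eq0.
  by rewrite le_eqVlt; apply/orP; left; apply/eqP; move: (K.+1%:R) k0 => k k0; field.
have Pf : P tie \is a fin_num by exact: fin_num_measure.
apply/eqP; rewrite eq_le measure_ge0 andbT -(fineK Pf) lee_fin leNgt; apply/negP => r0.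
pose K := Num.truncn (n%:R * 4 / fine (P tie)).
have := bound K; rewrite -{1}(fineK Pf) lee_fin leNgt => /negP; apply.
rewrite ltr_pdivrMr// [ltRHS]mulrC -ltr_pdivrMr//; exact: truncnS_gt.
Qed.

End epochs.

Lemma measurable_fun_fiber d d' (T : measurableType d) (T' : measurableType d') (C : countType)
    (phi : T -> C) (f : C -> T -> T') : (forall c, measurable (phi @^-1` [set c])) ->
  (forall c, measurable_fun setT (f c)) -> measurable_fun setT (fun w => f (phi w) w).
Proof.
move=> mphi mf _ B mB; rewrite setTI.
rewrite (_ : _ @^-1` B = \bigcup_(c : C) (phi @^-1` [set c] `&` f c @^-1` B)).
  apply: measurable_bigcup_count => c; apply: measurableI => //.
  by rewrite -[X in measurable X]setTI; exact: mf.
by apply/seteqP; split=> [w fw|w [c _ [/= <-]]//]; exists (phi w).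
Qed.

Section epoch_lists.
Context (R : realType) (d : nat) (tau : site d * nat -> R).
Implicit Types (A : {fset site d}) (J : set R).

Lemma epoch_list_unique A J L L' : epoch_list tau A J L -> epoch_list tau A J L' -> L = L'.
Proof.
move=> [EL pL] [EL' pL']; apply: (@irr_sorted_eq _ (fun e e' => tau e' < tau e)).
- by move=> e2 e1 e3 h1 h2; exact: lt_trans h2 h1.
- by move=> e; rewrite ltxx.
- exact: pairwise_sorted.
- exact: pairwise_sorted.
- by move=> e; apply/idP/idP => [/EL/EL'|/EL'/EL].
Qed.

Lemma epoch_list_exists A J (S := [set e | e.1 \in A /\ J (tau e)]) : finite_set S ->
  (forall e e', S e -> tau e = tau e' -> e = e') -> exists L, epoch_list tau A J L.
Proof.
move=> finS inj; pose r := fun e e' : site d * nat => tau e' <= tau e.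
have inS e : e \in sort r (fset_set S) <-> S e.
  by rewrite mem_sort in_fset_set// inE.
exists (sort r (fset_set S)); split; first by move=> e; rewrite inS.
have : pairwise [rel x y | r x y && (x != y)] (sort r (fset_set S)).
  rewrite pairwise_relI -sorted_pairwise; last by move=> e2 e1 e3 h1 h2; exact: le_trans h2 h1.
  rewrite sort_sorted; last by move=> e e'; exact: le_total.
  by rewrite -uniq_pairwise sort_uniq fset_uniq.
have allS : all (mem (sort r (fset_set S))) (sort r (fset_set S)) by apply/allP.
apply: (sub_in_pairwise _ allS) => e e' /inS Se _ /andP[ee' ne].
rewrite lt_neqAle (_ : tau e' <= tau e)// andbT; apply: contraNN ne => /eqP e'e.
by apply/eqP; apply: inj.
Qed.

End epoch_lists.

Section harness_path.
Context (R : realType) (d : nat) (alpha : R) (p : site d -> site d -> R)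
  (nb : site d -> {fset site d}) (rho : R) (u u' : site d -> R)
  (dat : cfg R (site d)).
Hypothesis hk : harness_kernel alpha p nb rho u u'.
Context (dO : measure_display) (Omega : measurableType dO)
  (P : probability Omega R) (T xi : site d -> nat -> Omega -> R).
Hypothesis mp : marked_poisson P T xi.
Local Notation label := (site d * nat)%type.
Local Notation RB := (measurableTypeR R).
Local Notation G := (@normal_prob R 0 1).
Local Notation tau := (epoch_time T).
Local Notation noise := (@noise R d alpha dat nat).
Local Notation evolve := (@evolve R d alpha p nb nat).
Local Notation heats := (heats alpha p dat).
Local Notation QL := (QL alpha p nb).
Local Notation Pavg := (Pavg p nb).
Implicit Types (A : {fset site d}) (L : seq label) (t : R) (z w : site d -> R).

(** With ties or infinitely many epochs no [epoch_list] exists and the default [[::]] is taken;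
    [recent_spec] confines this to a null set. *)
Definition recent A t (o : Omega) : seq label :=
  xget [::] [set L | epoch_list (tau o) A `[0, t]%classic L].

Lemma recent_uniq A t o : uniq (recent A t o).
Proof. by rewrite /recent; case: xgetP => // L _; exact: epoch_list_uniq. Qed.

Let time_event_pairwise L : time_event T [set o | pairwise (fun e e' => tau o e' < tau o e) L].
Proof.
elim: L => [|e L IH].
  by rewrite (_ : [set o | _] = setT); [exact: sigma_generatedT|apply/seteqP; split].
rewrite (_ : [set o | _] = [set o | all (fun e' => tau o e' < tau o e) L] `&`
    [set o | pairwise (fun e e' => tau o e' < tau o e) L]); last first.
  by apply/seteqP; split=> o /= /andP.
apply: sigma_generatedI => //; elim: L {IH} => [|e' L IH].
  by rewrite (_ : [set o | _] = setT); [exact: sigma_generatedT|apply/seteqP; split].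
rewrite (_ : [set o | _] = [set o | tau o e' < tau o e] `&`
    [set o | all (fun e' => tau o e' < tau o e) L]); last first.
  by apply/seteqP; split=> o /= /andP.
by apply: sigma_generatedI => //; exact: time_event_lt.
Qed.

Let time_event_list A t L : time_event T [set o | epoch_list (tau o) A `[0, t]%classic L].
Proof.
have te e : time_event T [set o | (e \in L) <->
    (if e.1 \in A then [set o | `[0, t]%classic (tau o e)] else set0) o].
  apply: time_event_if; case: ifP => _; first by apply: time_event_at; exact: measurable_itv.
  exact: sigma_algebra0.
rewrite (_ : [set o | _] = (\bigcap_(e : label) [set o | (e \in L) <->
    (if e.1 \in A then [set o | `[0, t]%classic (tau o e)] else set0) o]) `&`
    [set o | pairwise (fun e e' => tau o e' < tau o e) L]).
  apply: sigma_generatedI; last exact: time_event_pairwise.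
  exact: (sigma_generated_bigcap te).
apply/seteqP; split=> o /=.
  move=> [EL pL]; split=> // e _ /=; rewrite EL.
  by case: ifP => eA; split=> [[]|].
move=> [EL pL]; split=> // e; have [h1 h2] := EL e I.
case: ifP h1 h2 => eA h1 h2; split.
- by move=> /h1.
- by move=> [_ /h2].
- by move=> /h1.
- by move=> [].
Qed.

Lemma time_event_recent A t L : time_event T (recent A t @^-1` [set L]).
Proof.
have E L' o : epoch_list (tau o) A `[0, t]%classic L' -> recent A t o = L'.
  move=> EL; apply: xget_subset1 => // L1 L2; exact: epoch_list_unique.
have E' L' : L' != [::] -> recent A t @^-1` [set L'] = [set o | epoch_list (tau o) A `[0, t]%classic L'].
  move=> L0; apply/seteqP; split=> o /=; last exact: E.
  by rewrite /recent; case: xgetP => [L1 -> /= h <-//|_ L'0]; move: L0; rewrite -L'0.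
have [->|L0] := eqVneq L [::]; last by rewrite E'//; exact: time_event_list.
(* [[::]] is also the default value, so its fibre is obtained as the complement of all the
   others. *)
rewrite (_ : _ @^-1` _ = ~` \bigcup_(L' : label * seq label)
   (recent A t @^-1` [set L'.1 :: L'.2])).
  apply: sigma_generatedC; apply: sigma_generated_bigcup => L';
    rewrite E'//; exact: time_event_list.
apply/seteqP; split=> o /=; first by move=> o0 [L' _]; rewrite /= o0.
by case E0 : (recent A t o) => [//|e L'] h; exfalso; apply: h; exists (e, L').
Qed.

Let measurable_recent A t L : measurable (recent A t @^-1` [set L]).
Proof. by apply: (time_event_measurable mp); exact: time_event_recent. Qed.

Lemma recent_spec (F : nat -> {fset site d}) t :
  {ae P, forall o, forall n, epoch_list (tau o) (F n) `[0, t]%classic (recent (F n) t o)}.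
Proof.
have fin : {ae P, forall o, forall n, finite_set (hits T (slab (F n) 0 (t + 1)) o)}.
  by apply: ae_count => n; exact: (finite_slab mp).
apply: filterS2 fin (no_ties mp) => o fin tie n.
apply: (@xgetPex _ [::] [set L | epoch_list (tau o) (F n) `[0, t]%classic L]).
apply: epoch_list_exists.
  apply: sub_finite_set (fin n) => e /= [eF]; rewrite in_itv/= => /andP[e0 et].
  by apply/slabP; split=> //; rewrite e0 (le_lt_trans et)// ltrDl.
by move=> e e' [_ /=]; rewrite in_itv/= => /andP[e0 _]; exact: tie.
Qed.

Definition marks (o : Omega) : cfg R label := fun e => xi e.1 e.2 o.

Lemma measurable_marks : measurable_fun setT marks.
Proof. by apply: measurable_fun_cfg => e; exact: mp_mark mp _ _. Qed.

Variable gam : probability (cfg R label) R.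
Hypothesis gamE : forall (S : {fset label}) (A : label -> set RB),
  (forall e, measurable (A e)) ->
  gam [set x | forall e, e \in S -> A e (x e)] = (\prod_(e <- S) G (A e))%E.

(** [mp_marks_iid] is the product formula on boxes; for fixed [E] both sides are finite measures in
    [B], determined by the boxes. *)
Lemma marks_indep E B : time_event T E -> measurable B ->
  P (E `&` marks @^-1` B) = (P E * gam B)%E.
Proof.
move=> tE mB; have mE := time_event_measurable mp tE.
have PE : P E \is a fin_num by exact: fin_num_measure.
pose m1_ : {measure set (cfg R label) -> \bar R} := pushforward (mrestr P mE) marks.
pose m1 : {measure set (cfg R label) -> \bar R} := m1_ measurable_marks.
have PE0 : 0 <= fine (P E) by rewrite fine_ge0.
pose m2 : {measure set (cfg R label) -> \bar R} := mscale (NngNum PE0) gam.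
suff : m1 B = m2 B.
  rewrite /m1 /m2 /m1_ /= /mscale /= /pushforward /mrestr fineK// setIC => <-//.
apply: cfg_measure_unique mB => [|S a].
  rewrite (_ : m1 setT = P E) ?(le_lt_trans (probability_le1 P mE)) ?ltry//.
  by rewrite /m1 /m1_ /= /pushforward /mrestr preimage_setT setTI.
rewrite /m1 /m2 /m1_ /= /mscale /= /pushforward /mrestr fineK//.
pose I e : set RB := `[a e, +oo[%classic.
have mI e : measurable (I e) by exact: measurable_itv.
rewrite setIC; apply: etrans (etrans (mp_marks_iid mp S tE mI) _).
  congr (P (_ `&` _)); apply/seteqP; split=> o /= h e /h;
  by rewrite /I/= in_itv/= andbT.
rewrite -gamE//; congr (_ * gam _)%E; apply/seteqP; split=> x /= h e /h;
by rewrite /I/= in_itv/= andbT.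
Qed.

Lemma measurable_evolve_recent A t z :
  measurable_fun setT (fun o => evolve (recent A t o) z (noise (marks o)) : cfg R (site d)).
Proof.
apply: (@measurable_fun_fiber _ _ Omega (cfg R (site d)) _ (recent A t)
  (fun L o => evolve L z (noise (marks o)))) => // L.
apply: (measurable_evolve dat hk); first exact: measurable_cst.
exact: measurable_marks.
Qed.

Let measurable_evolve_norm L z i : measurable_fun (U := \bar R) setT
  (fun x : cfg R label => (evolve L z (fun e => `|noise x e|) i)%:E).
Proof.
apply/measurable_EFinP; elim: L i => [|e L IH] i /=; first exact: measurable_cst.
rewrite /update; case: eqP => _ //; apply: measurable_funD.
  apply: measurable_funM => //; apply: measurable_sum => j; exact: measurable_funM.
apply: measurableT_comp => //; apply: measurable_funD => //; exact: measurable_cfg_eval.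
Qed.

Lemma evolve_recent_law A t f z : BLf f ->
  \int[P]_o f (evolve (recent A t o) z (noise (marks o))) =
  \int[P]_o heats (map fst (recent A t o)) f z.
Proof.
move=> fBL; have [mf [M fM]] := BL_bmf fBL.
have fM' x : 0 <= f x + M by have := fM x; rewrite ler_norml => /andP[? _]; lra.
have b1 : bmf (fun o => f (evolve (recent A t o) z (noise (marks o)))).
  split; last by exists M.
  by apply: (measurableT_comp mf); exact: measurable_evolve_recent.
have b2 : bmf (fun o => heats (map fst (recent A t o)) f z).
  split; last by exists M => o; exact: (heats_norm dat hk).
  by apply: (measurable_fun_fiber (f := fun L (_ : Omega) => heats (map fst L) f z)).
have bx L : bmf (fun x : cfg R label => f (evolve L z (noise x))).
  split; last by exists M.
  apply: (measurableT_comp mf); apply: (measurable_evolve dat hk) => //; exact: measurable_cst.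
have := @integral_fiber _ _ _ _ _ P marks gam _ (recent A t)
  (fun L x => (f (evolve L z (noise x)) + M)%:E) measurable_marks (measurable_recent A t).
have mPhi L : measurable_fun (U := \bar R) setT
    (fun x : cfg R label => (f (evolve L z (noise x)) + M)%:E).
  by apply/measurable_EFinP; apply: measurable_funD => //; exact: (bx L).1.
move=> /(_ mPhi) h.
have {}h := h (fun L x => fM' (evolve L z (noise x)))
  (fun L B mB => marks_indep (time_event_recent A t L) mB).
have bM := bmf_cst _ M.
have E o : (\int[gam]_x (f (evolve (recent A t o) z (noise x)) + M)%:E)%E =
    (heats (map fst (recent A t o)) f z + M)%:E.
  rewrite -EFin_Rint ?RintD ?Rint_cst//; try exact: bmfD.
  by rewrite (evolve_law dat hk gamE)//; exact: recent_uniq.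
move: h; under [in RHS]eq_integral do rewrite E.
rewrite -!EFin_Rint; try exact: bmfD.
by rewrite !RintD// !Rint_cst => -[] /addIr.
Qed.

Variable c : R.
Hypothesis c_ge0 : 0 <= c.
Hypothesis Gc : (\int[G]_z (`|z|%:E) <= c%:E)%E.

Lemma evolve_norm_moment L z w i : supersol alpha p nb dat c w -> (forall j, 0 <= z j <= w j) ->
  (\int[gam]_x (evolve L z (fun e => `|noise x e|) i)%:E <= (w i)%:E)%E.
Proof.
move=> [w0 ws] zw.
have ev0 L' x j : 0 <= evolve L' z (fun e => `|noise x e|) j.
  by apply: (evolve_ge0 hk) => // k; have /andP[] := zw k.
have a0 : 0 <= alpha by have /andP[/ltW] := hk_alpha hk.
elim: L i => [|e L IH] i /=.
  rewrite integral_cst//; have g1 : gam setT = 1%E by exact: probability_setT.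
  by rewrite [X in (_ * X)%E]g1 mule1 lee_fin; have /andP[] := zw i.
rewrite /update; case: eqP => [->|_]; last exact: IH.
apply: (@le_trans _ _ ((alpha * Pavg w e.1 + (c + `|dat e.1|))%:E)); last first.
  by rewrite lee_fin; exact: ws.
under eq_integral do rewrite EFinD.
rewrite ge0_integralD//; last 3 first.
- move=> x _; rewrite lee_fin mulr_ge0// sumr_ge0// => j _.
  by rewrite mulr_ge0// (hk_ge0 hk).
- apply/measurable_EFinP; apply: measurable_funM => //; apply: measurable_sum => j.
  by apply: measurable_funM => //; apply/measurable_EFinP; exact: measurable_evolve_norm.
- apply/measurable_EFinP; apply: measurableT_comp => //; apply: measurable_funD => //.
  exact: measurable_cfg_eval.
rewrite EFinD leeD//; last exact: (noise_moment dat hk gamE e Gc).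
under eq_integral do rewrite EFinM.
rewrite ge0_integralZl//; last 2 first.
- apply/measurable_EFinP; apply: measurable_sum => j.
  by apply: measurable_funM => //; apply/measurable_EFinP; exact: measurable_evolve_norm.
- by move=> x _; rewrite lee_fin sumr_ge0// => j _; rewrite mulr_ge0// (hk_ge0 hk).
rewrite EFinM lee_wpmul2l ?lee_fin// /Pavg.
under eq_integral do rewrite -sumEFin.
rewrite ge0_integral_sum//; last 2 first.
- move=> j; apply/measurable_EFinP.
  by apply: measurable_funM => //; apply/measurable_EFinP; exact: measurable_evolve_norm.
- by move=> j x _; rewrite lee_fin mulr_ge0// (hk_ge0 hk).
rewrite -sumEFin; apply: lee_sum => j _.
under eq_integral do rewrite EFinM.
rewrite ge0_integralZl ?lee_fin ?(hk_ge0 hk)//; last by move=> x _; rewrite lee_fin.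
by rewrite EFinM lee_wpmul2l ?lee_fin ?(hk_ge0 hk).
Qed.

Variable F : nat -> {fset site d}.
Hypothesis eF : exhausts F.

(** The duality needs finite absolute sums. In finite boxes these have means bounded by the
    supersolution [w], uniformly in the box, and Fatou's lemma passes to the lower limit, which is a
    true limit wherever the epochs are regular. *)
Lemma eta_limit t z w : supersol alpha p nb dat c w -> (forall j, `|z j| <= w j) ->
  {ae P, forall o, forall i,
    evolve (recent (F n) t o) (cutoff (F n) z) (noise (marks o)) i @[n --> \oo] -->
    Defs.eta alpha p dat T xi t z o i}.
Proof.
move=> ws zw.
pose X i n o := (evolve (recent (F n) t o) (cutoff (F n) (fun j => `|z j|))
  (fun e => `|noise (marks o) e|) i)%:E.
have z0 n j : 0 <= cutoff (F n) (fun j => `|z j|) j by rewrite /cutoff; case: ifP.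
have X0 i n o : (0 <= X i n o)%E by rewrite lee_fin (evolve_ge0 hk).
have mX i n : measurable_fun (U := \bar R) setT (X i n).
  apply: (measurable_fun_fiber (f := fun L o => (evolve L (cutoff (F n) (fun j => `|z j|))
    (fun e => `|noise (marks o) e|) i)%:E)) => // L.
  exact: (measurableT_comp (measurable_evolve_norm L _ i) measurable_marks).
have fin : {ae P, forall o, forall i, (limn_einf (X i ^~ o) < +oo)%E}.
  apply: ae_count => i.
  have mL : measurable_fun (U := \bar R) setT (fun o => limn_einf (X i ^~ o)).
    apply: (emeasurable_fun_cvg (fun n o => einfs (X i ^~ o) n)).
      exact: measurable_fun_einfs.
    by move=> o _; rewrite limn_einf_lim; exact: is_cvg_einfs.
  have L0 o : (0 <= limn_einf (X i ^~ o))%E.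
    rewrite limn_einf_lim; apply: lime_ge; first exact: is_cvg_einfs.
    by apply: nearW => n; apply: le_ereal_inf_tmp => _ [m _ <-].
  have /integrable_ae : P.-integrable setT (fun o => limn_einf (X i ^~ o)).
    apply/integrableP; split=> //.
    under eq_integral => x _ do rewrite gee0_abs//.
    apply: (@le_lt_trans _ _ (w i)%:E); last by rewrite ltry.
    apply: le_trans (fatou _ _ _ _) _ => //.
    rewrite limn_einf_lim; apply: lime_le; first exact: is_cvg_einfs.
    apply: nearW => n; apply: (@le_trans _ _ (\int[P]_o X i n o)%E).
      by apply: ereal_inf_lbound; exists n => /=.
    rewrite (@integral_fiber _ _ _ _ _ P marks gam _ (recent (F n) t)
      (fun L x => (evolve L (cutoff (F n) (fun j => `|z j|)) (fun e => `|noise x e|) i)%:E))//.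
    - apply: (@le_trans _ _ (\int[P]_o (cst (w i)%:E) o)%E); last first.
        rewrite integral_cst//; have P1 : P setT = 1%E by exact: probability_setT.
        by rewrite [X in (_ * X)%E]P1 mule1.
      apply: ge0_le_integral => //.
      + by move=> o _; apply: integral_ge0 => x _; rewrite lee_fin (evolve_ge0 hk).
      + exact: (measurable_fun_fiber (f := fun L (_ : Omega) => (\int[gam]_x (evolve L
          (cutoff (F n) (fun j => `|z j|)) (fun e => `|noise x e|) i)%:E)%E)).
      + move=> o _; apply: evolve_norm_moment => // j; rewrite z0 /=.
        by rewrite /cutoff; case: ifP => // _; exact: ws.1.
    - exact: measurable_marks.
    - by move=> L x; rewrite lee_fin (evolve_ge0 hk).
    - by move=> L B mB; apply: marks_indep => //; exact: time_event_recent.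
  move=> /(_ measurableT); apply: filterS => x /(_ I).
  by rewrite ge0_fin_numE.
apply: filterS2 fin (recent_spec F t) => o fin El i.
apply: (evolve_cvg_dual hk eF El).
have cv := @evolve_cvg_ge0 _ _ _ _ _ _ _ _ hk _ _ eF _ _ El (fun j => `|z j|)
  (fun e => `|noise (marks o) e|) i (fun=> normr_ge0 _) (fun=> normr_ge0 _).
apply: le_lt_trans (fin i); rewrite -(cvg_lim _ cv)//.
by rewrite is_cvg_limn_einfE//; apply/cvg_ex; eexists; exact: cv.
Qed.

End harness_path.

(** * Convergence of the semigroup *)

Section nonmeasurable_bounded.
Context d (T : measurableType d) (R : realType) (mu : probability T R).
Import HBNNSimple.

Let ge0_le (f g : T -> \bar R) : (forall x, 0 <= f x)%E -> (forall x, f x <= g x)%E ->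
  (\int[mu]_x f x <= \int[mu]_x g x)%E.
Proof.
move=> f0 fg; rewrite !ge0_integralTE//; last by move=> x; exact: le_trans (fg x).
apply: ge_ereal_sup => _ [h /= hf <-]; apply: ereal_sup_ubound; exists h => //= x.
exact: le_trans (hf x) (fg x).
Qed.

Variable M : R.

Let part_fin (f : T -> R) : (forall x, `|f x| <= M) ->
  (\int[mu]_x (EFin \o f)^\+ x)%E \is a fin_num /\ (\int[mu]_x (EFin \o f)^\- x)%E \is a fin_num.
Proof.
move=> fM; have bd (g : T -> \bar R) : (forall x, 0 <= g x)%E -> (forall x, g x <= M%:E)%E ->
    (\int[mu]_x g x)%E \is a fin_num.
  move=> g0 gM; rewrite ge0_fin_numE; last exact: integral_ge0.
  apply: le_lt_trans (ge0_le g0 gM) _; rewrite integral_cst//.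
  have m1 : mu setT = 1%E by exact: probability_setT.
  by rewrite [X in (_ * X)%E]m1 mule1 ltry.
have M0 (x : T) : 0 <= M by exact: le_trans (fM x).
split; apply: bd => x.
- by rewrite funeposE le_max lexx orbT.
- by rewrite funeposE/= -EFin_max lee_fin ge_max (M0 x) (le_trans (ler_norm _) (fM x)).
- by rewrite funenegE le_max lexx orbT.
- rewrite funenegE/= -EFin_max lee_fin ge_max (M0 x) andbT.
  by rewrite (le_trans (ler_norm _))// normrN.
Qed.

(** The integrals of the positive and negative parts are suprema over simple functions, hence
    monotone, and finite under the bound [M]. Order and sign can thus be used for the semigroup as a
    function of the start, where additivity is not at hand. *)
Lemma le_Rint_nonmeasurable (f g : T -> R) : (forall x, `|f x| <= M) ->
  (forall x, `|g x| <= M) -> (forall x, f x <= g x) -> \int[mu]_x f x <= \int[mu]_x g x.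
Proof.
move=> fM gM fg; have [fp fn] := part_fin fM; have [gp gn] := part_fin gM.
rewrite /Rintegral fine_le//.
- by rewrite integralE fin_numB; apply/andP; split; [exact: fp|exact: fn].
- by rewrite integralE fin_numB; apply/andP; split; [exact: gp|exact: gn].
rewrite integralE [leRHS]integralE; apply: leeB; apply: ge0_le => x.
- by rewrite funeposE le_max lexx orbT.
- by rewrite !funeposE/= -!EFin_max lee_fin ge_max !le_max (fg x) lexx orbT.
- by rewrite funenegE le_max lexx orbT.
- by rewrite !funenegE/= -!EFin_max lee_fin ge_max !le_max lerN2 (fg x) lexx orbT.
Qed.

Lemma RintN_nonmeasurable (f : T -> R) : (forall x, `|f x| <= M) ->
  \int[mu]_x (- f x) = - \int[mu]_x f x.
Proof.
move=> fM; have [fp fn] := part_fin fM; rewrite /Rintegral -fineN; congr fine.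
rewrite [in RHS]integralE fin_num_oppeB// integralE addeC.
by congr (- _ + _)%E; apply: eq_integral => x _; rewrite ?funeposE ?funenegE/= ?opprK.
Qed.

Lemma Rint_norm_nonmeasurable (f : T -> R) : (forall x, `|f x| <= M) ->
  `|\int[mu]_x f x| <= M.
Proof.
move=> fM; have M0 : 0 <= M by exact: le_trans (fM point).
have fMx x : - M <= f x <= M by rewrite -ler_norml.
rewrite ler_norml; apply/andP; split.
  rewrite -[leLHS](Rint_cst mu); apply: le_Rint_nonmeasurable => // x.
    by rewrite normrN ger0_norm.
  by have /andP[] := fMx x.
rewrite -[leRHS](Rint_cst mu); apply: le_Rint_nonmeasurable => // x.
  by rewrite ger0_norm.
by have /andP[] := fMx x.
Qed.

(** The limit agrees almost surely with the upper limit of the [f_ n], which is measurable. *)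
Lemma Rint_dct_nonmeasurable (f_ : nat -> T -> R) (f : T -> R) :
  (forall n, measurable_fun setT (f_ n)) -> (forall n x, `|f_ n x| <= M) ->
  {ae mu, forall x, f_ n x @[n --> \oo] --> f x} ->
  \int[mu]_x f_ n x @[n --> \oo] --> \int[mu]_x f x.
Proof.
move=> mf fM cf; pose g x := fine (limn_esup (fun n => (f_ n x)%:E)).
have mg : measurable_fun setT g.
  apply: (measurableT_comp (fine_measurable _)) => //.
  by apply: measurable_fun_limn_esup => n; exact/measurable_EFinP.
have fg : {ae mu, forall x, f x = g x}.
  apply: filterS cf => x cx; rewrite /g.
  have cE : (fun n => (f_ n x)%:E) @ \oo --> (f x)%:E.
    by apply: cvg_EFin => //; exact: nearW.
  rewrite is_cvg_limn_esupE; first by rewrite (cvg_lim _ cE).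
  by apply/cvg_ex; eexists; exact: cE.
rewrite [X in _ --> X](_ : _ = \int[mu]_x g x).
  apply: (Rint_dct (M := M)) => //; apply: filterS2 cf fg => x; first by move=> + <-.
rewrite /Rintegral; congr fine; apply: ae_eq_integral_nonmeasurable.
  exact/measurable_EFinP.
by apply: filterS fg => x ->.
Qed.

End nonmeasurable_bounded.

Lemma subseq_sorted_subset (T : eqType) (r : rel T) (s1 s2 : seq T) : transitive r ->
  irreflexive r -> sorted r s1 -> sorted r s2 -> {subset s1 <= s2} -> subseq s1 s2.
Proof.
move=> tr ir o1 o2 sub; rewrite (_ : s1 = [seq x <- s2 | x \in s1]) ?filter_subseq//.
apply: (irr_sorted_eq tr ir) => //; first exact: sorted_filter.
by move=> x; rewrite mem_filter /=; apply/idP/andP => [x1|[]//]; split=> //; exact: sub.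
Qed.

Section convergence.
Context (R : realType) (d : nat) (alpha : R) (p : site d -> site d -> R)
  (nb : site d -> {fset site d}) (rho : R) (u u' : site d -> R)
  (dat : cfg R (site d)).
Hypothesis hk : harness_kernel alpha p nb rho u u'.
Local Notation label := (site d * nat)%type.
Local Notation G := (@normal_prob R 0 1).
Local Notation tau := (epoch_time _).
Local Notation noise := (@noise R d alpha dat nat).
Local Notation evolve := (@evolve R d alpha p nb nat).
Local Notation heats := (heats alpha p dat).
Local Notation QL := (QL alpha p nb).
Implicit Types (A : {fset site d}) (L : seq label) (t : R) (z w : site d -> R).

Variable mu : probability (cfg R (site d)) R.
Hypothesis mu_heat : forall k, heat_invariant alpha p dat mu k.
Variable C0 : R.
Hypothesis mu_moment : moments_le mu (fun j => C0 * u j).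

(** Both the start [z] and a start drawn from [mu] are compared with the start 0, at the cost of C u
    and C0 u; dropping the updates of [L] that are not in [D] only enlarges [QL u]. *)
Lemma heats_near_mean (D L : seq (site d)) f F C' C z : BLf f -> 0 <= C' ->
  lipf (fun v => C' * \sum_(i <- F : {fset site d}) v i) f ->
  (forall j, `|z j| <= C * u j) -> subseq D L ->
  `|heats L f z - \int[mu]_x f x| <= C' * \sum_(i <- F) (C0 + C) * QL D u i.
Proof.
move=> fBL C'0 fL zC DL.
have h1 := heats_concentrate dat hk L fBL C'0 fL mu_moment.
rewrite (heats_invariant hk (fun k _ => mu_heat k) fBL) in h1.
have h2 := heats_lip dat hk L fBL (mono_sum F C'0) fL z (fun=> 0).
have u0 i : 0 <= u i by exact: ltW (u_gt0 hk i).
have CC : 0 <= C0 + C.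
  rewrite addr_ge0// -(pmulr_lge0 _ (u_gt0 hk 0)) ?(le_trans _ (zC 0))//.
  by have := mu_moment 0; rewrite -lee_fin; apply: le_trans; exact: integral_ge0.
apply: (@le_trans _ _ (C' * \sum_(i <- F) C * QL L u i + C' * \sum_(i <- F) C0 * QL L u i)).
  rewrite -[X in `|X|](subrKA (heats L f (fun=> 0))) (le_trans (ler_normD _ _))//.
  apply: lerD; last by rewrite distrC.
  apply: le_trans h2 _; apply: ler_wpM2l => //; apply: ler_sum => i _.
  rewrite -[leRHS](congr1 (fun h => h i) (QLZ _ _ _ _ _ _)).
  by apply: (QL_le hk) => j; rewrite subr0.
rewrite -mulrDr; apply: ler_wpM2l => //; rewrite -big_split/=; apply: ler_sum => i _.
rewrite -mulrDl (addrC C); apply: ler_wpM2l => //.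
exact: (QL_subseq hk (superharmonic_u hk)).
Qed.

Variable s : nat -> site d.
Hypothesis s_io : forall j n, exists2 m, (n <= m)%N & s m = j.

Context (dO : measure_display) (Omega : measurableType dO)
  (P : probability Omega R) (T xi : site d -> nat -> Omega -> R).
Hypothesis mp : marked_poisson P T xi.

(* The [l]-th of the [m] equal slices of [0, t], counted backwards from [t]. *)
Let lo t m l : R := t * (m - l.+1)%:R / m%:R.
Let hi t m l : R := t * (m - l)%:R / m%:R.

Definition slice_void t m l : set Omega :=
  [set o | forall e, e.1 \in [fset s l]%fset -> ~~ (lo t m l <= T e.1 e.2 o < hi t m l)].

(** One epoch of [s l] is picked in each slice. As the slices run backwards in time, these epochs
    come in the order of [recent], whose head is the latest. *)
Lemma subseq_recent t m A o : 0 <= t -> (forall l, (l < m)%N -> s l \in A) ->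
  epoch_list (epoch_time T o) A `[0, t]%classic (recent T A t o) ->
  (forall l, (l < m)%N -> ~ slice_void t m l o) ->
  subseq (sched s m) (map fst (recent T A t o)).
Proof.
move=> t0 sA [EL pL] nv.
have ex l : exists e : label, (l < m)%N -> e.1 = s l /\ lo t m l <= T e.1 e.2 o < hi t m l.
  have [lm|ml] := ltnP l m; last by exists (0, 0%N).
  have := nv l lm => /existsNP[e /not_implyP[]]; rewrite inE => /eqP es /negP/negPn te.
  by exists e.
have [e he] := choice ex.
have -> : sched s m = map fst (mkseq e m).
  rewrite /sched /mkseq -map_comp; apply/eq_in_map => l; rewrite mem_iota add0n => /andP[_ lm].
  by rewrite /= (he l lm).1.
apply: map_subseq; apply: (@subseq_sorted_subset _ (fun e e' => epoch_time T o e' < epoch_time T o e)).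
- by move=> e2 e1 e3 h1 h2; exact: lt_trans h2 h1.
- by move=> e1; rewrite ltxx.
- apply/(sortedP (0, 0%N)) => l; rewrite size_mkseq => lm.
  rewrite !nth_mkseq//; last exact: ltnW.
  have [_ /andP[h1 _]] := he l (ltnW lm); have [_ /andP[_ h2]] := he l.+1 lm.
  exact: lt_le_trans h2 h1.
- exact: pairwise_sorted.
- move=> e1 /mapP[l]; rewrite mem_iota add0n => /andP[_ lm] ->.
  apply/EL; have [es /andP[h1 h2]] := he l lm; split; first by rewrite es; exact: sA.
  rewrite /= in_itv/= (le_trans _ h1)/=; last by rewrite /lo divr_ge0// mulr_ge0.
  rewrite (le_trans (ltW h2))// /hi ler_pdivrMr ?ltr0n ?(leq_ltn_trans _ lm)//.
  by rewrite ler_wpM2l// ler_nat leq_subr.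
Qed.

Lemma measurable_slice_void t m l : measurable (slice_void t m l).
Proof.
rewrite (_ : slice_void t m l = [set o | hits T (slab [fset s l]%fset (lo t m l) (hi t m l)) o = [set` fset0]]).
  apply: (time_event_measurable mp); apply: time_event_hits => j; exact: measurable_slab.
apply/seteqP; split=> o /=.
  move=> h; apply/seteqP; split=> e // /slabP[es et].
  by have := h e es; rewrite et.
move=> h e es; apply/negP => et; suff : [set` (fset0 : {fset label})] e by [].
by rewrite -h; apply/slabP.
Qed.

Lemma slice_void_prob t m l : 0 <= t -> (l < m)%N ->
  P (slice_void t m l) = (expR (- (t / m%:R)))%:E.
Proof.
move=> t0 lm; have m0 : 0 < m%:R :> R by rewrite ltr0n (leq_ltn_trans _ lm).
have hl : hi t m l - lo t m l = t / m%:R.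
  rewrite /hi /lo -mulrBl -mulrBr -natrB; last by rewrite leq_sub2l.
  by rewrite (_ : (m - l - (m - l.+1) = 1)%N) ?mulr1//; move: lm; clear; lia.
rewrite (void_slab mp); last by rewrite -subr_ge0 hl divr_ge0// ltW.
by rewrite cardfs1 mul1r hl.
Qed.

Variable c : R.
Hypothesis c_ge0 : 0 <= c.
Hypothesis Gc : (\int[G]_z (`|z|%:E) <= c%:E)%E.
Variable D : R.
Hypothesis datD : forall i, `|dat i| <= D * u i.

Local Notation eta := (Defs.eta alpha p dat T xi).
Local Notation semigroup := (harness_semigroup alpha p dat P T xi).

(** If no slice misses its epoch, the first [m] updates of the schedule occur in the right order and
    give the first term. Otherwise the error is at most 2M, and each slice is void with probability
    exp(-t/m). The start enters through [C] only. *)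
Lemma semigroup_near_mean t m f F C' C M (z : cfg R (site d)) : 0 <= t -> BLf f -> 0 <= C' ->
  lipf (fun v => C' * \sum_(i <- F : {fset site d}) v i) f ->
  (forall x, `|f x| <= M) -> (forall j, `|z j| <= C * u j) ->
  `|semigroup t f z - \int[mu]_x f x| <=
  C' * \sum_(i <- F) (C0 + C) * QL (sched s m) u i + 2 * M * (m%:R * expR (- (t / m%:R))).
Proof.
move=> t0 fBL C'0 fL fM zC.
set eps := C' * _.
have [gam gamE] := @indep_measure R label (fun=> G).
have [Fs eF] := exhausts_countable (site d).
have M0 : 0 <= M by exact: le_trans (fM (fun=> 0)).
have u0 i : 0 <= u i by exact: ltW (u_gt0 hk i).
have Cge0 : 0 <= C by rewrite -(pmulr_lge0 _ (u_gt0 hk 0)) (le_trans _ (zC 0)).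
have [w ws zw] : exists2 w, supersol alpha p nb dat c w & forall j, `|z j| <= w j.
  (* Adding the superharmonic [C * u] to a supersolution keeps it one and makes it dominate the
     start. *)
  exists (fun i => (c + D) / (1 - rho) * u i + C * u i).
    have [w0 ws] := supersol_u hk c_ge0 datD.
    split=> i; first by rewrite addr_ge0// mulr_ge0.
    rewrite PavgD mulrDr addrAC; apply: lerD; first exact: ws.
    by rewrite PavgZ mulrCA ler_wpM2l//; exact: (superharmonic_u hk).
  move=> j; apply: le_trans (zC j) _; rewrite lerDr; exact: (supersol_u hk c_ge0 datD).1.
have lim := eta_limit hk mp gamE Gc eF t ws zw.
have [mf [M' fM']] := BL_bmf fBL; have [_ cf _] := BL_loc_test fBL.
have cvS : \int[P]_o heats (map fst (recent T (Fs n) t o)) f (cutoff (Fs n) z) @[n --> \oo] -->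
    semigroup t f z.
  rewrite (_ : (fun n => _) = fun n => \int[P]_o f (evolve (recent T (Fs n) t o)
    (cutoff (Fs n) z) (noise (marks xi o)))); last first.
    by apply/funext => n; rewrite (evolve_recent_law dat hk mp gamE).
  apply: (@Rint_dct_nonmeasurable _ _ _ _ M) => //.
    by move=> n; apply: (measurableT_comp mf); exact: (measurable_evolve_recent dat hk mp).
  apply: filterS lim => o lim.
  have cX : (fun n => evolve (recent T (Fs n) t o) (cutoff (Fs n) z) (noise (marks xi o)) : cfg R (site d))
      @ \oo --> (eta t z o : cfg R (site d)) by apply/cfg_cvgP => i; exact: lim.
  exact: (cvg_comp _ _ cX (cf _)).
have [n0 hn0] := exhausts_subset [fset x in sched s m]%fset eF.
pose h n o := heats (map fst (recent T (Fs n) t o)) f (cutoff (Fs n) z).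
have hM n o : `|h n o| <= M by exact: (heats_norm dat hk).
have bh n : bmf (h n).
  split; last by exists M.
  apply: (measurable_fun_fiber (f := fun L (_ : Omega) => heats (map fst L) f (cutoff (Fs n) z))) => //.
  by move=> L; apply: (time_event_measurable mp); exact: time_event_recent.
have IM : `|\int[mu]_x f x| <= M by apply: Rint_norm_le => //; exact: BL_bmf.
(* As soon as one slice is void the sum is at least 1, so [g] dominates the error in both cases; its
   mean is the union bound. *)
pose g o := eps + 2 * M * \sum_(l < m) \1_(slice_void t m l) o.
have eps0 : 0 <= eps.
  rewrite mulr_ge0// sumr_ge0// => i _; rewrite mulr_ge0 ?(QL_ge0 hk)// addr_ge0//.
  rewrite -(pmulr_lge0 _ (u_gt0 hk 0)).
  by have := mu_moment 0; rewrite -lee_fin; apply: le_trans; exact: integral_ge0.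
have hg n : (n0 <= n)%N -> {ae P, forall o, `|h n o - \int[mu]_x f x| <= g o}.
  move=> /hn0 sub; have := recent_spec mp Fs t; apply: filterS => o /(_ n) El.
  have [nv|/existsNP[l /not_implyP[lm /contrapT vl]]] :=
      pselect (forall l, (l < m)%N -> ~ slice_void t m l o).
    apply: le_trans (_ : eps <= g o); last first.
      by rewrite lerDl mulr_ge0 ?mulr_ge0// sumr_ge0.
    apply: (heats_near_mean fBL C'0 fL).
      by move=> j; rewrite /cutoff; case: ifP => // _; rewrite normr0 mulr_ge0.
    apply: subseq_recent => // l lm; apply: sub; rewrite in_fset; apply/mapP.
    by exists l; rewrite ?mem_iota.
  apply: (@le_trans _ _ (2 * M)); first by rewrite mulr2n mulrDl mul1r (le_trans (ler_normB _ _))// lerD.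
  rewrite (@le_trans _ _ (2 * M * \sum_(l < m) \1_(slice_void t m l) o))//; last by rewrite lerDr.
  rewrite ler_peMr ?mulr_ge0// (bigD1 (Ordinal lm))//= indicE mem_set//.
  by rewrite lerDl sumr_ge0.
have mI l : measurable_fun setT (\1_(slice_void t m l) : Omega -> R).
  by apply: measurable_indic; exact: measurable_slice_void.
have Ig : (\int[P]_o (g o)%:E = (eps + 2 * M * (m%:R * expR (- (t / m%:R))))%:E)%E.
  have P1 : P setT = 1%E by exact: probability_setT.
  under eq_integral do rewrite EFinD.
  rewrite ge0_integralD//; last 2 first.
  - by move=> o _; rewrite lee_fin mulr_ge0 ?mulr_ge0// sumr_ge0.
  - apply/measurable_EFinP; apply: measurable_funM; first exact: measurable_cst.
    exact: measurable_sum.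
  rewrite integral_cst// [X in (_ * X + _)%E]P1 mule1 EFinD; congr (_ + _)%E.
  under eq_integral do rewrite EFinM.
  rewrite ge0_integralZl ?lee_fin ?mulr_ge0//; last 2 first.
  - by apply/measurable_EFinP; apply: measurable_sum.
  - by move=> o _; rewrite lee_fin sumr_ge0.
  rewrite [RHS]EFinM; congr (_ * _)%E.
  under eq_integral do rewrite -sumEFin.
  rewrite ge0_integral_sum//; last by move=> l; apply/measurable_EFinP.
  rewrite (eq_bigr (fun=> (expR (- (t / m%:R)))%:E)) => [|l _]; last first.
    rewrite integral_indic ?setIT//; last exact: measurable_slice_void.
    exact: slice_void_prob.
  by rewrite sumEFin sumr_const card_ord mulr_natl.
have cvN : `|\int[P]_o h n o - \int[mu]_x f x| @[n --> \oo] --> `|semigroup t f z - \int[mu]_x f x|.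
  by apply: cvg_norm; apply: cvgB; [exact: cvS|exact: cvg_cst].
rewrite -(cvg_lim (@Rhausdorff R) cvN); apply: limr_le.
  by apply/cvg_ex; eexists; exact: cvN.
exists n0 => // n /= n0n.
have bd := bmfB (bh n) (bmf_cst _ (\int[mu]_x f x)).
rewrite -[X in _ - X](Rint_cst P) -RintB//; last exact: bmf_cst.
apply: le_trans (le_normr_Rintegral _ (bmf_integrable P bd)) _ => //.
rewrite -lee_fin (EFin_Rint P (bmf_norm bd)) -Ig.
apply: ae_ge0_le_integral => //.
- by apply/measurable_EFinP; exact: (bmf_norm bd).1.
- by move=> o _; rewrite lee_fin addr_ge0// mulr_ge0 ?mulr_ge0// sumr_ge0.
- apply/measurable_EFinP; apply: measurable_funD => //; apply: measurable_funM => //.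
  exact: measurable_sum.
- by apply: filterS (hg n n0n) => o ho _; rewrite lee_fin.
Qed.

Lemma semigroup_cvg_unif f C e : BLf f -> 0 < e ->
  \forall t \near +oo, forall z : cfg R (site d), (forall j, `|z j| <= C * u j) ->
    `|semigroup t f z - \int[mu]_x f x| <= e.
Proof.
move=> fBL e0; have [F [C' [C'0 fL]]] := BL_lipf fBL; have [[M fM] _] := fBL.
have M0 : 0 <= M by exact: le_trans (fM (fun=> 0)).
have e20 : 0 < e / 2 by rewrite divr_gt0.
have : C' * (\sum_(i <- F) (C0 + C) * QL (sched s n) u i) @[n --> \oo] --> (0 : R).
  rewrite -[X in _ --> X](mulr0 C'); apply: cvgMr.
  rewrite [X in _ --> X](_ : 0 = \sum_(i <- F) (C0 + C) * 0); last first.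
    by rewrite big1// => ? _; rewrite mulr0.
  by apply: cvg_sumr => i; apply: cvgMr; exact: (sched_cvg_u hk s_io).
move=> /cvgrPdist_le /(_ _ e20) [m _ /(_ m (leqnn m))] /=.
rewrite sub0r normrN => /(le_trans (ler_norm _)) hm.
(* By exp(-t/m) <= m/t the void-slice term is at most 2M m^2 / t; [m] is fixed first, then [t]. *)
have K0 : 0 <= 2 * M * (m%:R * m%:R) / (e / 2) by rewrite divr_ge0 ?mulr_ge0// ltW.
near=> t => z zC.
have tK : 2 * M * (m%:R * m%:R) / (e / 2) < t by near: t; apply: nbhs_pinfty_gt; exact: num_real.
have t0 : 0 < t by exact: le_lt_trans tK.
apply: le_trans (semigroup_near_mean m (ltW t0) fBL C'0 fL fM zC) _.
rewrite [leRHS](splitr e); apply: lerD => //.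
apply: (@le_trans _ _ (2 * M * (m%:R * m%:R / t))); last first.
  by rewrite mulrA ler_pdivrMr// [leRHS]mulrC -ler_pdivrMr// ltW.
apply: ler_wpM2l; first by rewrite mulr_ge0.
have [->|m0] := eqVneq m 0%N; first by rewrite !mul0r.
rewrite -mulrA; apply: ler_wpM2l => //.
have mp0 : 0 < m%:R :> R by rewrite ltr0n lt0n.
rewrite expRN -[leRHS]invrK invf_div lef_pV2 ?posrE ?expR_gt0 ?divr_gt0//.
by apply: le_trans (expR_ge1Dx _); rewrite lerDr.
Unshelve. all: by end_near.
Qed.

Lemma semigroup_norm t f M z : (forall x, `|f x| <= M) -> `|semigroup t f z| <= M.
Proof. by move=> fM; exact: Rint_norm_nonmeasurable. Qed.

Lemma nu_semigroup_cvg (X : set (cfg R (site d))) (nu : probability (cfg R (site d)) R) f :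
  measurable X -> nu X = 1%E -> (forall x, X x -> exists C, forall i, `|x i| <= C * u i) ->
  loc_test f -> \int[nu]_(z in X) semigroup t f z @[t --> +oo] --> \int[mu]_x f x.
Proof.
move=> mX nuX Xu.
have cutE h : \int[nu]_(z in X) h z = \int[nu]_z (if z \in X then h z else 0).
  rewrite /Rintegral integral_mkcond; congr fine; apply: eq_integral => z _.
  by rewrite patchE; case: ifP.
have cutM (h : cfg R (site d) -> R) (M : R) : 0 <= M -> (forall z, `|h z| <= M) ->
    forall z : cfg R (site d), `|if z \in X then h z else 0| <= M.
  by move=> M0 hM z; case: ifP => // _; rewrite normr0.
move: f; apply: (@BL_cvg_test _ _ _ _ _ (fun t f => \int[nu]_(z in X) semigroup t f z)).
- move=> f g [[M fM] _ _] [[M' gM] _ _] fg; apply: nearW => t; rewrite !cutE.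
  have fM' x : `|f x| <= Num.max M M' by rewrite le_max fM.
  have gM' x : `|g x| <= Num.max M M' by rewrite le_max gM orbT.
  have M0 : 0 <= Num.max M M' by exact: le_trans (fM' (fun=> 0)).
  apply: (@le_Rint_nonmeasurable _ _ _ _ (Num.max M M')).
  + by apply: cutM => // z; exact: semigroup_norm.
  + by apply: cutM => // z; exact: semigroup_norm.
  + move=> z; case: ifP => // _; apply: (@le_Rint_nonmeasurable _ _ _ _ (Num.max M M')) => //.
- move=> f [[M fM] _ _]; apply: nearW => t; rewrite !cutE.
  have M0 : 0 <= M by exact: le_trans (fM (fun=> 0)).
  rewrite -(@RintN_nonmeasurable _ _ _ _ M); last by apply: cutM => // z; exact: semigroup_norm.
  apply: eq_Rintegral => z _; case: ifP => _; last by rewrite oppr0.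
  by rewrite /harness_semigroup (@RintN_nonmeasurable _ _ _ _ M).
move=> f fBL; have [[M fM] _] := fBL.
have M0 : 0 <= M by exact: le_trans (fM (fun=> 0)).
(* On [B k] the convergence is uniform; these sets increase to [X], so their complements have small
   mass under [nu]. *)
pose B k := X `&` [set z : cfg R (site d) | forall i, `|z i| <= k%:R * u i].
have mB k : measurable (B k).
  apply: measurableI => //; rewrite (_ : mkset _ =
    \bigcap_(i : site d) ((fun z : cfg R (site d) => `|z i|) @^-1` `]-oo, k%:R * u i]%classic)).
    apply: measurable_bigcap_count => i; rewrite -[X in measurable X]setTI.
    by apply: (measurableT_comp (@normr_measurable R setT) (measurable_cfg_eval i)).
  apply/seteqP; split=> z /=; first by move=> h i _ /=; rewrite in_itv/=.
  by move=> h i; have := h i I; rewrite /= in_itv/=.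
have nB : nondecreasing_seq B.
  move=> k l kl; apply/subsetPset => z [Xz h]; split=> // i; apply: le_trans (h i) _.
  by rewrite ler_wpM2r ?ler_nat//; exact: ltW (u_gt0 hk i).
have BU : nu (\bigcup_k B k) = 1%E.
  apply/eqP; rewrite eq_le probability_le1/=; last exact: bigcupT_measurable.
  rewrite -nuX; apply: le_measure; rewrite ?inE//; first exact: bigcupT_measurable.
  move=> z Xz; have [C zC] := Xu z Xz; exists (Num.truncn C).+1 => //; split=> // i; apply: le_trans (zC i) _.
  by rewrite ler_wpM2r ?(ltW (u_gt0 hk i))// ltW// truncnS_gt.
have cvB := nondecreasing_cvg_mu (mu := nu) mB (bigcupT_measurable _ mB) nB.
apply/cvgrPdist_le => e e0.
(* The final error is e1 + 2M e1. *)
pose e1 := e / (1 + 2 * M).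
have M1 : 0 < 1 + 2 * M by rewrite ltr_pwDl// mulr_ge0.
have e10 : 0 < e1 by rewrite divr_gt0.
have [k nuk] : exists k, (nu (~` B k) <= e1%:E)%E.
  have [l l1 cvl] : exists2 l, l = 1%E & (fun k => nu (B k)) @ \oo --> l.
    by exists (nu (\bigcup_k B k)).
  move: cvl; rewrite l1 => /fine_cvgP[_ /cvgrPdist_le /(_ _ e10)] [k _ /(_ k (leqnn k))] /= hk1.
  exists k; rewrite probability_setC// -(fineK (fin_num_measure nu _ (mB k))) -EFinB lee_fin.
  exact: le_trans (ler_norm _) hk1.
have := semigroup_cvg_unif k%:R fBL e10; apply: filterS => t ht.
rewrite cutE distrC.
set I := \int[mu]_x f x in ht *.
have IM : `|I| <= M by apply: Rint_norm_le => //; exact: BL_bmf.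
have mI : bmf (\1_(~` B k) : cfg R (site d) -> R).
  split; first by apply: measurable_indic; exact: measurableC.
  by exists 1 => x; rewrite indicE ger0_norm// lern1 leq_b1.
have RI : \int[nu]_z \1_(~` B k) z <= e1.
  rewrite -lee_fin (EFin_Rint nu mI) integral_indic ?setIT//; exact: measurableC.
have bd (z : cfg R (site d)) : `|(if z \in X then semigroup t f z else 0) - I| <= e1 + 2 * M * \1_(~` B k) z.
  rewrite indicE; have [Bz|nBz] := pselect (B k z).
    have -> : (z \in ~` B k) = false by apply: memNset => /(_ Bz).
    rewrite mulr0 addr0.
    by have [Xz zk] := Bz; rewrite (mem_set Xz); exact: ht.
  rewrite (mem_set (nBz : (~` B k) z)) mulr1 (le_trans (ler_normB _ _))//.
  apply: (@le_trans _ _ (M + M)); last by rewrite mulr2n mulrDl mul1r lerDr ltW.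
  by apply: lerD => //; apply: cutM => // ?; exact: semigroup_norm.
pose g (z : cfg R (site d)) : R := e1 + 2 * M * \1_(~` B k) z.
have bg : bmf g by apply: bmfD; [exact: bmf_cst|exact: bmfZ].
have Ig : \int[nu]_z g z <= e.
  rewrite (RintD nu (bmf_cst _ e1) (bmfZ (2 * M) mI)) (RintZ nu _ mI) Rint_cst.
  apply: (@le_trans _ _ (e1 + 2 * M * e1)); first by rewrite lerD2l ler_wpM2l// mulr_ge0.
  by rewrite -{1}[e1]mul1r -mulrDl mulrC divfK// gt_eqF.
have gM z : `|g z| <= e1 + 2 * M.
  rewrite ger0_norm; last by rewrite addr_ge0 ?(ltW e10)// mulr_ge0 ?mulr_ge0.
  by rewrite lerD2l ler_piMr ?mulr_ge0// indicE lern1 leq_b1.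
pose MM := M + (e1 + 2 * M).
have cM (z : cfg R (site d)) : `|if z \in X then semigroup t f z else 0| <= MM.
  apply: (@le_trans _ _ M); last by rewrite lerDl addr_ge0 ?(ltW e10)// mulr_ge0.
  by apply: cutM => // ?; exact: semigroup_norm.
have gI (sg : R) (z : cfg R (site d)) : `|sg| <= 1 -> `|I + sg * g z| <= MM.
  move=> sg1; rewrite (le_trans (ler_normD _ _))// lerD// normrM.
  by rewrite (le_trans _ (gM z))// ler_piMl.
have EI (sg : R) : \int[nu]_z (I + sg * g z) = I + sg * \int[nu]_z g z.
  by rewrite (RintD nu (bmf_cst _ I) (bmfZ sg bg)) (RintZ nu _ bg) Rint_cst.
(* The integrand is enclosed between the measurable [I - g] and [I + g], so monotonicity
   suffices. *)
rewrite ler_distl; apply/andP; split.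
- apply: (@le_trans _ _ (\int[nu]_z (I + (-1) * g z))); first by rewrite EI mulN1r lerD2l lerN2.
  apply: (@le_Rint_nonmeasurable _ _ _ _ MM) => // z; first by apply: gI; rewrite normrN1.
  by have := bd z; rewrite ler_distl mulN1r => /andP[].
- apply: (@le_trans _ _ (\int[nu]_z (I + 1 * g z))); last by rewrite EI mul1r lerD2l.
  apply: (@le_Rint_nonmeasurable _ _ _ _ MM) => // z; first by apply: gI; rewrite normr1.
  by have := bd z; rewrite ler_distl mul1r => /andP[].
Qed.

End convergence.

(** The 2-adic valuation takes each value v at arbitrarily large integers, here at 2^v (2n + 1). *)
Lemma recurrent_schedule (C : countType) (c0 : C) :
  exists s : nat -> C, forall c n, exists2 m, (n <= m)%N & s m = c.
Proof.
exists (fun m => odflt c0 (choice.unpickle (logn 2 m))) => c n.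
exists (2 ^ choice.pickle c * n.*2.+1)%N.
  by rewrite (leq_trans (_ : n <= n.*2.+1)%N)// ?leq_pmull ?expn_gt0// -addnn -addnS leq_addr.
rewrite lognM ?expn_gt0// pfactorK// logn_coprime ?addn0 ?choice.pickleK//.
by rewrite coprime2n /= odd_double.
Qed.

Lemma Xspace_full (R : realType) (d : nat) (N : 'rV[R]_d -> R) (alpha Rg : R)
    (mu : probability (cfg R (site d)) R) (B : R) (halpha : 0 < alpha < 1) :
  (\int[mu]_x (\esum_(i in [set: site d]) (`|x i| * (lattice_weight N alpha Rg i)^-1)%:E)
     <= B%:E)%E -> mu (Xspace N alpha Rg) = 1%E.
Proof.
move=> muB; have mX := @measurable_Xspace _ _ N _ Rg halpha.
have w0 i : 0 <= (lattice_weight N alpha Rg i)^-1 by rewrite invr_ge0 expR_ge0.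
have mS : measurable_fun setT (fun x : cfg R (site d) =>
    \esum_(i in [set: site d]) (`|x i| * (lattice_weight N alpha Rg i)^-1)%:E)%E.
  apply: measurable_esum => [i|i x]; last by rewrite lee_fin mulr_ge0.
  apply/measurable_EFinP; apply: measurable_funM => //; apply: measurableT_comp => //.
  exact: measurable_cfg_eval.
have S0 (x : cfg R (site d)) :
    (0 <= \esum_(i in [set: site d]) (`|x i| * (lattice_weight N alpha Rg i)^-1)%:E)%E.
  by apply: esum_ge0 => i _; rewrite lee_fin mulr_ge0.
have /integrable_ae : mu.-integrable setT (fun x : cfg R (site d) =>
    \esum_(i in [set: site d]) (`|x i| * (lattice_weight N alpha Rg i)^-1)%:E)%E.
  apply/integrableP; split=> //; under eq_integral => x _ do rewrite gee0_abs//.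
  by rewrite (le_lt_trans muB)// ltry.
move=> /(_ measurableT) aeX.
have : mu.-negligible (~` Xspace N alpha Rg).
  apply: negligibleS aeX => x /= nX h; apply: nX; apply/(XspaceE _ _ halpha).
  by rewrite -ge0_fin_numE//; exact: h.
move=> /(negligibleP mu (measurableC mX)) muXC.
have := probability_setC mu (measurableC mX); rewrite setCK => ->.
by rewrite [X in (1 - X)%E]muXC sube0.
Qed.

Theorem theorem2p2 (R : realType) (d : nat) (N : 'rV[R]_d -> R)
    (alpha Rg : R) (p : site d -> site d -> R) (dat : cfg R (site d))
    (hd : (1 <= d)%N) (hN : is_norm N) (halpha : 0 < alpha < 1) (hRg : 0 < Rg)
    (hp : harness_matrix N Rg p) (hdat : Xspace N alpha Rg dat)
    (hp0 : p 0 0 = 0) :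
  exists mu : probability (cfg R (site d)) R,
  [/\ forall (dO : measure_display) (Omega : measurableType dO)
        (P : probability Omega R) (T xi : site d -> nat -> Omega -> R),
        marked_poisson P T xi ->
      forall nu : probability (cfg R (site d)) R,
        nu (Xspace N alpha Rg) = 1%E ->
      forall f : cfg R (site d) -> R, test_function f ->
        \int[nu]_(z in Xspace N alpha Rg)
            harness_semigroup alpha p dat P T xi t f z @[t --> +oo] -->
          \int[mu]_x f x,
      forall y : cfg R (site d), Xspace N alpha Rg y ->
      forall La : nat -> {fset site d},
        (forall n, {subset La n <= La n.+1}) ->
        (forall i, exists n, i \in La n) ->
      forall f : cfg R (site d) -> R, test_function f ->
        gibbs_mean (fun i j => alpha * p i j) (1 - alpha) dat (La n) y f
            @[n --> \oo] -->
          \int[mu]_x f x,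
      forall k : site d, reversible mu (site_generator alpha p dat k),
      reversible mu (harness_generator alpha p dat) &
      [/\ mu (Xspace N alpha Rg) = 1%E,
          DLR (fun i j => alpha * p i j) (1 - alpha) dat mu &
          forall mu' : probability (cfg R (site d)) R,
            mu' (Xspace N alpha Rg) = 1%E ->
            DLR (fun i j => alpha * p i j) (1 - alpha) dat mu' ->
            forall A, measurable A -> mu' A = mu A]].
Proof.
have [nb [rho [u' [hk w_rho]]]] := lattice_harness_kernel hN halpha hRg hp hp0.
have XC x := @Xspace_le_weight _ _ N alpha Rg halpha x.
have mX := @measurable_Xspace _ _ N _ Rg halpha.
have [D datD] := XC _ hdat.
have [c c0 Gc] := normal_abs_moment_at (oner_neq0 R).
have [s s_io] := recurrent_schedule (0 : site d).
have [mu [mu_lim mu_mom]] := stationary_law hk c0 Gc datD s_io.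
have mu_heat k := mu_heat_invariant hk c0 Gc datD s_io mu_lim k.
have mu_moments i := mu_mom _ i (supersol_u hk c0 datD).
exists mu; split.
- move=> dO Omega P T xi mp nu nuX f tf.
  exact: (nu_semigroup_cvg hk mu_heat mu_moments s_io mp c0 Gc datD mX nuX XC tf).
- move=> y /XC[C yC] La La_mono La_cover f tf.
  exact: (gibbs_mean_cvg hk c0 Gc datD s_io mu_lim (conj La_mono La_cover) yC tf).
- exact: (mu_reversible_site hk c0 Gc datD s_io mu_lim).
- exact: (mu_reversible hk c0 Gc datD s_io mu_lim).
split.
- have [S1 hS1] := Xspace_bound halpha hdat.
  have [S2 hS2] := weight_summable hN halpha hRg.
  (* [S1] bounds the weighted sum of the data and [S2] the sum of the weights, which takes care of
     the constant source [c]. *)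
  apply: Xspace_full => //; apply: (weighted_moment hk _ _ w_rho c0 datD (S := c * S2 + S1)) mu_mom.
  + by move=> i; rewrite invr_ge0 expR_ge0.
  + by move=> i; rewrite mulVf// gt_eqF// expR_gt0.
  + move=> A; under eq_bigr do rewrite mulrDr (mulrC _ c).
    by rewrite big_split/= -mulr_sumr lerD// ler_wpM2l.
- apply: (gibbs_stationary_DLR (hk := hk)) => La.
  exact: (mu_gibbs_stationary hk c0 Gc datD s_io mu_lim).
- move=> mu' mu'X dlr; apply: (mu_unique (hk := hk) c0 Gc datD s_io mu_lim XC mX mu'X) => La.
  exact: (DLR_gibbs_stationary hk La dlr).
Qed.
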